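(* Suppose $\rho\in(-\infty,-2)$ and $v_0\in(0,\pi)\cup(\pi,2\pi)$. Let $\gamma:(0,T)\to\mathbb D$ be the radial $\mathrm{SLE}_0(\rho)$ starting at $1$, with reference point $0$ and force point $e^{iv_0}$. Then $\gamma$ is a simple curve and can be continuously extended to $T$. If $\rho\in(-4,-2)$, then $\gamma(T-)\in\gamma_{(0,T)}\cup\partial\mathbb D\setminus\{e^{iv_0}\}$, in such a way that $\gamma$ separates $e^{iv_0}$ from $0$ in $\mathbb D$. Moreover, the component of $\mathbb D\setminus\gamma$ containing $0$ has interior angle $\pi\frac{4+\rho}{2}$ at $\gamma(T-)$ (unless $\gamma(T-)=1$, in which case the interior angle is $\pi\frac{4+\rho}4$). If $\rho\le-4$, then $\gamma(T-)=e^{iv_0}$ and the component of $\mathbb D\setminus\gamma$ containing $0$ has an interior angle $\pi\frac{\rho+4}{\rho+2}$ at $e^{iv_0}$.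
   Context: $\mathbb D$ is the unit disk. The radial $\mathrm{SLE}_0(\rho)$ in $\mathbb D$ starting at $1$ with reference point $0$ and force point $e^{iv_0}$ is the curve, parametrized by conformal radius, whose driving function $W_t=e^{iw_t}$ solves $\dot w_t=\frac\rho2\cot\frac{w_t-v_t}2$, $w_0=0$, where $e^{iv_t}=g_t(e^{iv_0})$ with $v$ continuous and equal to $v_0$ at $t=0$, and $\partial_tg_t(z)=g_t(z)\frac{W_t+g_t(z)}{W_t-g_t(z)}$, $g_0(z)=z$; here $g_t:\mathbb D\setminus\gamma_t\to\mathbb D$ with $g_t(0)=0$, $g_t'(0)=e^t$. It is run up to $T=\tau_{0+}=\lim_{\varepsilon\to0+}\inf\{t:|W_t-e^{iv_t}|=\varepsilon\}$. $\gamma_{(0,T)}=\gamma((0,T))$, and $\gamma(T-)$ is the limit of $\gamma(t)$ as $t\to T-$. *)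

(* Defs.v *)
From Stdlib Require Import Reals.
From Coquelicot Require Import Coquelicot.

Open Scope R_scope.

(** * Planar topology *)

Definition cis (x : R) : C := (cos x, sin x).

Definition disk (z : C) : Prop := Cmod z < 1.

Definition closure (E : C -> Prop) (x : C) : Prop :=
  forall eps, 0 < eps -> exists y, E y /\ Cmod (y - x) < eps.

Definition frontier (E : C -> Prop) (x : C) : Prop :=
  closure E x /\ closure (fun z => ~ E z) x.

Definition connected (A : C -> Prop) : Prop :=
  forall U V : C -> Prop, open U -> open V ->
    (forall z, A z -> U z \/ V z) ->
    (exists z, A z /\ U z) -> (exists z, A z /\ V z) ->
    exists z, A z /\ U z /\ V z.

Definition component (E : C -> Prop) (x z : C) : Prop :=
  exists A : C -> Prop,
    connected A /\ (forall y, A y -> E y) /\ A x /\ A z.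

(** * Curves on the time interval (0, T) *)

Definition before (T : Rbar) (t : R) : Prop := 0 < t /\ Rbar_lt t T.

Definition trace (I : R -> Prop) (gamma : R -> C) (z : C) : Prop :=
  exists t, I t /\ z = gamma t.

Definition simple_curve (T : Rbar) (gamma : R -> C) : Prop :=
  continuous_on (before T) gamma /\
  forall s t, before T s -> before T t -> gamma s = gamma t -> s = t.

Definition left_limit (T : Rbar) (gamma : R -> C) (p : C) : Prop :=
  filterlim gamma (within (fun t => Rbar_lt t T) (Rbar_locally T)) (locally p).

(** The component containing 0 of the disk minus [gamma (I)]. *)
Definition complement0 (I : R -> Prop) (gamma : R -> C) : C -> Prop :=
  component (fun z => disk z /\ ~ trace I gamma z) (RtoC 0).

(** * Radial SLE_0(rho) *)

Definition cot (x : R) : R := cos x / sin x.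

(** Derivative relative to [0, +oo): one-sided at 0, the usual one at [t > 0]. *)
Definition is_derive_nonneg {V : NormedModule R_AbsRing}
    (f : R -> V) (t : R) (l : V) : Prop :=
  filterdiff f (within (fun s => 0 <= s) (locally t)) (fun h => scal h l).

Definition conformal_onto_disk (D : C -> Prop) (f : C -> C) : Prop :=
  (forall z, D z -> @ex_derive C_AbsRing C_NormedModule f z) /\
  (forall z, D z -> disk (f z)) /\
  (forall z z', D z -> D z' -> f z = f z' -> z = z') /\
  (forall y, disk y -> exists z, D z /\ f z = y).

Definition hitting_time (T : Rbar) (w v : R -> R) (eps : R) : Rbar :=
  Glb_Rbar (fun t => 0 <= t /\ Rbar_lt t T /\
                     Cmod (cis (w t) - cis (v t)) = eps).

(** Convergence [tau eps --> T] as [eps --> 0+], in the order topology of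
    [Rbar]: [Rbar_locally T] is a filter on [R], while [tau] may be infinite. *)
Definition right_limit0_Rbar (tau : R -> Rbar) (T : Rbar) : Prop :=
  (forall a : Rbar, Rbar_lt a T -> at_right 0 (fun eps => Rbar_lt a (tau eps))) /\
  (forall b : Rbar, Rbar_lt T b -> at_right 0 (fun eps => Rbar_lt (tau eps) b)).

(** [gamma], restricted to (0, T), is the radial SLE_0(rho) in the disk from 1
    with reference point 0 and force point [cis v0].  The domain of the Loewner
    map [g t] is the component containing 0 of the disk minus [gamma ((0, t])],
    so that simplicity of [gamma] is not built in; the flow is also followed at
    the boundary point [cis v0]. The values of [gamma], [w], [v], [g] outside
    their domains are irrelevant. *)
Definition radial_SLE0 (rho v0 : R) (T : Rbar) (gamma : R -> C) : Prop :=
  (forall t, before T t -> disk (gamma t)) /\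
  continuous_on (before T) gamma /\
  filterlim gamma (at_right 0) (locally (RtoC 1)) /\
  exists (w v : R -> R) (g : R -> C -> C),
    let D (t : R) := complement0 (fun s => 0 < s <= t) gamma in
    (w 0 = 0 /\
     forall t, 0 <= t -> Rbar_lt t T ->
       is_derive_nonneg w t (rho / 2 * cot ((w t - v t) / 2))) /\
    (v 0 = v0 /\
     continuous_on (fun t => 0 <= t /\ Rbar_lt t T) v /\
     forall t, 0 <= t -> Rbar_lt t T -> cis (v t) = g t (cis v0)) /\
    right_limit0_Rbar (hitting_time T w v) T /\
    (forall z, disk z \/ z = cis v0 -> g 0 z = z) /\
    (forall t z, 0 <= t -> Rbar_lt t T -> D t z \/ z = cis v0 ->
       is_derive_nonneg (V := C_R_NormedModule) (fun s => g s z) t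
         (g t z * ((cis (w t) + g t z) / (cis (w t) - g t z)))%C) /\
    (forall t, 0 <= t -> Rbar_lt t T ->
       conformal_onto_disk (D t) (g t) /\
       g t (RtoC 0) = RtoC 0 /\
       @is_derive C_AbsRing C_NormedModule (g t) (RtoC 0) (RtoC (exp t))).

(** * Interior angles *)

(** [a], on [0, 1], is a simple arc of the frontier of [Om] issued from [p]
    whose half-tangent at [p] has direction [cis beta]. *)
Definition frontier_arc (Om : C -> Prop) (p : C) (a : R -> C) (beta : R) : Prop :=
  a 0 = p /\
  continuous_on (fun s => 0 <= s <= 1) a /\
  (forall s t, 0 <= s <= 1 -> 0 <= t <= 1 -> a s = a t -> s = t) /\
  (forall s, 0 <= s <= 1 -> frontier Om (a s)) /\
  filterlim (fun s => ((a s - p) / RtoC (Cmod (a s - p)))%C)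
    (at_right 0) (locally (cis beta)).

(** Near [p] the frontier of [Om] consists of two arcs [a] and [b] issued from
    [p], and [alpha] is the angle from the half-tangent of [a] to that of [b],
    turning counterclockwise through [Om].  The last condition locates [Om]
    between the arcs; it is what distinguishes [alpha] from [2 * PI - alpha]
    and gives a meaning to the angles [0] and [2 * PI]. *)
Definition interior_angle (Om : C -> Prop) (p : C) (alpha : R) : Prop :=
  0 <= alpha <= 2 * PI /\
  exists (a b : R -> C) (beta : R),
    frontier_arc Om p a beta /\
    frontier_arc Om p b (beta + alpha) /\
    (forall s t, 0 < s <= 1 -> 0 < t <= 1 -> a s <> b t) /\
    (exists r, 0 < r /\
       forall z, frontier Om z -> Cmod (z - p) < r ->
         exists s, 0 <= s <= 1 /\ (z = a s \/ z = b s)) /\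
    (forall eps, 0 < eps ->
       exists r, 0 < r /\
         forall s phi, 0 < s < r ->
           (beta + eps < phi < beta + alpha - eps ->
              Om (p + RtoC s * cis phi)%C) /\
           (beta + alpha + eps < phi < beta + 2 * PI - eps ->
              ~ Om (p + RtoC s * cis phi)%C)).

(* Main.v *)
(** Put [c = - (rho + 2) / 2]. Since [u = cos ((w - v) / 2)] solves [u' = (c / 2) u], the lifetime is finite. Rotate
    [g t] so that [cis (v t)] becomes [1] and map the disk to the right half-plane, [1] going to infinity; the driving
    point is then [- i / eta] with [eta = sqrt (1 - u ^ 2) / u]. The flow preserves
      [FF c eta w = (1 - w ^ 2) (kap w - i eta) ^ (2 / c)],
      [kap w] = integral over [p] in [0, 1] of [((1 + r) / 2 + (1 - r) / 2 * w) ^ (- c)], [r = p ^ (2 / c)],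
    because [(w ^ 2 - 1) kap' = c (1 - w kap)]. On the imaginary axis [FF c eta] takes its values on the curve
    [ell c J = (a0 + i J) ^ (2 / c)], [J] being maximal at the driving point, and it is injective inside: the number of
    preimages of a point off the image of the axis does not change when [eta] increases to infinity. Hence a point swallowed
    at time [t] has the value [ell c (J t)], [J t] being that maximum, so that [gamma] is the preimage of a piece of [ell c]
    under [F = FF c (tan (v0 / 2))], and the component of [0] left at the end is the preimage of the star-shaped region bounded
    by [ell c]. If [c >= 1], [J t] tends to infinity and [gamma] tends to the force point; the angle there is read off
    [F ~ - 4 eta ^ (2 / c) cis (- pi / c) / ((z - V) / V) ^ 2]. If [c < 1], [J t] tends to [TT = a0 tan (pi c / 2)], where
    [ell c TT = ell c (- TT)], so that [gamma] runs into itself or into the circle, at an angle [pi (1 - c)] which the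
    conformal map [F] preserves, except at [1], where [F] has a critical point and the angle is halved. The case
    [v0 > pi] follows by reflection in the real axis. *)

Require Import Defs.
From Stdlib Require Import Reals Lra Lia Classical IndefiniteDescription.
From Stdlib Require Import FunctionalExtensionality Ranalysis5.
From Coquelicot Require Import Coquelicot.

Open Scope R_scope.

(** Origin of the invariant: along a trajectory, [eta] as a function of [w] satisfies the linear
    equation [(1 - w ^ 2) eta' = c (eta w + i)]. Its homogeneous solutions are the multiples of
    [(1 - w ^ 2) ^ (- c / 2)], and [- i kap] is a particular solution. Hence
    [(1 - w ^ 2) ^ (c / 2) (kap w - i eta)] is constant, and [FF] is its power [2 / c]. Taking for
    [kap] the solution holomorphic at [1], the image of the origin, and raising to [2 / c] removes
    all branching there; it remains to know that [kap - i eta] stays in the right half-plane, where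
    the principal power is available. The obstacle: the hypotheses give neither simplicity of
    [gamma] nor boundary values of [g t]; a point is only known to leave the component of [0] at
    some time. The curve is therefore recovered from the values of [F]. The value at a swallowed
    point determines its swallowing time, and since [F] is open while [ell c] contains no open set,
    the points swallowed at time [t] reduce to [gamma t]. *)

Lemma nbhd_C (z : C) (P : C -> Prop) :
  locally z P <-> exists eps, 0 < eps /\ forall y, Cmod (y - z)%C < eps -> P y.
Proof.
split.
- intros [eps H]. exists eps. split; [apply cond_pos|].
  intros y Hy. apply H. apply C_NormedModule_mixin_compat1. exact Hy.
- intros [eps [He H]].
  (* Balls of [C] are squares of the product metric; the square of half-side [eps / 2] lies in the
     disk of radius [eps], as [sqrt 2 <= 2]. *)
  assert (Hs : 0 < eps / 2) by lra.
  exists (mkposreal _ Hs). intros y Hy. apply H.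
  assert (Hb := C_NormedModule_mixin_compat2 z y _ Hy). simpl in Hb.
  eapply Rlt_le_trans; [exact Hb|].
  assert (sqrt 2 <= 2). { rewrite <- (sqrt_square 2) at 2 by lra. apply sqrt_le_1; lra. }
  nra.
Qed.

Lemma Cmod_pos (z : C) : z <> 0 -> 0 < Cmod z.
Proof. apply Cmod_gt_0. Qed.

Lemma Cmod_pos_neq (z : C) : 0 < Cmod z -> z <> 0.
Proof. apply Cmod_gt_0. Qed.

Lemma Cmod_sub_sym (a b : C) : Cmod (a - b)%C = Cmod (b - a)%C.
Proof. rewrite <- Cmod_opp. f_equal. ring. Qed.

Lemma Cmod_triangle_sub (a b d : C) : Cmod (a - d)%C <= Cmod (a - b)%C + Cmod (b - d)%C.
Proof. replace (a - d)%C with ((a - b) + (b - d))%C by ring. apply Cmod_triangle. Qed.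

Lemma Cmod_rev_triangle (a b : C) : Cmod a - Cmod b <= Cmod (a - b)%C.
Proof.
replace (Cmod a) with (Cmod ((a - b) + b)%C) by (f_equal; ring).
pose proof (Cmod_triangle (a - b)%C b). lra.
Qed.

Lemma Cmod_rev_triangle2 (a b : C) : Cmod a - Cmod b <= Cmod (a + b)%C.
Proof.
pose proof (Cmod_rev_triangle a (-b)%C). rewrite Cmod_opp in H.
replace (a - - b)%C with (a + b)%C in H by ring. exact H.
Qed.

Lemma Cmod_le_ReIm (z : C) : Cmod z <= Rabs (Re z) + Rabs (Im z).
Proof.
pose proof (Cmod2_alt z).
pose proof (Rabs_pos (Re z)). pose proof (Rabs_pos (Im z)).
assert (Cmod z ^ 2 <= (Rabs (Re z) + Rabs (Im z)) ^ 2).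
{ rewrite H. rewrite (pow2_abs (Re z)), (pow2_abs (Im z)) || (rewrite <- (pow2_abs (Re z)), <- (pow2_abs (Im z))); nra. }
nra.
Qed.

Lemma Im_le_Cmod (z : C) : Rabs (Im z) <= Cmod z.
Proof.
pose proof (Cmod2_alt z). pose proof (Cmod_ge_0 z).
apply Rabs_le. nra.
Qed.

Lemma Re_le_Cmod (z : C) : Re z <= Cmod z.
Proof. pose proof (re_le_Cmod z). pose proof (Rle_abs (Re z)). lra. Qed.

Lemma Re_sub (a b : C) : Re (a - b)%C = Re a - Re b.
Proof. auto. Qed.

Lemma Im_sub (a b : C) : Im (a - b)%C = Im a - Im b.
Proof. auto. Qed.

Lemma C_eq (a b : C) : Re a = Re b -> Im a = Im b -> a = b.
Proof. destruct a, b; simpl; intros; subst; reflexivity. Qed.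

Lemma Csub_0 (a b : C) : (a - b)%C = 0%R -> a = b.
Proof. intro H. replace a with ((a - b) + b)%C by ring. rewrite H. ring. Qed.

Lemma Cmod_sub_0 (a b : C) : Cmod (a - b)%C <= 0 -> a = b.
Proof. intro H. apply Csub_0, Cmod_eq_0. pose proof (Cmod_ge_0 (a - b)%C). lra. Qed.

Ltac Cring := apply C_eq; simpl; ring.

Ltac pos := repeat first [assumption | lra | apply Rmin_pos | apply Rmin_glb_lt | apply Rdiv_lt_0_compat
  | apply Rmult_lt_0_compat | apply Rinv_0_lt_compat | apply exp_pos | apply pow_lt].

Ltac rmin := repeat match goal with
  | H : context [Rmin ?a ?b] |- _ =>
      lazymatch goal with _ : Rmin a b <= a |- _ => fail | _ => pose proof (Rmin_l a b); pose proof (Rmin_r a b) end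
  | |- context [Rmin ?a ?b] =>
      lazymatch goal with _ : Rmin a b <= a |- _ => fail | _ => pose proof (Rmin_l a b); pose proof (Rmin_r a b) end
  end; lra.

Lemma C_eq_small (a b : C) : (forall eps, 0 < eps -> Cmod (a - b)%C <= eps) -> a = b.
Proof.
intro H. apply Cmod_sub_0.
specialize (H (Cmod (a - b)%C / 2)). lra.
Qed.

(** * Differentiation relative to a subset of the plane *)

(** With [S] the whole plane this is complex differentiability; with [S] a
    subset of the real line it is differentiability of a curve [s |-> f (RtoC s)],
    possibly one-sided. *)
Definition hd (S : C -> Prop) (f : C -> C) (z l : C) : Prop :=
  forall eps, 0 < eps -> exists d, 0 < d /\ forall y, S y -> Cmod (y - z)%C < d ->
    Cmod (f y - f z - l * (y - z))%C <= eps * Cmod (y - z)%C.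

Definition all_C : C -> Prop := fun _ => True.
Notation hdC := (hd all_C).

Definition ct (S : C -> Prop) (f : C -> C) (z : C) : Prop :=
  forall eps, 0 < eps -> exists d, 0 < d /\ forall y, S y -> Cmod (y - z)%C < d ->
    Cmod (f y - f z)%C < eps.

Lemma hd_subset S S' f z l : (forall y, S y -> S' y) -> hd S' f z l -> hd S f z l.
Proof.
intros HS H eps He. destruct (H eps He) as [d [Hd Hy]]. exists d. auto.
Qed.

Lemma hd_lip S f z l : hd S f z l -> exists d, 0 < d /\ forall y, S y -> Cmod (y - z)%C < d ->
  Cmod (f y - f z)%C <= (Cmod l + 1) * Cmod (y - z)%C.
Proof.
intros H. destruct (H 1 Rlt_0_1) as [d [Hd Hy]]. exists d. split; auto.
intros y Sy Hyz. specialize (Hy y Sy Hyz).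
replace (f y - f z)%C with ((f y - f z - l * (y - z)) + l * (y - z))%C by ring.
eapply Rle_trans; [apply Cmod_triangle|]. rewrite (Cmod_mult l). lra.
Qed.

Lemma hd_ct S f z l : hd S f z l -> ct S f z.
Proof.
intros H eps He. destruct (hd_lip _ _ _ _ H) as [d [Hd Hy]].
assert (Hl : 0 < Cmod l + 1) by (pose proof (Cmod_ge_0 l); lra).
exists (Rmin d (eps / (Cmod l + 1))). split.
{ pos. }
intros y Sy Hyz. eapply Rle_lt_trans.
{ apply Hy; auto. rmin. }
assert (Cmod (y - z)%C < eps / (Cmod l + 1)) by rmin.
apply (Rmult_lt_compat_l (Cmod l + 1)) in H0; auto.
replace ((Cmod l + 1) * (eps / (Cmod l + 1))) with eps in H0 by (field; lra). exact H0.
Qed.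

Lemma hd_ext S f g z l :
  (exists d, 0 < d /\ forall y, S y -> Cmod (y - z)%C < d -> f y = g y) -> f z = g z ->
  hd S f z l -> hd S g z l.
Proof.
intros [d0 [Hd0 He]] Hz H eps Heps. destruct (H eps Heps) as [d [Hd Hy]].
exists (Rmin d d0). split; [pos|].
intros y Sy Hyz. rewrite <- Hz, <- He; auto.
- apply Hy; auto. rmin.
- rmin.
Qed.

Lemma hd_ext_all S f g z l : (forall y, f y = g y) -> hd S f z l -> hd S g z l.
Proof. intros H. apply hd_ext; auto. exists 1. split; [lra|auto]. Qed.

Lemma hd_eq S f z l l' : l = l' -> hd S f z l -> hd S f z l'.
Proof. intros ->; auto. Qed.

Lemma hd_const S a z : hd S (fun _ => a) z 0%R.
Proof. exists 1. split; [lra|]. intros y _ _.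
replace (a - a - 0%R * (y - z))%C with (RtoC 0) by ring.
rewrite Cmod_0. pose proof (Cmod_ge_0 (y - z)%C). nra.
Qed.

Lemma hd_id S z : hd S (fun y => y) z 1%R.
Proof. exists 1. split; [lra|]. intros y _ _.
replace (y - z - 1%R * (y - z))%C with (RtoC 0) by ring.
rewrite Cmod_0. pose proof (Cmod_ge_0 (y - z)%C). nra.
Qed.

Lemma hd_plus S f g z l m : hd S f z l -> hd S g z m -> hd S (fun y => f y + g y)%C z (l + m)%C.
Proof.
intros Hf Hg eps He.
destruct (Hf (eps/2)) as [d1 [Hd1 H1]]; [lra|].
destruct (Hg (eps/2)) as [d2 [Hd2 H2]]; [lra|].
exists (Rmin d1 d2). split; [pos|]. intros y Sy Hyz.
specialize (H1 y Sy (Rlt_le_trans _ _ _ Hyz (Rmin_l _ _))).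
specialize (H2 y Sy (Rlt_le_trans _ _ _ Hyz (Rmin_r _ _))).
replace (f y + g y - (f z + g z) - (l + m) * (y - z))%C
  with ((f y - f z - l * (y - z)) + (g y - g z - m * (y - z)))%C by ring.
eapply Rle_trans; [apply Cmod_triangle|]. lra.
Qed.

Lemma hd_mult S f g z l m : hd S f z l -> hd S g z m ->
  hd S (fun y => f y * g y)%C z (l * g z + f z * m)%C.
Proof.
intros Hf Hg eps He.
pose proof (Cmod_ge_0 (f z)) as Pf. pose proof (Cmod_ge_0 (g z)) as Pg.
pose proof (Cmod_ge_0 l) as Pl. pose proof (Cmod_ge_0 m) as Pm.
set (A := Cmod (f z) + Cmod (g z) + (Cmod l + 1) * (Cmod m + 1) + 1).
assert (HA : 0 < A) by (unfold A; nra).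
destruct (hd_lip _ _ _ _ Hf) as [d3 [Hd3 H3]].
destruct (hd_lip _ _ _ _ Hg) as [d4 [Hd4 H4]].
assert (HE : 0 < eps / A) by pos.
destruct (Hf (eps/A)) as [d1 [Hd1 H1]]; auto.
destruct (Hg (eps/A)) as [d2 [Hd2 H2]]; auto.
exists (Rmin (Rmin d1 d2) (Rmin (Rmin d3 d4) (eps/A))).
split; [pos|]. intros y Sy Hyz.
assert (Hm : forall a b x, x < Rmin a b -> x < a /\ x < b).
{ split; eapply Rlt_le_trans; eauto using Rmin_l, Rmin_r. }
apply Hm in Hyz. destruct Hyz as [Ha Hb]. apply Hm in Ha. apply Hm in Hb.
destruct Ha as [Ha1 Ha2]. destruct Hb as [Hb Hc]. apply Hm in Hb. destruct Hb as [Hb1 Hb2].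
specialize (H1 y Sy Ha1). specialize (H2 y Sy Ha2). specialize (H3 y Sy Hb1). specialize (H4 y Sy Hb2).
replace (f y * g y - f z * g z - (l * g z + f z * m) * (y - z))%C
  with ((f y - f z - l * (y - z)) * g z + f z * (g y - g z - m * (y - z))
        + (f y - f z) * (g y - g z))%C by ring.
eapply Rle_trans; [apply Cmod_triangle|].
eapply Rle_trans; [apply Rplus_le_compat_r, Cmod_triangle|]. rewrite !Cmod_mult.
set (t := Cmod (y - z)%C) in *. assert (Pt : 0 <= t) by apply Cmod_ge_0.
assert (E : eps / A * A = eps) by (field; lra).
set (e := eps / A) in *.
pose proof (Cmod_ge_0 (f y - f z)%C). pose proof (Cmod_ge_0 (g y - g z)%C).
assert ((Cmod l + 1) * t * ((Cmod m + 1) * t) <= e * t * ((Cmod l + 1) * (Cmod m + 1))).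
{ replace ((Cmod l + 1) * t * ((Cmod m + 1) * t)) with (t * t * ((Cmod l + 1) * (Cmod m + 1))) by ring.
  apply Rmult_le_compat_r; [nra|]. nra. }
rewrite <- E. unfold A. nra.
Qed.

Lemma hd_comp S S' f g z l m : hd S' f (g z) l -> hd S g z m -> (forall y, S y -> S' (g y)) ->
  hd S (fun y => f (g y)) z (l * m)%C.
Proof.
intros Hf Hg HS eps He.
pose proof (Cmod_ge_0 l) as Pl. pose proof (Cmod_ge_0 m) as Pm.
set (A := Cmod l + Cmod m + 1). assert (HA : 0 < A) by (unfold A; nra).
assert (HE : 0 < eps / A) by pos.
destruct (Hf (eps/A)) as [d1 [Hd1 H1]]; auto.
destruct (Hg (eps/A)) as [d2 [Hd2 H2]]; auto.
destruct (hd_lip _ _ _ _ Hg) as [d3 [Hd3 H3]].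
destruct (hd_ct _ _ _ _ Hg d1 Hd1) as [d4 [Hd4 H4]].
exists (Rmin d2 (Rmin d3 d4)). split; [pos|]. intros y Sy Hyz.
assert (Ha := Rlt_le_trans _ _ _ Hyz (Rmin_l _ _)).
assert (Hb := Rlt_le_trans _ _ _ Hyz (Rmin_r _ _)).
specialize (H4 y Sy (Rlt_le_trans _ _ _ Hb (Rmin_r _ _))).
specialize (H3 y Sy (Rlt_le_trans _ _ _ Hb (Rmin_l _ _))).
specialize (H2 y Sy Ha). specialize (H1 (g y) (HS y Sy) H4).
replace (f (g y) - f (g z) - l * m * (y - z))%C
  with ((f (g y) - f (g z) - l * (g y - g z)) + l * (g y - g z - m * (y - z)))%C by ring.
eapply Rle_trans; [apply Cmod_triangle|]. rewrite Cmod_mult.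
assert (E : eps / A * A = eps) by (field; lra).
set (e := eps / A) in *.
rewrite <- E. unfold A. nra.
Qed.

Lemma hdC_comp S f g z l m : hdC f (g z) l -> hd S g z m -> hd S (fun y => f (g y)) z (l * m)%C.
Proof. intros Hf Hg. eapply hd_comp; eauto. intros; exact I. Qed.

Lemma hd_opp S f z l : hd S f z l -> hd S (fun y => - f y)%C z (- l)%C.
Proof.
intros H. eapply hd_eq; [|eapply hd_ext_all; [|apply (hd_mult S (fun _ => RtoC (-1)) f z); [apply hd_const|exact H]]].
- ring.
- intro y; simpl. ring.
Qed.

Lemma hd_minus S f g z l m : hd S f z l -> hd S g z m -> hd S (fun y => f y - g y)%C z (l - m)%C.
Proof. intros. apply hd_plus; auto. apply hd_opp; auto. Qed.

Lemma hd_scal S a f z l : hd S f z l -> hd S (fun y => a * f y)%C z (a * l)%C.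
Proof.
intros H. eapply hd_eq; [|apply (hd_mult S (fun _ => a) f z); [apply hd_const|exact H]]. ring.
Qed.

Lemma hdC_inv (z : C) : z <> 0 -> hdC Cinv z (- / (z * z))%C.
Proof.
intros Hz eps He.
assert (Pz : 0 < Cmod z) by (apply Cmod_pos; auto).
set (a := Cmod z) in *.
exists (Rmin (a/2) (eps * (a * a * a) / 2)). split.
{ pos. }
intros y _ Hy.
assert (H1 := Rlt_le_trans _ _ _ Hy (Rmin_l _ _)).
assert (H2 := Rlt_le_trans _ _ _ Hy (Rmin_r _ _)).
assert (Py : a / 2 < Cmod y).
{ pose proof (Cmod_rev_triangle z y). rewrite Cmod_sub_sym in H1. fold a in H. lra. }
assert (Hy0 : y <> 0). { apply Cmod_pos_neq. lra. }
replace (/ y - / z - - / (z * z) * (y - z))%C with ((y - z) * (y - z) / (y * (z * z)))%C by (field; auto).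
rewrite Cmod_div by (repeat apply Cmult_neq_0; auto). rewrite !Cmod_mult.
set (t := Cmod (y - z)%C) in *. assert (0 <= t) by apply Cmod_ge_0.
apply Rmult_le_reg_r with (Cmod y * (a * a)). { pos. }
unfold Rdiv. rewrite Rmult_assoc, Rinv_l, Rmult_1_r.
2:{ apply Rgt_not_eq. pos. }
assert (t <= eps * (Cmod y * (a * a))) by nra.
nra.
Qed.

Lemma hd_inv S (f : C -> C) (z l : C) : f z <> 0 -> hd S f z l -> hd S (fun y => / f y)%C z (- l / (f z * f z))%C.
Proof.
intros Hz H. eapply hd_eq; [|apply (hdC_comp S Cinv f z _ _ (hdC_inv _ Hz) H)].
Cring.
Qed.

Lemma hd_div S (f g : C -> C) (z l m : C) : g z <> 0 -> hd S f z l -> hd S g z m ->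
  hd S (fun y => f y / g y)%C z ((l * g z - f z * m) / (g z * g z))%C.
Proof.
intros Hz Hf Hg. eapply hd_eq; [|apply hd_mult; [exact Hf|apply hd_inv; [auto|exact Hg]]].
cbv beta. field; auto.
Qed.

(** * Curves *)

Definition RL : C -> Prop := fun y => Im y = 0.

Definition seg (a b : R) : C -> Prop := fun y => Im y = 0 /\ a <= Re y <= b.

Lemma hd_Re (S : C -> Prop) (f : C -> C) (t : R) (l : C) :
  (exists d, 0 < d /\ forall s, Rabs (s - t) < d -> S (RtoC s)) -> hd S f (RtoC t) l ->
  is_derive (fun s => Re (f (RtoC s))) t (Re l) /\ is_derive (fun s => Im (f (RtoC s))) t (Im l).
Proof.
intros [d0 [Hd0 HS]] H.
split; apply is_derive_Reals; intros eps He;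
  destruct (H (eps/2)) as [d [Hd Hy]]; try lra;
  (assert (Hm : 0 < Rmin d d0) by pos);
  exists (mkposreal _ Hm); intros h Hh Hlt; simpl in Hlt;
  (assert (H1 := Rlt_le_trans _ _ _ Hlt (Rmin_l _ _)));
  (assert (H2 := Rlt_le_trans _ _ _ Hlt (Rmin_r _ _)));
  (assert (E : (RtoC (t + h) - t)%C = h) by Cring);
  specialize (Hy (RtoC (t + h)));
  rewrite E, Cmod_R in Hy;
  (assert (HSt : S (RtoC (t + h))) by (apply HS; replace (t + h - t) with h by ring; auto));
  specialize (Hy HSt H1).
- replace ((Re (f (RtoC (t + h))) - Re (f t)) / h - Re l)
    with (Re (f (RtoC (t + h)) - f t - l * h)%C / h).
  2:{ rewrite !Re_sub, re_scal_r. field. auto. }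
  rewrite Rabs_div by auto. pose proof (Rabs_pos_lt h Hh).
  apply Rle_lt_trans with (eps / 2); [|lra].
  apply Rmult_le_reg_r with (Rabs h); auto. unfold Rdiv at 1. rewrite Rmult_assoc, Rinv_l by lra.
  rewrite Rmult_1_r. eapply Rle_trans; [apply re_le_Cmod|lra].
- replace ((Im (f (RtoC (t + h))) - Im (f t)) / h - Im l)
    with (Im (f (RtoC (t + h)) - f t - l * h)%C / h).
  2:{ rewrite !Im_sub, im_scal_r. field. auto. }
  rewrite Rabs_div by auto. pose proof (Rabs_pos_lt h Hh).
  apply Rle_lt_trans with (eps / 2); [|lra].
  apply Rmult_le_reg_r with (Rabs h); auto. unfold Rdiv at 1. rewrite Rmult_assoc, Rinv_l by lra.
  rewrite Rmult_1_r. eapply Rle_trans; [apply Im_le_Cmod|lra].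
Qed.

Lemma hd_real (f : R -> R) (t l : R) :
  is_derive f t l -> hd RL (fun y => RtoC (f (Re y))) t l.
Proof.
intros H. apply is_derive_Reals in H. intros eps He. destruct (H eps He) as [d Hd].
exists d. split; [apply cond_pos|]. intros y Hy Hyt.
unfold RL in Hy. destruct y as [y1 y2]. simpl in Hy. subst y2. simpl.
set (h := y1 - t).
assert (E : ((y1, 0) - t)%C = h) by (apply C_eq; unfold h; simpl; ring).
rewrite E in *. rewrite Cmod_R in *.
replace (RtoC (f y1) - RtoC (f t) - l * h)%C with (RtoC (f y1 - f t - l * h)) by Cring.
rewrite Cmod_R. destruct (Req_dec h 0) as [Z|Z].
- assert (y1 = t) by (unfold h in Z; lra). subst y1. rewrite Z.
  replace (f t - f t - l * 0) with 0 by ring. rewrite Rabs_R0. lra.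
- specialize (Hd h Z Hyt). replace (t + h) with y1 in Hd by (unfold h; ring).
  replace (f y1 - f t - l * h) with (((f y1 - f t) / h - l) * h) by (field; auto).
  rewrite Rabs_mult. apply Rmult_le_compat_r; [apply Rabs_pos|lra].
Qed.

Lemma ct_continuous (S : C -> Prop) f t :
  (exists d, 0 < d /\ forall s, Rabs (s - t) < d -> S s) -> ct S f t ->
  continuity_pt (fun s => Re (f s)) t /\ continuity_pt (fun s => Im (f s)) t.
Proof.
intros [d0 [Hd0 HS]] H. split; intros eps He; destruct (H eps He) as [d [Hd Hy]];
 exists (Rmin d d0); (split; [pos|]); intros s [_ Hs]; simpl in *; unfold R_dist in *;
 (assert (H1 := Rlt_le_trans _ _ _ Hs (Rmin_l _ _)));
 (assert (H2 := Rlt_le_trans _ _ _ Hs (Rmin_r _ _)));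
 (assert (E : (s - t)%C = RtoC (s - t)) by Cring);
 specialize (Hy s (HS s H2)); rewrite E, Cmod_R in Hy; specialize (Hy H1);
 eapply Rle_lt_trans; try exact Hy.
- apply (re_le_Cmod (f s - f t)%C).
- apply (Im_le_Cmod (f s - f t)%C).
Qed.

Lemma ct_const S a z : ct S (fun _ => a) z.
Proof. eapply hd_ct, hd_const. Qed.

Lemma ct_comp S S' f g z : ct S' f (g z) -> ct S g z -> (forall y, S y -> S' (g y)) ->
  ct S (fun y => f (g y)) z.
Proof.
intros Hf Hg HS eps He. destruct (Hf eps He) as [d [Hd H]].
destruct (Hg d Hd) as [d' [Hd' H']]. exists d'. auto.
Qed.

Lemma ctC_comp S f g z : ct all_C f (g z) -> ct S g z -> ct S (fun y => f (g y)) z.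
Proof. intros Hf Hg. eapply ct_comp; eauto. intros; exact I. Qed.

Lemma ct_plus S f g z : ct S f z -> ct S g z -> ct S (fun y => f y + g y)%C z.
Proof.
intros Hf Hg eps He.
destruct (Hf (eps/2)) as [d1 [Hd1 H1]]; [lra|].
destruct (Hg (eps/2)) as [d2 [Hd2 H2]]; [lra|].
exists (Rmin d1 d2). split; [pos|]. intros y Sy Hyz.
specialize (H1 y Sy (Rlt_le_trans _ _ _ Hyz (Rmin_l _ _))).
specialize (H2 y Sy (Rlt_le_trans _ _ _ Hyz (Rmin_r _ _))).
replace (f y + g y - (f z + g z))%C with ((f y - f z) + (g y - g z))%C by ring.
eapply Rle_lt_trans; [apply Cmod_triangle|]. lra.
Qed.

Lemma ct_mult S f g z : ct S f z -> ct S g z -> ct S (fun y => f y * g y)%C z.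
Proof.
intros Hf Hg eps He.
pose proof (Cmod_ge_0 (f z)) as Pf. pose proof (Cmod_ge_0 (g z)) as Pg.
set (A := Cmod (f z) + Cmod (g z) + 1).
assert (HE : 0 < eps / A) by (apply Rdiv_lt_0_compat; unfold A; lra).
assert (E : eps / A * A = eps) by (field; unfold A; lra).
assert (Hm : 0 < Rmin 1 (eps / A)) by pos.
destruct (Hf _ Hm) as [d1 [Hd1 H1]]. destruct (Hg _ HE) as [d2 [Hd2 H2]].
exists (Rmin d1 d2). split; [pos|]. intros y Sy Hyz.
specialize (H1 y Sy (Rlt_le_trans _ _ _ Hyz (Rmin_l _ _))).
specialize (H2 y Sy (Rlt_le_trans _ _ _ Hyz (Rmin_r _ _))).
assert (Ha := Rlt_le_trans _ _ _ H1 (Rmin_l _ _)).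
assert (Hb := Rlt_le_trans _ _ _ H1 (Rmin_r _ _)).
replace (f y * g y - f z * g z)%C
  with ((f y - f z) * g z + f z * (g y - g z) + (f y - f z) * (g y - g z))%C by ring.
eapply Rle_lt_trans; [apply Cmod_triangle|].
eapply Rle_lt_trans; [apply Rplus_le_compat_r, Cmod_triangle|]. rewrite !Cmod_mult.
pose proof (Cmod_ge_0 (f y - f z)%C).
rewrite <- E. set (e := eps / A) in *. unfold A. nra.
Qed.

Lemma ct_subset S S' f z : (forall y, S y -> S' y) -> ct S' f z -> ct S f z.
Proof.
intros HS H eps He. destruct (H eps He) as [d [Hd Hy]]. exists d. auto.
Qed.

(** * Mean value inequalities *)

Lemma real_MVT (f df : R -> R) (a b : R) : a < b ->
  (forall x, a < x < b -> is_derive f x (df x)) ->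
  (forall x, a <= x <= b -> forall eps, 0 < eps -> exists d, 0 < d /\
     forall y, a <= y <= b -> Rabs (y - x) < d -> Rabs (f y - f x) < eps) ->
  exists c, a < c < b /\ f b - f a = df c * (b - a).
Proof.
intros Hab Hd Hc.
(* Composing with the retraction onto [[a, b]] turns continuity relative to the interval into
   two-sided continuity at the endpoints. *)
set (cl := fun x => Rmax a (Rmin x b)).
assert (Hcl : forall x, a <= cl x <= b).
{ split; [apply Rmax_l|]. apply Rmax_lub; [lra|rmin]. }
assert (Hid : forall x, a <= x <= b -> cl x = x).
{ intros x Hx. unfold cl. rewrite Rmin_left by lra. apply Rmax_right. lra. }
assert (HL : forall x y, Rabs (cl y - cl x) <= Rabs (y - x)).
{ intros x y. unfold cl, Rmax, Rmin.
  repeat destruct Rle_dec; unfold Rabs; repeat destruct Rcase_abs; lra. }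
assert (D : forall c, a < c < b -> derivable_pt_lim (fun x => f (cl x)) c (df c)).
{ intros c Hx. apply is_derive_Reals.
  apply is_derive_ext_loc with f; [|auto].
  assert (Hr : 0 < Rmin (c - a) (b - c)) by pos.
  exists (mkposreal _ Hr). intros y Hy. change (Rabs (y - c) < Rmin (c - a) (b - c)) in Hy.
  rewrite Hid; auto. pose proof (Rmin_l (c - a) (b - c)). pose proof (Rmin_r (c - a) (b - c)).
  apply Rabs_lt_between in Hy. lra. }
set (pr := fun c (H : a < c < b) => exist _ (df c) (D c H) : derivable_pt (fun x => f (cl x)) c).
set (pr2 := fun c (H : a < c < b) => derivable_pt_id c).
destruct (MVT (fun x => f (cl x)) id a b pr pr2 Hab) as [c [P Hv]].
- intros c Hx eps He. destruct (Hc (cl c) (Hcl c) eps He) as [d [Hd0 Hy]].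
  exists d. split; auto. intros y [_ Hyc].
  apply Hy; auto. eapply Rle_lt_trans; [auto|auto].
- intros c Hx. apply derivable_continuous, derivable_id.
- exists c. split; auto. rewrite derive_pt_id in Hv.
  unfold id in Hv. rewrite !Hid in Hv by lra. simpl in Hv. lra.
Qed.

Lemma seg_interior (a b t : R) : a < t < b ->
  exists d, 0 < d /\ forall s, Rabs (s - t) < d -> seg a b s.
Proof. exists (Rmin (t - a) (b - t)). split; [pos|].
intros s Hs. pose proof (Rmin_l (t - a) (b - t)). pose proof (Rmin_r (t - a) (b - t)).
apply Rabs_lt_between in Hs. split; simpl; auto; lra.
Qed.

Lemma curve_MVT (f l : C -> C) (a b : R) : a < b ->
  (forall t, a <= t <= b -> ct (seg a b) f t) ->
  (forall t, a < t < b -> hd (seg a b) f t (l t)) ->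
  exists c, a < c < b /\ Re (f b) - Re (f a) = Re (l c) * (b - a).
Proof.
intros Hab Hc Hd.
apply (real_MVT (fun s => Re (f s)) (fun s => Re (l s))); auto.
- intros x Hx. apply (hd_Re (seg a b)); [apply seg_interior; auto|auto].
- intros x Hx eps He. destruct (Hc x Hx eps He) as [d [Hd0 Hy]]. exists d. split; auto.
  intros y Hyab Hyx. rewrite <- Re_sub. eapply Rle_lt_trans; [apply re_le_Cmod|].
  apply Hy; [split; simpl; auto|].
  replace (y - x)%C with (RtoC (y - x)) by Cring. rewrite Cmod_R. auto.
Qed.

(** The real mean value theorem is applied to the component of [f] along its own increment [D], that
    is to [Re (Cconj D * f)], whose total increase is [|D| ^ 2]. *)
Lemma curve_lip (f l : C -> C) (a b M : R) : a <= b ->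
  (forall t, a <= t <= b -> ct (seg a b) f t) ->
  (forall t, a < t < b -> hd (seg a b) f t (l t)) ->
  (forall t, a < t < b -> Cmod (l t) <= M) ->
  Cmod (f b - f a)%C <= M * (b - a).
Proof.
intros Hab Hc Hd HM.
destruct (Req_dec a b) as [E|E].
{ subst b. replace (f a - f a)%C with (RtoC 0) by ring. rewrite Cmod_0. lra. }
assert (Hlt : a < b) by lra.
set (D := (f b - f a)%C).
destruct (Req_dec (Cmod D) 0) as [Z|Z].
{ assert (0 <= M). { specialize (HM ((a+b)/2)). pose proof (Cmod_ge_0 (l (RtoC ((a+b)/2)))). lra. } nra. }
destruct (curve_MVT (fun y => Cconj D * f y)%C (fun y => Cconj D * l y)%C a b Hlt) as [c [Hcab Hv]].
- intros t Ht. apply ct_mult; [apply ct_const|auto].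
- intros t Ht. apply hd_scal. auto.
- assert (E1 : Re (Cconj D * f b)%C - Re (Cconj D * f a)%C = Cmod D ^ 2).
  { rewrite <- Re_sub. replace (Cconj D * f b - Cconj D * f a)%C with (D * Cconj D)%C by Cring.
    rewrite <- Cmod2_conj. auto. }
  assert (Re (Cconj D * l c)%C <= Cmod D * M).
  { eapply Rle_trans; [apply Re_le_Cmod|]. rewrite Cmod_mult, Cmod_conj.
    apply Rmult_le_compat_l; [apply Cmod_ge_0|auto]. }
  pose proof (Cmod_ge_0 D).
  nra.
Qed.

Lemma curve_const (f : C -> C) (a b : R) : a <= b ->
  (forall t, a <= t <= b -> ct (seg a b) f t) ->
  (forall t, a < t < b -> hd (seg a b) f t 0) ->
  f b = f a.
Proof.
intros Hab Hc Hd. apply Cmod_sub_0.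
replace 0 with (0 * (b - a)) by ring.
apply curve_lip with (l := fun _ => 0); auto.
intros. rewrite Cmod_0. lra.
Qed.

Definition affine (a b : C) : C -> C := fun s => (a + s * (b - a))%C.

Lemma hd_affine S (a b s : C) : hd S (affine a b) s (b - a)%C.
Proof. eapply hd_eq; [|apply hd_plus; [apply hd_const|apply hd_mult; [apply hd_id|apply hd_const]]].
Cring.
Qed.

Lemma convex_lip (f l : C -> C) (a b : C) (M : R) :
  (forall s, 0 <= s <= 1 -> hdC f (affine a b s) (l (affine a b s))) ->
  (forall s, 0 <= s <= 1 -> Cmod (l (affine a b s)) <= M) ->
  Cmod (f b - f a)%C <= M * Cmod (b - a)%C.
Proof.
intros Hd HM.
assert (E : Cmod (f (affine a b 1) - f (affine a b 0))%C <= (M * Cmod (b - a)%C) * (1 - 0)).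
{ apply (curve_lip (fun s => f (affine a b s)) (fun s => l (affine a b s) * (b - a))%C); [lra|..].
  - intros t Ht. eapply hd_ct. eapply hdC_comp; [auto|apply hd_affine].
  - intros t Ht. eapply hdC_comp; [apply Hd; lra|apply hd_affine].
  - intros t Ht. rewrite Cmod_mult. apply Rmult_le_compat_r; [apply Cmod_ge_0|apply HM; lra]. }
replace (affine a b 1) with b in E by (unfold affine; ring).
replace (affine a b 0) with a in E by (unfold affine; ring). lra.
Qed.

Lemma Cconj_sub (a b : C) : Cconj (a - b)%C = (Cconj a - Cconj b)%C.
Proof. Cring. Qed.

Lemma Cconj_add (a b : C) : Cconj (a + b)%C = (Cconj a + Cconj b)%C.
Proof. Cring. Qed.

Lemma Cconj_mul (a b : C) : Cconj (a * b)%C = (Cconj a * Cconj b)%C.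
Proof. Cring. Qed.

Lemma hd_conj_real (S : C -> Prop) (f : C -> C) (t : R) (l : C) :
  (forall y, S y -> Im y = 0) -> hd S f t l -> hd S (fun y => Cconj (f y)) t (Cconj l).
Proof.
intros HS H eps He. destruct (H eps He) as [d [Hd Hy]]. exists d. split; auto.
intros y Sy Hyt. specialize (Hy y Sy Hyt).
assert (E : Cconj (y - t)%C = (y - t)%C).
{ specialize (HS y Sy). destruct y as [y1 y2]; simpl in *. subst. Cring. }
rewrite <- Cmod_conj in Hy. rewrite !Cconj_sub, Cconj_mul, E in Hy. exact Hy.
Qed.

(** * Compactness and the open mapping property *)

Definition ctR (K : C -> Prop) (f : C -> R) (x : C) : Prop :=
  forall eps, 0 < eps -> exists d, 0 < d /\
    forall y, K y -> Cmod (y - x)%C < d -> Rabs (f y - f x) < eps.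

Lemma C_BW (u : nat -> C) (M : R) : (forall n, Cmod (u n) <= M) ->
  exists l, forall eps N, 0 < eps -> exists n, (N <= n)%nat /\ Cmod (u n - l)%C < eps.
Proof.
intros HM.
assert (Hr : forall n, - M <= Re (u n) <= M).
{ intro n. apply Rabs_le_between. eapply Rle_trans; [apply re_le_Cmod|auto]. }
assert (Hi : forall n, - M <= Im (u n) <= M).
{ intro n. apply Rabs_le_between. eapply Rle_trans; [apply Im_le_Cmod|auto]. }
destruct (Bolzano_Weierstrass (fun n => Re (u n)) _ (compact_P3 (-M) M) Hr) as [l1 H1].
assert (Hex : forall n, exists p, (n <= p)%nat /\ Rabs (Re (u p) - l1) < / (INR n + 1)).
{ intro n. assert (Hp : 0 < / (INR n + 1)) by (apply Rinv_0_lt_compat; pose proof (pos_INR n); lra).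
  destruct (H1 (fun x => Rabs (x - l1) < / (INR n + 1)) n) as [p [Hnp Hpp]].
  - exists (mkposreal _ Hp). intros x Hx. exact Hx.
  - eauto. }
destruct (functional_choice _ Hex) as [phi Hphi].
destruct (Bolzano_Weierstrass (fun n => Im (u (phi n))) _ (compact_P3 (-M) M) (fun n => Hi (phi n))) as [l2 H2].
exists (l1, l2). intros eps N He.
destruct (nfloor_ex (/ (eps / 2))) as [k Hk]. { left. pos. }
assert (Hp : 0 < eps / 2) by lra.
destruct (H2 (fun x => Rabs (x - l2) < eps / 2) (max N k)) as [p [Hnp Hpp]].
- exists (mkposreal _ Hp). intros x Hx. exact Hx.
- exists (phi p). destruct (Hphi p) as [Hp1 Hp2]. split; [lia|].
  eapply Rle_lt_trans; [apply Cmod_le_ReIm|].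
  replace (Re (u (phi p) - (l1, l2))%C) with (Re (u (phi p)) - l1) by auto.
  replace (Im (u (phi p) - (l1, l2))%C) with (Im (u (phi p)) - l2) by auto.
  assert (/ (INR p + 1) < eps / 2).
  { rewrite <- (Rinv_inv (eps / 2)). apply Rinv_0_lt_contravar; [pos|]. assert (INR k <= INR p) by (apply le_INR; lia). lra. }
  lra.
Qed.

Lemma C_min (K : C -> Prop) (f : C -> R) (M B : R) :
  (exists x, K x) -> (forall x, K x -> Cmod x <= M) -> (forall x, closure K x -> K x) ->
  (forall x, K x -> ctR K f x) -> (forall x, K x -> B <= f x) ->
  exists x, K x /\ forall y, K y -> f x <= f y.
Proof.
intros [x0 Hx0] HM Hcl Hct HB.
destruct (completeness (fun r => exists x, K x /\ r = - f x)) as [s [Hs1 Hs2]].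
{ exists (- B). intros r [x [Kx ->]]. specialize (HB x Kx). lra. }
{ eauto. }
assert (Hex : forall n : nat, exists x, K x /\ f x < - s + / (INR n + 1)).
{ intro n. assert (Hp : 0 < / (INR n + 1)) by (apply Rinv_0_lt_compat; pose proof (pos_INR n); lra).
  apply NNPP. intro Hn.
  assert (s <= s - / (INR n + 1)); [|lra]. apply Hs2. intros r [x [Kx ->]].
  apply Rnot_lt_le. intro Hlt. apply Hn. exists x. split; auto. lra. }
destruct (functional_choice _ Hex) as [u Hu].
destruct (C_BW u M) as [l Hl]; [intro n; apply HM, Hu|].
assert (Kl : K l).
{ apply Hcl. intros eps He. destruct (Hl eps 0%nat He) as [n [_ Hn]]. exists (u n). split; auto. apply Hu. }
exists l. split; auto.
assert (f l <= - s).
{ apply Rnot_lt_le. intro Hlt. set (e := (f l + s) / 2). assert (He : 0 < e) by pos.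
  destruct (Hct l Kl e He) as [d [Hd Hy]].
  destruct (nfloor_ex (/ e)) as [k Hk]. { left. pos. }
  destruct (Hl d k Hd) as [n [Hn1 Hn2]].
  specialize (Hy (u n) (proj1 (Hu n)) Hn2). destruct (Hu n) as [_ Hun].
  assert (/ (INR n + 1) < e).
  { rewrite <- (Rinv_inv e). apply Rinv_0_lt_contravar; [pos|]. assert (INR k <= INR n) by (apply le_INR; lia). lra. }
  apply Rabs_lt_between in Hy. unfold e in *. lra. }
intros y Ky. assert (- f y <= s) by eauto. lra.
Qed.

(** The step [eta / l] moves the value in the prescribed direction [eta] to first order; minimality
    arguments use it to exhibit a better point. *)
Lemma hd_direction (f : C -> C) (z l eta : C) (eps : R) : hdC f z l -> l <> 0 -> 0 < eps ->
  exists s0, 0 < s0 /\ forall s, 0 < s < s0 ->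
    Cmod (f (z + s * (eta / l)) - f z - s * eta)%C <= eps * s.
Proof.
intros H Hl He.
set (A := Cmod (eta / l)%C + 1). assert (HA : 0 < A) by (unfold A; pose proof (Cmod_ge_0 (eta / l)%C); lra).
destruct (H (eps / A)) as [d [Hd Hy]]; [pos|].
exists (d / A). split; [pos|]. intros s Hs.
specialize (Hy (z + s * (eta / l))%C I).
assert (E : Cmod (z + s * (eta / l) - z)%C = s * Cmod (eta / l)%C).
{ replace (z + s * (eta / l) - z)%C with (s * (eta / l))%C by ring.
  rewrite Cmod_mult, Cmod_R, Rabs_right; lra. }
assert (Hlt : s * A < d). { destruct Hs as [_ Hs]. apply (Rmult_lt_compat_r A) in Hs; auto.
  replace (d / A * A) with d in Hs by (field; lra). exact Hs. }
replace (l * (z + s * (eta / l) - z))%C with (s * eta)%C in Hy by (field; auto).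
eapply Rle_trans; [apply Hy|].
- unfold A in Hlt. lra.
-
  replace (eps * s) with (eps / A * (s * A)) by (field; lra).
  apply Rmult_le_compat_l; [nra|]. unfold A. nra.
Qed.

Lemma hd_expands (f : C -> C) S (z l : C) : hd S f z l -> l <> 0 ->
  exists d, 0 < d /\ forall y, S y -> Cmod (y - z)%C < d ->
    Cmod l / 2 * Cmod (y - z)%C <= Cmod (f y - f z)%C.
Proof.
intros H Hl. assert (Pl : 0 < Cmod l) by (apply Cmod_pos; auto).
destruct (H (Cmod l / 2)) as [d [Hd Hy]]; [lra|]. exists d. split; auto.
intros y Sy Hyz. specialize (Hy y Sy Hyz).
pose proof (Cmod_rev_triangle (l * (y - z))%C (l * (y - z) - (f y - f z))%C) as Ht.
replace (l * (y - z) - (l * (y - z) - (f y - f z)))%C with (f y - f z)%C in Ht by ring.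
rewrite Cmod_mult, (Cmod_sub_sym (l * (y - z))%C) in Ht. lra.
Qed.

Lemma closed_ball_closed (z : C) (r : R) (x : C) :
  closure (fun y => Cmod (y - z)%C <= r) x -> Cmod (x - z)%C <= r.
Proof.
intros H. apply Rnot_lt_le. intro Hlt.
destruct (H (Cmod (x - z)%C - r)) as [y [Hy1 Hy2]]; [lra|].
pose proof (Cmod_triangle_sub x y z). rewrite (Cmod_sub_sym x y) in H0. lra.
Qed.

Lemma Cmod_self (z : C) : Cmod (z - z) = 0.
Proof. replace (z - z)%C with (RtoC 0) by ring. apply Cmod_0. Qed.

(** Open mapping by minimization. A minimum of [|f - zeta|] over the closed ball is not on the
    boundary, where [f] is at distance at least [m] from [f z0]. At an interior minimum [z1] with
    nonzero distance, a small step along [(zeta - f z1) / l1] would decrease it. *)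
Lemma open_ball (f : C -> C) (z0 : C) (p m : R) : 0 < p -> 0 < m ->
  (forall z, Cmod (z - z0)%C <= p -> exists l, l <> RtoC 0 /\ hdC f z l) ->
  (forall z, Cmod (z - z0)%C = p -> m <= Cmod (f z - f z0)%C) ->
  forall zeta, Cmod (zeta - f z0)%C < m / 2 -> exists z, Cmod (z - z0)%C < p /\ f z = zeta.
Proof.
intros Hp Hm Hf H1 zeta Hz. pose proof (Cmod_self z0) as S0.
set (K := fun y => Cmod (y - z0)%C <= p).
destruct (C_min K (fun y => Cmod (f y - zeta)%C) (Cmod z0 + p) 0) as [z1 [Kz1 Hmin]].
- exists z0. unfold K. lra.
- intros x Kx. unfold K in Kx. pose proof (Cmod_rev_triangle x z0). lra.
- apply closed_ball_closed; auto.
- intros x Kx eps He. destruct (Hf x) as [lx [_ Hx]]; [auto|].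
  destruct (hd_ct _ _ _ _ Hx eps He) as [d [Hd Hy]]. exists d. split; auto.
  intros y _ Hyx. specialize (Hy y I Hyx). eapply Rle_lt_trans; [|exact Hy].
  apply Rabs_le. pose proof (Cmod_triangle_sub (f y) (f x) zeta). pose proof (Cmod_triangle_sub (f x) (f y) zeta).
  rewrite (Cmod_sub_sym (f x) (f y)) in H0. lra.
- intros; apply Cmod_ge_0.
- unfold K in Kz1. exists z1.
  assert (Hm0 : Cmod (f z1 - zeta)%C < m / 2).
  { eapply Rle_lt_trans; [apply (Hmin z0); unfold K; lra|]. rewrite Cmod_sub_sym. auto. }
  assert (Hin : Cmod (z1 - z0)%C < p).
  { apply Rnot_le_lt. intro Hge.
    specialize (H1 z1 ltac:(lra)).
    pose proof (Cmod_triangle_sub (f z1) zeta (f z0)). nra. }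
  split; [lra|]. apply NNPP. intro Hne.
  assert (Hpos : 0 < Cmod (f z1 - zeta)%C). { apply Cmod_pos. intro E. apply Hne. apply Csub_0; auto. }
  destruct (Hf z1) as [l1 [Hl1 Hh1]]; [lra|].
  destruct (hd_direction f z1 l1 (zeta - f z1)%C (Cmod (f z1 - zeta)%C / 2) Hh1 Hl1) as [s0 [Hs0 Hs]]; [lra|].
  set (q := Cmod ((zeta - f z1) / l1)%C).
  set (s := Rmin (s0 / 2) (Rmin (1 / 2) ((p - Cmod (z1 - z0)%C) / (q + 1)))).
  assert (Hq : 0 <= q) by apply Cmod_ge_0.
  assert (Hspos : 0 < s) by pos.
  assert (Hs1 : s <= s0 / 2) by apply Rmin_l.
  assert (Hs2 : s <= 1 / 2) by (eapply Rle_trans; [apply Rmin_r|rmin]).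
  assert (Hs3 : s <= (p - Cmod (z1 - z0)%C) / (q + 1)) by (eapply Rle_trans; [apply Rmin_r|rmin]).
  set (z2 := (z1 + s * ((zeta - f z1) / l1))%C).
  assert (Kz2 : K z2).
  { unfold K, z2. replace (z1 + s * ((zeta - f z1) / l1) - z0)%C with ((z1 - z0) + s * ((zeta - f z1) / l1))%C by ring.
    eapply Rle_trans; [apply Cmod_triangle|]. rewrite Cmod_mult, Cmod_R, Rabs_right by lra. fold q.
    apply (Rmult_le_compat_r (q + 1)) in Hs3; [|lra].
    replace ((p - Cmod (z1 - z0)%C) / (q + 1) * (q + 1)) with (p - Cmod (z1 - z0)%C) in Hs3 by (field; lra). nra. }
  specialize (Hmin z2 Kz2). assert (Hss : 0 < s < s0) by lra. specialize (Hs s Hss). fold z2 in Hs.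
  replace (f z2 - zeta)%C with ((f z2 - f z1 - s * (zeta - f z1)) + RtoC (1 - s) * (f z1 - zeta))%C in Hmin.
  2:{ Cring. }
  pose proof (Cmod_triangle (f z2 - f z1 - s * (zeta - f z1))%C (RtoC (1 - s) * (f z1 - zeta))%C) as Ht.
  rewrite Cmod_mult, Cmod_R, Rabs_right in Ht by lra. nra.
Qed.

Lemma Re_min_critical (f : C -> C) (z l : C) (r : R) : 0 < r -> hdC f z l ->
  (forall y, Cmod (y - z)%C < r -> Re (f z) <= Re (f y)) -> l = 0.
Proof.
intros Hr H Hmin. apply NNPP. intro Hl.
destruct (hd_direction f z l (RtoC (-1)) (1/2) H Hl) as [s0 [Hs0 Hs]]; [lra|].
set (q := Cmod (RtoC (-1) / l)%C). assert (Hq : 0 <= q) by apply Cmod_ge_0.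
set (s := Rmin (s0 / 2) (r / (q + 1))).
assert (Hspos : 0 < s) by pos.
assert (Hs1 : s <= s0 / 2) by apply Rmin_l. assert (Hs2 : s <= r / (q + 1)) by apply Rmin_r.
assert (Hss : 0 < s < s0) by lra. specialize (Hs s Hss).
specialize (Hmin (z + s * (RtoC (-1) / l))%C).
assert (Cmod (z + s * (RtoC (-1) / l) - z)%C < r).
{ replace (z + s * (RtoC (-1) / l) - z)%C with (s * (RtoC (-1) / l))%C by ring.
  rewrite Cmod_mult, Cmod_R, Rabs_right by lra. fold q.
  apply (Rmult_le_compat_r (q + 1)) in Hs2; [|lra].
  replace (r / (q + 1) * (q + 1)) with r in Hs2 by (field; lra). lra. }
pose proof (Re_le_Cmod (f (z + s * (RtoC (-1) / l)) - f z - s * RtoC (-1))%C) as Hre.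
rewrite !Re_sub, re_scal_l in Hre. simpl in Hre.
lra.
Qed.

(** * Complex exponential, logarithm and powers *)

Definition Cexp (z : C) : C := (RtoC (exp (Re z)) * cis (Im z))%C.

(** With [atan] for the argument this is the principal logarithm in the right half-plane only; the
    powers [Cpw] whose analytic properties are used have their base there. *)
Definition Clog (z : C) : C := (ln (Cmod z), atan (Im z / Re z)).

Definition Cpw (z : C) (a : R) : C := Cexp (RtoC a * Clog z)%C.

Lemma cis_add (x y : R) : cis (x + y) = (cis x * cis y)%C.
Proof. apply C_eq; simpl; [rewrite cos_plus|rewrite sin_plus]; ring. Qed.

Lemma Cmod_cis (x : R) : Cmod (cis x) = 1.
Proof.
unfold Cmod, cis; simpl. pose proof (sin2_cos2 x). unfold Rsqr in H.
replace (cos x * (cos x * 1) + sin x * (sin x * 1)) with 1 by lra. apply sqrt_1.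
Qed.

Lemma cis_0 : cis 0 = 1.
Proof. unfold cis. rewrite cos_0, sin_0. auto. Qed.

Lemma Cconj_cis (x : R) : Cconj (cis x) = cis (- x).
Proof. apply C_eq; simpl; [rewrite cos_neg|rewrite sin_neg]; ring. Qed.

Lemma Cexp_add (a b : C) : Cexp (a + b)%C = (Cexp a * Cexp b)%C.
Proof.
unfold Cexp. rewrite re_plus, im_plus, exp_plus, cis_add, RtoC_mult. ring.
Qed.

Lemma Cexp_0 : Cexp 0 = 1.
Proof. unfold Cexp. simpl. rewrite exp_0, cis_0. ring. Qed.

Lemma Cmod_Cexp (z : C) : Cmod (Cexp z) = exp (Re z).
Proof.
unfold Cexp. rewrite Cmod_mult, Cmod_cis, Cmod_R, Rabs_right, Rmult_1_r; auto.
apply Rle_ge, Rlt_le, exp_pos.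
Qed.

Lemma Cexp_neq_0 (z : C) : Cexp z <> 0.
Proof. apply Cmod_pos_neq. rewrite Cmod_Cexp. pos. Qed.

Lemma Cexp_R (x : R) : Cexp x = RtoC (exp x).
Proof. unfold Cexp. simpl. rewrite cis_0. ring. Qed.

Lemma Cexp_opp (z : C) : Cexp (- z)%C = (/ Cexp z)%C.
Proof.
assert (H : (Cexp (- z) * Cexp z)%C = 1).
{ rewrite <- Cexp_add. replace (- z + z)%C with (RtoC 0) by ring. apply Cexp_0. }
pose proof (Cexp_neq_0 z).
replace (Cexp (- z)%C) with ((Cexp (- z) * Cexp z) / Cexp z)%C by (field; auto). rewrite H. Cring.
Qed.

Lemma real_hd_ineq (f : R -> R) (t l : R) : is_derive f t l -> forall eps, 0 < eps ->
  exists d, 0 < d /\ forall s, Rabs (s - t) < d -> Rabs (f s - f t - l * (s - t)) <= eps * Rabs (s - t).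
Proof.
intros H eps He. destruct (hd_real f t l H eps He) as [d [Hd Hy]]. exists d. split; auto.
intros s Hs. specialize (Hy s eq_refl).
replace (s - t)%C with (RtoC (s - t)) in Hy by Cring.
rewrite Cmod_R in Hy. specialize (Hy Hs). simpl in Hy.
replace (RtoC (f s) - RtoC (f t) - l * RtoC (s - t))%C with (RtoC (f s - f t - l * (s - t))) in Hy
  by Cring.
rewrite Cmod_R in Hy. exact Hy.
Qed.

Lemma hdC_Cexp_0 : hdC Cexp 0 1.
Proof.
intros eps He.
assert (He5 : 0 < eps / 7) by lra.
assert (D1 : is_derive exp 0 1) by (auto_derive; auto; rewrite exp_0; ring).
assert (D2 : is_derive sin 0 1) by (auto_derive; auto; rewrite cos_0; ring).
assert (D3 : is_derive cos 0 0) by (auto_derive; auto; rewrite sin_0; ring).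
destruct (real_hd_ineq exp 0 1 D1 _ He5) as [d1 [Hd1 H1]].
destruct (real_hd_ineq sin 0 1 D2 _ He5) as [d2 [Hd2 H2]].
destruct (real_hd_ineq cos 0 0 D3 _ He5) as [d3 [Hd3 H3]].
rewrite exp_0 in H1. rewrite sin_0 in H2. rewrite cos_0 in H3.
exists (Rmin (Rmin d1 d2) (Rmin d3 (Rmin 1 (eps/7)))). split; [pos|].
intros [x y] _ Hy.
replace ((x, y) - 0)%C with (x, y) in * by Cring.
rewrite Cexp_0.
assert (Hx : Rabs x <= Cmod (x, y)) by apply (re_le_Cmod (x, y)).
assert (Hy' : Rabs y <= Cmod (x, y)) by apply (Im_le_Cmod (x, y)).
assert (Hm : forall a b u, u < Rmin a b -> u < a /\ u < b).
{ split; eapply Rlt_le_trans; eauto using Rmin_l, Rmin_r. }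
apply Hm in Hy. destruct Hy as [Ha Hb]. apply Hm in Ha. apply Hm in Hb.
destruct Hb as [Hb1 Hb]. apply Hm in Hb.
specialize (H1 x). specialize (H2 y). specialize (H3 y).
replace (x - 0) with x in H1 by ring. replace (y - 0) with y in * by ring.
(* The three terms are the error of [exp], the errors of [cos] and [sin] multiplied by [1 + x], and
   the mixed term [i x y]; they cost 1, 4 and 1 shares of [eps / 7]. *)
replace (Cexp (x, y) - 1 - 1 * (x, y))%C with
  (RtoC (exp x - 1 - 1 * x) * cis y + RtoC (1 + x) * (cos y - 1 - 0 * y, sin y - 0 - 1 * y)%R + x * (0, y)%R)%C.
2:{ Cring. }
eapply Rle_trans; [apply Cmod_triangle|].
eapply Rle_trans; [apply Rplus_le_compat_r, Cmod_triangle|]. rewrite !Cmod_mult, Cmod_cis, !Cmod_R.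
pose proof (Cmod_le_ReIm (cos y - 1 - 0 * y, sin y - 0 - 1 * y)) as G. simpl in G.
pose proof (Cmod_le_ReIm (0, y)) as G2. simpl in G2. rewrite Rabs_R0 in G2.
assert (Rabs (1 + x) <= 2). { pose proof (Rabs_triang 1 x). rewrite Rabs_R1 in H. lra. }
pose proof (Rabs_pos x).
set (q := Cmod (cos y - 1 - 0 * y, sin y - 0 - 1 * y)) in *. assert (0 <= q) by apply Cmod_ge_0.
nra.
Qed.

Lemma hdC_Cexp (z : C) : hdC Cexp z (Cexp z).
Proof.
apply hd_ext_all with (fun y => Cexp z * Cexp (y - z))%C.
- intro y. rewrite <- Cexp_add. f_equal. ring.
- eapply hd_eq; [|apply hd_scal; apply (hdC_comp _ Cexp (fun y => y - z)%C); [|apply hd_minus; [apply hd_id|apply hd_const]]].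
  2:{ replace (z - z)%C with (RtoC 0) by ring. apply hdC_Cexp_0. }
  ring.
Qed.

Lemma hd_Cexp S f z l : hd S f z l -> hd S (fun y => Cexp (f y)) z (Cexp (f z) * l)%C.
Proof. apply (hdC_comp S Cexp); auto. apply hdC_Cexp. Qed.

Lemma Cmod_RHP (z : C) : 0 < Re z -> Cmod z = Re z * sqrt (1 + (Im z / Re z)²).
Proof.
intros Hz. apply Rsqr_inj; [apply Cmod_ge_0|apply Rmult_le_pos; [lra|apply sqrt_pos]|].
rewrite Rsqr_mult, Rsqr_sqrt. 2:{ pose proof (Rle_0_sqr (Im z / Re z)). lra. }
pose proof (Cmod2_alt z) as H. unfold Rsqr. replace (Cmod z * Cmod z) with (Cmod z ^ 2) by ring. rewrite H.
field. lra.
Qed.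

Lemma Cexp_Clog (z : C) : 0 < Re z -> Cexp (Clog z) = z.
Proof.
intros Hz. assert (Pz : 0 < Cmod z). { pose proof (Re_le_Cmod z). lra. }
unfold Cexp, Clog. simpl. rewrite exp_ln by auto. unfold cis. rewrite cos_atan, sin_atan.
pose proof (Cmod_RHP z Hz) as H.
assert (0 < sqrt (1 + (Im z / Re z)²)) by nra.
rewrite H. apply C_eq; simpl; field; lra.
Qed.

Lemma Clog_Cexp (w : C) : - (PI / 2) < Im w < PI / 2 -> Clog (Cexp w) = w.
Proof.
intros H. unfold Clog. rewrite Cmod_Cexp, ln_exp. apply C_eq; simpl; auto.
replace ((exp (Re w) * sin (Im w) + 0 * cos (Im w)) / (exp (Re w) * cos (Im w) - 0 * sin (Im w)))
  with (tan (Im w)).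
- apply atan_tan; auto.
- assert (0 < cos (Im w)) by (apply cos_gt_0; lra). pose proof (exp_pos (Re w)). unfold tan. field. lra.
Qed.

Lemma Im_Clog (z : C) : - (PI / 2) < Im (Clog z) < PI / 2.
Proof. unfold Clog; simpl. pose proof (atan_bound (Im z / Re z)). lra. Qed.

Lemma continuous_Im (z : C) : continuous (fun y : C => Im y) z.
Proof. apply continuous_snd. Qed.

Lemma continuous_Re (z : C) : continuous (fun y : C => Re y) z.
Proof. apply continuous_fst. Qed.

Lemma continuous_ct (f : C -> R) (z : C) : continuous f z -> ctR all_C f z.
Proof.
intros H eps He.
assert (L : locally z (fun y => Rabs (f y - f z) < eps)).
{ apply (H (fun x => Rabs (x - f z) < eps)). exists (mkposreal _ He). auto. }
destruct (proj1 (nbhd_C z _) L) as [d [Hd Hy]]. exists d. auto.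
Qed.

Lemma ctR_pair S (f g : C -> R) (z : C) : ctR S f z -> ctR S g z -> ct S (fun y => (f y, g y)) z.
Proof.
intros Hf Hg eps He. destruct (Hf (eps/2)) as [d1 [Hd1 H1]]; [lra|].
destruct (Hg (eps/2)) as [d2 [Hd2 H2]]; [lra|].
exists (Rmin d1 d2). split; [pos|]. intros y Sy Hyz.
specialize (H1 y Sy (Rlt_le_trans _ _ _ Hyz (Rmin_l _ _))).
specialize (H2 y Sy (Rlt_le_trans _ _ _ Hyz (Rmin_r _ _))).
eapply Rle_lt_trans; [apply Cmod_le_ReIm|]. simpl.
replace (f y + - f z) with (f y - f z) by ring. replace (g y + - g z) with (g y - g z) by ring. lra.
Qed.

Lemma ctR_Cmod S (z : C) : ctR S Cmod z.
Proof.
intros eps He. exists eps. split; auto. intros y _ Hy. eapply Rle_lt_trans; [|exact Hy].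
apply Rabs_le. pose proof (Cmod_rev_triangle y z). pose proof (Cmod_rev_triangle z y).
rewrite (Cmod_sub_sym z y) in H0. lra.
Qed.

Lemma ctR_comp S (f : C -> R) (g : R -> R) (z : C) : ctR S f z -> continuity_pt g (f z) -> ctR S (fun y => g (f y)) z.
Proof.
intros Hf Hg eps He. destruct (Hg eps He) as [d [Hd H]]. destruct (Hf d Hd) as [d' [Hd' H']].
exists d'. split; auto. intros y Sy Hy. specialize (H' y Sy Hy).
destruct (Req_dec (f y) (f z)) as [E|E].
- rewrite E. replace (g (f z) - g (f z)) with 0 by ring. rewrite Rabs_R0. auto.
- apply H. split; [|auto]. split; [exact I|auto].
Qed.

Lemma ct_Clog (z : C) : 0 < Re z -> ct all_C Clog z.
Proof.
intros Hz. assert (Pz : 0 < Cmod z). { pose proof (Re_le_Cmod z). lra. }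
apply (ctR_pair _ (fun y => ln (Cmod y)) (fun y => atan (Im y / Re y))).
- apply ctR_comp; [apply ctR_Cmod|]. apply derivable_continuous_pt. exists (/ Cmod z).
  apply derivable_pt_lim_ln; auto.
- apply continuous_ct. apply (continuous_comp (fun y : C => Im y / Re y) atan); [|apply continuous_atan].
  apply (continuous_mult (K := R_AbsRing) (fun y : C => Im y) (fun y : C => / Re y)); [apply continuous_Im|].
  apply (continuous_comp (fun y : C => Re y) Rinv); [apply continuous_Re|apply continuous_Rinv; lra].
Qed.

Lemma hdC_inverse (f g : C -> C) (z l : C) :
  ct all_C g z -> (exists d, 0 < d /\ forall y, Cmod (y - z)%C < d -> f (g y) = y) ->
  hdC f (g z) l -> l <> 0 -> hdC g z (/ l)%C.
Proof.
intros Hg [d0 [Hd0 Hfg]] Hf Hl eps He.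
assert (Pl : 0 < Cmod l) by (apply Cmod_pos; auto).
destruct (hd_expands f _ _ l Hf Hl) as [d1 [Hd1 H1]].
assert (He' : 0 < eps * Cmod l * Cmod l / 2) by pos.
destruct (Hf _ He') as [d2 [Hd2 H2]].
assert (Hm : 0 < Rmin d1 d2) by pos.
destruct (Hg _ Hm) as [d3 [Hd3 H3]].
exists (Rmin d0 d3). split; [pos|]. intros y _ Hy.
specialize (H3 y I (Rlt_le_trans _ _ _ Hy (Rmin_r _ _))).
specialize (H1 (g y) I (Rlt_le_trans _ _ _ H3 (Rmin_l _ _))).
specialize (H2 (g y) I (Rlt_le_trans _ _ _ H3 (Rmin_r _ _))).
assert (E1 : f (g y) = y) by (apply Hfg; eapply Rlt_le_trans; [exact Hy|rmin]).
assert (E2 : f (g z) = z). { apply Hfg. replace (z - z)%C with (RtoC 0) by ring. rewrite Cmod_0; auto. }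
rewrite E1, E2 in *.
replace (g y - g z - / l * (y - z))%C with (- ((y - z - l * (g y - g z)) / l))%C by (field; auto).
rewrite Cmod_opp, Cmod_div by auto.
apply Rmult_le_reg_r with (Cmod l); auto. unfold Rdiv. rewrite Rmult_assoc, Rinv_l, Rmult_1_r by lra.
nra.
Qed.

Lemma RHP_open (z : C) : 0 < Re z -> forall y, Cmod (y - z)%C < Re z -> 0 < Re y.
Proof.
intros Hz y Hy. pose proof (re_le_Cmod (y - z)%C) as H. rewrite Re_sub in H.
apply Rabs_le_between in H. lra.
Qed.

Lemma hdC_Clog (z : C) : 0 < Re z -> hdC Clog z (/ z)%C.
Proof.
intros Hz. assert (Pz : z <> 0). { intro E. rewrite E in Hz. simpl in Hz. lra. }
apply hdC_inverse with Cexp; auto.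
- apply ct_Clog; auto.
- exists (Re z). split; auto. intros y Hy. apply Cexp_Clog. eapply RHP_open; eauto.
- rewrite <- (Cexp_Clog z) at 2 by auto. apply hdC_Cexp.
Qed.

Lemma Cpw_neq_0 z a : Cpw z a <> 0.
Proof. apply Cexp_neq_0. Qed.

Lemma Cpw_plus z a b : Cpw z (a + b) = (Cpw z a * Cpw z b)%C.
Proof. unfold Cpw. rewrite <- Cexp_add. f_equal. Cring. Qed.

Lemma Cpw_1 z : 0 < Re z -> Cpw z 1 = z.
Proof. unfold Cpw. rewrite Cmult_1_l. apply Cexp_Clog; auto. Qed.

Lemma Cpw_minus1 z a : 0 < Re z -> Cpw z a = (Cpw z (a - 1) * z)%C.
Proof.
intros. rewrite <- (Cpw_1 z) at 3 by auto. rewrite <- Cpw_plus. f_equal. ring.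
Qed.

Lemma Cmod_Cpw z a : Cmod (Cpw z a) = Rpower (Cmod z) a.
Proof. unfold Cpw. rewrite Cmod_Cexp. rewrite re_scal_l. auto. Qed.

Lemma Clog_R (x : R) : 0 < x -> Clog x = RtoC (ln x).
Proof.
intros. unfold Clog. rewrite Cmod_R, Rabs_right by lra.
unfold Rdiv. rewrite Rmult_0_l, atan_0. auto.
Qed.

Lemma Cpw_R (x a : R) : 0 < x -> Cpw x a = RtoC (Rpower x a).
Proof. intros. unfold Cpw. rewrite Clog_R by auto. rewrite <- RtoC_mult. apply Cexp_R. Qed.

Lemma hdC_Cpw (z : C) (a : R) : 0 < Re z -> hdC (fun y => Cpw y a) z (a * Cpw z (a - 1))%C.
Proof.
intros Hz. assert (Pz : z <> 0). { intro E. rewrite E in Hz. simpl in Hz. lra. } eapply hd_eq; [|apply hd_Cexp, hd_scal, hdC_Clog; auto].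
assert (E := Cpw_minus1 z a Hz). unfold Cpw at 1 in E. cbv beta. rewrite E. field; auto.
Qed.

Lemma hd_Cpw S f z l a : 0 < Re (f z) -> hd S f z l ->
  hd S (fun y => Cpw (f y) a) z (a * Cpw (f z) (a - 1) * l)%C.
Proof. intros Hz H. apply (hdC_comp S (fun y => Cpw y a)); auto. apply hdC_Cpw; auto. Qed.

Lemma Clog_scal (x : R) (z : C) : 0 < x -> 0 < Re z -> Clog (x * z)%C = (RtoC (ln x) + Clog z)%C.
Proof.
intros Hx Hz. assert (Pz : 0 < Cmod z). { pose proof (Re_le_Cmod z). lra. }
unfold Clog. rewrite Cmod_mult, Cmod_R, Rabs_right by lra. rewrite ln_mult by auto.
apply C_eq; simpl; [ring|]. rewrite Rplus_0_l. f_equal. unfold Re, Im in *. field. lra.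
Qed.

Lemma Cpw_scal (x : R) (z : C) (a : R) : 0 < x -> 0 < Re z ->
  Cpw (x * z)%C a = (RtoC (Rpower x a) * Cpw z a)%C.
Proof.
intros. unfold Cpw. rewrite Clog_scal by auto.
replace (a * (RtoC (ln x) + Clog z))%C with (RtoC (a * ln x) + a * Clog z)%C by Cring.
rewrite Cexp_add, Cexp_R. auto.
Qed.

Lemma Clog_conj (z : C) : Clog (Cconj z) = Cconj (Clog z).
Proof.
unfold Clog. rewrite Cmod_conj. apply C_eq; simpl; auto.
replace (- snd z / fst z) with (- (snd z / fst z)) by lra. apply atan_opp.
Qed.

Lemma Cexp_conj (z : C) : Cexp (Cconj z) = Cconj (Cexp z).
Proof. destruct z as [x y]. apply C_eq; simpl; rewrite ?cos_neg, ?sin_neg; ring. Qed.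

Lemma Cpw_conj (z : C) (a : R) : Cpw (Cconj z) a = Cconj (Cpw z a).
Proof. unfold Cpw. rewrite Clog_conj, <- Cexp_conj. f_equal. Cring. Qed.

Lemma exp_le_id (x : R) : Rpower 1 x = 1.
Proof. unfold Rpower. rewrite ln_1, Rmult_0_r. apply exp_0. Qed.

Lemma Rpower_neg_antitone (x y a : R) : 0 < x <= y -> a <= 0 -> Rpower y a <= Rpower x a.
Proof.
intros H Ha. unfold Rpower. destruct (Req_dec x y) as [->|Hn]; [lra|].
assert (ln x < ln y) by (apply ln_increasing; lra).
destruct (Req_dec a 0) as [->|Hn0]; [rewrite !Rmult_0_l; lra|].
left. apply exp_increasing. nra.
Qed.

(** * Integrals of complex functions over [0, 1] *)

Definition Ccont (f : C -> C) : Prop := forall t, ct RL f (RtoC t).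

Definition Cint (f : C -> C) : C :=
  (RInt (fun s => Re (f (RtoC s))) 0 1, RInt (fun s => Im (f (RtoC s))) 0 1).

Lemma RL_all t : exists d, 0 < d /\ forall s, Rabs (s - t) < d -> RL s.
Proof. exists 1. split; [lra|]. reflexivity. Qed.

Lemma Ccont_continuous f : Ccont f -> (forall t, continuous (fun s => Re (f (RtoC s))) t) /\
  (forall t, continuous (fun s => Im (f (RtoC s))) t).
Proof. split; intro t; apply continuity_pt_filterlim;
  apply (ct_continuous RL f t (RL_all t) (H t)).
Qed.

Lemma Ccont_ex f a b : Ccont f -> ex_RInt (fun s => Re (f s)) a b /\ ex_RInt (fun s => Im (f s)) a b.
Proof.
intros H. destruct (Ccont_continuous f H). split; apply (ex_RInt_continuous (V := R_CompleteNormedModule)); auto.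
Qed.

Lemma Cint_ext f g : (forall s, 0 < s < 1 -> f (RtoC s) = g (RtoC s)) -> Cint f = Cint g.
Proof.
intros H. unfold Cint. f_equal; apply RInt_ext; rewrite Rmin_left, Rmax_right by lra; intros; rewrite H; auto.
Qed.

Lemma Cint_plus f g : Ccont f -> Ccont g -> Cint (fun y => f y + g y)%C = (Cint f + Cint g)%C.
Proof.
intros Hf Hg. destruct (Ccont_ex f 0 1 Hf), (Ccont_ex g 0 1 Hg). apply C_eq; simpl;
  [rewrite <- (RInt_plus (V := R_CompleteNormedModule) (fun s => Re (f s)) (fun s => Re (g s)))
  |rewrite <- (RInt_plus (V := R_CompleteNormedModule) (fun s => Im (f s)) (fun s => Im (g s)))]; auto.
Qed.

Lemma Cint_scal a f : Ccont f -> Cint (fun y => a * f y)%C = (a * Cint f)%C.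
Proof.
intros Hf. destruct (Ccont_ex f 0 1 Hf) as [H1 H2].
assert (S1 : forall k, ex_RInt (fun s => k * Re (f s)) 0 1) by (intro k; apply (ex_RInt_scal (V := R_NormedModule)); auto).
assert (S2 : forall k, ex_RInt (fun s => k * Im (f s)) 0 1) by (intro k; apply (ex_RInt_scal (V := R_NormedModule)); auto).
assert (E1 : forall k, RInt (fun s => k * Re (f s)) 0 1 = k * RInt (fun s => Re (f s)) 0 1)
  by (intro k; apply (RInt_scal (V := R_CompleteNormedModule)); auto).
assert (E2 : forall k, RInt (fun s => k * Im (f s)) 0 1 = k * RInt (fun s => Im (f s)) 0 1)
  by (intro k; apply (RInt_scal (V := R_CompleteNormedModule)); auto).
unfold Cint. apply C_eq.
- replace (Re _) with (RInt (fun s => minus (Re a * Re (f s)) (Im a * Im (f s))) 0 1) by auto.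
  rewrite (RInt_minus (V := R_CompleteNormedModule)) by auto. rewrite E1, E2. auto.
- replace (Im (RInt _ _ _, _)) with (RInt (fun s => plus (Re a * Im (f s)) (Im a * Re (f s))) 0 1) by auto.
  rewrite (RInt_plus (V := R_CompleteNormedModule)) by auto. rewrite E1, E2. auto.
Qed.

Lemma Ccont_plus f g : Ccont f -> Ccont g -> Ccont (fun y => f y + g y)%C.
Proof. intros Hf Hg t. apply ct_plus; auto. Qed.

Lemma Ccont_mult f g : Ccont f -> Ccont g -> Ccont (fun y => f y * g y)%C.
Proof. intros Hf Hg t. apply ct_mult; auto. Qed.

Lemma Ccont_const a : Ccont (fun _ => a).
Proof. intro t. apply ct_const. Qed.

Lemma Cint_const a : Cint (fun _ => a) = a.
Proof.
unfold Cint. rewrite !RInt_const. unfold scal; simpl; unfold mult; simpl.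
Cring.
Qed.

Lemma Cint_bound f M : Ccont f -> (forall s, 0 <= s <= 1 -> Cmod (f s) <= M) -> Cmod (Cint f) <= 2 * M.
Proof.
intros Hf HM. destruct (Ccont_ex f 0 1 Hf) as [H1 H2].
assert (B1 : Rabs (RInt (fun s => Re (f s)) 0 1) <= (1 - 0) * M).
{ apply abs_RInt_le_const; auto; [lra|]. intros. eapply Rle_trans; [apply re_le_Cmod|auto]. }
assert (B2 : Rabs (RInt (fun s => Im (f s)) 0 1) <= (1 - 0) * M).
{ apply abs_RInt_le_const; auto; [lra|]. intros. eapply Rle_trans; [apply Im_le_Cmod|auto]. }
eapply Rle_trans; [apply Cmod_le_ReIm|]. unfold Cint; simpl. lra.
Qed.

(** Made for the integrand of [kap] at infinity, which is small except near [p = 1]. The factor 2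
    comes from treating real and imaginary parts separately. *)
Lemma Cint_bound_split f M m d : Ccont f -> 0 < d < 1 ->
  (forall s, 0 <= s <= 1 - d -> Cmod (f s) <= m) ->
  (forall s, 1 - d <= s <= 1 -> Cmod (f s) <= M) -> 0 <= m -> Cmod (Cint f) <= 2 * (m + d * M).
Proof.
intros Hf Hd Hm HM Pm.
assert (H : forall h : C -> R, (forall z, Rabs (h z) <= Cmod z) ->
   (forall a b, ex_RInt (fun s => h (f s)) a b) -> Rabs (RInt (fun s => h (f s)) 0 1) <= m + d * M).
{ intros h Hh Hex. rewrite <- (RInt_Chasles (V := R_CompleteNormedModule) _ 0 (1 - d) 1) by auto. eapply Rle_trans; [apply Rabs_triang|].
  assert (B1 : Rabs (RInt (fun s => h (f s)) 0 (1 - d)) <= ((1 - d) - 0) * m).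
  { apply abs_RInt_le_const; auto; [lra|]. intros. eapply Rle_trans; [auto|auto]. }
  assert (B2 : Rabs (RInt (fun s => h (f s)) (1 - d) 1) <= (1 - (1 - d)) * M).
  { apply abs_RInt_le_const; auto; [lra|]. intros. eapply Rle_trans; [auto|auto]. }
  nra. }
eapply Rle_trans; [apply Cmod_le_ReIm|]. unfold Cint; simpl.
pose proof (H Re re_le_Cmod (fun a b => proj1 (Ccont_ex f a b Hf))).
pose proof (H Im Im_le_Cmod (fun a b => proj2 (Ccont_ex f a b Hf))). lra.
Qed.

(** Differentiability is asked only inside the interval because [p ^ (2 / c)] has no derivative at
    [0] when [c > 2]. *)
Lemma Cint_FTC (F f : C -> C) : Ccont f -> (forall t, 0 <= t <= 1 -> ct (seg 0 1) F t) ->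
  (forall t, 0 < t < 1 -> hd (seg 0 1) F t (f t)) ->
  Cint f = (F 1 - F 0)%C.
Proof.
intros Hf HF Hd.
assert (H : forall h : C -> R,
   (forall t, continuous (fun s => h (f (RtoC s))) t) ->
   (forall t, 0 < t < 1 -> is_derive (fun s => h (F (RtoC s))) t (h (f t))) ->
   (forall z w, Rabs (h z - h w) <= Cmod (z - w)%C) ->
   RInt (fun s => h (f s)) 0 1 = h (F 1) - h (F 0)).
{ intros h Hc Hder Hl.
  assert (Hex : forall a b, ex_RInt (fun s => h (f s)) a b) by (intros; apply (ex_RInt_continuous (V := R_CompleteNormedModule)); auto).
  set (I := fun x => RInt (fun s => h (f s)) 0 x).
  assert (DI : forall x, is_derive I x (h (f x))).
  { intro x. apply (is_derive_RInt (fun s => h (f s)) I 0); auto.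
    apply filter_forall. intro y. apply (RInt_correct (V := R_CompleteNormedModule)); auto. }
  destruct (real_MVT (fun x => h (F x) - I x) (fun x => h (f x) - h (f x)) 0 1) as [c [_ Hc']].
  - lra.
  - intros x Hx. apply (is_derive_minus (V := R_NormedModule)); auto.
  - intros x Hx eps He.
    assert (CI : continuity_pt I x). { apply derivable_continuous_pt. exists (h (f x)). apply is_derive_Reals; auto. }
    destruct (CI (eps / 2)) as [d1 [Hd1 H1]]; [lra|].
    destruct (HF x Hx (eps / 2)) as [d2 [Hd2 H2]]; [lra|].
    exists (Rmin d1 d2). split; [pos|]. intros y Hy Hyx.
    assert (A1 := Rlt_le_trans _ _ _ Hyx (Rmin_l _ _)). assert (A2 := Rlt_le_trans _ _ _ Hyx (Rmin_r _ _)).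
    specialize (H2 y). replace (y - x)%C with (RtoC (y - x)) in H2 by Cring.
    rewrite Cmod_R in H2. specialize (H2 (conj eq_refl Hy) A2).
    assert (Rabs (I y - I x) < eps / 2).
    { destruct (Req_dec x y) as [->|Hn].
      - replace (I y - I y) with 0 by ring. rewrite Rabs_R0. lra.
      - apply (H1 y). split; [split; [exact Logic.I|auto]|auto]. }
    specialize (Hl (F y) (F x)).
    replace (h (F y) - I y - (h (F x) - I x)) with ((h (F y) - h (F x)) - (I y - I x)) by ring.
    eapply Rle_lt_trans; [apply Rabs_triang|]. rewrite Rabs_Ropp. lra.
  -
    assert (I0 : I 0 = 0) by apply (RInt_point (V := R_CompleteNormedModule)). lra. }
destruct (Ccont_continuous f Hf) as [C1 C2]. apply C_eq.
- apply (H Re); auto.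
  + intros t Ht. apply (hd_Re (seg 0 1) F t _ (seg_interior _ _ _ Ht) (Hd t Ht)).
  + intros z w. rewrite <- Re_sub. apply re_le_Cmod.
- apply (H Im); auto.
  + intros t Ht. apply (hd_Re (seg 0 1) F t _ (seg_interior _ _ _ Ht) (Hd t Ht)).
  + intros z w. rewrite <- Im_sub. apply Im_le_Cmod.
Qed.

(** * The function [kap] *)

(** The function [p ^ (2 / c)] on [[0, 1]], extended by constants so that integrands are continuous
    on the whole line, as [Ccont] requires. *)
Definition rr (c p : R) : R := if Rle_dec p 0 then 0 else Rpower (Rmin p 1) (2 / c).

Definition EE (r : R) (w : C) : C := (RtoC ((1 + r) / 2) + RtoC ((1 - r) / 2) * w)%C.

Definition kap (c : R) (w : C) : C := Cint (fun y => Cpw (EE (rr c (Re y)) w) (- c)).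

Definition kap1 (c : R) (w : C) : C :=
  Cint (fun y => RtoC (- c) * Cpw (EE (rr c (Re y)) w) (- c - 1) * RtoC ((1 - rr c (Re y)) / 2))%C.

Lemma rr_bound c p : 0 < c -> 0 <= rr c p <= 1.
Proof. unfold rr. destruct Rle_dec; [lra|]. split; [left; apply exp_pos|].
assert (0 < Rmin p 1) by pos.
unfold Rpower. apply Rle_trans with (exp 0); [|rewrite exp_0; lra].
assert (Hl : ln (Rmin p 1) <= 0).
{ destruct (Req_dec (Rmin p 1) 1) as [->|Hn]; [rewrite ln_1; lra|].
  left. apply Rlt_le_trans with (ln 1); [|rewrite ln_1; lra]. apply ln_increasing; auto. rmin. }
assert (0 < 2 / c) by pos.
destruct (Req_dec (2 / c * ln (Rmin p 1)) 0) as [->|Hn]; [lra|]. left. apply exp_increasing. nra.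
Qed.

Lemma rr_derive c p : 0 < c -> 0 < p < 1 -> is_derive (rr c) p (2 / c * rr c p / p).
Proof.
intros Hc Hp. apply is_derive_ext_loc with (fun p => exp (2 / c * ln p)).
- assert (Hd : 0 < Rmin p (1 - p)) by pos.
  exists (mkposreal _ Hd). intros y Hy. change (Rabs (y - p) < Rmin p (1 - p)) in Hy.
  pose proof (Rmin_l p (1 - p)). pose proof (Rmin_r p (1 - p)).
  apply Rabs_lt_between in Hy. unfold rr. destruct Rle_dec; [lra|]. rewrite Rmin_left by lra. auto.
- unfold rr. destruct Rle_dec; [lra|]. rewrite Rmin_left by lra. unfold Rpower.
  auto_derive; [lra|]. lra.
Qed.

Lemma rr_cont c p : 0 < c -> continuity_pt (rr c) p.
Proof.
intros Hc. assert (H2c : 0 < 2 / c) by pos.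
destruct (Rlt_le_dec 0 p) as [Hp|Hp].
- apply continuity_pt_filterlim.
  apply (continuous_ext_loc _ (fun p => exp (2 / c * ln (Rmin p 1)))).
  { exists (mkposreal _ Hp). intros y Hy. change (Rabs (y - p) < p) in Hy.
    apply Rabs_lt_between in Hy. unfold rr. destruct Rle_dec; [lra|]. auto. }
  apply continuous_exp_comp. apply (continuous_mult (K := R_AbsRing) (fun _ => 2 / c)); [apply continuous_const|].
  assert (0 < Rmin p 1) by pos.
  apply (continuous_comp (fun p => Rmin p 1) ln).
  + apply continuity_pt_filterlim. intros eps He. exists eps. split; auto. intros y [_ Hy].
    simpl in *. unfold R_dist in *. eapply Rle_lt_trans; [|exact Hy].
    unfold Rmin; repeat destruct Rle_dec; unfold Rabs; repeat destruct Rcase_abs; lra.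
  + apply continuity_pt_filterlim. apply derivable_continuous_pt. exists (/ Rmin p 1). apply derivable_pt_lim_ln; auto.
- intros eps He. exists (Rmin 1 (Rpower eps (c / 2))). split; [pos|].
  intros y [_ Hy]. simpl in *. unfold R_dist in *.
  assert (E : rr c p = 0) by (unfold rr; destruct Rle_dec; auto; lra). rewrite E, Rminus_0_r.
  destruct (Rle_lt_dec y 0) as [Hy0|Hy0].
  { unfold rr; destruct Rle_dec; [|lra]. rewrite Rabs_R0. auto. }
  assert (H1 := Rlt_le_trans _ _ _ Hy (Rmin_l _ _)). assert (H2 := Rlt_le_trans _ _ _ Hy (Rmin_r _ _)).
  apply Rabs_lt_between in H1. apply Rabs_lt_between in H2.
  unfold rr. destruct Rle_dec; [lra|]. rewrite Rmin_left by lra.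
  rewrite Rabs_right by (apply Rle_ge; left; apply exp_pos).
  apply Rlt_le_trans with (Rpower (Rpower eps (c / 2)) (2 / c)).
  + apply exp_increasing. apply Rmult_lt_compat_l; auto. apply ln_increasing; lra.
  + rewrite Rpower_mult. replace (c / 2 * (2 / c)) with 1 by (field; lra). rewrite Rpower_1; lra.
Qed.

Lemma ct_real (f : R -> R) (t : R) : continuity_pt f t -> ct RL (fun y => RtoC (f (Re y))) t.
Proof.
intros H eps He. destruct (H eps He) as [d [Hd Hy]]. exists d. split; auto.
intros y Hr Hyt. replace (RtoC (f (Re y)) - RtoC (f (Re t)))%C with (RtoC (f (Re y) - f t)) by Cring.
rewrite Cmod_R. destruct (Req_dec (Re y) t) as [E|E].
- rewrite E, Rminus_diag_eq, Rabs_R0; auto.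
- apply Hy. split; [split; [exact I|auto]|].
  eapply Rle_lt_trans; [|exact Hyt]. apply (re_le_Cmod (y - t)%C).
Qed.

Lemma Ccont_rr c (a b : R) : 0 < c -> Ccont (fun y => RtoC (a + b * rr c (Re y))).
Proof.
intros Hc t. apply (ct_real (fun p => a + b * rr c p)).
apply continuity_pt_plus; [apply continuity_const; intros ? ?; reflexivity|].
apply continuity_pt_scal. apply rr_cont; auto.
Qed.

(** The strip to the left of the axis makes [kap] differentiable in the full sense at the axis
    itself. The value [1/4] corresponds to [r = 0], [Re w = - 1/2]. *)
Lemma EE_Re r w : 0 <= r <= 1 -> - (1/2) < Re w -> 1/4 <= Re (EE r w).
Proof. unfold EE. rewrite re_plus, re_scal_l, re_RtoC. nra.
Qed.

Lemma Ccont_E c w : 0 < c -> Ccont (fun y => EE (rr c (Re y)) w).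
Proof.
intros Hc. apply Ccont_plus.
-
  replace (fun y : C => RtoC ((1 + rr c (Re y)) / 2)) with (fun y : C => RtoC (1/2 + 1/2 * rr c (Re y))).
  + apply Ccont_rr; auto.
  + apply FunctionalExtensionality.functional_extensionality. intro y. f_equal. field.
- apply Ccont_mult; [|apply Ccont_const].
  replace (fun y : C => RtoC ((1 - rr c (Re y)) / 2)) with (fun y : C => RtoC (1/2 + - (1/2) * rr c (Re y))).
  + apply Ccont_rr; auto.
  + apply FunctionalExtensionality.functional_extensionality. intro y. f_equal. field.
Qed.

Lemma Ccont_kint c w a : 0 < c -> - (1/2) < Re w -> Ccont (fun y => Cpw (EE (rr c (Re y)) w) a).
Proof.
intros Hc Hw t. apply (ctC_comp RL (fun z => Cpw z a)).
- eapply hd_ct. apply hdC_Cpw. pose proof (EE_Re (rr c (Re t)) w (rr_bound _ _ Hc) Hw). lra.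
- apply Ccont_E; auto.
Qed.

Lemma Ccont_kint1 c w : 0 < c -> - (1/2) < Re w ->
  Ccont (fun y => RtoC (- c) * Cpw (EE (rr c (Re y)) w) (- c - 1) * RtoC ((1 - rr c (Re y)) / 2))%C.
Proof.
intros Hc Hw. apply Ccont_mult; [apply Ccont_mult; [apply Ccont_const|apply Ccont_kint; auto]|].
replace (fun y : C => RtoC ((1 - rr c (Re y)) / 2)) with (fun y : C => RtoC (1/2 + - (1/2) * rr c (Re y))).
+ apply Ccont_rr; auto.
+ apply FunctionalExtensionality.functional_extensionality. intro y. f_equal. field.
Qed.

Lemma Cpw_quarter z a : 1/4 <= Re z -> a <= 0 -> Cmod (Cpw z a) <= Rpower (1/4) a.
Proof.
intros Hz Ha. rewrite Cmod_Cpw. apply Rpower_neg_antitone; auto. pose proof (Re_le_Cmod z). lra.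
Qed.

Lemma affine_Re a b s m : 0 <= s <= 1 -> m <= Re a -> m <= Re b -> m <= Re (affine a b s).
Proof. unfold affine. rewrite re_plus, re_scal_l, Re_sub. nra.
Qed.

Lemma affine_dist a b s : 0 <= s <= 1 -> Cmod (affine a b s - a)%C <= Cmod (b - a)%C.
Proof.
intros Hs. unfold affine. replace (a + s * (b - a) - a)%C with (s * (b - a))%C by ring.
rewrite Cmod_mult, Cmod_R, Rabs_right by lra. pose proof (Cmod_ge_0 (b - a)%C). nra.
Qed.

(** A bound for the second derivative of [z ^ (- c)] on the half-plane [Re z >= 1/4]. *)
Definition Mc (c : R) : R := c * (c + 1) * Rpower (1/4) (- c - 2).

Lemma Cpw_Taylor c z1 z2 : 0 < c -> 1/4 <= Re z1 -> 1/4 <= Re z2 ->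
  Cmod (Cpw z2 (- c) - Cpw z1 (- c) - RtoC (- c) * Cpw z1 (- c - 1) * (z2 - z1))%C <= Mc c * Cmod (z2 - z1)%C ^ 2.
Proof.
intros Hc H1 H2.
set (G1 := fun z => (RtoC (- c) * Cpw z (- c - 1))%C).
assert (L1 : forall s, 0 <= s <= 1 -> Cmod (G1 (affine z1 z2 s) - G1 z1)%C <= Mc c * Cmod (z2 - z1)%C).
{ intros s Hs. set (z := affine z1 z2 s).
  assert (Hz : 1/4 <= Re z) by (apply affine_Re; auto).
  eapply Rle_trans.
  - apply (convex_lip G1 (fun y => RtoC (- c) * (RtoC (- c - 1) * Cpw y (- c - 1 - 1)))%C z1 z (Mc c)).
    + intros u Hu. apply hd_scal. apply hdC_Cpw. pose proof (affine_Re z1 z u (1/4) Hu H1 Hz). lra.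
    + intros u Hu. rewrite !Cmod_mult, !Cmod_R. rewrite !Rabs_left by lra.
      assert (HP : Cmod (Cpw (affine z1 z u) (- c - 1 - 1)) <= Rpower (1/4) (- c - 2)).
      { replace (- c - 2) with (- c - 1 - 1) by ring. apply Cpw_quarter; [apply affine_Re; auto|lra]. } replace (- - c * (- (- c - 1) * Cmod (Cpw (affine z1 z u) (- c - 1 - 1))))
        with (c * (c + 1) * Cmod (Cpw (affine z1 z u) (- c - 1 - 1))) by ring.
      apply Rmult_le_compat_l; auto. nra.
  - apply Rmult_le_compat_l; [|apply affine_dist; auto]. unfold Mc. pose proof (exp_pos ((- c - 2) * ln (1/4))).
    unfold Rpower. nra. }
set (H := fun z => (Cpw z (- c) - G1 z1 * z)%C).
assert (L2 : Cmod (H z2 - H z1)%C <= (Mc c * Cmod (z2 - z1)%C) * Cmod (z2 - z1)%C).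
{ apply convex_lip with (l := fun z => (G1 z - G1 z1)%C); auto.
  intros s Hs. apply hd_minus.
  - apply hdC_Cpw. pose proof (affine_Re z1 z2 s (1/4) Hs H1 H2). lra.
  - eapply hd_eq; [|apply hd_scal, hd_id]. ring. }
replace (Cpw z2 (- c) - Cpw z1 (- c) - RtoC (- c) * Cpw z1 (- c - 1) * (z2 - z1))%C with (H z2 - H z1)%C by Cring.
lra.
Qed.

Lemma Mc_pos c : 0 < c -> 0 < Mc c.
Proof. intros. pos. Qed.

(** Differentiation under the integral sign: the Taylor remainder of the integrand is quadratic in
    [v - w], uniformly in [p], by [Cpw_Taylor]. *)
Lemma hdC_kap c w : 0 < c -> - (1/2) < Re w -> hdC (kap c) w (kap1 c w).
Proof.
intros Hc Hw eps He. pose proof (Mc_pos c Hc).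
exists (Rmin (Re w + 1/2) (eps / (2 * Mc c))). split.
{ pos. }
intros v _ Hv.
assert (V1 := Rlt_le_trans _ _ _ Hv (Rmin_l _ _)). assert (V2 := Rlt_le_trans _ _ _ Hv (Rmin_r _ _)).
assert (Hv' : - (1/2) < Re v).
{ pose proof (re_le_Cmod (v - w)%C) as G. rewrite Re_sub in G. apply Rabs_le_between in G. lra. }
unfold kap, kap1.
set (f1 := fun y => Cpw (EE (rr c (Re y)) v) (- c)). set (f2 := fun y => Cpw (EE (rr c (Re y)) w) (- c)).
set (f3 := fun y : C => (RtoC (- c) * Cpw (EE (rr c (Re y)) w) (- c - 1) * RtoC ((1 - rr c (Re y)) / 2))%C).
assert (C1 : Ccont f1) by exact (Ccont_kint c v _ Hc Hv'). assert (C2 : Ccont f2) by exact (Ccont_kint c w _ Hc Hw).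
assert (C3 : Ccont f3) by exact (Ccont_kint1 c w Hc Hw).
replace (Cint f1 - Cint f2 - Cint f3 * (v - w))%C with (Cint (fun y => f1 y + (RtoC (-1) * f2 y + (w - v) * f3 y)))%C.
2:{ rewrite Cint_plus, Cint_plus, !Cint_scal; auto. ring.
    apply Ccont_mult; auto; apply Ccont_const. apply Ccont_mult; auto; apply Ccont_const.
    apply Ccont_plus; apply Ccont_mult; auto; apply Ccont_const. }
set (t := Cmod (v - w)%C) in *. assert (0 <= t) by apply Cmod_ge_0.
apply Rle_trans with (2 * (Mc c * t ^ 2)).
- apply Cint_bound.
  { apply Ccont_plus; auto. apply Ccont_plus; apply Ccont_mult; auto; apply Ccont_const. }
  intros s Hs. unfold f1, f2, f3. simpl Re. set (r := rr c s).
  assert (Hr : 0 <= r <= 1) by (apply rr_bound; auto).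
  assert (Ed : (EE r v - EE r w)%C = (RtoC ((1 - r) / 2) * (v - w))%C) by Cring.
  pose proof (Cpw_Taylor c (EE r w) (EE r v) Hc (EE_Re r w Hr Hw) (EE_Re r v Hr Hv')) as HT.
  rewrite Ed in HT.
  replace (Cpw (EE r v) (- c) + (RtoC (-1) * Cpw (EE r w) (- c) + (w - v) * (RtoC (- c) * Cpw (EE r w) (- c - 1) * RtoC ((1 - r) / 2))))%C
   with (Cpw (EE r v) (- c) - Cpw (EE r w) (- c) - RtoC (- c) * Cpw (EE r w) (- c - 1) * (RtoC ((1 - r) / 2) * (v - w)))%C by ring.
  eapply Rle_trans; [exact HT|]. rewrite Cmod_mult, Cmod_R. fold t. rewrite Rabs_right by lra.
  apply Rmult_le_compat_l; [lra|]. nra.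
- apply (Rmult_lt_compat_l (2 * Mc c)) in V2; [|lra].
  replace (2 * Mc c * (eps / (2 * Mc c))) with eps in V2 by (field; lra). nra.
Qed.

Lemma Cpw_one a : Cpw 1 a = 1.
Proof. rewrite Cpw_R by lra. rewrite exp_le_id. auto. Qed.

(** The primitive [p E ^ (- c)] has derivative [g] in [p], because [p r' = (2 / c) r], and it goes
    from [0] to [1], as [E = 1] at [p = 1]. So the constant [1] on the right is [Cint g], and what
    is left is an identity between integrands. *)
Lemma kap_ode c w : 0 < c -> - (1/2) < Re w ->
  ((w * w - 1) * kap1 c w = c * (1 - w * kap c w))%C.
Proof.
intros Hc Hw.
set (E := fun y : C => EE (rr c (Re y)) w). set (r := fun y : C => RtoC (rr c (Re y))).
assert (HE : forall y, 0 < Re (E y)). { intro y. pose proof (EE_Re (rr c (Re y)) w (rr_bound _ _ Hc) Hw). unfold E. lra. }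
assert (Cr : Ccont r).
{ unfold r. replace (fun y : C => RtoC (rr c (Re y))) with (fun y : C => RtoC (0 + 1 * rr c (Re y))).
  - apply Ccont_rr; auto.
  - apply FunctionalExtensionality.functional_extensionality. intro y. Cring. }
set (g := fun y => (Cpw (E y) (- c - 1) * ((1 + w) / 2 + (w - 1) / 2 * r y))%C).
assert (Ck : Ccont (fun y => Cpw (E y) (- c - 1))) by exact (Ccont_kint c w _ Hc Hw).
assert (Ck0 : Ccont (fun y => Cpw (E y) (- c))) by exact (Ccont_kint c w _ Hc Hw).
assert (Cg : Ccont g).
{ apply Ccont_mult; auto. apply Ccont_plus; [apply Ccont_const|]. apply Ccont_mult; [apply Ccont_const|auto]. }
assert (I1 : Cint g = 1).
{ rewrite (Cint_FTC (fun y => y * Cpw (E y) (- c))%C g Cg).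
  - unfold E. replace (rr c (Re 1)) with 1.
    2:{ simpl. unfold rr. destruct Rle_dec; [lra|]. rewrite Rmin_left by lra. symmetry; apply exp_le_id. }
    replace (EE 1 w) with (RtoC 1). 2:{ apply C_eq; simpl; field. }
    rewrite Cpw_one. ring.
  - intros t Ht. apply ct_mult; [eapply hd_ct, hd_id|]. eapply ct_subset; [|auto]. intros y Hy; apply Hy.
  - intros t Ht.
    assert (Dr : hd (seg 0 1) r t (RtoC (2 / c * rr c t / t))).
    { apply hd_subset with RL; [intros y Hy; apply Hy|]. apply (hd_real (rr c)). apply rr_derive; auto. }
    assert (DE : hd (seg 0 1) E t (RtoC (2 / c * rr c t / t) * ((1 - w) / 2))%C).
    { apply hd_ext_all with (fun y => (1 + w) / 2 + r y * ((1 - w) / 2))%C.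
      - intro y. apply C_eq; simpl; field.
      - eapply hd_eq; [|apply hd_plus; [apply hd_const|apply hd_mult; [exact Dr|apply hd_const]]]. Cring. }
    eapply hd_eq; [|apply hd_mult; [apply hd_id|apply hd_Cpw; [auto|exact DE]]].
    unfold g. rewrite (Cpw_minus1 (E t) (- c)) by auto. replace (r t) with (RtoC (rr c t)) by auto.
    replace (E t) with ((1 + w) / 2 + RtoC (rr c t) * ((1 - w) / 2))%C at 2
      by (unfold E, EE; apply C_eq; simpl; field).
    set (P := Cpw (E t) (- c - 1)). set (q := rr c t).
    replace (t * (RtoC (- c) * P * (RtoC (2 / c * q / t) * ((1 - w) / 2))))%C
      with (RtoC (t * (- c * (2 / c * q / t))) * P * ((1 - w) / 2))%C by Cring.
    replace (t * (- c * (2 / c * q / t))) with (-2 * q) by (field; lra).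
    Cring. }
unfold kap, kap1.
change (fun y : C => Cpw (EE (rr c (Re y)) w) (- c)) with (fun y => Cpw (E y) (- c)).
set (f3 := fun y : C => (RtoC (- c) * Cpw (EE (rr c (Re y)) w) (- c - 1) * RtoC ((1 - rr c (Re y)) / 2))%C).
assert (C3 : Ccont f3) by exact (Ccont_kint1 c w Hc Hw).
rewrite <- I1 at 2.
apply Csub_0.
replace ((w * w - 1) * Cint f3 - c * (Cint g - w * Cint (fun y : C => Cpw (E y) (- c))))%C
 with (Cint (fun y => (w * w - 1) * f3 y + (RtoC (- c) * g y + (c * w) * Cpw (E y) (- c))))%C.
2:{ rewrite Cint_plus, Cint_plus, !Cint_scal; auto.
    - Cring.
    - apply Ccont_mult; auto; apply Ccont_const.
    - apply Ccont_mult; auto; apply Ccont_const.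
    - apply Ccont_mult; auto; apply Ccont_const.
    - apply Ccont_plus; apply Ccont_mult; auto; apply Ccont_const. }
rewrite (Cint_ext _ (fun _ => 0)); [apply Cint_const|].
intros s Hs. unfold f3, g. rewrite (Cpw_minus1 (E s) (- c)) by auto.
change (EE (rr c (Re s)) w) with (E s).
replace (E s) with ((1 + w) / 2 + r s * ((1 - w) / 2))%C
      by (unfold E, EE, r; apply C_eq; simpl; field).
replace (RtoC ((1 - rr c (Re s)) / 2)) with ((1 - r s) / 2)%C
  by (unfold r; apply C_eq; simpl; field).
Cring.
Qed.

Lemma kap_conj c w : 0 < c -> - (1/2) < Re w -> kap c (Cconj w) = Cconj (kap c w).
Proof.
intros Hc Hw.
assert (Hk := Ccont_kint c w (-c) Hc Hw).
destruct (Ccont_ex _ 0 1 Hk) as [_ H2].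
change (ex_RInt (fun s => Im (Cpw (EE (rr c s) w) (- c))) 0 1) in H2.
assert (E : forall s, Cpw (EE (rr c s) (Cconj w)) (- c) = Cconj (Cpw (EE (rr c s) w) (- c))).
{ intro s. rewrite <- Cpw_conj. f_equal. Cring. } apply C_eq.
-
  apply RInt_ext. intros s _. rewrite E. auto.
- change (RInt (fun s => Im (Cpw (EE (rr c s) (Cconj w)) (- c))) 0 1 = opp (RInt (fun s => Im (Cpw (EE (rr c s) w) (- c))) 0 1)).
  rewrite <- (RInt_opp (V := R_CompleteNormedModule) _ 0 1 H2). apply RInt_ext. intros s _. rewrite E. auto.
Qed.

Definition Bk (c : R) : R := 2 * Rpower (1/4) (- c).

Lemma kap_bound c w : 0 < c -> - (1/2) < Re w -> Cmod (kap c w) <= Bk c.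
Proof.
intros Hc Hw. apply Cint_bound.
- apply Ccont_kint; auto.
- intros s Hs. apply Cpw_quarter; [|lra]. apply EE_Re; auto. apply rr_bound; auto.
Qed.

(** For [p <= 1 - d] the modulus of [E] grows linearly with that of [w]; the interval [[1 - d, 1]]
    contributes at most [d] times the uniform bound [B] of the integrand. *)
Lemma kap_inf c eps : 0 < c -> 0 < eps -> exists M, 0 < M /\
  forall w, 0 <= Re w -> M <= Cmod w -> Cmod (kap c w) <= eps.
Proof.
intros Hc He.
set (B := Rpower (1/4) (- c)). assert (HB : 0 < B) by pos.
set (d := Rmin (1/2) (eps / (4 * B))).
assert (Hd : 0 < d) by pos.
assert (Hd1 : d <= 1/2) by apply Rmin_l. assert (Hd2 : d <= eps / (4 * B)) by apply Rmin_r.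
set (r0 := Rpower (1 - d) (2 / c)).
assert (H2c : 0 < 2 / c) by pos.
assert (Hr0 : 0 < r0 < 1).
{ split; [pos|]. apply Rlt_le_trans with (exp 0); [apply exp_increasing|rewrite exp_0; lra].
  assert (ln (1 - d) < ln 1) by (apply ln_increasing; lra). rewrite ln_1 in H. nra. }
(* Chosen so that [(1 - r0) / 2 * M], a lower bound for [|E|], has the power [- c] equal to
   [eps / 4]. *)
set (M := Rpower (eps / 4) (- / c) * (2 / (1 - r0))).
assert (HM : 0 < M) by pos.
exists M. split; auto. intros w Hw HMw.
assert (Hw' : - (1/2) < Re w) by lra.
apply Rle_trans with (2 * (eps / 4 + d * B)).
- apply Cint_bound_split; try lra.
  + apply Ccont_kint; auto.
  + intros s Hs. rewrite Cmod_Cpw.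
    assert (Hr : 0 <= rr c s <= r0).
    { split; [apply rr_bound; auto|]. unfold rr. destruct Rle_dec; [lra|]. rewrite Rmin_left by lra.
      unfold r0, Rpower. destruct (Req_dec s (1 - d)) as [->|Hn]; [lra|].
      left. apply exp_increasing. apply Rmult_lt_compat_l; auto. apply ln_increasing; lra. }
    set (r := rr c s) in *.
    assert (HE : (1 - r0) / 2 * Cmod w <= Cmod (EE r w)).
    { apply Rsqr_incr_0_var; [|apply Cmod_ge_0]. unfold Rsqr.
      replace (Cmod (EE r w) * Cmod (EE r w)) with (Cmod (EE r w) ^ 2) by ring.
      replace ((1 - r0) / 2 * Cmod w * ((1 - r0) / 2 * Cmod w)) with (((1 - r0) / 2) ^ 2 * Cmod w ^ 2) by ring.
      rewrite !Cmod2_alt. unfold EE. rewrite re_plus, im_plus, re_scal_l, im_scal_l, re_RtoC, im_RtoC.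
      set (x := Re w) in *. assert (((1 - r0) / 2) ^ 2 <= ((1 - r) / 2) ^ 2) by nra.
      assert (0 <= (1 + r) / 2 * ((1 - r) / 2 * x)) by (repeat apply Rmult_le_pos; lra).
      nra. }
    assert (H1 : Rpower (eps / 4) (- / c) <= Cmod (EE r w)).
    { apply Rle_trans with ((1 - r0) / 2 * M); [|nra].
      unfold M. right. field. lra. }
    assert (H0 : 0 < Rpower (eps / 4) (- / c)) by pos.
    eapply Rle_trans; [apply (Rpower_neg_antitone _ _ (- c) (conj H0 H1)); lra|].
    rewrite Rpower_mult. replace (- / c * - c) with 1 by (field; lra). rewrite Rpower_1; lra.
  + intros s Hs. apply Cpw_quarter; [|lra]. apply EE_Re; auto. apply rr_bound; auto.
- assert (d * B <= eps / 4).
  { apply (Rmult_le_compat_r B) in Hd2; [|lra]. replace (eps / (4 * B) * B) with (eps / 4) in Hd2 by (field; lra). auto. }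
  lra.
Qed.

(** The boundary point of the right half-plane at height [- x]. *)
Definition ax (x : R) : C := (0, - x).

(** The abscissa of the vertical line on which [(1 + x ^ 2) ^ (c / 2) kap (ax x)] moves; [KK] is the
    ordinate. *)
Definition a0 (c : R) : R := Re (kap c (RtoC 0)).

Definition KK (c x : R) : R := Rpower (1 + x ^ 2) (c / 2) * Im (kap c (ax x)).

Lemma ax_C x : ax x = (- Ci * x)%C.
Proof. Cring. Qed.

Lemma hd_ax S x : (forall y, S y -> Im y = 0) -> hd S (fun y => ax (Re y)) (RtoC x) (- Ci)%C.
Proof.
intros HS. eapply hd_ext with (fun y => - Ci * y)%C.
- exists 1. split; [lra|]. intros y Sy _. specialize (HS y Sy). destruct y as [y1 y2]. simpl in *. subst.
  Cring.
- Cring.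
- eapply hd_eq; [|apply hd_scal, hd_id]. ring.
Qed.

Lemma pw_derive c x : is_derive (fun x => Rpower (1 + x ^ 2) c) x (2 * c * x * Rpower (1 + x ^ 2) (c - 1)).
Proof.
assert (0 < 1 + x ^ 2) by nra.
replace (Rpower (1 + x ^ 2) (c - 1)) with (Rpower (1 + x ^ 2) c / (1 + x ^ 2)).
- unfold Rpower. auto_derive; [lra|]. simpl in *. lra.
- unfold Rminus. rewrite Rpower_plus, Rpower_Ropp, Rpower_1 by auto. lra.
Qed.

(** The equation for [kap] makes this derivative purely imaginary, which is why the boundary values
    of [FF] lie on the [2 / c] power of a vertical line. *)
Lemma kap_axis_hd c x : 0 < c ->
  hd RL (fun y => RtoC (Rpower (1 + Re y ^ 2) (c / 2)) * kap c (ax (Re y)))%C (RtoC x)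
        (Ci * RtoC (c * Rpower (1 + x ^ 2) (c / 2 - 1)))%C.
Proof.
intros Hc.
assert (Hw : - (1/2) < Re (ax x)) by (simpl; lra).
eapply hd_eq; [|apply hd_mult; [apply (hd_real _ _ _ (pw_derive (c/2) x))|]].
2:{ apply (hdC_comp RL (kap c) (fun y => ax (Re y)) x); [apply (hdC_kap c (ax x)); auto|].
    apply hd_ax. auto. }
cbv beta. replace (Re x) with x by auto.
assert (O := kap_ode c (ax x) Hc Hw).
assert (P : 0 < 1 + x ^ 2) by nra.
replace (Rpower (1 + x ^ 2) (c / 2)) with (Rpower (1 + x ^ 2) (c / 2 - 1) * (1 + x ^ 2)).
2:{ rewrite <- (Rpower_1 (1 + x ^ 2)) at 2 by auto. rewrite <- Rpower_plus. f_equal. ring. }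
set (q := Rpower (1 + x ^ 2) (c / 2 - 1)). set (k := kap c (ax x)) in *. set (k1 := kap1 c (ax x)) in *.
assert (Q : (- RtoC (1 + x ^ 2) * k1)%C = (c * (1 - ax x * k))%C).
{ rewrite <- O. Cring. }
replace (RtoC (q * (1 + x ^ 2)) * (k1 * - Ci))%C with (q * Ci * (- RtoC (1 + x ^ 2) * k1))%C by Cring.
rewrite Q.
replace (2 * (c / 2) * x * q) with (c * x * q) by lra. Cring.
Qed.

Lemma kap_axis c x : 0 < c ->
  (RtoC (Rpower (1 + x ^ 2) (c / 2)) * kap c (ax x))%C = (a0 c, KK c x).
Proof.
intros Hc.
apply C_eq; [|unfold KK; rewrite im_scal_l; reflexivity].
set (N := fun y => (RtoC (Rpower (1 + Re y ^ 2) (c / 2)) * kap c (ax (Re y)))%C).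
assert (E0 : Re (N 0) = a0 c).
{ unfold N, a0. simpl Re at 2 3. rewrite re_scal_l. replace (1 + 0 ^ 2) with 1 by ring. rewrite exp_le_id, Rmult_1_l.
  f_equal. f_equal. Cring. }
change (Re (N x) = Re (a0 c, KK c x)). simpl (Re (_, _)). rewrite <- E0.
assert (G : forall a b, a < b -> Re (N a) = Re (N b)).
{ intros a b Hab.
  destruct (curve_MVT N (fun y => Ci * RtoC (c * Rpower (1 + Re y ^ 2) (c / 2 - 1)))%C a b Hab) as [t [_ Ht]].
  - intros t _. apply ct_subset with RL; [intros y Hy; apply Hy|]. eapply hd_ct. apply kap_axis_hd; auto.
  - intros t _. apply hd_subset with RL; [intros y Hy; apply Hy|]. apply kap_axis_hd; auto.
  - assert (Z : forall q, Re (Ci * RtoC q)%C = 0) by (intro q; simpl; ring).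
    rewrite Z in Ht. lra. }
destruct (Rtotal_order x 0) as [H|[->|H]]; auto. symmetry; auto.
Qed.

Lemma KK_derive c x : 0 < c -> is_derive (KK c) x (c * Rpower (1 + x ^ 2) (c / 2 - 1)).
Proof.
intros Hc. destruct (hd_Re RL _ x _ (RL_all x) (kap_axis_hd c x Hc)) as [_ H].
replace (c * Rpower (1 + x ^ 2) (c / 2 - 1)) with (Im (Ci * RtoC (c * Rpower (1 + x ^ 2) (c / 2 - 1)))%C).
- eapply is_derive_ext; [|exact H]. intro t. cbv beta. rewrite im_scal_l. auto.
- simpl. ring.
Qed.

Lemma a0_pos c : 0 < c -> 0 < a0 c.
Proof.
intros Hc.
change (0 < RInt (fun s => Re (Cpw (EE (rr c s) 0) (- c))) 0 1).
assert (Hk := Ccont_kint c 0 (-c) Hc ltac:(simpl; lra)).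
destruct (Ccont_ex _ 0 1 Hk) as [H1 _].
apply Rlt_le_trans with (RInt (fun _ => 1) 0 1).
- rewrite RInt_const. pos.
- apply RInt_le; auto; [lra|apply ex_RInt_const|].
  intros s Hs. pose proof (rr_bound c s Hc) as Hr.
  replace (EE (rr c s) 0) with (RtoC ((1 + rr c s) / 2)) by Cring.
  rewrite Cpw_R by lra. apply Rle_trans with (Rpower 1 (- c)); [rewrite exp_le_id; lra|]. apply Rpower_neg_antitone; lra.
Qed.

Lemma Re_kap_axis c x : 0 < c -> 0 < Re (kap c (ax x)).
Proof.
intros Hc. pose proof (kap_axis c x Hc) as H. apply (f_equal Re) in H. rewrite re_scal_l in H. simpl Re at 2 in H.
pose proof (a0_pos c Hc). assert (0 < Rpower (1 + x ^ 2) (c / 2)) by pos. nra.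
Qed.

Lemma closed_RHP_axis w : 0 <= Re w -> 0 < Re w \/ w = ax (- Im w).
Proof.
intros [H|H]; [lra|right]. apply C_eq; simpl; [lra|ring].
Qed.

(* At a critical point the differential equation gives [kap w = / w], so [Re kap] has
   no minimum [<= 0] inside the half-plane. *)
Lemma kap_Re_min c w r : 0 < c -> 0 < Re w -> 0 < r ->
  (forall y, Cmod (y - w)%C < r -> Re (kap c w) <= Re (kap c y)) -> 0 < Re (kap c w).
Proof.
intros Hc Hw Hr Hmin.
assert (H1 : kap1 c w = 0) by (apply (Re_min_critical (kap c) w _ r Hr); auto; apply hdC_kap; auto; lra).
assert (O := kap_ode c w Hc ltac:(lra)). rewrite H1 in O.
assert (RtoC c <> 0) by (intro E; apply (f_equal Re) in E; simpl in E; lra).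
assert (E : (w * kap c w)%C = 1).
{ assert (E1 : (c * (1 - w * kap c w))%C = 0) by (rewrite <- O; ring).
  assert (E2 : (1 - w * kap c w)%C = 0).
  { replace (1 - w * kap c w)%C with ((c * (1 - w * kap c w)) / c)%C by (field; auto). rewrite E1. Cring. }
  replace (w * kap c w)%C with (1 - (1 - w * kap c w))%C by ring. rewrite E2. ring. }
assert (E2 : (Cconj w * (w * kap c w))%C = Cconj w) by (rewrite E; ring).
replace (Cconj w * (w * kap c w))%C with ((w * Cconj w) * kap c w)%C in E2 by ring.
rewrite <- Cmod2_conj in E2. apply (f_equal Re) in E2.
rewrite re_scal_l, re_conj in E2.
nra.
Qed.

Lemma kap_ctR c w : 0 < c -> 0 <= Re w -> forall S, ctR S (fun y => Re (kap c y)) w.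
Proof.
intros Hc Hw S eps He. destruct (hd_ct _ _ _ _ (hdC_kap c w Hc ltac:(lra)) eps He) as [d [Hd Hy]].
exists d. split; auto. intros y _ Hyw. rewrite <- Re_sub. eapply Rle_lt_trans; [apply re_le_Cmod|]. apply Hy; auto. exact I.
Qed.

(** Minimum principle on a large half-disk: a negative minimum is attained neither on the axis,
    where [Re kap > 0], nor far out, where [kap] is small, nor inside, by [kap_Re_min]. *)
Lemma kap_Re_nonneg c w : 0 < c -> 0 <= Re w -> 0 <= Re (kap c w).
Proof.
intros Hc Hw. apply Rnot_lt_le. intro Hneg.
destruct (kap_inf c (- Re (kap c w) / 2) Hc ltac:(lra)) as [M [HM Hinf]].
set (N := M + Cmod w + 1). pose proof (Cmod_ge_0 w).
destruct (C_min (fun y => 0 <= Re y /\ Cmod y <= N) (fun y => Re (kap c y)) N (- Bk c)) as [z [[Hz1 Hz2] Hmin]].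
- exists w. unfold N. lra.
- intros x Hx; apply Hx.
- intros x Hx. split; apply Rnot_lt_le; intro Hlt.
  + destruct (Hx (- Re x)) as [y [[Hy1 Hy2] Hy3]]; [lra|]. pose proof (re_le_Cmod (y - x)%C) as G. rewrite Re_sub in G.
    apply Rabs_le_between in G. lra.
  + destruct (Hx (Cmod x - N)) as [y [[Hy1 Hy2] Hy3]]; [lra|]. pose proof (Cmod_rev_triangle x y).
    rewrite (Cmod_sub_sym x y) in H0. lra.
- intros x Hx. apply kap_ctR; tauto.
- intros x Hx. pose proof (kap_bound c x Hc ltac:(lra)). pose proof (re_le_Cmod (kap c x)) as G.
  apply Rabs_le_between in G. lra.
- assert (Hzw : Re (kap c z) <= Re (kap c w)) by (apply Hmin; unfold N; lra).
  destruct (closed_RHP_axis z Hz1) as [Hp|Hax].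
  2:{ rewrite Hax in Hzw. pose proof (Re_kap_axis c (- Im z) Hc). lra. }
  assert (HzM : Cmod z < M).
  { apply Rnot_le_lt. intro Hge. specialize (Hinf z Hz1 Hge). pose proof (re_le_Cmod (kap c z)) as G.
    apply Rabs_le_between in G. lra. }
  assert (0 < Re (kap c z)); [|lra].
  apply kap_Re_min with (r := Rmin (Re z) 1); auto; [pos|].
  intros y Hy. apply Hmin.
  assert (A1 := Rlt_le_trans _ _ _ Hy (Rmin_l _ _)). assert (A2 := Rlt_le_trans _ _ _ Hy (Rmin_r _ _)).
  split. { left. eapply RHP_open; eauto. } pose proof (Cmod_rev_triangle y z). unfold N. lra.
Qed.

(** Once [Re kap >= 0] is known, an interior point with [Re kap <= 0] would be a local minimum, to
    which [kap_Re_min] applies. *)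
Lemma kap_Re_pos c w : 0 < c -> 0 <= Re w -> 0 < Re (kap c w).
Proof.
intros Hc Hw. destruct (closed_RHP_axis w Hw) as [Hp|Hax].
2:{ rewrite Hax. apply Re_kap_axis; auto. }
apply Rnot_le_lt. intro Hle.
assert (0 < Re (kap c w)); [|lra].
apply kap_Re_min with (r := Re w); auto. intros y Hy.
assert (0 < Re y) by (eapply RHP_open; eauto). pose proof (kap_Re_nonneg c y Hc ltac:(lra)). lra.
Qed.

(** * The invariant of the flow *)

Definition FF (c eta : R) (w : C) : C := ((1 - w * w) * Cpw (kap c w - Ci * RtoC eta) (2 / c))%C.

Definition FF1 (c eta : R) (w : C) : C :=
  (RtoC 2 * (Ci * RtoC eta * w - 1) * Cpw (kap c w - Ci * RtoC eta) (2 / c - 1))%C.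

Definition ell (c J : R) : C := Cpw (a0 c, J) (2 / c).

Definition JJ (c eta x : R) : R := KK c x - eta * Rpower (1 + x ^ 2) (c / 2).

Lemma Re_kap_eta c eta w : Re (kap c w - Ci * RtoC eta)%C = Re (kap c w).
Proof. simpl. ring. Qed.

Lemma FF_axis c eta x : 0 < c -> FF c eta (ax x) = ell c (JJ c eta x).
Proof.
intros Hc. unfold FF, ell.
assert (P : 0 < 1 + x ^ 2) by nra.
assert (E : (a0 c, JJ c eta x) = (RtoC (Rpower (1 + x ^ 2) (c / 2)) * (kap c (ax x) - Ci * eta))%C).
{ replace (RtoC (Rpower (1 + x ^ 2) (c / 2)) * (kap c (ax x) - Ci * eta))%C
   with (RtoC (Rpower (1 + x ^ 2) (c / 2)) * kap c (ax x) - Ci * RtoC (eta * Rpower (1 + x ^ 2) (c / 2)))%C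
   by Cring.
  rewrite kap_axis by auto. unfold JJ. Cring. }
rewrite E, Cpw_scal; [|pos|rewrite Re_kap_eta; apply Re_kap_axis; auto]. rewrite Rpower_mult. replace (c / 2 * (2 / c)) with 1 by (field; lra). rewrite Rpower_1 by auto. Cring.
Qed.

(** The equation for [kap] eliminates its derivative, after which [kap] itself cancels outside the
    power. One computation with both arguments moving serves for [eta] fixed, in [FF_hd], and along
    the flow, in [FF_conserved]. *)
Lemma FF_hd_gen S c (w eta : C -> C) t w' eta' : 0 < c -> 0 <= Re (w t) ->
  (exists e, eta t = RtoC e) ->
  hd S w t w' -> hd S eta t eta' ->
  hd S (fun y => (1 - w y * w y) * Cpw (kap c (w y) - Ci * eta y) (2 / c))%C t
    (RtoC 2 * Ci * Cpw (kap c (w t) - Ci * eta t) (2 / c - 1) *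
      ((eta t * w t + Ci) * w' - (1 - w t * w t) * eta' / RtoC c))%C.
Proof.
intros Hc Hw [e He] Dw De.
assert (Rk : 0 < Re (kap c (w t) - Ci * eta t)%C).
{ rewrite He, Re_kap_eta. apply kap_Re_pos; auto. }
assert (c0 : RtoC c <> 0) by (intro E; apply (f_equal Re) in E; simpl in E; lra).
eapply hd_eq; [|apply hd_mult; [apply hd_minus; [apply hd_const|apply hd_mult; [exact Dw|exact Dw]]
  |apply hd_Cpw; [lra|apply hd_minus; [eapply hdC_comp; [apply hdC_kap; auto; lra|exact Dw]|apply hd_scal; exact De]]]].
cbv beta. rewrite (Cpw_minus1 _ (2 / c) Rk).
assert (O := kap_ode c (w t) Hc ltac:(lra)).
set (P := Cpw (kap c (w t) - Ci * eta t) (2 / c - 1)). set (k := kap c (w t)) in *. set (k1 := kap1 c (w t)) in *.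
replace (RtoC (2 / c)) with (2 / c)%C by (rewrite RtoC_div; auto; lra).
set (W := w t) in *. set (H := eta t).
transitivity (P * ((- RtoC 2 * W * (k - Ci * H)) * w' - 2 / c * ((W * W - 1) * k1) * w' - (1 - W * W) * 2 / c * Ci * eta'))%C.
{ field; auto. }
rewrite O.
transitivity (P * ((- RtoC 2 * W * (k - Ci * H)) * w' - 2 * (1 - W * k) * w' - (1 - W * W) * 2 / c * Ci * eta'))%C.
{ field; auto. }
transitivity (P * (2 * Ci * W * H * w' + 2 * (Ci * Ci) * w' - (1 - W * W) * 2 / c * Ci * eta'))%C.
{ Cring. }
Cring.
Qed.

Lemma FF_hd c eta w : 0 < c -> 0 <= Re w -> hdC (FF c eta) w (FF1 c eta w).
Proof.
intros Hc Hw.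
eapply hd_eq; [|apply (FF_hd_gen all_C c (fun y => y) (fun _ => eta) w 1 0); auto;
   [exists eta; auto|apply hd_id|apply hd_const]].
Cring.
Qed.

Lemma FF_conserved S c (w eta : C -> C) t w' eta' : 0 < c -> 0 <= Re (w t) ->
  (exists e, eta t = RtoC e) -> hd S w t w' -> hd S eta t eta' ->
  (RtoC c * (eta t * w t + Ci) * w' = (1 - w t * w t) * eta')%C ->
  hd S (fun y => (1 - w y * w y) * Cpw (kap c (w y) - Ci * eta y) (2 / c))%C t (RtoC 0).
Proof.
intros Hc Hw He Dw De O. eapply hd_eq; [|apply (FF_hd_gen S c w eta t w' eta'); auto].
assert (c0 : RtoC c <> 0) by (intro E; apply (f_equal Re) in E; simpl in E; lra).
rewrite <- O. field; auto.
Qed.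

Lemma FF1_neq_0 c eta w : 0 < c -> 0 <= Re w -> (Ci * RtoC eta * w <> RtoC 1)%C -> FF1 c eta w <> RtoC 0.
Proof.
intros Hc Hw Hne. apply Cmult_neq_0; [apply Cmult_neq_0|apply Cpw_neq_0].
- intro E; apply (f_equal Re) in E; simpl in E; lra.
- intro E. apply Hne. apply Csub_0. exact E.
Qed.

(** The factor [i eta w - 1] can vanish only at the driving point [- i / eta], which is on the
    axis. *)
Lemma FF1_neq_0_open c eta w : 0 < c -> 0 <= eta -> 0 < Re w -> FF1 c eta w <> 0.
Proof.
intros Hc He Hw. apply FF1_neq_0; auto; [lra|]. intro E.
pose proof (f_equal Re E) as E1. pose proof (f_equal Im E) as E2. simpl in E1, E2.
assert (A1 : eta * Re w = 0) by (unfold Re; lra).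
apply Rmult_integral in A1. nra.
Qed.

(** Joint continuity in [eta] and [w], for limits along which time varies together with the
    point. *)
Definition jct (G : R -> C -> C) (e0 : R) (w0 : C) : Prop :=
  forall eps, 0 < eps -> exists d, 0 < d /\
    forall e w, Rabs (e - e0) < d -> Cmod (w - w0)%C < d -> Cmod (G e w - G e0 w0)%C < eps.

Lemma jct_mult G H e0 w0 : jct G e0 w0 -> jct H e0 w0 -> jct (fun e w => G e w * H e w)%C e0 w0.
Proof.
intros HG HH eps He. set (A := Cmod (G e0 w0)). set (B := Cmod (H e0 w0)).
assert (PA : 0 <= A) by apply Cmod_ge_0. assert (PB : 0 <= B) by apply Cmod_ge_0.
set (k := Rmin 1 (eps / (A + B + 2))).
assert (Pk : 0 < k) by pos. assert (k <= 1) by apply Rmin_l. assert (K2 : k <= eps / (A + B + 2)) by apply Rmin_r.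
apply (Rmult_le_compat_r (A + B + 2)) in K2; [|lra]. replace (eps / (A + B + 2) * (A + B + 2)) with eps in K2 by (field; lra).
destruct (HG k Pk) as [d1 [D1 H1]]. destruct (HH k Pk) as [d2 [D2 H2]].
exists (Rmin d1 d2). split; [pos|]. intros e w E1 E2.
specialize (H1 e w ltac:(rmin) ltac:(rmin)). specialize (H2 e w ltac:(rmin) ltac:(rmin)).
set (u := (G e w - G e0 w0)%C) in *. set (v := (H e w - H e0 w0)%C) in *.
replace (G e w * H e w - G e0 w0 * H e0 w0)%C with (u * v + (G e0 w0 * v + u * H e0 w0))%C by (Cring).
eapply Rle_lt_trans; [apply Cmod_triangle|]. eapply Rle_lt_trans; [apply Rplus_le_compat_l, Cmod_triangle|].
rewrite !Cmod_mult. fold A B. pose proof (Cmod_ge_0 u). nra.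
Qed.

Lemma jct_ct (f : C -> C) e0 w0 : ct all_C f w0 -> jct (fun _ w => f w) e0 w0.
Proof. intros H eps He. destruct (H eps He) as [d [Hd H']]. exists d. split; auto. intros e w _ Hw. apply H'; [exact I|auto]. Qed.

Lemma jct_lin a b e0 w0 : jct (fun e w => a * e + b)%C e0 w0.
Proof.
intros eps He. pose proof (Cmod_ge_0 a). exists (eps / (Cmod a + 1)). split; [pos|]. intros e w E _.
replace (a * e + b - (a * e0 + b))%C with (a * RtoC (e - e0))%C by (Cring).
rewrite Cmod_mult, Cmod_R. apply (Rmult_lt_compat_r (Cmod a + 1)) in E; [|lra].
replace (eps / (Cmod a + 1) * (Cmod a + 1)) with eps in E by (field; lra). nra.
Qed.

Lemma jct_plus G H e0 w0 : jct G e0 w0 -> jct H e0 w0 -> jct (fun e w => G e w + H e w)%C e0 w0.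
Proof.
intros HG HH eps He. destruct (HG (eps / 2) ltac:(lra)) as [d1 [D1 H1]]. destruct (HH (eps / 2) ltac:(lra)) as [d2 [D2 H2]].
exists (Rmin d1 d2). split; [pos|]. intros e w E1 E2.
specialize (H1 e w ltac:(rmin) ltac:(rmin)). specialize (H2 e w ltac:(rmin) ltac:(rmin)).
replace (G e w + H e w - (G e0 w0 + H e0 w0))%C with ((G e w - G e0 w0) + (H e w - H e0 w0))%C by ring.
eapply Rle_lt_trans; [apply Cmod_triangle|]. lra.
Qed.

Lemma jct_Cpw c a e0 w0 : 0 < c -> 0 <= Re w0 -> jct (fun e w => Cpw (kap c w - Ci * e) a)%C e0 w0.
Proof.
intros Hc Hw eps He. assert (Rq : 0 < Re (kap c w0 - Ci * e0)%C) by (rewrite Re_kap_eta; apply kap_Re_pos; auto).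
destruct (hd_ct _ _ _ _ (hdC_Cpw _ a Rq) eps He) as [d1 [D1 H1]].
assert (J : jct (fun e w => kap c w + (- Ci * e + 0))%C e0 w0).
{ apply jct_plus; [apply jct_ct; eapply hd_ct, hdC_kap; [auto|lra]|apply jct_lin]. }
destruct (J d1 D1) as [d [D H]]. exists d. split; auto. intros e w E1 E2. apply H1; [exact I|].
replace (kap c w - Ci * e - (kap c w0 - Ci * e0))%C
  with (kap c w + (- Ci * e + 0) - (kap c w0 + (- Ci * e0 + 0)))%C by ring. auto.
Qed.

Lemma FF_joint c e0 w0 : 0 < c -> 0 <= Re w0 -> jct (FF c) e0 w0.
Proof.
intros Hc Hw. apply (jct_mult (fun _ w => 1 - w * w)%C); [|apply jct_Cpw; auto].
apply jct_ct. eapply hd_ct, hd_minus; [apply hd_const|apply hd_mult; apply hd_id].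
Qed.

Lemma FF1_joint c e0 w0 : 0 < c -> 0 <= Re w0 -> jct (FF1 c) e0 w0.
Proof.
intros Hc Hw. apply (jct_mult (fun e w => 2 * (Ci * e * w - 1))%C); [|apply jct_Cpw; auto].
assert (J : jct (fun e w => (2 * Ci * e + 0) * w + - 2)%C e0 w0).
{ apply jct_plus; [apply jct_mult; [apply jct_lin|apply jct_ct; eapply hd_ct, hd_id]|apply jct_ct; eapply hd_ct, hd_const]. }
intros eps He. destruct (J eps He) as [d [D H]]. exists d. split; auto. intros e w E1 E2. specialize (H e w E1 E2).
replace (2 * (Ci * e * w - 1) - 2 * (Ci * e0 * w0 - 1))%C with
  ((2 * Ci * e + 0) * w + - 2 - ((2 * Ci * e0 + 0) * w0 + - 2))%C by ring. exact H.
Qed.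

(** Far out [|kap| <= eta / 2], so [|kap - i e| >= eta / 2] for every [e >= eta]. The uniformity
    keeps preimages bounded while [e] varies. *)
Lemma FF_inf_unif c eta B : 0 < c -> 0 < eta -> exists M, 0 < M /\
  forall e w, eta <= e -> 0 <= Re w -> M <= Cmod w -> B < Cmod (FF c e w).
Proof.
intros Hc He. destruct (kap_inf c (eta / 2) Hc ltac:(lra)) as [M0 [HM0 H0]].
set (L := Rpower (eta / 2) (2 / c)). assert (HL : 0 < L) by pos.
set (M := Rmax M0 (Rabs B / L + 2)).
assert (HB : 0 <= Rabs B / L). { apply Rmult_le_pos; [apply Rabs_pos|left; apply Rinv_0_lt_compat; auto]. }
assert (M0 <= M) by apply Rmax_l. assert (Rabs B / L + 2 <= M) by apply Rmax_r.
exists M. split; [lra|]. intros e w Hew Hw HMw.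
specialize (H0 w Hw ltac:(lra)). unfold FF. rewrite Cmod_mult, Cmod_Cpw.
assert (E1 : Cmod w ^ 2 - 1 <= Cmod (1 - w * w)%C).
{ pose proof (Cmod_rev_triangle (w * w)%C 1) as G. rewrite Cmod_sub_sym, Cmod_1, Cmod_mult in G. lra. }
assert (E2 : eta / 2 <= Cmod (kap c w - Ci * e)%C).
{ pose proof (Cmod_rev_triangle (Ci * e)%C (kap c w)) as G.
  rewrite Cmod_sub_sym, Cmod_mult, Cmod_Ci, Cmod_R, Rabs_right in G; lra. }
assert (E3 : L <= Rpower (Cmod (kap c w - Ci * e)%C) (2 / c)).
{ apply Rle_Rpower_l; [left; apply Rdiv_lt_0_compat; lra|lra]. }
assert (E4 : 0 < Cmod w ^ 2 - 1) by nra.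
apply Rlt_le_trans with ((Cmod w ^ 2 - 1) * L); [|nra].
assert (E5 : Rabs B / L < Cmod w ^ 2 - 1) by nra.
apply (Rmult_lt_compat_r L) in E5; auto. replace (Rabs B / L * L) with (Rabs B) in E5 by (field; lra).
pose proof (Rle_abs B). lra.
Qed.

Lemma FF_inf c eta B : 0 < c -> 0 < eta -> exists M, 0 < M /\
  forall w, 0 <= Re w -> M <= Cmod w -> B < Cmod (FF c eta w).
Proof. intros Hc He. destruct (FF_inf_unif c eta B Hc He) as [M [HM H]]. exists M. split; auto. intros w. apply H. lra. Qed.

Lemma pw_pos x a : 0 < Rpower (1 + x ^ 2) a.
Proof. pos. Qed.

Lemma JJ_derive c eta x : 0 < c -> is_derive (JJ c eta) x (c * Rpower (1 + x ^ 2) (c / 2 - 1) * (1 - eta * x)).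
Proof.
intros Hc. evar_last.
- apply (is_derive_minus (V := R_NormedModule) (KK c)); [apply KK_derive; auto|].
  apply (is_derive_scal (fun x => Rpower (1 + x ^ 2) (c / 2))); apply pw_derive.
- unfold minus, plus, opp; simpl. field.
Qed.

(** [tipJ c (1 / eta)] is the position of the tip on the line [ell]. *)
Definition tipJ (c Y : R) : R := JJ c (/ Y) Y.

(** An envelope computation: [Y] is the critical point of [JJ c (/ Y)], so only the explicit
    dependence on [eta = / Y] contributes. *)
Lemma tipJ_derive c Y : 0 < c -> 0 < Y -> is_derive (tipJ c) Y (Rpower (1 + Y ^ 2) (c / 2) / Y ^ 2).
Proof.
intros Hc HY.
assert (D1 : is_derive Rinv Y (- / Y ^ 2)) by (auto_derive; [lra|field; lra]).
assert (D2 : is_derive (fun Y => / Y * Rpower (1 + Y ^ 2) (c / 2)) Y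
  (- / Y ^ 2 * Rpower (1 + Y ^ 2) (c / 2) + / Y * (2 * (c / 2) * Y * Rpower (1 + Y ^ 2) (c / 2 - 1)))).
{ apply (is_derive_mult (K := R_AbsRing) Rinv (fun x => Rpower (1 + x ^ 2) (c / 2)) Y _ _ D1 (pw_derive (c/2) Y)).
  intros; apply Rmult_comm. }
replace (Rpower (1 + Y ^ 2) (c / 2) / Y ^ 2) with (c * Rpower (1 + Y ^ 2) (c / 2 - 1)
 - (- / Y ^ 2 * Rpower (1 + Y ^ 2) (c / 2) + / Y * (2 * (c / 2) * Y * Rpower (1 + Y ^ 2) (c / 2 - 1)))) by (field; lra).
apply (is_derive_minus (V := R_NormedModule) (KK c)); [apply KK_derive; auto|auto].
Qed.

Lemma incr_of_derive (f df : R -> R) a b : a < b -> (forall x, a <= x <= b -> is_derive f x (df x)) ->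
  (forall x, a < x < b -> 0 < df x) -> f a < f b.
Proof.
intros Hab Hd Hp. destruct (real_MVT f df a b Hab) as [t [Ht E]].
- intros x Hx. apply Hd; lra.
- intros x Hx eps He. assert (C : continuity_pt f x).
  { apply derivable_continuous_pt. exists (df x). apply is_derive_Reals, Hd; auto. }
  destruct (C eps He) as [d [Hd0 H]]. exists d. split; auto. intros y _ Hy.
  destruct (Req_dec y x) as [->|Hn]; [rewrite Rminus_diag_eq, Rabs_R0; auto|].
  apply H. split; [split; [exact I|auto]|auto].
- specialize (Hp t Ht). nra.
Qed.

Lemma tipJ_incr c Y1 Y2 : 0 < c -> 0 < Y1 < Y2 -> tipJ c Y1 < tipJ c Y2.
Proof.
intros Hc H. apply (incr_of_derive (tipJ c) (fun Y => Rpower (1 + Y ^ 2) (c / 2) / Y ^ 2)); [lra|..].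
- intros x Hx. apply tipJ_derive; lra.
- intros x Hx. pos.
Qed.

Lemma JJ_incr c eta x1 x2 : 0 < c -> 0 < eta -> x1 < x2 <= / eta -> JJ c eta x1 < JJ c eta x2.
Proof.
intros Hc He H. apply (incr_of_derive (JJ c eta) (fun x => c * Rpower (1 + x ^ 2) (c / 2 - 1) * (1 - eta * x))); [lra|..].
- intros x Hx. apply JJ_derive; auto.
- intros x Hx. pose proof (pw_pos x (c / 2 - 1)).
  apply Rmult_lt_0_compat; [nra|]. assert (eta * x < eta * / eta) by nra.
  rewrite Rinv_r in H1 by lra. lra.
Qed.

Lemma JJ_decr c eta x1 x2 : 0 < c -> 0 < eta -> / eta <= x1 < x2 -> JJ c eta x2 < JJ c eta x1.
Proof.
intros Hc He H.
assert (- JJ c eta x1 < - JJ c eta x2); [|lra].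
apply (incr_of_derive (fun x => - JJ c eta x) (fun x => - (c * Rpower (1 + x ^ 2) (c / 2 - 1) * (1 - eta * x)))); [lra|..].
- intros x Hx. apply (is_derive_opp (V := R_NormedModule)). apply JJ_derive; auto.
- intros x Hx. pose proof (pw_pos x (c / 2 - 1)).
  assert (eta * / eta < eta * x) by nra.
  rewrite Rinv_r in H1 by lra.
  assert (0 < c * Rpower (1 + x ^ 2) (c / 2 - 1) * (eta * x - 1)); [|lra].
  pos.
Qed.

Lemma JJ_le_tip c eta x : 0 < c -> 0 < eta -> JJ c eta x <= tipJ c (/ eta).
Proof. unfold tipJ. rewrite Rinv_inv.
destruct (Rtotal_order x (/ eta)) as [H|[->|H]]; [left; apply JJ_incr; auto; lra|lra|left; apply JJ_decr; auto; lra].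
Qed.

Lemma FF_tip c eta : 0 < c -> 0 < eta -> FF c eta (ax (/ eta)) = ell c (tipJ c (/ eta)).
Proof. intros. rewrite FF_axis by auto. unfold tipJ. rewrite Rinv_inv. auto. Qed.

(** ** Asymptotics of the tip *)

(** For [c >= 1] the derivative of [tipJ] exceeds [/ Y], so [tipJ] grows at least like the
    logarithm. *)
Lemma tipJ_unbounded c B : 1 <= c -> exists Y0, 0 < Y0 /\ forall Y, Y0 <= Y -> B < tipJ c Y.
Proof.
intros Hc.
set (A := B - tipJ c 1).
assert (G : forall Y, 1 < Y -> ln Y <= tipJ c Y - tipJ c 1).
{ intros Y HY.
  assert (H : tipJ c 1 - ln 1 < tipJ c Y - ln Y); [|rewrite ln_1 in H; lra].
  apply (incr_of_derive (fun Y => tipJ c Y - ln Y) (fun Y => Rpower (1 + Y ^ 2) (c / 2) / Y ^ 2 - / Y)); auto.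
  - intros x Hx. apply (is_derive_minus (V := R_NormedModule)); [apply tipJ_derive; lra|]. apply is_derive_ln. lra.
  - intros x Hx.
    assert (x < Rpower (1 + x ^ 2) (c / 2)).
    { apply Rlt_le_trans with (Rpower (1 + x ^ 2) (/ 2)).
      - rewrite Rpower_sqrt by nra. rewrite <- (sqrt_square x) at 1 by lra. apply sqrt_lt_1; nra.
      - apply Rle_Rpower; nra. }
    apply Rlt_Rminus. apply (Rmult_lt_reg_r (x ^ 2)); [nra|]. unfold Rdiv. rewrite Rmult_assoc, Rinv_l by nra.
    replace (/ x * x ^ 2) with x by (field; lra). lra. }
exists (exp (Rabs A + 1)). split; [pos|]. intros Y HY.
assert (1 < Y). { eapply Rlt_le_trans; [|exact HY]. apply Rlt_le_trans with (1 + (Rabs A + 1)); [pose proof (Rabs_pos A); lra|].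
  left. apply exp_ineq1. pose proof (Rabs_pos A). lra. }
specialize (G Y H).
assert (Rabs A + 1 <= ln Y). { rewrite <- (ln_exp (Rabs A + 1)).
  destruct (Req_dec (exp (Rabs A + 1)) Y) as [->|Hn]; [lra|]. left. apply ln_increasing; [pos|lra]. }
pose proof (Rle_abs A). unfold A in *. lra.
Qed.

Definition TT (c : R) : R := a0 c * tan (PI * c / 2).

Lemma Cexp_I (x : R) : Cexp (Ci * x)%C = cis x.
Proof. apply C_eq; simpl; replace (0 * x - 1 * 0) with 0 by ring; replace (0 * 0 + 1 * x) with x by ring; rewrite exp_0; ring. Qed.

Lemma hd_cis S x : (forall y, S y -> Im y = 0) -> hd S (fun y => cis (Re y)) (RtoC x) (Ci * cis x)%C.
Proof.
intros HS. apply hd_ext with (fun y => Cexp (Ci * y)%C).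
- exists 1. split; [lra|]. intros y Sy _. specialize (HS y Sy).
  rewrite <- Cexp_I. destruct y; simpl in *; subst; reflexivity.
- rewrite Cexp_I. auto.
- eapply hd_eq; [|apply hd_Cexp, hd_scal, hd_id]. rewrite Cexp_I. ring.
Qed.

Lemma Clog_cis x : - (PI/2) < x < PI/2 -> Clog (cis x) = (Ci * x)%C.
Proof.
intros H. rewrite <- Cexp_I. apply Clog_Cexp. simpl. lra.
Qed.

Lemma Cpw_cis x a : - (PI/2) < x < PI/2 -> Cpw (cis x) a = cis (a * x).
Proof.
intros H. unfold Cpw. rewrite Clog_cis by auto. rewrite <- Cexp_I. f_equal. Cring.
Qed.

Lemma Re_cis_pos x : - (PI/2) < x < PI/2 -> 0 < Re (cis x).
Proof. intros. apply cos_gt_0; lra. Qed.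

(* [w^c kap w] varies little along the arc from [p] to [- i p], since its derivative
   [c w^(c-1) (w - kap w) / (w^2 - 1)] is [O(|w|^(c-2))]. *)
Lemma kap_arc c p : 0 < c -> 2 <= p ->
  Cmod (cis (- (PI * c / 4)) * kap c (ax p) - cis (PI * c / 4) * kap c p)%C
    <= c * (p + Bk c) / (p ^ 2 - 1) * (PI / 2).
Proof.
intros Hc Hp. pose proof PI_RGT_0.
set (W := fun y => (p * cis (Re y))%C).
(* The shift by [PI / 4] puts the base of the power in the right half-plane for the whole arc
   [- PI / 2 <= t <= 0]; it only contributes a constant phase. The constant modulus [p ^ c] is left
   out. *)
set (G := fun y => (Cpw (cis (Re y + PI / 4)) c * kap c (W y))%C).
assert (HW : forall t, - (PI / 2) <= t <= 0 -> 0 <= Re (W t)).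
{ intros t Ht. unfold W. rewrite re_scal_l. simpl. apply Rmult_le_pos; [lra|]. apply cos_ge_0; lra. }
set (G1 := fun y => (Cpw (cis (Re y + PI / 4)) c * Ci * (c * kap c (W y) + W y * kap1 c (W y)))%C).
assert (D : forall t, - (PI / 2) <= t <= 0 -> hd (seg (- (PI / 2)) 0) G t (G1 t)).
{ intros t Ht.
  assert (HS : forall y, seg (- (PI / 2)) 0 y -> Im y = 0) by (intros y Hy; apply Hy).
  assert (D1 : hd (seg (- (PI / 2)) 0) (fun y => cis (Re y + PI / 4)) t (Ci * cis (t + PI / 4))%C).
  { apply hd_ext_all with (fun y => cis (Re y) * cis (PI / 4))%C; [intro; symmetry; apply cis_add|].
    eapply hd_eq; [|apply hd_mult; [apply hd_cis; auto|apply hd_const]]. rewrite cis_add. ring. }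
  assert (D2 : hd (seg (- (PI / 2)) 0) W t (Ci * W t)%C).
  { eapply hd_eq; [|apply hd_scal, hd_cis; auto]. Cring. }
  assert (Rp : 0 < Re (cis (t + PI / 4))) by (apply Re_cis_pos; lra).
  eapply hd_eq; [|apply hd_mult; [apply hd_Cpw; [auto|exact D1]|
     apply (hdC_comp _ (kap c) W t); [apply hdC_kap; auto; specialize (HW t Ht); lra|exact D2]]].
  unfold G1. replace (Re t) with t by auto.
  rewrite (Cpw_minus1 (cis (t + PI / 4)) c Rp). ring. }
assert (E : Cmod (G 0 - G (RtoC (- (PI / 2))))%C <= c * (p + Bk c) / (p ^ 2 - 1) * (0 - - (PI / 2))).
{ apply curve_lip with (l := G1); [lra|..].
  - intros t Ht. eapply hd_ct, D; auto.
  - intros t Ht. apply D; lra.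
  - intros t Ht. unfold G1.
    assert (Hw := HW t ltac:(lra)). set (w := W t) in *.
    assert (Mw : Cmod w = p). { unfold w, W. rewrite Cmod_mult, Cmod_cis, Cmod_R, Rabs_right; lra. }
    assert (O := kap_ode c w Hc ltac:(lra)).
    assert (M2 : p ^ 2 - 1 <= Cmod (w * w - 1)%C).
    { pose proof (Cmod_rev_triangle (w * w)%C 1) as T. rewrite Cmod_1, Cmod_mult, Mw in T. lra. }
    assert (P2 : 0 < p ^ 2 - 1) by nra.
    assert (Hn : (w * w - 1)%C <> 0) by (apply Cmod_pos_neq; lra).
    replace (c * kap c w + w * kap1 c w)%C with (c * (w - kap c w) / (w * w - 1))%C.
    2:{ replace (kap1 c w) with (((w * w - 1) * kap1 c w) / (w * w - 1))%C by (field; auto). rewrite O. field; auto. }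
    rewrite !Cmod_mult, Cmod_Ci, Cmod_Cpw, Cmod_cis, exp_le_id, Cmod_div, Cmod_mult, Cmod_R, Rabs_right; auto; [|lra].
    assert (Cmod (w - kap c w)%C <= p + Bk c).
    { eapply Rle_trans; [apply Cmod_triangle|]. rewrite Cmod_opp, Mw. pose proof (kap_bound c w Hc ltac:(lra)). lra. }
    rewrite !Rmult_1_l. pose proof (Cmod_ge_0 (w - kap c w)%C).
    apply Rmult_le_compat; [nra|left; apply Rinv_0_lt_compat; lra|nra|].
    apply Rinv_le_contravar; lra. }
unfold G, W in E. simpl (Re _) in E.
rewrite cis_0, Cmult_1_r in E.
rewrite !Cpw_cis in E by lra.
replace (c * (- (PI / 2) + PI / 4)) with (- (PI * c / 4)) in E by lra.
replace (c * (0 + PI / 4)) with (PI * c / 4) in E by lra.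
replace (p * cis (- (PI / 2)))%C with (ax p) in E.
2:{ apply C_eq; simpl; rewrite ?cos_neg, ?sin_neg, ?cos_PI2, ?sin_PI2; ring. }
rewrite Cmod_sub_sym. lra.
Qed.

Lemma kap_real c p : 0 < c -> 0 <= p -> Im (kap c p) = 0.
Proof.
intros Hc Hp. pose proof (kap_conj c p Hc ltac:(simpl; lra)) as H.
replace (Cconj p) with (RtoC p) in H by Cring.
apply (f_equal Im) in H.
change (Im (kap c p) = - Im (kap c p)) in H. lra.
Qed.

(* The identity [KK c (+oo) = TT c] between two complete beta integrals. *)
Lemma KK_bound c p : 0 < c < 1 -> 2 <= p ->
  Rabs (KK c p * cos (PI * c / 2) - a0 c * sin (PI * c / 2)) <= Rpower (1 + p ^ 2) (c / 2) * (c * (p + Bk c) / (p ^ 2 - 1) * (PI / 2)).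
Proof.
intros Hc Hp. pose proof (kap_arc c p (proj1 Hc) Hp) as H.
set (q := Rpower (1 + p ^ 2) (c / 2)). assert (Hq : 0 < q) by pos.
set (D := (cis (- (PI * c / 4)) * kap c (ax p) - cis (PI * c / 4) * kap c p)%C) in *.
assert (E : Im (q * (cis (- (PI * c / 4)) * D))%C = KK c p * cos (PI * c / 2) - a0 c * sin (PI * c / 2)).
{ replace (q * (cis (- (PI * c / 4)) * D))%C with
   (cis (- (PI * c / 4)) * cis (- (PI * c / 4)) * (q * kap c (ax p))
    - q * (cis (- (PI * c / 4)) * cis (PI * c / 4) * kap c p))%C by Cring.
  rewrite <- !cis_add. replace (- (PI * c / 4) + PI * c / 4) with 0 by ring.
  replace (- (PI * c / 4) + - (PI * c / 4)) with (- (PI * c / 2)) by lra.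
  unfold q. rewrite kap_axis by lra. rewrite cis_0, Cmult_1_l, Im_sub, im_scal_l, kap_real by lra.
  simpl. rewrite cos_neg, sin_neg. ring. }
rewrite <- E. eapply Rle_trans; [apply Im_le_Cmod|]. rewrite !Cmod_mult, Cmod_cis, Cmod_R, Rabs_right by lra. nra.
Qed.

Lemma cos_pc c : 0 < c < 1 -> 0 < cos (PI * c / 2).
Proof. intros. pose proof PI_RGT_0. apply cos_gt_0; nra. Qed.

Lemma Rpower_small a eps : a < 0 -> 0 < eps -> exists M, 0 < M /\ forall p, M <= p -> Rpower p a < eps.
Proof. exists (Rpower (eps / 2) (/ a)). split; [pos|]. intros p Hp.
apply Rle_lt_trans with (Rpower (Rpower (eps / 2) (/ a)) a).
- apply Rpower_neg_antitone; [split; [pos|auto]|lra].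
- rewrite Rpower_mult. replace (/ a * a) with 1 by (field; lra). rewrite Rpower_1; lra.
Qed.

Lemma pw_le p a : 1 <= p -> 0 <= a -> Rpower (1 + p ^ 2) (a / 2) <= Rpower 2 a * Rpower p a.
Proof.
intros Hp Ha. rewrite Rpower_mult_distr by lra.
apply Rle_trans with (Rpower ((2 * p) ^ 2) (a / 2)).
- apply Rle_Rpower_l; [lra|]. nra.
- rewrite <- Rpower_pow by lra. rewrite Rpower_mult. right. f_equal. simpl. field.
Qed.

(** The error in [KK_bound] is of order [p ^ (c - 1)], which tends to [0] because [c < 1]. *)
Lemma KK_lim c eps : 0 < c < 1 -> 0 < eps -> exists M, 2 <= M /\ forall p, M <= p -> Rabs (KK c p - TT c) < eps.
Proof.
intros Hc He. pose proof (cos_pc c Hc) as Hcos. pose proof PI_RGT_0. pose proof PI_4.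
assert (HB : 0 < Bk c) by pos.
set (L := Rpower 2 c * (c * (1 + Bk c) * 2 * 2)).
assert (HL : 0 < L) by pos.
destruct (Rpower_small (c - 1) (eps * cos (PI * c / 2) / L)) as [M [HM Hs]]; [lra| |].
{ pos. }
exists (Rmax 2 M). split; [apply Rmax_l|]. intros p Hp.
assert (2 <= p) by (eapply Rle_trans; [apply Rmax_l|exact Hp]).
assert (M <= p) by (eapply Rle_trans; [apply Rmax_r|exact Hp]).
specialize (Hs p H2). pose proof (KK_bound c p Hc H1) as K.
assert (E : KK c p * cos (PI * c / 2) - a0 c * sin (PI * c / 2) = (KK c p - TT c) * cos (PI * c / 2)).
{ unfold TT, tan. field. lra. }
rewrite E, Rabs_mult, (Rabs_right (cos _)) in K by lra.
apply Rmult_lt_reg_r with (cos (PI * c / 2)); auto.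
eapply Rle_lt_trans; [exact K|].
apply Rle_lt_trans with (L * Rpower p (c - 1)).
- assert (E2 : Rpower p (c - 1) = Rpower p c / p).
  { unfold Rminus. rewrite Rpower_plus, Rpower_Ropp, Rpower_1 by lra. lra. }
  rewrite E2. unfold L.
  assert (P1 := pw_le p c ltac:(lra) ltac:(lra)).
  apply Rle_trans with ((Rpower 2 c * Rpower p c) * ((c * (1 + Bk c) * 2 * 2) * / p)).
  2:{ lra. }
  apply Rmult_le_compat; [left; apply exp_pos| |lra|].
  { assert (0 < p ^ 2 - 1) by nra. apply Rmult_le_pos; [|lra]. apply Rmult_le_pos; [nra|]. left; apply Rinv_0_lt_compat; auto. }
  assert (0 < p ^ 2 - 1) by nra.
  replace (c * (1 + Bk c) * 2 * 2 * / p) with ((c * (1 + Bk c) * 2 / p) * 2) by lra.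
  apply Rmult_le_compat; try lra.
  { apply Rmult_le_pos; [nra|]. left; apply Rinv_0_lt_compat; auto. }
  apply Rmult_le_reg_r with (p * (p ^ 2 - 1)); [nra|].
  replace (c * (p + Bk c) / (p ^ 2 - 1) * (p * (p ^ 2 - 1))) with (c * (p * (p + Bk c))) by (field; lra).
  replace (c * (1 + Bk c) * 2 / p * (p * (p ^ 2 - 1))) with (c * ((1 + Bk c) * 2 * (p ^ 2 - 1))) by (field; lra).
  apply Rmult_le_compat_l; [lra|]. assert (p <= 2 * (p ^ 2 - 1)) by nra.
  nra.
- apply (Rmult_lt_compat_l L) in Hs; auto.
  replace (L * (eps * cos (PI * c / 2) / L)) with (eps * cos (PI * c / 2)) in Hs by (field; lra). exact Hs.
Qed.

(** [KK c Y - tipJ c Y = (1 + Y ^ 2) ^ (c / 2) / Y] is again of order [Y ^ (c - 1)]. *)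
Lemma tipJ_lim c eps : 0 < c < 1 -> 0 < eps -> exists M, 2 <= M /\ forall Y, M <= Y -> Rabs (tipJ c Y - TT c) < eps.
Proof.
intros Hc He. destruct (KK_lim c (eps / 2) Hc ltac:(lra)) as [M1 [HM1 H1]].
set (L := Rpower 2 c). assert (HL : 0 < L) by pos.
destruct (Rpower_small (c - 1) (eps / 2 / L)) as [M2 [HM2 H2]]; [lra|pos|].
exists (Rmax M1 M2). split; [eapply Rle_trans; [exact HM1|apply Rmax_l]|]. intros Y HY.
assert (Y1 : M1 <= Y) by (eapply Rle_trans; [apply Rmax_l|exact HY]).
assert (Y2 : M2 <= Y) by (eapply Rle_trans; [apply Rmax_r|exact HY]).
specialize (H1 Y Y1). specialize (H2 Y Y2).
unfold tipJ, JJ.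
assert (E2 : Rpower Y (c - 1) = Rpower Y c / Y).
{ unfold Rminus. rewrite Rpower_plus, Rpower_Ropp, Rpower_1 by lra. lra. }
assert (P1 := pw_le Y c ltac:(lra) ltac:(lra)). assert (P0 : 0 < / Y * Rpower (1 + Y ^ 2) (c / 2)) by pos.
assert (P2 : / Y * Rpower (1 + Y ^ 2) (c / 2) < eps / 2).
{ apply Rle_lt_trans with (L * Rpower Y (c - 1)).
  - rewrite E2. replace (L * (Rpower Y c / Y)) with (/ Y * (L * Rpower Y c)) by lra.
    apply Rmult_le_compat_l; [left; apply Rinv_0_lt_compat; lra|auto].
  - apply (Rmult_lt_compat_l L) in H2; auto. replace (L * (eps / 2 / L)) with (eps / 2) in H2 by (field; lra). exact H2. }
apply Rabs_lt_between in H1. apply Rabs_lt_between. lra.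
Qed.

Lemma tipJ_lt_TT c Y : 0 < c < 1 -> 0 < Y -> tipJ c Y < TT c.
Proof.
intros Hc HY. apply Rnot_le_lt. intro Hge.
assert (H1 := tipJ_incr c Y (Y + 1) ltac:(lra) ltac:(lra)).
destruct (tipJ_lim c (tipJ c (Y + 1) - TT c) Hc ltac:(lra)) as [M [HM H]].
set (Z := Rmax M (Y + 2)). specialize (H Z (Rmax_l _ _)).
assert (Y + 2 <= Z) by apply Rmax_r. assert (H2 := tipJ_incr c (Y + 1) Z ltac:(lra) ltac:(lra)).
apply Rabs_lt_between in H. lra.
Qed.

Lemma TT_pos c : 0 < c < 1 -> 0 < TT c.
Proof.
intros Hc. pose proof PI_RGT_0. apply Rmult_lt_0_compat; [apply a0_pos; lra|apply tan_gt_0; nra].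
Qed.

(** ** The line [ell] and the gauge of the star region it bounds *)

Lemma ell_polar c J : 0 < c -> ell c J = (RtoC (Rpower (Cmod (a0 c, J)) (2 / c)) * cis (2 / c * atan (J / a0 c)))%C.
Proof. unfold ell, Cpw, Clog. unfold Cexp.
rewrite re_scal_l, im_scal_l. auto.
Qed.

Lemma Cmod_ell c J : 0 < c -> Cmod (ell c J) = Rpower (Cmod (a0 c, J)) (2 / c).
Proof. intros. apply Cmod_Cpw. Qed.

Lemma Rpower_inj x y a : 0 < x -> 0 < y -> a <> 0 -> Rpower x a = Rpower y a -> x = y.
Proof.
intros Hx Hy Ha H. apply exp_inv in H. apply ln_inv; auto.
nra.
Qed.

Lemma Cmod_aJ c J : Cmod (a0 c, J) ^ 2 = a0 c ^ 2 + J ^ 2.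
Proof. rewrite Cmod2_alt. auto. Qed.

Lemma Cmod_aJ_pos c J : 0 < c -> 0 < Cmod (a0 c, J).
Proof. intros Hc. pose proof (Re_le_Cmod (a0 c, J)). simpl in H. pose proof (a0_pos c Hc). lra. Qed.

Lemma ell_sq c J1 J2 : 0 < c -> ell c J1 = ell c J2 -> J1 = J2 \/ J1 = - J2.
Proof.
intros Hc H. apply (f_equal Cmod) in H. rewrite !Cmod_ell in H by auto.
apply Rpower_inj in H; try apply Cmod_aJ_pos; auto.
2:{ apply Rgt_not_eq. pos. }
apply (f_equal (fun x => x ^ 2)) in H. rewrite !Cmod_aJ in H.
nra.
Qed.

(** The modulus determines the parameter up to sign. The angle condition says that [ell c J1] has
    argument less than [PI] in modulus, so it equals its conjugate [ell c (- J1)] only on the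
    positive axis, where [J1 = 0]. *)
Lemma ell_inj c J1 J2 : 0 < c -> Rabs (atan (J1 / a0 c)) < PI * c / 2 -> ell c J1 = ell c J2 -> J1 = J2.
Proof.
intros Hc Hb H. destruct (ell_sq c J1 J2 Hc H) as [E|E]; auto.
assert (E2 : J2 = - J1) by lra. subst J2.
rewrite !ell_polar in H by auto.
assert (Em : Cmod (a0 c, - J1) = Cmod (a0 c, J1)).
{ replace (a0 c, - J1) with (Cconj (a0 c, J1)) by auto. apply Cmod_conj. }
rewrite Em in H. set (P := Rpower (Cmod (a0 c, J1)) (2 / c)) in H. assert (HP : 0 < P) by pos.
replace (- J1 / a0 c) with (- (J1 / a0 c)) in H by lra. rewrite atan_opp in H.
set (al := atan (J1 / a0 c)) in *.
apply (f_equal Im) in H. simpl in H.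
replace (2 / c * - al) with (- (2 / c * al)) in H by ring. rewrite sin_neg in H.
assert (S0 : sin (2 / c * al) = 0) by nra.
apply Rabs_lt_between in Hb. assert (H2c : 0 < 2 / c) by pos.
assert (Hpi : - PI < 2 / c * al < PI).
{ replace PI with (2 / c * (PI * c / 2)) by (field; lra). nra. }
assert (A0 : 2 / c * al = 0).
{ destruct (Rtotal_order (2 / c * al) 0) as [L|[L|L]]; auto.
  - pose proof (sin_lt_0_var (2 / c * al) ltac:(lra) L). lra.
  - pose proof (sin_gt_0 (2 / c * al) L ltac:(lra)). lra. }
assert (al = 0) by nra.
assert (T := tan_atan (J1 / a0 c)). fold al in T. rewrite H0, tan_0 in T.
pose proof (a0_pos c Hc). assert (J1 = 0). { replace J1 with (J1 / a0 c * a0 c) by (field; lra). nra. }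
lra.
Qed.

(** By the product formula, two angles of [[0, PI]] at distance at least [eps] have cosines at
    distance at least [2 sin (eps / 2) ^ 2]. *)
Lemma acos_uc x y eps : -1 <= x <= 1 -> -1 <= y <= 1 -> 0 < eps <= PI ->
  Rabs (x - y) < 2 * sin (eps / 2) ^ 2 -> Rabs (acos x - acos y) < eps.
Proof.
intros Hx Hy He Hxy. apply Rnot_le_lt. intro Hge.
pose proof (acos_bound x) as Bx. pose proof (acos_bound y) as By.
assert (Ex := cos_acos x Hx). assert (Ey := cos_acos y Hy).
set (u := acos x) in *. set (v := acos y) in *. rewrite <- Ex, <- Ey, form2 in Hxy.
assert (G : forall a b, 0 <= a <= PI -> 0 <= b <= PI -> eps <= b - a -> sin (eps / 2) ^ 2 <= sin ((b - a) / 2) * sin ((b + a) / 2)).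
{ intros a b Ha Hb Hab.
  assert (sin (eps / 2) <= sin ((b - a) / 2)) by (apply sin_incr_1; lra).
  assert (0 < sin (eps / 2)) by (apply sin_gt_0; lra).
  assert (sin ((b - a) / 2) <= sin ((b + a) / 2)).
  { destruct (Rle_lt_dec ((b + a) / 2) (PI / 2)); [apply sin_incr_1; lra|].
    rewrite <- (sin_PI_x ((b + a) / 2)). apply sin_incr_1; lra. }
  nra. }
unfold Rabs in Hge. destruct Rcase_abs in Hge.
- specialize (G u v Bx By ltac:(lra)). replace ((u - v) / 2) with (- ((v - u) / 2)) in Hxy by lra.
  rewrite sin_neg in Hxy. replace ((u + v) / 2) with ((v + u) / 2) in Hxy by lra.
  apply Rabs_lt_between in Hxy. nra.
- specialize (G v u By Bx ltac:(lra)). apply Rabs_lt_between in Hxy. nra.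
Qed.

(** The modulus of the principal argument. *)
Definition Th (z : C) : R := acos (Re z / Cmod z).

Lemma Re_div_bound z : z <> RtoC 0 -> -1 <= Re z / Cmod z <= 1.
Proof.
intros Hz. apply Cmod_pos in Hz. apply Rabs_le_between. unfold Rdiv. rewrite Rabs_mult, (Rabs_right (/ _)).
2:{ apply Rle_ge, Rlt_le, Rinv_0_lt_compat; auto. }
apply Rmult_le_reg_r with (Cmod z); auto. rewrite Rmult_assoc, Rinv_l, Rmult_1_r, Rmult_1_l by lra. apply re_le_Cmod.
Qed.

Lemma Th_bound z : 0 <= Th z <= PI.
Proof. apply acos_bound. Qed.

Lemma Th_polar r psi : 0 < r -> Rabs psi <= PI -> Th (r * cis psi)%C = Rabs psi.
Proof.
intros Hr Hp. unfold Th. rewrite Cmod_mult, Cmod_cis, Cmod_R, Rabs_right, re_scal_l by lra. simpl.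
replace (r * cos psi / (r * 1)) with (cos psi) by (field; lra).
rewrite <- (acos_cos (Rabs psi)) by (split; [apply Rabs_pos|auto]).
unfold Rabs. destruct Rcase_abs; auto. rewrite cos_neg. auto.
Qed.

Lemma Th_le r psi : 0 < r -> Th (r * cis psi)%C <= Rabs psi.
Proof.
intros Hr. destruct (Rle_lt_dec (Rabs psi) PI); [rewrite Th_polar; lra|].
pose proof (Th_bound (r * cis psi)%C). lra.
Qed.

Lemma polar_exists z : z <> RtoC 0 -> exists psi, Rabs psi = Th z /\ z = (RtoC (Cmod z) * cis psi)%C.
Proof.
intros Hz. pose proof (Re_div_bound z Hz) as B. assert (Pz := Cmod_pos z Hz). pose proof (Th_bound z) as T.
assert (Ec : cos (Th z) = Re z / Cmod z) by (apply cos_acos; auto).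
assert (Es : Cmod z * sin (Th z) = Rabs (Im z)).
{ assert (S0 : 0 <= sin (Th z)) by (apply sin_ge_0; lra).
  apply Rsqr_inj; [nra|apply Rabs_pos|]. rewrite <- Rsqr_abs, Rsqr_mult.
  pose proof (sin2_cos2 (Th z)) as S2. replace (sin (Th z))² with (1 - (cos (Th z))²) by lra.
  rewrite Ec. pose proof (Cmod2_alt z). unfold Rsqr.
  replace (Cmod z * Cmod z * (1 - Re z / Cmod z * (Re z / Cmod z))) with (Cmod z ^ 2 - Re z ^ 2) by (field; lra).
  lra. }
assert (Er : Cmod z * cos (Th z) = Re z) by (rewrite Ec; field; lra).
destruct (Rle_lt_dec 0 (Im z)) as [Hi|Hi].
- exists (Th z). split; [apply Rabs_right; lra|]. rewrite Rabs_right in Es by lra.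
  apply C_eq; rewrite ?re_scal_l, ?im_scal_l; simpl; unfold Re, Im in *; lra.
- exists (- Th z). split; [rewrite Rabs_Ropp; apply Rabs_right; lra|]. rewrite Rabs_left in Es by lra.
  apply C_eq; rewrite ?re_scal_l, ?im_scal_l; simpl; rewrite ?cos_neg, ?sin_neg; unfold Re, Im in *; lra.
Qed.

Lemma ct_Th z : z <> RtoC 0 -> ctR all_C Th z.
Proof.
intros Hz eps He. pose proof PI_RGT_0 as Hpi.
set (e := Rmin eps PI). assert (Hep : 0 < e) by pos.
assert (e <= PI) by apply Rmin_r. assert (e <= eps) by apply Rmin_l.
assert (Hs : 0 < 2 * sin (e / 2) ^ 2). { assert (0 < sin (e / 2)) by (apply sin_gt_0; lra). nra. }
assert (Cq : ctR all_C (fun y => Re y / Cmod y) z).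
{ apply continuous_ct. apply (continuous_mult (K := R_AbsRing) (fun y : C => Re y) (fun y : C => / Cmod y)); [apply continuous_Re|].
  apply (continuous_comp (fun y : C => Cmod y) Rinv).
  - intros P HP. destruct HP as [d Hd]. apply (proj2 (nbhd_C z (fun y => P (Cmod y)))).
    exists d. split; [apply cond_pos|]. intros y Hy. apply Hd.
    change (Rabs (Cmod y - Cmod z) < d).
    eapply Rle_lt_trans; [|exact Hy]. apply Rabs_le. pose proof (Cmod_rev_triangle y z). pose proof (Cmod_rev_triangle z y).
    rewrite (Cmod_sub_sym z y) in H2. lra.
  - apply continuous_Rinv. apply Rgt_not_eq. apply Cmod_pos; auto. }
destruct (Cq _ Hs) as [d [Hd H1]].
assert (Pz := Cmod_pos z Hz).
exists (Rmin d (Cmod z)). split; [pos|]. intros y _ Hy.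
assert (Y1 := Rlt_le_trans _ _ _ Hy (Rmin_l _ _)). assert (Y2 := Rlt_le_trans _ _ _ Hy (Rmin_r _ _)).
assert (Hy0 : y <> 0). { apply Cmod_pos_neq. pose proof (Cmod_rev_triangle z y). rewrite Cmod_sub_sym in Y2. lra. }
apply Rlt_le_trans with e; auto. apply acos_uc; [apply Re_div_bound; auto|apply Re_div_bound; auto|lra|apply H1; [exact I|auto]].
Qed.

(** This is [Re (z ^ (c / 2))], replaced by [0] where the argument exceeds [PI / c]; it is
    homogeneous of degree [c / 2]. If [c < 1] the cut-off is never reached, and the use of the
    modulus of the argument makes the function continuous across the negative axis. *)
Definition gau (c : R) (z : C) : R :=
  if Req_EM_T (Cmod z) 0 then 0 else Rpower (Cmod z) (c / 2) * cos (Rmin (c * Th z / 2) (PI / 2)).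

Lemma gau_0 c : gau c 0 = 0.
Proof. unfold gau. destruct Req_EM_T; auto. rewrite Cmod_0 in n. lra. Qed.

Lemma gau_neq0 c z : z <> RtoC 0 -> gau c z = Rpower (Cmod z) (c / 2) * cos (Rmin (c * Th z / 2) (PI / 2)).
Proof. unfold gau. destruct Req_EM_T; auto. apply Cmod_eq_0 in e. contradiction. Qed.

Lemma Rmin_cos_bound c z : 0 < c -> 0 <= Rmin (c * Th z / 2) (PI / 2) <= PI / 2.
Proof. pose proof (Th_bound z). split; [|rmin].
apply Rmin_glb; [|lra]. nra.
Qed.

Lemma gau_ge c r psi : 0 < c -> 0 < r -> c * Rabs psi / 2 <= PI / 2 ->
  Rpower r (c / 2) * cos (c * psi / 2) <= gau c (r * cis psi)%C.
Proof.
intros Hc Hr Hp.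
assert (Hz : (r * cis psi)%C <> 0).
{ apply Cmod_pos_neq. rewrite Cmod_mult, Cmod_cis, Cmod_R, Rabs_right; lra. }
rewrite gau_neq0 by auto. rewrite Cmod_mult, Cmod_cis, Cmod_R, Rabs_right, Rmult_1_r by lra.
apply Rmult_le_compat_l; [left; apply exp_pos|].
assert (Ea : cos (c * psi / 2) = cos (c * Rabs psi / 2)).
{ unfold Rabs. destruct Rcase_abs; auto. replace (c * - psi / 2) with (- (c * psi / 2)) by lra. rewrite cos_neg. auto. }
rewrite Ea. pose proof (Rmin_cos_bound c (r * cis psi)%C Hc) as [B1 B2].
assert (0 <= c * Rabs psi / 2) by (pose proof (Rabs_pos psi); nra).
apply cos_decr_1; try lra.
eapply Rle_trans; [apply Rmin_l|]. pose proof (Th_le r psi Hr). nra.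
Qed.

Lemma gau_eq c r psi : 0 < c -> 0 < r -> Rabs psi <= PI -> c * Rabs psi / 2 <= PI / 2 ->
  gau c (r * cis psi)%C = Rpower r (c / 2) * cos (c * psi / 2).
Proof.
intros Hc Hr Hp Hp2.
assert (Hz : (r * cis psi)%C <> 0).
{ apply Cmod_pos_neq. rewrite Cmod_mult, Cmod_cis, Cmod_R, Rabs_right; lra. }
rewrite gau_neq0 by auto. rewrite Cmod_mult, Cmod_cis, Cmod_R, Rabs_right, Rmult_1_r by lra.
rewrite Th_polar by auto. rewrite Rmin_left by lra.
unfold Rabs. destruct Rcase_abs; auto. replace (c * - psi / 2) with (- (c * psi / 2)) by lra. rewrite cos_neg. auto.
Qed.

Lemma gau_zero c r psi : 0 < c -> 0 < r -> Rabs psi <= PI -> PI / 2 <= c * Rabs psi / 2 ->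
  gau c (r * cis psi)%C = 0.
Proof.
intros Hc Hr Hp Hp2.
assert (Hz : (r * cis psi)%C <> 0).
{ apply Cmod_pos_neq. rewrite Cmod_mult, Cmod_cis, Cmod_R, Rabs_right; lra. }
rewrite gau_neq0 by auto. rewrite Th_polar by auto. rewrite Rmin_right by lra. rewrite cos_PI2. ring.
Qed.

Lemma gau_scal c s z : 0 < c -> 0 < s -> gau c (s * z)%C = Rpower s (c / 2) * gau c z.
Proof.
intros Hc Hs. destruct (classic (z = 0)) as [->|Hz].
{ rewrite Cmult_0_r, gau_0. ring. }
assert (Pz := Cmod_pos z Hz).
assert (Hz2 : (s * z)%C <> 0).
{ apply Cmod_pos_neq. rewrite Cmod_mult, Cmod_R, Rabs_right; nra. }
rewrite !gau_neq0 by auto. unfold Th. rewrite re_scal_l, Cmod_mult, Cmod_R, Rabs_right by lra.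
replace (s * Re z / (s * Cmod z)) with (Re z / Cmod z) by (field; lra).
rewrite <- Rpower_mult_distr by auto. ring.
Qed.

Lemma ell_gau_cos c J : 0 < c -> Rpower (Rpower (Cmod (a0 c, J)) (2 / c)) (c / 2) * cos (c * (2 / c * atan (J / a0 c)) / 2) = a0 c.
Proof.
intros Hc. rewrite Rpower_mult. replace (2 / c * (c / 2)) with 1 by (field; lra).
rewrite Rpower_1 by (apply Cmod_aJ_pos; auto).
replace (c * (2 / c * atan (J / a0 c)) / 2) with (atan (J / a0 c)) by (field; lra).
pose proof (a0_pos c Hc) as A. pose proof (Cmod_RHP (a0 c, J) A) as E. simpl (Re _) in E. simpl (Im _) in E.
rewrite E, cos_atan. field. apply Rgt_not_eq, sqrt_lt_R0. pose proof (Rle_0_sqr (J / a0 c)). lra.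
Qed.

(** For [c < 1] and large [|J|] the nominal argument [(2 / c) atan (J / a0)] exceeds [PI]; the
    principal one is smaller and the cosine larger, hence only an inequality. *)
Lemma gau_ell_ge c J : 0 < c -> a0 c <= gau c (ell c J).
Proof.
intros Hc. rewrite ell_polar by auto. rewrite <- (ell_gau_cos c J Hc) at 1.
apply gau_ge; auto; [pos|].
rewrite Rabs_mult, Rabs_right by (apply Rle_ge, Rlt_le, Rdiv_lt_0_compat; lra).
replace (c * (2 / c * Rabs (atan (J / a0 c))) / 2) with (Rabs (atan (J / a0 c))) by (field; lra).
pose proof (atan_bound (J / a0 c)). apply Rabs_le. lra.
Qed.

Lemma gau_ell_eq c J : 0 < c -> Rabs (atan (J / a0 c)) <= PI * c / 2 -> gau c (ell c J) = a0 c.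
Proof.
intros Hc Hb. rewrite ell_polar by auto.
assert (H2c : 0 < 2 / c) by pos.
rewrite gau_eq; [apply ell_gau_cos; auto|auto|pos|..];
rewrite Rabs_mult, (Rabs_right (2 / c)) by lra.
- replace PI with (2 / c * (PI * c / 2)) by (field; lra). nra.
- replace (c * (2 / c * Rabs (atan (J / a0 c))) / 2) with (Rabs (atan (J / a0 c))) by (field; lra).
  pose proof (atan_bound (J / a0 c)). apply Rabs_le. lra.
Qed.

Lemma gau_eq_ell c z : 0 < c -> gau c z = a0 c -> exists J, z = ell c J /\ Rabs (atan (J / a0 c)) <= PI * c / 2.
Proof.
intros Hc H. pose proof (a0_pos c Hc) as A.
assert (Hz : z <> 0). { intros ->. rewrite gau_0 in H. lra. }
destruct (polar_exists z Hz) as [psi [Hpsi Ez]]. rewrite gau_neq0 in H by auto.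
pose proof (Cmod_pos z Hz) as Pz. pose proof (Th_bound z) as T.
assert (Hlt : c * Th z / 2 < PI / 2).
{ apply Rnot_le_lt. intro Hge. rewrite Rmin_right, cos_PI2 in H by lra. lra. }
rewrite Rmin_left in H by lra.
set (al := c * psi / 2).
assert (Hal : Rabs al = c * Th z / 2).
{ unfold al, Rdiv. rewrite !Rabs_mult, Hpsi, (Rabs_right c), (Rabs_right (/ 2)) by lra. ring. }
assert (Hal2 : - (PI / 2) < al < PI / 2). { apply Rabs_lt_between. lra. }
assert (Hcos : 0 < cos al) by (apply cos_gt_0; lra).
assert (Ec : cos (c * Th z / 2) = cos al).
{ rewrite <- Hal. unfold Rabs. destruct Rcase_abs; auto. rewrite cos_neg; auto. }
rewrite Ec in H.
exists (a0 c * tan al).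
assert (Eq : a0 c * tan al / a0 c = tan al) by (field; lra).
assert (Ea : atan (a0 c * tan al / a0 c) = al) by (rewrite Eq; apply atan_tan; auto).
split.
2:{ rewrite Ea, Hal. nra. }
rewrite ell_polar by auto. rewrite Ea.
replace (2 / c * al) with psi by (unfold al; field; lra).
assert (Em : Cmod (a0 c, a0 c * tan al) = Rpower (Cmod z) (c / 2)).
{ rewrite (Cmod_RHP (a0 c, a0 c * tan al) A). simpl (Re _). simpl (Im _). rewrite Eq.
  assert (E1 : sqrt (1 + (tan al)²) = / cos al).
  { pose proof (cos_atan (tan al)) as Q. rewrite atan_tan in Q by auto. rewrite Q.
    field. apply Rgt_not_eq, sqrt_lt_R0. pose proof (Rle_0_sqr (tan al)). lra. }
  rewrite E1, <- H. field. lra. }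
rewrite Em, Rpower_mult. replace (c / 2 * (2 / c)) with 1 by (field; lra). rewrite Rpower_1; auto.
Qed.

Lemma ct_gau c z : 0 < c -> ctR all_C (gau c) z.
Proof.
intros Hc. destruct (classic (z = 0)) as [->|Hz].
- intros eps He. exists (Rpower eps (2 / c)). split; [pos|]. intros y _ Hy.
  replace (y - 0)%C with y in Hy by ring. rewrite gau_0, Rminus_0_r.
  destruct (classic (y = 0)) as [->|Hy0]; [rewrite gau_0, Rabs_R0; auto|].
  rewrite gau_neq0 by auto. pose proof (Rmin_cos_bound c y Hc) as B.
  assert (0 <= cos (Rmin (c * Th y / 2) (PI / 2))) by (apply cos_ge_0; lra).
  pose proof (COS_bound (Rmin (c * Th y / 2) (PI / 2))).
  assert (P1 : 0 < Rpower (Cmod y) (c / 2)) by pos.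
  rewrite Rabs_right by nra.
  apply Rle_lt_trans with (Rpower (Cmod y) (c / 2)); [nra|].
  replace eps with (Rpower (Rpower eps (2 / c)) (c / 2)).
  2:{ rewrite Rpower_mult. replace (2 / c * (c / 2)) with 1 by (field; lra). apply Rpower_1; auto. }
  apply Rlt_Rpower_l; [lra|]. split; [apply Cmod_pos; auto|auto].
- assert (Pz := Cmod_pos z Hz).
  assert (G : ctR all_C (fun y => Rpower (Cmod y) (c / 2) * cos (Rmin (c * Th y / 2) (PI / 2))) z).
  { assert (C1 : ctR all_C (fun y => Rpower (Cmod y) (c / 2)) z).
    { apply (ctR_comp _ Cmod (fun x => Rpower x (c / 2))); [apply ctR_Cmod|].
      apply derivable_continuous_pt. exists (c / 2 * Rpower (Cmod z) (c / 2 - 1)). apply derivable_pt_lim_power; auto. }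
    assert (C2 : ctR all_C (fun y => cos (Rmin (c * Th y / 2) (PI / 2))) z).
    { apply (ctR_comp _ Th (fun x => cos (Rmin (c * x / 2) (PI / 2)))); [apply ct_Th; auto|].
      apply continuity_pt_filterlim. apply (continuous_cos_comp (fun x => Rmin (c * x / 2) (PI / 2))).
      apply continuity_pt_filterlim. intros eps He. exists (2 * eps / c). split; [pos|].
      intros y [_ Hy]. simpl in *. unfold R_dist in *.
      assert (Hy2 : Rabs (c * y / 2 - c * Th z / 2) < eps).
      { replace (c * y / 2 - c * Th z / 2) with (c / 2 * (y - Th z)) by lra. rewrite Rabs_mult, (Rabs_right (c / 2)) by lra.
        apply (Rmult_lt_compat_l (c / 2)) in Hy; [|lra]. replace (c / 2 * (2 * eps / c)) with eps in Hy by (field; lra). exact Hy. }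
      eapply Rle_lt_trans; [|exact Hy2].
      unfold Rmin; repeat destruct Rle_dec; unfold Rabs; repeat destruct Rcase_abs; lra. }
    intros eps He. destruct (ct_mult all_C (fun y => RtoC (Rpower (Cmod y) (c / 2))) (fun y => RtoC (cos (Rmin (c * Th y / 2) (PI / 2)))) z) with (eps := eps)
      as [d [Hd H]]; auto.
    - intros e He'. destruct (C1 e He') as [d [Hd H]]. exists d. split; auto. intros y Sy Hy. rewrite <- RtoC_minus, Cmod_R. auto.
    - intros e He'. destruct (C2 e He') as [d [Hd H]]. exists d. split; auto. intros y Sy Hy. rewrite <- RtoC_minus, Cmod_R. auto.
    - exists d. split; auto. intros y Sy Hy. specialize (H y Sy Hy). rewrite <- !RtoC_mult, <- RtoC_minus, Cmod_R in H. exact H. }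
  intros eps He. destruct (G eps He) as [d [Hd H]]. exists (Rmin d (Cmod z)). split; [pos|].
  intros y Sy Hy. assert (Y1 := Rlt_le_trans _ _ _ Hy (Rmin_l _ _)). assert (Y2 := Rlt_le_trans _ _ _ Hy (Rmin_r _ _)).
  assert (Hy0 : y <> 0). { apply Cmod_pos_neq. pose proof (Cmod_rev_triangle z y). rewrite Cmod_sub_sym in Y2. lra. }
  rewrite !gau_neq0 by auto. auto.
Qed.

Definition clamp (a b x : R) : R := Rmax a (Rmin x b).

Lemma clamp_bound a b x : a <= b -> a <= clamp a b x <= b.
Proof. split; [apply Rmax_l|]. apply Rmax_lub; [lra|rmin]. Qed.

Lemma clamp_id a b x : a <= x <= b -> clamp a b x = x.
Proof. intros. unfold clamp. rewrite Rmin_left by lra. apply Rmax_right. lra. Qed.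

Lemma clamp_lip a b x y : Rabs (clamp a b y - clamp a b x) <= Rabs (y - x).
Proof.
unfold clamp, Rmax, Rmin. repeat destruct Rle_dec; unfold Rabs; repeat destruct Rcase_abs; lra.
Qed.

(** * The disk and the right half-plane *)

Definition den (eta : R) (h : C) : C := ((RtoC eta + Ci) + (RtoC eta - Ci) * h)%C.

Lemma Cmod_eta_i eta : Cmod (RtoC eta + Ci)%C = sqrt (eta ^ 2 + 1).
Proof.
unfold Cmod. f_equal. simpl. ring.
Qed.

Lemma Cmod_eta_i' eta : Cmod (RtoC eta - Ci)%C = sqrt (eta ^ 2 + 1).
Proof. unfold Cmod. f_equal. simpl. ring. Qed.

Lemma sqrt_ge_1 eta : 1 <= sqrt (eta ^ 2 + 1).
Proof. rewrite <- sqrt_1 at 1. apply sqrt_le_1; nra. Qed.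

Lemma den_bound eta h r : Cmod h <= r -> r < 1 -> sqrt (eta ^ 2 + 1) * (1 - r) <= Cmod (den eta h).
Proof. unfold den. pose proof (Cmod_rev_triangle2 (eta + Ci)%C ((eta - Ci) * h)%C) as T.
rewrite Cmod_mult, Cmod_eta_i, Cmod_eta_i' in T. pose proof (sqrt_ge_1 eta). nra.
Qed.

Lemma den_neq0 eta h : Cmod h < 1 -> den eta h <> 0.
Proof.
intros Hh. apply Cmod_pos_neq. pose proof (den_bound eta h (Cmod h) ltac:(lra) Hh). pose proof (sqrt_ge_1 eta). nra.
Qed.

Lemma one_minus_neq0 h : Cmod h < 1 -> (1 - h)%C <> 0.
Proof.
intros Hh E. apply Csub_0 in E. rewrite <- E, Cmod_1 in Hh. lra.
Qed.

Lemma Cdiv_Cmod2 (a z : C) : z <> 0 -> (a / z)%C = (RtoC (/ Cmod z ^ 2) * (a * Cconj z))%C.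
Proof.
intros Hz. assert (P := Cmod_pos z Hz).
rewrite RtoC_inv by nra. rewrite Cmod2_conj.
field. split; auto. intro E. apply Hz. rewrite <- (Cconj_conj z), E. Cring.
Qed.

Definition to_w (h : C) : C := ((1 + h) / (1 - h))%C.

Lemma to_w_Re h : h <> RtoC 1 -> Re (to_w h) = (1 - Cmod h ^ 2) / Cmod (1 - h)%C ^ 2.
Proof.
intros Hh. assert (N : (1 - h)%C <> 0). { intro E. apply Csub_0 in E. auto. }
unfold to_w. rewrite Cdiv_Cmod2 by auto.
rewrite re_scal_l, (Cmod2_alt h).
replace (Re ((1 + h) * Cconj (1 - h))%C) with (1 - (Re h ^ 2 + Im h ^ 2)) by (destruct h; simpl; ring).
lra.
Qed.

Lemma to_w_pos h : Cmod h < 1 -> 0 < Re (to_w h).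
Proof.
intros Hh. assert (h <> 1). { intro E. rewrite E, Cmod_1 in Hh. lra. }
rewrite to_w_Re by auto. pose proof (Cmod_ge_0 h). apply Rdiv_lt_0_compat; [nra|]. apply pow_lt, Cmod_pos, one_minus_neq0; auto.
Qed.

Lemma hdC_to_w h : h <> RtoC 1 -> hdC to_w h (RtoC 2 / ((1 - h) * (1 - h)))%C.
Proof.
intros Hh. assert (N : (1 - h)%C <> 0). { intro E. apply Csub_0 in E. auto. } eapply hd_eq; [|apply hd_div; [auto|apply hd_plus; [apply hd_const|apply hd_id]|apply hd_minus; [apply hd_const|apply hd_id]]]. Cring.
Qed.

Definition to_h (w : C) : C := ((w - 1) / (w + 1))%C.

Lemma wp1_neq0 w : 0 <= Re w -> (w + 1)%C <> 0.
Proof. intros Hw E. apply (f_equal Re) in E. change (Re w + 1 = 0) in E. lra. Qed.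

Lemma to_w_h w : 0 <= Re w -> to_w (to_h w) = w.
Proof.
intros Hw. assert (N := wp1_neq0 w Hw). unfold to_w, to_h. field. split; auto. intro E. apply (f_equal Re) in E. simpl in E. lra.
Qed.

Lemma to_h_w h : h <> RtoC 1 -> to_h (to_w h) = h.
Proof.
intros Hh. assert (N : (1 - h)%C <> 0). { intro E. apply Csub_0 in E. auto. }
unfold to_w, to_h. field. split; auto. intro E. apply (f_equal Re) in E. simpl in E. lra.
Qed.

Lemma to_h_neq1 w : 0 <= Re w -> to_h w <> 1.
Proof.
intros Hw E. assert (N := wp1_neq0 w Hw). unfold to_h in E.
assert (X : (w - 1)%C = (w + 1)%C). { replace (w - 1)%C with ((w - 1) / (w + 1) * (w + 1))%C by (field; auto). rewrite E. ring. }
apply (f_equal Re) in X. simpl in X. lra.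
Qed.

Lemma to_h_sq w : 0 <= Re w -> Cmod (to_h w) ^ 2 = 1 - Re w * Cmod (1 - to_h w)%C ^ 2.
Proof.
intros Hw. assert (N := to_h_neq1 w Hw). pose proof (to_w_Re (to_h w) N) as H. rewrite to_w_h in H by auto.
assert (P : 0 < Cmod (1 - to_h w)%C). { apply Cmod_pos. intro E. apply Csub_0 in E. auto. }
rewrite H. field. lra.
Qed.

Lemma to_h_lt1 w : 0 < Re w -> Cmod (to_h w) < 1.
Proof.
intros Hw. pose proof (to_h_sq w ltac:(lra)) as H. assert (N := to_h_neq1 w ltac:(lra)).
assert (P : 0 < Cmod (1 - to_h w)%C ^ 2). { apply pow_lt, Cmod_pos. intro E. apply Csub_0 in E. auto. } nra.
Qed.

Lemma FF_zero c eta w : 0 <= Re w -> FF c eta w = 0 -> w = 1.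
Proof.
intros Hw H.
assert (E : ((1 - w) * (1 + w))%C = 0).
{ apply NNPP. intro Hn. apply (Cmult_neq_0 (1 - w * w)%C (Cpw (kap c w - Ci * eta) (2 / c))); auto.
  - intro E. apply Hn. rewrite <- E. ring.
  - apply Cpw_neq_0. }
apply NNPP. intro Hn. apply (Cmult_neq_0 (1 - w)%C (1 + w)%C); auto.
- intro E2. apply Csub_0 in E2. auto.
- rewrite Cplus_comm. apply wp1_neq0; auto.
Qed.

Lemma Cmult_reg_r (z a b : C) : z <> 0 -> (a * z = b * z)%C -> a = b.
Proof.
intros Hz E. transitivity (a * z / z)%C; [field; auto|]. rewrite E. field; auto.
Qed.

Lemma interval_clopen (P : R -> Prop) a b : a <= b -> P a ->
  (forall s, a <= s <= b -> P s -> exists d, 0 < d /\ forall t, a <= t <= b -> Rabs (t - s) < d -> P t) ->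
  (forall s, a <= s <= b -> ~ P s -> exists d, 0 < d /\ forall t, a <= t <= b -> Rabs (t - s) < d -> ~ P t) ->
  P b.
Proof.
intros Hab Pa HO HC.
destruct (completeness (fun s => a <= s <= b /\ forall t, a <= t <= s -> P t)) as [m [Hm1 Hm2]].
- exists b. intros x [Hx _]. lra.
- exists a. split; [lra|]. intros t Ht. replace t with a by lra. auto.
- assert (Hm : a <= m <= b).
  { split; [apply Hm1; split; [lra|]; intros t Ht; replace t with a by lra; auto|apply Hm2; intros x [Hx _]; lra]. }
  assert (Below : forall t, a <= t < m -> P t).
  { intros t Ht. apply NNPP. intro Hn. assert (m <= t); [|lra]. apply Hm2. intros x [Hx1 Hx2].
    apply Rnot_lt_le. intro Hlt. apply Hn, Hx2. lra. }
  assert (Pm : P m).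
  { apply NNPP. intro Hn. destruct (HC m Hm Hn) as [d [Hd H]].
    destruct (Req_dec m a) as [E|E]; [rewrite E in Hn; auto|].
    set (t := m - Rmin (d / 2) (m - a)). assert (0 < Rmin (d / 2) (m - a)) by pos.
    assert (Rmin (d / 2) (m - a) <= d / 2) by rmin. assert (Rmin (d / 2) (m - a) <= m - a) by apply Rmin_r.
    apply (H t); [unfold t; lra| |apply Below; unfold t; lra]. unfold t. rewrite Rabs_left; lra. }
  destruct (HO m Hm Pm) as [d [Hd H]].
  destruct (Req_dec m b) as [E|E]; [rewrite <- E; auto|].
  set (e := Rmin (d / 2) (b - m)). assert (0 < e) by pos.
  assert (e <= d / 2) by apply Rmin_l. assert (e <= b - m) by apply Rmin_r.
  assert (m + e <= m); [|lra]. apply Hm1. split; [lra|]. intros t Ht.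
  destruct (Rlt_le_dec t m); [apply Below; lra|]. apply H; [lra|]. rewrite Rabs_right; lra.
Qed.

Lemma ball_segment (z y1 y2 : C) r s : 0 <= s <= 1 -> Cmod (y1 - z)%C < r -> Cmod (y2 - z)%C < r ->
  Cmod (y1 + s * (y2 - y1) - z)%C < r.
Proof.
intros Hs H1 H2.
replace (y1 + s * (y2 - y1) - z)%C with (RtoC (1 - s) * (y1 - z) + s * (y2 - z))%C by Cring.
eapply Rle_lt_trans; [apply Cmod_triangle|]. rewrite !Cmod_mult, !Cmod_R, !Rabs_right by lra.
destruct (Req_dec s 1) as [->|]; [lra|]. nra.
Qed.

(** * Injectivity of the invariant *)

(** Injectivity near [w0], uniform in nearby [e]: the derivative stays within half the modulus of
    [l], its value at [(e0, w0)]. This is what prevents two preimages from merging in a limit. *)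
Lemma FF_expand c e0 w0 : 0 < c -> 0 < e0 -> 0 < Re w0 -> exists d m, 0 < d /\ 0 < m /\
  forall e w1 w2, Rabs (e - e0) < d -> Cmod (w1 - w0)%C < d -> Cmod (w2 - w0)%C < d ->
    m * Cmod (w2 - w1)%C <= Cmod (FF c e w2 - FF c e w1)%C.
Proof.
intros Hc He Hw. set (l := FF1 c e0 w0). assert (Pl : 0 < Cmod l) by (apply Cmod_pos, FF1_neq_0_open; auto; lra).
destruct (FF1_joint c e0 w0 Hc ltac:(lra) (Cmod l / 2) ltac:(lra)) as [d [D H]].
exists (Rmin d (Re w0)), (Cmod l / 2). split; [pos|]. split; [lra|]. intros e w1 w2 E E1 E2.
assert (Seg : forall s, 0 <= s <= 1 -> Cmod (affine w1 w2 s - w0)%C < Rmin d (Re w0)).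
{ intros s Hs. apply ball_segment; auto. }
assert (L := convex_lip (fun w => FF c e w - l * w)%C (fun w => FF1 c e w - l)%C w1 w2 (Cmod l / 2)).
assert (L' : Cmod (FF c e w2 - l * w2 - (FF c e w1 - l * w1))%C <= Cmod l / 2 * Cmod (w2 - w1)%C).
{ apply L.
  - intros s Hs. specialize (Seg s Hs).
    apply hd_minus; [apply FF_hd; auto; left; apply (RHP_open w0 Hw); rmin|].
    eapply hd_eq; [|apply hd_mult; [apply hd_const|apply hd_id]]. Cring.
  - intros s Hs. specialize (Seg s Hs). left. apply H; rmin. }
pose proof (Cmod_rev_triangle (l * (w2 - w1))%C (l * (w2 - w1) - (FF c e w2 - FF c e w1))%C) as T.
replace (l * (w2 - w1) - (l * (w2 - w1) - (FF c e w2 - FF c e w1)))%C with (FF c e w2 - FF c e w1)%C in T by ring.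
replace (FF c e w2 - l * w2 - (FF c e w1 - l * w1))%C with (- (l * (w2 - w1) - (FF c e w2 - FF c e w1)))%C in L' by ring.
rewrite Cmod_opp in L'. rewrite Cmod_mult in T. lra.
Qed.

Lemma FF_open c e0 w0 r : 0 < c -> 0 < e0 -> 0 < Re w0 -> 0 < r -> exists d, 0 < d /\
  forall e z, Rabs (e - e0) < d -> Cmod (z - FF c e0 w0)%C < d -> exists v, 0 < Re v /\ Cmod (v - w0)%C < r /\ FF c e v = z.
Proof.
intros Hc He Hw Hr. destruct (FF_expand c e0 w0 Hc He Hw) as [d [m [D [M H]]]].
set (p := Rmin r (Rmin d (Re w0)) / 2). assert (Hp : 0 < p) by (pos).
assert (Q : p < r /\ p < d /\ p < Re w0) by (unfold p; repeat split; rmin). destruct (FF_joint c e0 w0 Hc ltac:(lra) (m * p / 4) ltac:(nra)) as [d2 [D2 H2]].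
exists (Rmin (Rmin d (e0 / 2)) (Rmin d2 (m * p / 4))). split; [pos|].
intros e z E Ez. destruct (open_ball (FF c e) w0 p (m * p) Hp ltac:(pos)) with (zeta := z) as [v [V1 V2]].
- intros w Hwp. assert (0 < Re w) by (apply (RHP_open w0 Hw); lra). exists (FF1 c e w).
  assert (0 < e). { assert (Rabs (e - e0) < e0 / 2) by rmin. apply Rabs_lt_between in H1. lra. }
  split; [apply FF1_neq_0_open; auto; lra|apply FF_hd; auto; lra].
- intros w Hwp. rewrite <- Hwp. apply H; [rmin|rewrite Cmod_self; lra|lra].
- specialize (H2 e w0 ltac:(rmin) ltac:(rewrite Cmod_self; lra)). rewrite Cmod_sub_sym in H2.
  pose proof (Cmod_triangle_sub z (FF c e0 w0) (FF c e w0)). rmin.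
- exists v. split; [apply (RHP_open w0 Hw); lra|]. split; [lra|auto].
Qed.

Lemma C_BW2 (u v : nat -> C) M : (forall n, Cmod (u n) <= M /\ Cmod (v n) <= M) ->
  exists a b, forall eps N, 0 < eps -> exists n, (N <= n)%nat /\ Cmod (u n - a) < eps /\ Cmod (v n - b) < eps.
Proof.
intros H. destruct (C_BW u M) as [a Ha]; [apply H|].
assert (X : forall k : nat, exists n, (k <= n)%nat /\ Cmod (u n - a) < / (INR k + 1)).
{ intro k. apply Ha. pose proof (pos_INR k). pos. }
apply functional_choice in X. destruct X as [f Hf]. destruct (C_BW (fun k => v (f k)) M) as [b Hb]; [intro; apply H|].
exists a, b. intros eps N He. destruct (archimed_cor1 eps He) as [k [K1 K2]].
destruct (Hb eps (max N k) He) as [n [N1 N2]]. destruct (Hf n) as [F1 F2]. exists (f n). split; [lia|]. split; [|lra].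
apply Rlt_trans with (/ (INR n + 1)); [lra|]. eapply Rle_lt_trans; [|exact K1].
apply Rinv_le_contravar; [apply lt_0_INR; auto|]. pose proof (le_INR k n ltac:(lia)). lra.
Qed.

Definition double (c e : R) (z : C) : Prop :=
  exists w1 w2, 0 < Re w1 /\ 0 < Re w2 /\ w1 <> w2 /\ FF c e w1 = z /\ FF c e w2 = z.

Lemma Re_limit_nonneg (u : nat -> C) a : (forall n, 0 <= Re (u n)) ->
  (forall eps, 0 < eps -> exists n, Cmod (u n - a) < eps) -> 0 <= Re a.
Proof.
intros Hu Ha. apply Rnot_lt_le. intro Hn. destruct (Ha (- Re a) ltac:(lra)) as [n H]. specialize (Hu n).
pose proof (re_le_Cmod (u n - a)%C) as Q. rewrite Re_sub in Q. apply Rabs_le_between in Q. lra.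
Qed.

(* The number of preimages cannot jump from one to two as long as the target stays off the image of the boundary. *)
Lemma double_clopen c (e0 : R) (e : R -> R) (z : R -> C) : 0 < c -> 0 < e0 ->
  (forall s eps, 0 <= s <= 1 -> 0 < eps -> exists d, 0 < d /\ forall t, 0 <= t <= 1 -> Rabs (t - s) < d ->
     Rabs (e t - e s) < eps /\ Cmod (z t - z s) < eps) ->
  (forall s, 0 <= s <= 1 -> e0 <= e s) -> (forall s x, 0 <= s <= 1 -> z s <> FF c (e s) (ax x)) ->
  double c (e 0) (z 0) -> double c (e 1) (z 1).
Proof.
intros Hc He0 Hct He Hav H0. apply (interval_clopen (fun s => double c (e s) (z s)) 0 1); [lra|auto|..].
- intros s Hs [w1 [w2 [R1 [R2 [N [E1 E2]]]]]]. specialize (He s Hs).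
  assert (Hr : 0 < Cmod (w1 - w2)) by (apply Cmod_pos; intro X; apply N, Csub_0, X).
  destruct (FF_open c (e s) w1 (Cmod (w1 - w2) / 2) Hc ltac:(lra) R1 ltac:(lra)) as [d1 [D1 H1]].
  destruct (FF_open c (e s) w2 (Cmod (w1 - w2) / 2) Hc ltac:(lra) R2 ltac:(lra)) as [d2 [D2 H2]].
  destruct (Hct s (Rmin d1 d2) Hs ltac:(pos)) as [d [D H]]. exists d. split; auto. intros t Ht Hts.
  destruct (H t Ht Hts) as [T1 T2].
  destruct (H1 (e t) (z t)) as [v1 [V1 [V1' V1'']]]; [rmin|rewrite E1; rmin|].
  destruct (H2 (e t) (z t)) as [v2 [V2 [V2' V2'']]]; [rmin|rewrite E2; rmin|].
  exists v1, v2. repeat split; auto. intros ->. pose proof (Cmod_triangle_sub w1 v2 w2) as T. rewrite (Cmod_sub_sym w1 v2) in T. lra.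
(* Otherwise pairs of preimages exist at parameters tending to [s]. They stay bounded, their cluster
   points are not on the axis because the target avoids its image, and they cannot coalesce by
   [FF_expand]; so the pair survives at [s]. *)
- intros s Hs HnS. apply NNPP. intro Hno.
  assert (X : forall n : nat, exists p : R * (C * C), let (t, q) := p in let (a, b) := q in 0 <= t <= 1 /\ Rabs (t - s) < / (INR n + 1) /\
     0 < Re a /\ 0 < Re b /\ a <> b /\ FF c (e t) a = z t /\ FF c (e t) b = z t).
  { intro n. apply NNPP. intro Hn. apply Hno. exists (/ (INR n + 1)). split; [pose proof (pos_INR n); pos|].
    intros t Ht Hts [a [b Hab]]. apply Hn. exists (t, (a, b)). auto. }
  apply functional_choice in X. destruct X as [f Hf].
  set (t := fun n => fst (f n)). set (a := fun n => fst (snd (f n))). set (b := fun n => snd (snd (f n))).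
  assert (Hf' : forall n, 0 <= t n <= 1 /\ Rabs (t n - s) < / (INR n + 1) /\
     0 < Re (a n) /\ 0 < Re (b n) /\ a n <> b n /\ FF c (e (t n)) (a n) = z (t n) /\ FF c (e (t n)) (b n) = z (t n)).
  { intro n. specialize (Hf n). unfold t, a, b. destruct (f n) as [t' [a' b']]. exact Hf. }
  assert (Ht : forall d, 0 < d -> exists N, forall n, (N <= n)%nat -> Rabs (t n - s) < d).
  { intros d Hd. destruct (archimed_cor1 d Hd) as [N [N1 N2]]. exists N. intros n Hn. destruct (Hf' n) as [_ [Q _]].
    eapply Rlt_trans; [exact Q|]. eapply Rle_lt_trans; [|exact N1]. apply Rinv_le_contravar; [apply lt_0_INR; auto|].
    pose proof (le_INR N n ltac:(lia)). lra. }
  destruct (Hct s 1 Hs ltac:(lra)) as [d1 [D1 H1]]. destruct (Ht d1 D1) as [N1 HN1].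
  destruct (FF_inf_unif c e0 (Cmod (z s) + 1) Hc He0) as [M [HM HMw]].
  assert (Bd : forall n w, (N1 <= n)%nat -> 0 < Re w -> FF c (e (t n)) w = z (t n) -> Cmod w <= M).
  { intros n w Hn Rw E. apply Rnot_lt_le. intro HMw'. destruct (Hf' n) as [T1 _]. destruct (H1 (t n) T1 (HN1 n Hn)) as [_ T2].
    specialize (HMw (e (t n)) w (He _ T1) ltac:(lra) ltac:(lra)). rewrite E in HMw. pose proof (Cmod_rev_triangle (z (t n)) (z s)). lra. }
  destruct (C_BW2 (fun n => a (N1 + n)%nat) (fun n => b (N1 + n)%nat) M) as [a0' [b0' Hcl]].
  { intro n. destruct (Hf' (N1 + n)%nat) as [T1 [T2 [R1 [R2 [_ [E1 E2]]]]]]. split; apply (Bd (N1 + n)%nat); auto; lia. }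
  assert (Lim : forall (u : nat -> C) w, (forall n, 0 < Re (u n) /\ FF c (e (t n)) (u n) = z (t n)) ->
    (forall eps N, 0 < eps -> exists n, (N <= n)%nat /\ Cmod (u n - w) < eps) -> 0 < Re w /\ FF c (e s) w = z s).
  { intros u w Hu Hw.
    assert (Rw : 0 <= Re w). { apply (Re_limit_nonneg u); [intro n; left; apply Hu|]. intros eps Heps. destruct (Hw eps O Heps) as [n [_ Hn]]. exists n. auto. }
    assert (E : FF c (e s) w = z s).
    { apply C_eq_small. intros eps Heps. destruct (FF_joint c (e s) w Hc Rw (eps / 2) ltac:(lra)) as [d2 [D2 H2]].
      destruct (Hct s (Rmin d2 (eps / 2)) Hs ltac:(pos)) as [d3 [D3 H3]]. destruct (Ht d3 D3) as [N3 HN3].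
      destruct (Hw d2 N3 D2) as [n [Hn1 Hn2]]. destruct (H3 (t n)) as [Q1 Q2]; [apply Hf'|auto|].
      specialize (H2 (e (t n)) (u n) ltac:(rmin) Hn2). destruct (Hu n) as [_ En]. rewrite En, Cmod_sub_sym in H2.
      pose proof (Cmod_triangle_sub (FF c (e s) w) (z (t n)) (z s)) as T.
      rmin. }
    split; [|auto]. destruct Rw as [Rw|Rw]; [lra|]. exfalso. apply (Hav s (- Im w) Hs). rewrite <- E. f_equal.
    apply C_eq; simpl; [lra|ring]. }
  destruct (Lim a a0') as [Ra Ea].
  { split; apply Hf'. }
  { intros eps N Heps. destruct (Hcl eps N Heps) as [n [Hn [Q _]]]. exists (N1 + n)%nat. split; [lia|lra]. }
  destruct (Lim b b0') as [Rb Eb].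
  { split; apply Hf'. }
  { intros eps N Heps. destruct (Hcl eps N Heps) as [n [Hn [_ Q]]]. exists (N1 + n)%nat. split; [lia|lra]. }
  destruct (classic (a0' = b0')) as [Eab|Nab]; [|apply HnS; exists a0', b0'; auto 6].
  subst b0'. destruct (FF_expand c (e s) a0' Hc ltac:(specialize (He s Hs); lra) Ra) as [d [m [D [Hm HE]]]].
  destruct (Hct s d Hs D) as [d3 [D3 H3]]. destruct (Ht d3 D3) as [N3 HN3].
  destruct (Hcl d N3 D) as [n [Hn [Q1 Q2]]]. set (k := (N1 + n)%nat) in *.
  destruct (Hf' k) as [T1 [_ [_ [_ [Nk [Ek1 Ek2]]]]]]. destruct (H3 (t k) T1 (HN3 k ltac:(unfold k; lia))) as [Q3 _].
  specialize (HE (e (t k)) (a k) (b k) Q3 Q1 Q2). rewrite Ek1, Ek2, Cmod_self in HE.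
  apply Nk. symmetry. apply Cmod_sub_0. nra.
Qed.

(** For large [eta] the whole image of the axis lies on the part [J <= - B] of [ell], far from the
    origin. *)
Lemma tipJ_low c B : 0 < c -> exists E0, 0 < E0 /\ forall E, E0 <= E -> tipJ c (/ E) <= - B.
Proof. exists (Rmax 1 (Rabs (KK c 1) + Rabs B)). pose proof (Rmax_l 1 (Rabs (KK c 1) + Rabs B)). pose proof (Rmax_r 1 (Rabs (KK c 1) + Rabs B)).
split; [lra|]. intros E HE. assert (IE : 0 < / E <= 1). { split; [pos|]. rewrite <- Rinv_1. apply Rinv_le_contravar; lra. }
assert (HK : KK c (/ E) <= KK c 1).
{ destruct (Req_dec (/ E) 1) as [->|]; [lra|]. left. apply (incr_of_derive (KK c) (fun x => c * Rpower (1 + x ^ 2) (c / 2 - 1))); [lra|intros; apply KK_derive; auto|].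
  intros y _. pos. }
assert (HP : 1 <= Rpower (1 + (/ E) ^ 2) (c / 2)).
{ rewrite <- (Rpower_O (1 + (/ E) ^ 2)) at 1 by nra. apply Rle_Rpower; nra. }
unfold tipJ, JJ. rewrite Rinv_inv. pose proof (Rle_abs (KK c 1)). pose proof (Rle_abs B). nra.
Qed.

(** Two deformations carry a pair of preimages of [z0] to a pair of preimages of [0], which has only
    [1]. First [eta] grows to [E1] with the value fixed; then the value shrinks radially. The bound
    asked of [tipJ_low] makes the points of [ell] met at [E1] have modulus at least [|z0| + 1]. *)
Lemma FF_inj_off c eta w1 w2 : 0 < c -> 0 < eta -> 0 < Re w1 -> 0 < Re w2 -> FF c eta w1 = FF c eta w2 ->
  (forall J, J <= tipJ c (/ eta) -> FF c eta w1 <> ell c J) -> w1 = w2.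
Proof.
intros Hc He R1 R2 E Hoff. apply NNPP. intro N. set (z0 := FF c eta w1) in *.
destruct (tipJ_low c (Rpower (Cmod z0 + 1) (c / 2)) Hc) as [E0 [P0 H0]].
set (E1 := Rmax E0 eta). assert (L1 : E0 <= E1) by apply Rmax_l. assert (L2 : eta <= E1) by apply Rmax_r.
assert (D1 : double c E1 z0).
{ replace E1 with (eta + 1 * (E1 - eta)) by ring. apply (double_clopen c eta (fun s => eta + s * (E1 - eta)) (fun _ => z0) Hc He).
  - intros s eps Hs Heps. exists (eps / (E1 - eta + 1)). split; [pos|]. intros t Ht Hts. rewrite Cmod_self. split; [|lra].
    replace (eta + t * (E1 - eta) - (eta + s * (E1 - eta))) with ((t - s) * (E1 - eta)) by ring. rewrite Rabs_mult, (Rabs_right (E1 - eta)) by lra.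
    apply (Rmult_lt_compat_r (E1 - eta + 1)) in Hts; [|lra]. replace (eps / (E1 - eta + 1) * (E1 - eta + 1)) with eps in Hts by (field; lra). nra.
  - intros s Hs. nra.
  - intros s x Hs. rewrite FF_axis by auto. apply Hoff. assert (Ge : eta <= eta + s * (E1 - eta)) by nra.
    eapply Rle_trans; [apply JJ_le_tip; auto; lra|]. destruct Ge as [Ge|<-]; [left|lra].
    apply tipJ_incr; auto. split; [pos|apply Rinv_lt_contravar; nra].
  - replace (eta + 0 * (E1 - eta)) with eta by ring. exists w1, w2. repeat (split; [assumption|]). split; [reflexivity|symmetry; exact E]. }
assert (D2 : double c E1 0).
{ replace (RtoC 0) with (RtoC (1 - 1) * z0)%C by (Cring).
  apply (double_clopen c E1 (fun _ => E1) (fun s => RtoC (1 - s) * z0)%C Hc ltac:(lra)).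
  - intros s eps Hs Heps. pose proof (Cmod_ge_0 z0). exists (eps / (Cmod z0 + 1)). split; [pos|]. intros t Ht Hts. rewrite Rminus_diag, Rabs_R0. split; [lra|].
    replace (RtoC (1 - t) * z0 - RtoC (1 - s) * z0)%C with (RtoC (s - t) * z0)%C by (Cring). rewrite Cmod_mult, Cmod_R, Rabs_minus_sym.
    apply (Rmult_lt_compat_r (Cmod z0 + 1)) in Hts; [|lra]. replace (eps / (Cmod z0 + 1) * (Cmod z0 + 1)) with eps in Hts by (field; lra).
    pose proof (Rabs_pos (t - s)). nra.
  - intros; lra.
  - intros s x Hs X. rewrite FF_axis in X by auto. pose proof (JJ_le_tip c E1 x Hc ltac:(lra)) as HJ. specialize (H0 E1 L1).
    pose proof (Cmod_ge_0 z0) as Z0. apply (f_equal Cmod) in X. rewrite Cmod_ell, Cmod_mult, Cmod_R, Rabs_right in X by (lra).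
    set (J := JJ c E1 x) in *. pose proof (Im_le_Cmod (a0 c, J)) as Q. simpl in Q. rewrite Rabs_left1 in Q by (pose proof (exp_pos (c / 2 * ln (Cmod z0 + 1))); unfold Rpower in *; lra).
    assert (Q2 : Cmod z0 + 1 <= Rpower (Cmod (a0 c, J)) (2 / c)).
    { rewrite <- (Rpower_1 (Cmod z0 + 1)) by lra. replace 1 with (c / 2 * (2 / c)) at 2 by (field; lra). rewrite <- Rpower_mult.
      apply Rle_Rpower_l; [left; pos|]. split; [pos|lra]. }
    nra.
  - rewrite Rminus_0_r, Cmult_1_l. exact D1. }
destruct D2 as [u1 [u2 [U1 [U2 [Nu [Z1 Z2]]]]]]. apply Nu. rewrite (FF_zero c E1 u1), (FF_zero c E1 u2); auto; lra.
Qed.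

Lemma Cmod_cis_diff w v : Cmod (cis w - cis v)%C = 2 * Rabs (sin ((w - v) / 2)).
Proof.
set (m := (w + v) / 2). set (d := (w - v) / 2).
assert (E1 : cis w = (cis m * cis d)%C) by (rewrite <- cis_add; f_equal; unfold m, d; field).
assert (E2 : cis v = (cis m * cis (- d))%C) by (rewrite <- cis_add; f_equal; unfold m, d; field).
assert (S2 : (cis w - cis v)%C = (cis m * (Ci * RtoC (2 * sin d)))%C).
{ rewrite E1, E2.
  apply C_eq; simpl; rewrite ?cos_neg, ?sin_neg; ring. }
rewrite S2, !Cmod_mult, Cmod_cis, Cmod_Ci, Cmod_R, Rabs_mult, (Rabs_right 2) by lra. ring.
Qed.

(* The curve [ell] meets each circle around 0 at most twice. *)
Lemma ell_no_interior c z d : 0 < c -> 0 < d -> exists y, Cmod (y - z)%C < d /\ forall J, y <> ell c J.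
Proof.
intros Pc Hd. apply NNPP. intro Hno.
assert (All : forall y, Cmod (y - z)%C < d -> exists J, y = ell c J).
{ intros y Hy. apply NNPP. intro Hn. apply Hno. exists y. split; auto. intros J E. apply Hn. exists J; auto. }
assert (Hz : exists z0, z0 <> RtoC 0 /\ Cmod (z0 - z)%C < d / 2).
{ destruct (classic (z = 0)) as [->|Hz].
  - exists (RtoC (d / 4)). split; [intro X; apply RtoC_inj in X; lra|]. rewrite <- RtoC_minus, Cmod_R, Rabs_right; lra.
  - exists z. split; auto. replace (z - z)%C with (RtoC 0) by ring. rewrite Cmod_0. lra. }
destruct Hz as [z0 [N0 Z0]]. pose proof (Cmod_pos z0 N0) as P0.
set (e := Rmin 1 (d / 4 / Cmod z0)). assert (He : 0 < e) by (pos).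
assert (E1 : e <= 1) by apply Rmin_l. assert (E2 : e <= d / 4 / Cmod z0) by apply Rmin_r. apply Rle_div_r in E2; auto.
assert (Near : forall x, 0 <= x <= e -> exists J, (cis x * z0)%C = ell c J).
{ intros x Hx. apply All. pose proof (Cmod_triangle_sub (cis x * z0)%C z0 z) as T1.
  replace (cis x * z0 - z0)%C with ((cis x - cis 0) * z0)%C in T1 by (rewrite cis_0; ring).
  rewrite Cmod_mult, Cmod_cis_diff in T1. replace ((x - 0) / 2) with (x / 2) in T1 by field.
  assert (Rabs (sin (x / 2)) <= x / 2).
  { destruct (Req_dec x 0) as [->|]; [replace (0 / 2) with 0 by field; rewrite sin_0, Rabs_R0; lra|].
    rewrite Rabs_right; [left; apply sin_lt_x; lra|]. apply Rle_ge, sin_ge_0; pose proof PI2_1; lra. }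
  nra. }
destruct (Near 0 ltac:(lra)) as [Ja Ea]. destruct (Near (e / 2) ltac:(lra)) as [Jb Eb]. destruct (Near e ltac:(lra)) as [Jc Ec].
assert (Hc : forall x y, 0 <= x <= 1 -> 0 <= y <= 1 -> (cis x * z0)%C = (cis y * z0)%C -> x = y).
{ intros x y Hx Hy E. apply Cmult_reg_r in E; auto. apply (f_equal Re) in E.
  pose proof PI2_1. apply cos_inj in E; auto; lra. }
assert (Hm : forall x J y J', (cis x * z0)%C = ell c J -> (cis y * z0)%C = ell c J' -> J = J' \/ J = - J').
{ intros x J y J' Ex Ey. apply (f_equal Cmod) in Ex. apply (f_equal Cmod) in Ey. rewrite Cmod_mult, Cmod_cis, Cmod_ell in Ex, Ey by auto.
  rewrite Ey in Ex. apply Rpower_inj in Ex; try apply Cmod_aJ_pos; auto; [|apply Rgt_not_eq, Rdiv_lt_0_compat; lra].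
  apply (f_equal (fun x => x ^ 2)) in Ex. rewrite !Cmod_aJ in Ex. nra. }
assert (Nab : Ja <> Jb) by (intro X; subst Jb; rewrite <- Ea in Eb; apply Hc in Eb; lra).
assert (Nac : Ja <> Jc) by (intro X; subst Jc; rewrite <- Ea in Ec; apply Hc in Ec; lra).
assert (Nbc : Jb <> Jc) by (intro X; subst Jc; rewrite <- Eb in Ec; apply Hc in Ec; lra).
destruct (Hm _ _ _ _ Ea Eb); [auto|]. destruct (Hm _ _ _ _ Ea Ec); [auto|]. lra.
Qed.

(** If an interior point shared its value with a point of the axis, a nearby value off [ell] would,
    by openness, have preimages near both, against [FF_inj_off]. The radius is a third of the
    distance because [w], [v1], [v] and [ax x] would be joined by three steps. *)
Lemma FF_avoid c eta w x : 0 < c -> 0 < eta -> 0 < Re w -> FF c eta w <> FF c eta (ax x).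
Proof.
intros Hc He Hw E.
assert (Hne : 0 < Cmod (w - ax x)) by (apply Cmod_pos; intro X; apply Csub_0 in X; rewrite X in Hw; simpl in Hw; lra).
set (r := Cmod (w - ax x) / 3). assert (Hr : 0 < r) by (unfold r; lra).
destruct (FF_open c eta w r Hc He Hw Hr) as [d [Hd H]].
destruct (hd_ct _ _ _ _ (FF_hd c eta (ax x) Hc ltac:(simpl; lra)) (d / 2) ltac:(lra)) as [d1 [Hd1 H1]].
set (s := Rmin d1 r / 2). assert (Hs : 0 < s) by (unfold s; assert (0 < Rmin d1 r) by pos; lra).
assert (Hs1 : s < d1 /\ s < r) by (unfold s; split; rmin).
set (v := (ax x + RtoC s)%C).
assert (Ev : Cmod (v - ax x) = s). { unfold v. replace (ax x + RtoC s - ax x)%C with (RtoC s) by ring. rewrite Cmod_R, Rabs_right; lra. }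
assert (Hv : 0 < Re v) by (unfold v; rewrite re_plus; simpl; lra).
specialize (H1 v I ltac:(lra)). rewrite <- E in H1.
destruct (FF_open c eta v r Hc He Hv Hr) as [d2 [Hd2 H2]].
destruct (ell_no_interior c (FF c eta v) (Rmin d2 (d / 2)) Hc ltac:(pos)) as [y [Hy1 Hy2]].
assert (Z : Rabs (eta - eta) = 0) by (rewrite Rminus_diag; apply Rabs_R0).
destruct (H2 eta y ltac:(lra) ltac:(rmin)) as [v2 [V1 [V2 V3]]].
destruct (H eta y ltac:(lra)) as [v1 [W1 [W2 W3]]].
{ pose proof (Cmod_triangle_sub y (FF c eta v) (FF c eta w)). assert (Cmod (y - FF c eta v) < d / 2) by rmin. lra. }
assert (X : v1 = v2). { apply (FF_inj_off c eta v1 v2 Hc He W1 V1); [rewrite V3; exact W3|]. rewrite W3. intros J _. apply Hy2. }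
subst v2. pose proof (Cmod_triangle_sub w v1 (ax x)) as T1. pose proof (Cmod_triangle_sub v1 v (ax x)) as T2.
rewrite (Cmod_sub_sym w v1) in T1. unfold r in *. lra.
Qed.

(** Every [J] up to the tip is a value of [JJ c eta] on the half-line left of [/ eta], by the
    intermediate value theorem; then [FF_avoid] applies. *)
Lemma FF_avoid_ell c eta w J : 0 < c -> 0 < eta -> 0 < Re w -> J <= tipJ c (/ eta) -> FF c eta w <> ell c J.
Proof.
intros Hc He Hw HJ.
assert (Hex : exists x, JJ c eta x = J).
{ destruct (Req_dec J (tipJ c (/ eta))) as [->|Hn].
  { exists (/ eta). unfold tipJ. rewrite Rinv_inv. auto. }
  assert (Hlow : exists x, x <= 0 /\ JJ c eta x <= J).
  {
    (* At this abscissa [eta (1 + x ^ 2) ^ (c / 2)] dominates both [- J] and [KK c 0]. *)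
    exists (- (Rmax 1 (Rpower (Rabs (J / eta) + Rabs (KK c 0 / eta) + 1) (/ c)))).
    set (X := Rmax 1 (Rpower (Rabs (J / eta) + Rabs (KK c 0 / eta) + 1) (/ c))).
    assert (HX : 1 <= X) by apply Rmax_l. split; [lra|]. unfold JJ.
    assert (Hk : KK c (- X) <= KK c 0).
    { left. apply (incr_of_derive (KK c) (fun x => c * Rpower (1 + x ^ 2) (c / 2 - 1))); [lra|intros; apply KK_derive; auto|].
      intros y _. apply Rmult_lt_0_compat; auto. apply exp_pos. }
    assert (Hp : Rabs (J / eta) + Rabs (KK c 0 / eta) + 1 <= Rpower (1 + (- X) ^ 2) (c / 2)).
    { pose proof (Rabs_pos (J / eta)). pose proof (Rabs_pos (KK c 0 / eta)).
      apply Rle_trans with (Rpower (Rpower (Rabs (J / eta) + Rabs (KK c 0 / eta) + 1) (/ c)) c).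
      - rewrite Rpower_mult, Rinv_l, Rpower_1; lra.
      - apply Rle_trans with (Rpower X c).
        + apply Rle_Rpower_l; [lra|]. split; [apply exp_pos|apply Rmax_r].
        + replace c with (2 * (c / 2)) at 1 by lra. rewrite <- Rpower_mult. apply Rle_Rpower_l; [lra|].
          replace 2 with (INR 2) by auto. rewrite Rpower_pow by lra. split; [apply pow_lt; lra|simpl; nra]. }
    assert (P1 : - J <= eta * Rabs (J / eta)).
    { rewrite <- (Rabs_right eta) at 1 by lra. rewrite <- Rabs_mult. replace (eta * (J / eta)) with J by (field; lra).
      rewrite <- Rabs_Ropp. apply Rle_abs. }
    assert (P2 : KK c 0 <= eta * Rabs (KK c 0 / eta)).
    { rewrite <- (Rabs_right eta) at 1 by lra. rewrite <- Rabs_mult. replace (eta * (KK c 0 / eta)) with (KK c 0) by (field; lra).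
      apply Rle_abs. }
    nra. }
  destruct Hlow as [x0 [Hx0 HJ0]].
  destruct (IVT_gen (JJ c eta) x0 (/ eta) J) as [x [_ Hx]].
  - intro y. apply derivable_continuous_pt. exists (c * Rpower (1 + y ^ 2) (c / 2 - 1) * (1 - eta * y)).
    apply is_derive_Reals, JJ_derive; auto.
  - unfold tipJ in HJ. rewrite Rinv_inv in HJ. split.
    + rmin.
    + eapply Rle_trans; [exact HJ|apply Rmax_r].
  - eauto. }
destruct Hex as [x <-]. rewrite <- FF_axis by auto. apply FF_avoid; auto.
Qed.

Lemma FF_inj c eta w1 w2 : 0 < c -> 0 < eta -> 0 < Re w1 -> 0 < Re w2 -> FF c eta w1 = FF c eta w2 -> w1 = w2.
Proof. intros. apply (FF_inj_off c eta); auto. intros J. apply FF_avoid_ell; auto. Qed.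

(** * The hypotheses in epsilon-delta form *)

Definition Rnn : C -> Prop := fun y => Im y = 0 /\ 0 <= Re y.

Definition inT (T : Rbar) (t : R) : Prop := 0 <= t /\ Rbar_lt t T.

Definition hull_c (gamma : R -> C) (t : R) : C -> Prop := complement0 (fun s => 0 < s <= t) gamma.

(** What the proof uses of [radial_SLE0]; the maps [g t] enter only as bijections. *)
Record SLEhyp (rho v0 : R) (T : Rbar) (gamma : R -> C) (w v : R -> R) (g : R -> C -> C) : Prop := {
  hyp_disk : forall t, before T t -> disk (gamma t);
  hyp_cont : forall t, before T t -> forall eps, 0 < eps -> exists d, 0 < d /\
    forall s, before T s -> Rabs (s - t) < d -> Cmod (gamma s - gamma t)%C < eps;
  hyp_start : forall eps, 0 < eps -> exists d, 0 < d /\ forall s, 0 < s < d -> Cmod (gamma s - RtoC 1)%C < eps;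
  hyp_w0 : w 0 = 0;
  hyp_w : forall t, inT T t -> hd Rnn (fun y => RtoC (w (Re y))) (RtoC t) (RtoC (rho / 2 * cot ((w t - v t) / 2)));
  hyp_v0 : v 0 = v0;
  hyp_v : forall t, inT T t -> forall eps, 0 < eps -> exists d, 0 < d /\
    forall s, inT T s -> Rabs (s - t) < d -> Rabs (v s - v t) < eps;
  hyp_gv : forall t, inT T t -> cis (v t) = g t (cis v0);
  hyp_hit : right_limit0_Rbar (hitting_time T w v) T;
  hyp_g0 : forall z, disk z -> g 0 z = z;
  hyp_ode : forall t z, inT T t -> hull_c gamma t z \/ z = cis v0 ->
    hd Rnn (fun y => g (Re y) z) (RtoC t) (g t z * ((cis (w t) + g t z) / (cis (w t) - g t z)))%C;
  hyp_in : forall t z, inT T t -> hull_c gamma t z -> disk (g t z);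
  hyp_inj : forall t z z', inT T t -> hull_c gamma t z -> hull_c gamma t z' -> g t z = g t z' -> z = z';
  hyp_surj : forall t y, inT T t -> disk y -> exists z, hull_c gamma t z /\ g t z = y }.

Lemma nonneg_filter_lim (t : R) : is_filter_lim (within (fun s => 0 <= s) (locally t)) t.
Proof. intros P HP. destruct HP as [e H]. exists e. auto. Qed.

Lemma derive_nonneg_C (f : R -> C) (t : R) (l : C) :
  is_derive_nonneg (V := C_R_NormedModule) f t l -> hd Rnn (fun y => f (Re y)) t l.
Proof.
intros [_ H] eps He. specialize (H t (nonneg_filter_lim t) (mkposreal _ He)). destruct H as [d Hd].
exists d. split; [apply cond_pos|]. intros y [Hy0 Hy1] Hyt. destruct y as [y1 y2]. simpl in Hy0, Hy1. subst y2.
replace ((y1, 0) - t)%C with (RtoC (y1 - t)) in * by Cring. rewrite Cmod_R in *.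
specialize (Hd y1 Hyt Hy1).
rewrite <- Cmod_norm in Hd.
match type of Hd with Cmod ?X <= _ => replace X with (f y1 - f t - l * RtoC (y1 - t))%C in Hd end.
- auto.
- apply C_eq; simpl; unfold mult, scal, minus, plus, opp; simpl; unfold mult; simpl; ring.
Qed.

Lemma derive_nonneg_R (f : R -> R) (t l : R) :
  is_derive_nonneg f t l -> hd Rnn (fun y => RtoC (f (Re y))) t l.
Proof.
intros [_ H] eps He. specialize (H t (nonneg_filter_lim t) (mkposreal _ He)). destruct H as [d Hd].
exists d. split; [apply cond_pos|]. intros y [Hy0 Hy1] Hyt. destruct y as [y1 y2]. simpl in Hy0, Hy1. subst y2.
simpl (Re (y1, 0)). simpl (Re t).
replace ((y1, 0) - t)%C with (RtoC (y1 - t)) in * by Cring. rewrite Cmod_R in *.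
replace (RtoC (f y1) - RtoC (f t) - l * RtoC (y1 - t))%C with (RtoC (f y1 - f t - l * (y1 - t))) by Cring.
rewrite Cmod_R.
replace (f y1 - f t - l * (y1 - t)) with (minus (minus (f y1) (f t)) (scal (minus y1 t) l)).
- auto.
- unfold minus, plus, opp, scal; simpl; unfold mult; simpl; ring.
Qed.

Lemma continuous_on_C (D : R -> Prop) (f : R -> C) : continuous_on D f -> forall t, D t -> forall eps, 0 < eps ->
  exists d, 0 < d /\ forall s, D s -> Rabs (s - t) < d -> Cmod (f s - f t)%C < eps.
Proof.
intros H t Dt eps He. specialize (H t Dt (fun z => Cmod (z - f t)%C < eps)).
destruct H as [d Hd].
- apply nbhd_C. exists eps. auto.
- exists d. split; [apply cond_pos|]. auto.
Qed.

Lemma continuous_on_R (D : R -> Prop) (f : R -> R) : continuous_on D f -> forall t, D t -> forall eps, 0 < eps ->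
  exists d, 0 < d /\ forall s, D s -> Rabs (s - t) < d -> Rabs (f s - f t) < eps.
Proof.
intros H t Dt eps He. specialize (H t Dt (fun z => Rabs (z - f t) < eps)).
destruct H as [d Hd].
- exists (mkposreal _ He). auto.
- exists d. split; [apply cond_pos|]. auto.
Qed.

Lemma radial_SLE0_hyp rho v0 T gamma : radial_SLE0 rho v0 T gamma -> exists w v g, SLEhyp rho v0 T gamma w v g.
Proof.
intros [Hd [Hc [Hs [w [v [g [[Hw0 Hw] [[Hv0 [Hvc Hgv]] [Hhit [Hg0 [Hode Hconf]]]]]]]]]]].
exists w, v, g. constructor; auto.
- apply continuous_on_C; auto.
- intros eps He. specialize (Hs (fun z => Cmod (z - 1)%C < eps)). destruct Hs as [d H].
  + apply nbhd_C. exists eps. auto.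
  + exists d. split; [apply cond_pos|]. intros s Hs. apply H; [|lra].
    change (Rabs (s - 0) < d). rewrite Rabs_right; lra.
- intros t [Ht1 Ht2]. apply (derive_nonneg_R w). auto.
- apply continuous_on_R; auto.
- intros t [Ht1 Ht2]. auto.
- intros t z [Ht1 Ht2] Hz. apply (derive_nonneg_C (fun s => g s z)). auto.
- intros t z [Ht1 Ht2] Hz. destruct (Hconf t Ht1 Ht2) as [[_ [H _]] _]. auto.
- intros t z z' [Ht1 Ht2] Hz Hz' E. destruct (Hconf t Ht1 Ht2) as [[_ [_ [H _]]] _]. auto.
- intros t y [Ht1 Ht2] Hy. destruct (Hconf t Ht1 Ht2) as [[_ [_ [_ H]]] _]. auto.
Qed.

(** ** Reflection in the real axis *)

Lemma open_conj (U : C -> Prop) : open U -> open (fun z => U (Cconj z)).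
Proof.
intros HU z Hz. apply nbhd_C. specialize (HU _ Hz). apply (proj1 (nbhd_C _ _)) in HU. destruct HU as [e [He H]].
exists e. split; auto. intros y Hy. apply H. rewrite <- Cconj_sub, Cmod_conj. auto.
Qed.

Lemma connected_conj (A : C -> Prop) : connected A -> connected (fun z => A (Cconj z)).
Proof.
intros HA U V HU HV Hcov [x [Ax Ux]] [y [Ay Vy]].
destruct (HA (fun z => U (Cconj z)) (fun z => V (Cconj z))) as [z [Az [Uz Vz]]].
- apply open_conj; auto.
- apply open_conj; auto.
- intros z Az. apply Hcov. rewrite Cconj_conj. auto.
- exists (Cconj x). rewrite Cconj_conj. auto.
- exists (Cconj y). rewrite Cconj_conj. auto.
- exists (Cconj z). rewrite Cconj_conj. auto.
Qed.

Lemma component_conj (E E' : C -> Prop) x z : (forall y, E y -> E' (Cconj y)) -> component E x z ->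
  component E' (Cconj x) (Cconj z).
Proof.
intros HE [A [HA [HAE [Ax Az]]]]. exists (fun y => A (Cconj y)). split; [apply connected_conj; auto|].
split; [|rewrite !Cconj_conj; auto]. intros y Ay. rewrite <- (Cconj_conj y). auto.
Qed.

Lemma disk_conj z : disk z -> disk (Cconj z).
Proof. unfold disk. rewrite Cmod_conj. auto. Qed.

Lemma complement0_conj I gamma z : complement0 I gamma z -> complement0 I (fun t => Cconj (gamma t)) (Cconj z).
Proof.
intros H. unfold complement0. replace (RtoC 0) with (Cconj 0) by Cring.
eapply component_conj; [|exact H]. intros y [Hy Hn]. split; [apply disk_conj; auto|].
intros [t [It E]]. apply Hn. exists t. split; auto. rewrite <- (Cconj_conj y), E, Cconj_conj. auto.
Qed.

Lemma complement0_conj' I gamma z : complement0 I (fun t => Cconj (gamma t)) z -> complement0 I gamma (Cconj z).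
Proof.
intros H. apply complement0_conj in H.
destruct H as [A [HA [HAE HA0]]]. exists A. split; auto. split; auto. intros y Ay. destruct (HAE y Ay) as [Hd Hn].
split; auto. intros [t [It E]]. apply Hn. exists t. rewrite Cconj_conj. auto.
Qed.

Lemma cis_2PI_minus x : cis (2 * PI - x) = Cconj (cis x).
Proof.
rewrite Cconj_cis. apply C_eq; simpl.
- replace (2 * PI - x) with (- x + 2 * 1 * PI) by ring. replace 1 with (INR 1) by auto. apply cos_period.
- replace (2 * PI - x) with (- x + 2 * 1 * PI) by ring. replace 1 with (INR 1) by auto. apply sin_period.
Qed.

Lemma hd_conj_Rnn f t l : hd Rnn f (RtoC t) l -> hd Rnn (fun y => Cconj (f y)) (RtoC t) (Cconj l).
Proof. apply hd_conj_real. intros y Hy; apply Hy. Qed.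

Lemma Cconj_div (a b : C) : Cconj (a / b)%C = (Cconj a / Cconj b)%C.
Proof.
unfold Cdiv. rewrite Cconj_mul. f_equal. destruct b as [x y]. apply C_eq; unfold Cconj, Cinv; simpl.
- f_equal. ring.
- unfold Rdiv. replace (- y * (- y * 1)) with (y * (y * 1)) by ring. ring.
Qed.

Lemma cot_conj w v : cot ((- w - (2 * PI - v)) / 2) = - cot ((w - v) / 2).
Proof.
replace ((- w - (2 * PI - v)) / 2) with (- ((w - v) / 2 + PI)) by lra.
unfold cot. rewrite cos_neg, sin_neg, neg_cos, neg_sin. unfold Rdiv. rewrite Ropp_involutive. ring.
Qed.

(** [v] becomes [2 PI - v] rather than [- v], so that a force point on the lower half-circle is sent
    to a [v0] in [(0, PI)]. *)
Lemma SLEhyp_conj rho v0 T gamma w v g : SLEhyp rho v0 T gamma w v g ->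
  SLEhyp rho (2 * PI - v0) T (fun t => Cconj (gamma t)) (fun t => - w t) (fun t => 2 * PI - v t)
    (fun t z => Cconj (g t (Cconj z))).
Proof.
intros H. destruct H as [Hd Hc Hs Hw0 Hw Hv0 Hv Hgv Hhit Hg0 Hode Hin Hinj Hsurj].
constructor.
- intros t Ht. apply disk_conj; auto.
- intros t Ht eps He. destruct (Hc t Ht eps He) as [d [Hd0 H]]. exists d. split; auto. intros s Hs1 Hs2.
  rewrite <- Cconj_sub, Cmod_conj. auto.
- intros eps He. destruct (Hs eps He) as [d [Hd0 H]]. exists d. split; auto. intros s Hs1.
  replace (RtoC 1) with (Cconj 1) by Cring. rewrite <- Cconj_sub, Cmod_conj. auto.
- lra.
- intros t Ht. rewrite cot_conj.
  eapply hd_eq; [|eapply hd_ext_all; [|apply hd_opp, (Hw t Ht)]].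
  + Cring.
  + intro y. Cring.
- lra.
- intros t Ht eps He. destruct (Hv t Ht eps He) as [d [Hd0 H]]. exists d. split; auto. intros s Hs1 Hs2.
  replace (2 * PI - v s - (2 * PI - v t)) with (- (v s - v t)) by ring. rewrite Rabs_Ropp. auto.
- intros t Ht. rewrite !cis_2PI_minus, Cconj_conj. f_equal. auto.
- assert (E : forall eps, hitting_time T (fun t => - w t) (fun t => 2 * PI - v t) eps = hitting_time T w v eps).
  { intro eps. apply Glb_Rbar_eqset. intro t.
    rewrite cis_2PI_minus, <- Cconj_cis, <- Cconj_sub, Cmod_conj. tauto. }
  destruct Hhit as [H1 H2]. split; intros a Ha.
  + specialize (H1 a Ha). eapply filter_imp; [|exact H1]. intros eps He. rewrite E. auto.
  + specialize (H2 a Ha). eapply filter_imp; [|exact H2]. intros eps He. rewrite E. auto.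
- intros z Hz. rewrite Hg0, Cconj_conj; auto. apply disk_conj; auto.
- intros t z Ht Hz.
  assert (Hz' : hull_c gamma t (Cconj z) \/ Cconj z = cis v0).
  { destruct Hz as [Hz|Hz]; [left; apply complement0_conj'; auto|right]. rewrite Hz, cis_2PI_minus, Cconj_conj. auto. }
  eapply hd_eq; [|apply hd_conj_Rnn, (Hode t (Cconj z) Ht Hz')].
  rewrite Cconj_mul, Cconj_div, Cconj_add, Cconj_sub, <- Cconj_cis. auto.
- intros t z Ht Hz. apply disk_conj, Hin; auto. apply complement0_conj'; auto.
- intros t z z' Ht Hz Hz' E. rewrite <- (Cconj_conj z), <- (Cconj_conj z'). f_equal.
  apply (Hinj t); auto; try (apply complement0_conj'; auto).
  rewrite <- (Cconj_conj (g t (Cconj z))), E, Cconj_conj. auto.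
- intros t y Ht Hy. destruct (Hsurj t (Cconj y) Ht (disk_conj _ Hy)) as [z [Hz E]].
  exists (Cconj z). rewrite Cconj_conj, E, Cconj_conj. split; auto. apply complement0_conj; auto.
Qed.

(** * The angle between the driving function and the force point *)

(** The identity includes the collision [cis w = cis v]: both sides are then [0] by the convention
    on division by zero. Collisions are excluded only later. *)
Lemma cis_ratio w v : ((cis w + cis v) / (cis w - cis v))%C = (- Ci * RtoC (cot ((w - v) / 2)))%C.
Proof.
set (m := (w + v) / 2). set (d := (w - v) / 2).
assert (E1 : cis w = (cis m * cis d)%C) by (rewrite <- cis_add; f_equal; unfold m, d; field).
assert (E2 : cis v = (cis m * cis (- d))%C) by (rewrite <- cis_add; f_equal; unfold m, d; field).
assert (S1 : (cis w + cis v)%C = (cis m * RtoC (2 * cos d))%C).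
{ rewrite E1, E2.
  apply C_eq; simpl; rewrite ?cos_neg, ?sin_neg; ring. }
assert (S2 : (cis w - cis v)%C = (cis m * (Ci * RtoC (2 * sin d)))%C).
{ rewrite E1, E2.
  apply C_eq; simpl; rewrite ?cos_neg, ?sin_neg; ring. }
rewrite S1, S2. unfold cot. destruct (Req_dec (sin d) 0) as [Z|Z].
- rewrite Z. unfold Rdiv. rewrite Rinv_0, !Rmult_0_r.
  replace (/ 0)%C with (RtoC 0).
  + unfold Cdiv.
    unfold Cinv. unfold Rdiv. Cring.
  + unfold Cinv. unfold Rdiv. Cring.
- assert (Mn : cis m <> 0) by (apply Cmod_pos_neq; rewrite Cmod_cis; lra).
  assert (Zn : RtoC (sin d) <> 0) by (intro E; apply (f_equal Re) in E; simpl in E; lra).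
  assert (In : Ci <> 0) by apply Ci_nz.
  assert (CiCi : (Ci * Ci)%C = (- RtoC 1)%C) by Cring.
  rewrite RtoC_div by auto. rewrite !RtoC_mult.
  assert (Sn : forall x : C, x = (- Ci * Ci * x)%C) by (intro x; replace (- Ci * Ci * x)%C with (- (Ci * Ci) * x)%C by ring; rewrite CiCi; ring).
  rewrite (Sn (cis m * (2 * RtoC (cos d)) / _)%C). field. auto.
Qed.

(** Near [t] the continuous lift is [v t - i Clog (cis (v - v t))], so it inherits a derivative from
    [cis v]. *)
Lemma hd_lift (S : C -> Prop) (v : R -> R) t l : (forall y, S y -> Im y = 0) ->
  (forall eps, 0 < eps -> exists d, 0 < d /\ forall y, S y -> Cmod (y - RtoC t)%C < d -> Rabs (v (Re y) - v t) < eps) ->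
  hd S (fun y => cis (v (Re y))) (RtoC t) (Ci * cis (v t) * RtoC l)%C ->
  hd S (fun y => RtoC (v (Re y))) (RtoC t) (RtoC l).
Proof.
intros HS Hc H. pose proof PI_RGT_0.
destruct (Hc (PI / 2) ltac:(lra)) as [d [Hd Hd']].
assert (Ciinv : (- Ci * Ci)%C = 1) by Cring.
assert (D : hd S (fun y => cis (v (Re y)) * cis (- v t))%C t (Ci * l)%C).
{ eapply hd_eq; [|apply hd_mult; [exact H|apply hd_const]]. cbv beta.
  replace (Ci * cis (v t) * l * cis (- v t) + cis (v (Re t)) * 0)%C with (Ci * l * (cis (v t) * cis (- v t)))%C by ring.
  rewrite <- cis_add. replace (v t + - v t) with 0 by ring. rewrite cis_0. ring. }
assert (E0 : (cis (v (Re t)) * cis (- v t))%C = 1).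
{ rewrite <- cis_add. simpl. replace (v t + - v t) with 0 by ring. apply cis_0. }
apply hd_ext with (fun y => RtoC (v t) + - Ci * Clog (cis (v (Re y)) * cis (- v t)))%C.
- exists d. split; auto. intros y Sy Hy. rewrite <- cis_add.
  specialize (Hd' y Sy Hy). apply Rabs_lt_between in Hd'.
  rewrite Clog_cis by lra.
  Cring.
- rewrite E0. rewrite Clog_R, ln_1 by lra. Cring.
- assert (DL : hdC Clog (cis (v (Re t)) * cis (- v t))%C (/ 1)%C) by (rewrite E0; apply hdC_Clog; simpl; lra).
  eapply hd_eq; [|apply hd_plus; [apply hd_const|apply hd_scal; exact (hdC_comp S Clog (fun y => cis (v (Re y)) * cis (- v t))%C t _ _ DL D)]].
  replace (0 + - Ci * (/ 1 * (Ci * l)))%C with ((- Ci * Ci) * l / 1)%C by Cring.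
  rewrite Ciinv. field.
Qed.

Lemma first_zero (f : R -> R) b : 0 <= b ->
  (forall x, 0 <= x <= b -> forall eps, 0 < eps -> exists d, 0 < d /\ forall y, 0 <= y <= b -> Rabs (y - x) < d -> Rabs (f y - f x) < eps) ->
  f 0 <> 0 -> f b = 0 -> exists t, 0 < t <= b /\ f t = 0 /\ forall s, 0 <= s < t -> f s <> 0.
Proof.
intros Hb Hc H0 Hfb.
destruct (completeness (fun t => 0 <= t <= b /\ forall s, 0 <= s <= t -> f s <> 0)) as [t [Ht1 Ht2]].
- exists b. intros x [Hx _]. lra.
- exists 0. split; [lra|]. intros s Hs. replace s with 0 by lra. auto.
- assert (B0 : 0 <= t). { apply Ht1. split; [lra|]. intros s Hs. replace s with 0 by lra. auto. }
  assert (B1 : t <= b). { apply Ht2. intros x [Hx _]. lra. }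
  assert (Hlt : forall s, 0 <= s < t -> f s <> 0).
  { intros s Hs E. assert (t <= s); [|lra]. apply Ht2. intros x [Hx Hx2]. apply Rnot_lt_le. intro. apply (Hx2 s); lra. }
  assert (Hft : f t = 0).
  { apply NNPP. intro Hne. destruct (Hc t (conj B0 B1) (Rabs (f t))) as [d [Hd Hy]]; [apply Rabs_pos_lt; auto|].
    assert (Hnear : forall y, 0 <= y <= b -> Rabs (y - t) < d -> f y <> 0).
    { intros y Y1 Y2 E. specialize (Hy y Y1 Y2). rewrite E in Hy. replace (0 - f t) with (- f t) in Hy by ring.
      rewrite Rabs_Ropp in Hy. lra. }
    assert (t < b). { destruct B1; auto. subst t. lra. }
    set (x := Rmin b (t + d / 2)). assert (x <= b) by apply Rmin_l. assert (x <= t + d / 2) by apply Rmin_r.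
    assert (t < x) by pos.
    assert (x <= t); [|lra]. apply Ht1. split; [lra|]. intros s Hs.
    destruct (Rlt_le_dec s t); [apply Hlt; lra|]. apply Hnear; [lra|]. rewrite Rabs_right; lra. }
  exists t. split; [|auto]. destruct B0; [lra|]. subst t. lra.
Qed.

(** ** Connectedness *)

Lemma open_ball_in (U : C -> Prop) z : open U -> U z -> exists e, 0 < e /\ forall y, Cmod (y - z)%C < e -> U y.
Proof. intros HU Uz. apply (proj1 (nbhd_C _ _) (HU z Uz)). Qed.

Lemma connected_curve (k : R -> C) :
  (forall s, 0 <= s <= 1 -> forall eps, 0 < eps -> exists d, 0 < d /\ forall t, 0 <= t <= 1 -> Rabs (t - s) < d -> Cmod (k t - k s)%C < eps) ->
  connected (fun z => exists s, 0 <= s <= 1 /\ z = k s).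
Proof.
intros Hk U V HU HV Hcov [x [[sx [Hsx Ex]] Ux]] [y [[sy [Hsy Ey]] Vy]]. apply NNPP. intro Hno.
assert (Near : forall W s, open W -> 0 <= s <= 1 -> W (k s) -> exists d, 0 < d /\ forall t, 0 <= t <= 1 -> Rabs (t - s) < d -> W (k t)).
{ intros W s HW Hs Ws. destruct (open_ball_in W (k s) HW Ws) as [e [He H]].
  destruct (Hk s Hs e He) as [d [Hd H']]. exists d. auto. }
assert (G : forall W W' a b, open W -> open W' -> 0 <= a <= 1 -> 0 <= b <= 1 -> a <= b -> (forall s, 0 <= s <= 1 -> W (k s) \/ W' (k s)) ->
   (forall s, 0 <= s <= 1 -> W (k s) -> W' (k s) -> False) -> W (k a) -> W' (k b) -> False).
{ intros W W' a b HW HW' Ha Hb Hab Hc Hd Wa Wb. apply (Hd b); auto.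
  apply (interval_clopen (fun s => W (k s)) a b); auto.
  - intros s Hs Ws. destruct (Near W s HW ltac:(lra) Ws) as [d [H1 H2]]. exists d. split; auto. intros t Ht. apply H2; lra.
  - intros s Hs Ws. destruct (Hc s ltac:(lra)) as [|Ws']; [contradiction|].
    destruct (Near W' s HW' ltac:(lra) Ws') as [d [H1 H2]]. exists d. split; auto. intros t Ht1 Ht2 Wt. apply (Hd t); auto; [lra|apply H2; auto; lra]. }
assert (Hcov' : forall s, 0 <= s <= 1 -> U (k s) \/ V (k s)) by eauto.
assert (Hdis : forall s, 0 <= s <= 1 -> U (k s) -> V (k s) -> False).
{ intros s Hs A B. apply Hno. exists (k s). split; [exists s|]; auto. }
subst x y. destruct (Rle_lt_dec sx sy).
- eauto.
- apply (G V U sy sx); auto; try lra; [intros s Hs; destruct (Hcov' s Hs); auto|intros s Hs A B; apply (Hdis s); auto].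
Qed.

Lemma connected_segment p q : connected (fun z => exists s, 0 <= s <= 1 /\ z = (p + s * (q - p))%C).
Proof.
apply (connected_curve (fun s => p + s * (q - p))%C). intros s Hs e He.
exists (e / (1 + Cmod (q - p)%C)). pose proof (Cmod_ge_0 (q - p)%C). split; [pos|]. intros t _ Ht.
replace (p + t * (q - p) - (p + s * (q - p)))%C with (RtoC (t - s) * (q - p))%C by Cring.
rewrite Cmod_mult, Cmod_R. apply Rlt_div_r in Ht; [|lra]. nra.
Qed.

Lemma connected_union (A B : C -> Prop) p : connected A -> connected B -> A p -> B p -> connected (fun z => A z \/ B z).
Proof.
intros HA HB Ap Bp.
assert (G : forall U V, open U -> open V -> (forall z, A z \/ B z -> U z \/ V z) -> U p -> (exists y, (A y \/ B y) /\ V y) ->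
  exists z, (A z \/ B z) /\ U z /\ V z).
{ intros U V HU HV Hc Up [y [[Ay|By] Vy]].
  - destruct (HA U V) as [z [Z1 Z2]]; auto; [exists p; auto|exists y; auto|exists z; auto].
  - destruct (HB U V) as [z [Z1 Z2]]; auto; [exists p; auto|exists y; auto|exists z; auto]. }
intros U V HU HV Hc Hx Hy. destruct (Hc p (or_introl Ap)) as [Up|Vp].
- auto.
- destruct (G V U) as [z [Z1 [Z2 Z3]]]; auto.
  + intros z Hz. destruct (Hc z Hz); auto.
  + eauto.
Qed.

Lemma component_segment (E : C -> Prop) x y z : component E x y ->
  (forall s, 0 <= s <= 1 -> E (y + s * (z - y))%C) -> component E x z.
Proof.
intros [A [HA [AE [Ax Ay]]]] Hs.
exists (fun u => A u \/ exists s, 0 <= s <= 1 /\ u = (y + s * (z - y))%C). repeat split.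
- apply connected_union with y; auto; [apply connected_segment|]. exists 0. split; [lra|ring].
- intros u [Au|[s [H1 ->]]]; auto.
- auto.
- right. exists 1. split; [lra|ring].
Qed.

Lemma component_ball (E : C -> Prop) x z r y1 y2 : (forall y, Cmod (y - z)%C < r -> E y) ->
  Cmod (y1 - z)%C < r -> Cmod (y2 - z)%C < r -> component E x y1 -> component E x y2.
Proof.
intros HE H1 H2 Hc. apply component_segment with y1; auto. intros s Hs. apply HE, ball_segment; auto.
Qed.

Lemma component_mono (E E' : C -> Prop) x z : (forall y, E y -> E' y) -> component E x z -> component E' x z.
Proof. intros H [A [H1 [H2 H3]]]. exists A. auto. Qed.

Lemma component_sub (E : C -> Prop) x z : component E x z -> E z.
Proof. intros [A [_ [H [_ Az]]]]. auto. Qed.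

Lemma component_refl (E : C -> Prop) x : E x -> component E x x.
Proof. exists (fun z => z = x). repeat split; auto; [|intros y ->; auto].
intros U V _ _ _ [y [-> Uy]] [y' [-> Vy]]. exists x; auto.
Qed.

(* The set reachable inside one of the open sets [E' n] is clopen in [E]. *)
Lemma component_exhaust (E : C -> Prop) (E' : R -> C -> Prop) (I : R -> Prop) x z :
  (exists t, I t) -> (forall t, I t -> E' t x) ->
  (forall t t', I t -> I t' -> (forall y, E' t y -> E' t' y) \/ (forall y, E' t' y -> E' t y)) ->
  (forall y, E y -> exists t r, I t /\ 0 < r /\ forall y', Cmod (y' - y)%C < r -> E' t y') ->
  component E x z -> exists t, I t /\ component (E' t) x z.
Proof.
intros [t0 It0] Hx Hmono Hloc [A [HA [AE [Ax Az]]]]. apply NNPP. intro Hno.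
set (U := fun y => exists r, 0 < r /\ forall y', Cmod (y' - y)%C < r -> exists t, I t /\ component (E' t) x y').
set (W := fun y => exists r, 0 < r /\ forall y', Cmod (y' - y)%C < r -> ~ exists t, I t /\ component (E' t) x y').
assert (Op : forall Q : C -> Prop, open (fun y => exists r, 0 < r /\ forall y', Cmod (y' - y)%C < r -> Q y')).
{ intros Q y [r [Hr H]]. apply nbhd_C. exists (r / 2). split; [lra|]. intros y1 Hy1. exists (r / 2). split; [lra|].
  intros y2 Hy2. apply H. pose proof (Cmod_triangle_sub y2 y1 y). lra. }
assert (Cov : forall y, A y -> ((exists t, I t /\ component (E' t) x y) -> U y) /\ (~ (exists t, I t /\ component (E' t) x y) -> W y)).
{ intros y Ay. destruct (Hloc y (AE y Ay)) as [t [r [It [Hr H]]]].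
  assert (Y0 : Cmod (y - y)%C < r) by (replace (y - y)%C with (RtoC 0) by ring; rewrite Cmod_0; lra).
  assert (Tr : forall y1 y2, Cmod (y1 - y)%C < r -> Cmod (y2 - y)%C < r -> (exists t, I t /\ component (E' t) x y1) -> exists t, I t /\ component (E' t) x y2).
  { intros y1 y2 H1 H2 [t' [It' Hc]]. destruct (Hmono t t' It It') as [M|M].
    - exists t'. split; auto. apply component_ball with y r y1; auto.
    - exists t. split; auto. apply component_ball with y r y1; auto. apply component_mono with (E' t'); auto. }
  split; intros Hc; exists r; split; auto; intros y' Hy'.
  - eauto.
  - eauto. }
destruct (HA U W) as [y [Ay [[r1 [Hr1 H1]] [r2 [Hr2 H2]]]]]; try apply Op.
- intros y Ay. destruct (Cov y Ay). destruct (classic (exists t, I t /\ component (E' t) x y)); auto.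
- exists x. split; auto. apply Cov; auto. exists t0. split; auto. apply component_refl; auto.
- exists z. split; auto. apply Cov; auto.
- assert (Y0 : forall r, 0 < r -> Cmod (y - y)%C < r) by (intros r Hr; replace (y - y)%C with (RtoC 0) by ring; rewrite Cmod_0; lra).
  apply (H2 y); auto.
Qed.

Lemma Rbar_cases (x : Rbar) : (exists r, x = Finite r) \/ x = p_infty \/ x = m_infty.
Proof. destruct x; eauto. Qed.

(** * The invariant as a function on the disk *)

Definition Fm (c v0 : R) (z : C) : C := FF c (tan (v0 / 2)) (to_w (z * cis (- v0)))%C.

Lemma tan_half_pos v0 : 0 < v0 < PI -> 0 < tan (v0 / 2).
Proof. intros H. apply tan_gt_0; lra. Qed.

Lemma cis_opp_r v0 : (cis v0 * cis (- v0) = 1)%C.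
Proof. rewrite <- cis_add. replace (v0 + - v0) with 0 by ring. apply cis_0. Qed.

Lemma rot_neq1 v0 z : disk z -> (z * cis (- v0))%C <> 1.
Proof. intros Hz X. apply (f_equal Cmod) in X. rewrite Cmod_mult, Cmod_cis, Cmod_1 in X. unfold disk in Hz. lra. Qed.

Lemma to_w_rot v0 z : disk z -> 0 < Re (to_w (z * cis (- v0))).
Proof. intros Hz. apply to_w_pos. rewrite Cmod_mult, Cmod_cis, Rmult_1_r. auto. Qed.

Lemma hdC_to_h w : 0 <= Re w -> hdC to_h w (2 / ((w + 1) * (w + 1)))%C.
Proof.
intros Hw. pose proof (wp1_neq0 w Hw) as N.
eapply hd_eq; [|apply hd_div; [auto|apply hd_minus; [apply hd_id|apply hd_const]|apply hd_plus; [apply hd_id|apply hd_const]]].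
Cring.
Qed.

Lemma Fm_open c v0 z r : 0 < c -> 0 < v0 < PI -> disk z -> 0 < r -> exists d, 0 < d /\
  forall y, Cmod (y - Fm c v0 z)%C < d -> exists z', disk z' /\ Cmod (z' - z)%C < r /\ Fm c v0 z' = y.
Proof.
intros Hc Hv Hz Hr. pose proof (to_w_rot v0 z Hz) as Hw. set (w0 := to_w (z * cis (- v0))%C) in *.
pose proof (rot_neq1 v0 z Hz) as N0.
destruct (hd_ct _ _ _ _ (hdC_to_h w0 ltac:(lra)) r Hr) as [d1 [Hd1 H1]].
destruct (FF_open c (tan (v0 / 2)) w0 d1 Hc (tan_half_pos v0 Hv) Hw Hd1) as [d [Hd H]].
exists d. split; auto. intros y Hy. destruct (H _ y ltac:(rewrite Rminus_diag, Rabs_R0; exact Hd) Hy) as [w1 [W1 [W2 W3]]].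
pose proof (cis_opp_r v0) as Ei.
exists (to_h w1 * cis v0)%C. split; [|split].
- unfold disk. rewrite Cmod_mult, Cmod_cis, Rmult_1_r. apply to_h_lt1; auto.
- specialize (H1 w1 I W2). replace (to_h w1 * cis v0 - z)%C with ((to_h w1 - to_h w0) * cis v0)%C.
  + rewrite Cmod_mult, Cmod_cis, Rmult_1_r. auto.
  + unfold w0. rewrite to_h_w by auto. transitivity (to_h w1 * cis v0 - z * (cis v0 * cis (- v0)))%C; [ring|]. rewrite Ei. ring.
- unfold Fm. rewrite <- Cmult_assoc, Ei, Cmult_1_r, to_w_h by lra. auto.
Qed.

Lemma ct_Fm c v0 z : 0 < c -> disk z -> ct all_C (Fm c v0) z.
Proof.
intros Hc Hz. pose proof (to_w_rot v0 z Hz) as Hw. eapply hd_ct.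
apply (hdC_comp all_C (FF c (tan (v0 / 2))) (fun z => to_w (z * cis (- v0)))); [apply FF_hd; [auto|lra]|].
apply (hdC_comp all_C to_w (fun z => (z * cis (- v0))%C)); [apply hdC_to_w, rot_neq1; auto|]. apply hd_mult; [apply hd_id|apply hd_const].
Qed.

Lemma atan_bound_TT a J : 0 < a -> (a < 1 -> Rabs J < TT a) -> Rabs (atan (J / a0 a)) < PI * a / 2.
Proof.
intros Ha H. pose proof (atan_bound (J / a0 a)) as B. pose proof (a0_pos a Ha) as A0.
destruct (Rlt_le_dec a 1) as [Hl|Hg].
- specialize (H Hl). unfold TT in H. apply Rabs_lt_between in H.
  assert (E : atan (tan (PI * a / 2)) = PI * a / 2) by (apply atan_tan; nra).
  apply Rabs_lt_between. rewrite <- E. rewrite <- atan_opp. split; apply atan_increasing.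
  + apply Rlt_div_r; lra.
  + apply Rlt_div_l; lra.
- apply Rabs_lt_between. nra.
Qed.

(** The curve, seen through the invariant [Fm]: it is the preimage of a piece of the curve [ell c]. *)
Record Slit (c v0 Te : R) (gamma : R -> C) (J : R -> R) : Prop := {
  sl_c : 0 < c;
  sl_v0 : 0 < v0 < PI;
  sl_T : 0 < Te;
  sl_J0 : J 0 = tipJ c (/ tan (v0 / 2));
  sl_incr : forall s t, 0 <= s < t -> t < Te -> J s < J t;
  sl_onto : forall j, tipJ c (/ tan (v0 / 2)) < j -> (c < 1 -> j < TT c) -> exists t, 0 < t < Te /\ J t = j;
  sl_TT : c < 1 -> forall t, 0 <= t < Te -> J t < TT c;
  sl_disk : forall t, 0 < t < Te -> disk (gamma t);
  sl_cont : forall t eps, 0 < t < Te -> 0 < eps -> exists d, 0 < d /\ forall s, 0 < s < Te -> Rabs (s - t) < d -> Cmod (gamma s - gamma t)%C < eps;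
  sl_inj : forall s t, 0 < s < Te -> 0 < t < Te -> gamma s = gamma t -> s = t;
  sl_start : forall eps, 0 < eps -> exists d, 0 < d /\ forall s, 0 < s < d -> Cmod (gamma s - RtoC 1)%C < eps;
  sl_F : forall t, 0 < t < Te -> Fm c v0 (gamma t) = ell c (J t);
  sl_trace : forall z t, disk z -> 0 < t < Te -> Fm c v0 z = ell c (J t) -> z = gamma t }.

(** * The flow up to the lifetime *)

Section TimeAnalysis.

Context (rho v0 : R) (T : Rbar) (gamma : R -> C) (w v : R -> R) (g : R -> C -> C).
Context (Hyp : SLEhyp rho v0 T gamma w v g) (Hrho : rho < -2) (Hv0 : 0 < v0 < PI).

Let c := - (rho + 2) / 2.
Let dd t := (w t - v t) / 2.
Let u0 := cos (v0 / 2).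
Let uu t := u0 * exp (c / 2 * t).

Lemma c_pos : 0 < c.
Proof. pos. Qed.

Lemma u0_bound : 0 < u0 < 1.
Proof. split; [apply cos_gt_0; lra|].
rewrite <- cos_0. apply cos_decreasing_1; lra.
Qed.

Lemma inT_le t s : inT T t -> 0 <= s <= t -> inT T s.
Proof. intros [H1 H2] Hs. split; [lra|]. apply Rbar_le_lt_trans with t; auto. simpl. lra. Qed.

Lemma inT_open t : inT T t -> exists d, 0 < d /\ forall s, 0 <= s < t + d -> inT T s.
Proof.
intros [H1 H2]. destruct T as [Tr| |]; simpl in H2; try contradiction.
- exists (Tr - t). split; [lra|]. split; simpl; lra.
- exists 1. split; [lra|]. split; simpl; auto; lra.
Qed.

Lemma Rnn_near t : inT T t -> exists d, 0 < d /\ forall y, Rnn y -> Cmod (y - t)%C < d -> inT T (Re y) /\ y = RtoC (Re y) /\ Rabs (Re y - t) <= Cmod (y - t)%C.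
Proof.
intros Ht. destruct (inT_open t Ht) as [d [Hd H]]. exists d. split; auto.
intros y [Hy1 Hy2] Hy. assert (B : Rabs (Re y - t) <= Cmod (y - t)%C) by apply (re_le_Cmod (y - t)%C).
split; [|split; auto].
- apply H. assert (Rabs (Re y - t) < d) by lra. apply Rabs_lt_between in H0. lra.
- apply C_eq; simpl; auto.
Qed.

Lemma hd_v t : inT T t -> hd Rnn (fun y => RtoC (v (Re y))) t (RtoC (- cot (dd t))).
Proof.
intros Ht. destruct (Rnn_near t Ht) as [d0 [Hd0 H0]].
apply hd_lift.
- intros y Hy; apply Hy.
- intros eps He. destruct (hyp_v _ _ _ _ _ _ _ Hyp t Ht eps He) as [d [Hd Hy]].
  exists (Rmin d d0). split; [pos|]. intros y Sy Hyt.
  assert (Y1 := Rlt_le_trans _ _ _ Hyt (Rmin_l _ _)). assert (Y2 := Rlt_le_trans _ _ _ Hyt (Rmin_r _ _)).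
  destruct (H0 y Sy Y2) as [A [B D]]. apply Hy; auto. lra.
- apply hd_ext with (fun y => g (Re y) (cis v0)).
  + exists d0. split; auto. intros y Sy Hyt. destruct (H0 y Sy Hyt) as [A _]. symmetry. apply (hyp_gv _ _ _ _ _ _ _ Hyp); auto.
  + symmetry. apply (hyp_gv _ _ _ _ _ _ _ Hyp); auto.
  + eapply hd_eq; [|apply (hyp_ode _ _ _ _ _ _ _ Hyp t (cis v0) Ht); right; auto].
    rewrite <- (hyp_gv _ _ _ _ _ _ _ Hyp) by auto. rewrite cis_ratio. fold (dd t). Cring.
Qed.

Lemma hd_dd t : inT T t -> hd Rnn (fun y => RtoC (dd (Re y))) t (RtoC (- (c / 2) * cot (dd t))).
Proof.
intros Ht. eapply hd_eq; [|apply hd_ext_all with (fun y => RtoC (1/2) * (RtoC (w (Re y)) - RtoC (v (Re y))))%C;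
  [|apply hd_scal, hd_minus; [apply (hyp_w _ _ _ _ _ _ _ Hyp); auto|apply hd_v; auto]]].
- fold (dd t). rewrite <- RtoC_minus, <- RtoC_mult. f_equal. unfold c. field.
- intro y. rewrite <- RtoC_minus, <- RtoC_mult. f_equal. unfold dd. field.
Qed.

Lemma hd_real_comp S (f : R -> R) (k : R -> R) t l l' : (forall y, S y -> Im y = 0) ->
  is_derive f (k t) l -> hd S (fun y => RtoC (k (Re y))) (RtoC t) (RtoC l') ->
  hd S (fun y => RtoC (f (k (Re y)))) (RtoC t) (RtoC (l * l')).
Proof.
intros HS Df Dk. rewrite RtoC_mult.
apply (hd_comp S RL (fun y => RtoC (f (Re y))) (fun y => RtoC (k (Re y))) t); auto.
- apply hd_real. exact Df.
- intros; reflexivity.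
Qed.

Lemma hd_cos t : inT T t -> sin (dd t) <> 0 ->
  hd Rnn (fun y => RtoC (cos (dd (Re y)))) t (RtoC (c / 2 * cos (dd t))).
Proof.
intros Ht Hs. replace (c / 2 * cos (dd t)) with (- sin (dd t) * (- (c / 2) * cot (dd t))) by (unfold cot; field; auto).
apply hd_real_comp with (k := dd).
- intros y Hy; apply Hy.
- auto_derive; auto. ring.
- apply hd_dd; auto.
Qed.

Lemma hd_cos0 t : inT T t -> sin (dd t) = 0 -> hd Rnn (fun y => RtoC (cos (dd (Re y)))) t 0.
Proof.
intros Ht Hs. replace 0 with (- sin (dd t) * (- (c / 2) * cot (dd t))) by nra.
apply hd_real_comp with (k := dd).
- intros y Hy; apply Hy.
- auto_derive; auto. ring.
- apply hd_dd; auto.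
Qed.

Lemma hd_uu S t : (forall y, S y -> Im y = 0) -> hd S (fun y => RtoC (uu (Re y))) (RtoC t) (RtoC (c / 2 * uu t)).
Proof.
intros HS. apply hd_subset with RL; auto. apply (hd_real uu). unfold uu. auto_derive; auto. ring.
Qed.

Lemma seg_Rnn a b : 0 <= a -> forall y, seg a b y -> Rnn y.
Proof. intros Ha y [H1 H2]. split; auto. lra. Qed.

Lemma dd_0 : dd 0 = - (v0 / 2).
Proof. unfold dd. rewrite (hyp_w0 _ _ _ _ _ _ _ Hyp), (hyp_v0 _ _ _ _ _ _ _ Hyp). field. Qed.

Lemma cos_dd_before t : inT T t -> (forall s, 0 <= s < t -> sin (dd s) <> 0) -> cos (dd t) = uu t.
Proof.
intros Ht Hne. pose proof Ht as [Ht0 _].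
set (k := fun y => (RtoC (cos (dd (Re y))) * RtoC (exp (- (c / 2) * Re y)))%C).
assert (De : forall S s, (forall y, S y -> Im y = 0) -> hd S (fun y => RtoC (exp (- (c / 2) * Re y))) (RtoC s) (RtoC (- (c / 2) * exp (- (c / 2) * s)))).
{ intros S s HS. apply hd_subset with RL; auto. apply (hd_real (fun s => exp (- (c / 2) * s))). auto_derive; auto. ring. }
assert (E : k t = k 0).
{ apply curve_const; auto.
  - intros s Hs. assert (Hs' : inT T s) by (apply (inT_le t); auto).
    apply ct_mult.
    + apply ct_subset with Rnn; [apply seg_Rnn; lra|]. destruct (Req_dec (sin (dd s)) 0); [eapply hd_ct, hd_cos0|eapply hd_ct, hd_cos]; auto.
    + eapply hd_ct, De. intros y Hy; apply Hy.
  - intros s Hs. assert (Hs' : inT T s) by (apply (inT_le t); auto; lra).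
    eapply hd_eq; [|apply hd_mult; [apply hd_subset with Rnn; [apply seg_Rnn; lra|apply hd_cos; auto; apply Hne; lra]|apply De; intros y Hy; apply Hy]].
    Cring. }
unfold k in E. apply (f_equal Re) in E. rewrite <- !RtoC_mult in E. simpl in E.
rewrite dd_0, cos_neg in E. replace (- (c / 2) * 0) with 0 in E by ring. rewrite exp_0 in E.
unfold uu, u0. replace (c / 2 * t) with (- (- (c / 2) * t)) by ring. rewrite exp_Ropp.
pose proof (exp_pos (- (c / 2) * t)). rewrite <- (Rmult_1_r (cos (v0 / 2))), <- E. field. lra.
Qed.

(** The equations hold on all of [[0, T)] with [cot] equal to [0] at a zero of [sin], so a collision
    must be ruled out. At the first zero [cos dd] agrees with [uu] on the left, hence has a nonzero
    left derivative, while the chain rule gives derivative [0]. *)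
Lemma sin_dd_neq0 t : inT T t -> sin (dd t) <> 0.
Proof.
intros Ht Hz. pose proof Ht as [Ht0 _]. pose proof u0_bound as U0.
destruct (first_zero (fun t => sin (dd t)) t Ht0) as [t1 [Ht1 [Hz1 Hne]]]; auto.
- intros x Hx eps He. assert (Hx' : inT T x) by (apply (inT_le t); auto).
  assert (D : hd Rnn (fun y => RtoC (sin (dd (Re y)))) x (RtoC (cos (dd x) * (- (c / 2) * cot (dd x))))).
  { apply hd_real_comp with (k := dd); [intros y Hy; apply Hy|auto_derive; auto; ring|apply hd_dd; auto]. }
  destruct (hd_ct _ _ _ _ D eps He) as [d [Hd Hy]]. exists d. split; auto. intros y Hy1 Hy2.
  specialize (Hy y). rewrite <- RtoC_minus, Cmod_R in Hy. rewrite <- RtoC_minus, Cmod_R in Hy.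
  apply Hy; auto. split; simpl; lra.
- rewrite dd_0, sin_neg. assert (0 < sin (v0 / 2)) by (apply sin_gt_0; lra). lra.
- assert (Ht1' : inT T t1) by (apply (inT_le t); auto; lra).
  assert (E1 : cos (dd t1) = uu t1) by (apply cos_dd_before; auto).
  assert (Dn : RtoC (c / 2 * uu t1) <> 0).
  { intro X. apply (f_equal Re) in X. simpl in X. assert (0 < c / 2 * uu t1) by pos. lra. }
  destruct (hd_expands _ _ _ _ (hd_uu Rnn t1 (fun y Hy => proj1 Hy)) Dn) as [d1 [Hd1 H1]].
  set (A := Cmod (RtoC (c / 2 * uu t1))) in *. assert (HA : 0 < A) by (apply Cmod_pos; auto).
  destruct (hd_cos0 t1 Ht1' Hz1 (A / 4) ltac:(lra)) as [d2 [Hd2 H2]].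
  set (s := t1 - Rmin (Rmin d1 d2) t1 / 2).
  assert (Hm : 0 < Rmin (Rmin d1 d2) t1) by pos.
  assert (M1 : Rmin (Rmin d1 d2) t1 <= d1) by rmin.
  assert (M2 : Rmin (Rmin d1 d2) t1 <= d2) by rmin.
  assert (M3 : Rmin (Rmin d1 d2) t1 <= t1) by rmin.
  assert (Rs : Rnn s) by (split; unfold s; simpl; lra).
  assert (Ed : Cmod (s - t1)%C = t1 - s) by (rewrite <- RtoC_minus, Cmod_R, Rabs_left; unfold s; lra).
  specialize (H1 s Rs). specialize (H2 s Rs). rewrite Ed in H1, H2.
  specialize (H1 ltac:(unfold s; lra)). specialize (H2 ltac:(unfold s; lra)).
  simpl (Re _) in H1, H2.
  rewrite (cos_dd_before s), E1 in H2.
  + replace (RtoC (uu s) - RtoC (uu t1) - 0 * (s - t1))%C with (RtoC (uu s) - RtoC (uu t1))%C in H2 by ring.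
    assert (t1 - s > 0) by (unfold s; lra). nra.
  + apply (inT_le t1); auto. unfold s; lra.
  + intros x Hx. apply Hne. unfold s in Hx; lra.
Qed.

Lemma cos_dd t : inT T t -> cos (dd t) = uu t.
Proof.
intros Ht. apply cos_dd_before; auto. intros s Hs. apply sin_dd_neq0. apply (inT_le t); auto; lra.
Qed.

Lemma uu_lt1 t : inT T t -> 0 < uu t < 1.
Proof.
intros Ht. pose proof u0_bound as U0. split; [pos|].
pose proof (sin_dd_neq0 t Ht) as S. rewrite <- (cos_dd t Ht). pose proof (sin2_cos2 (dd t)) as E. unfold Rsqr in E. nra.
Qed.

(** The sign is that of the initial value [- sin (v0 / 2)], preserved because [sin dd] never
    vanishes. *)
Lemma sin_dd t : inT T t -> sin (dd t) = - sqrt (1 - uu t ^ 2).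
Proof.
intros Ht. pose proof Ht as [Ht0 _].
assert (Hneg : sin (dd t) < 0).
{ apply Rnot_le_lt. intro Hge.
  assert (H0 : sin (dd 0) < 0). { rewrite dd_0, sin_neg. assert (0 < sin (v0 / 2)) by (apply sin_gt_0; lra). lra. }
  set (cl := fun x => clamp 0 t x).
  destruct (IVT_gen (fun x => sin (dd (cl x))) 0 t 0) as [x [_ Hx]].
  - intros x eps He. assert (Hx' : inT T (cl x)) by (apply (inT_le t); auto; apply clamp_bound; auto).
    assert (D : hd Rnn (fun y => RtoC (sin (dd (Re y)))) (RtoC (cl x)) (RtoC (cos (dd (cl x)) * (- (c / 2) * cot (dd (cl x)))))).
    { apply hd_real_comp with (k := dd); [intros y Hy; apply Hy|auto_derive; auto; ring|apply hd_dd; auto]. }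
    destruct (hd_ct _ _ _ _ D eps He) as [d [Hd Hy]]. exists d. split; auto. intros y [_ Hy2].
    specialize (Hy (RtoC (cl y))). rewrite <- !RtoC_minus, !Cmod_R in Hy.
    apply Hy. { split; simpl; auto. apply clamp_bound; auto. }
    eapply Rle_lt_trans; [apply clamp_lip|auto].
  - unfold cl. rewrite !clamp_id by lra. split.
    + rmin.
    + eapply Rle_trans; [|apply Rmax_r]. lra.
  - apply (sin_dd_neq0 (cl x)); auto. apply (inT_le t); auto. apply clamp_bound; auto. }
rewrite <- (cos_dd t Ht). pose proof (sin2_cos2 (dd t)) as E. unfold Rsqr in E.
replace (1 - cos (dd t) ^ 2) with ((- sin (dd t)) * (- sin (dd t))) by lra. rewrite sqrt_square by lra. ring.
Qed.

Definition Tend : R := 2 / c * ln (/ u0).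

Lemma Tend_pos : 0 < Tend.
Proof.
pose proof u0_bound. apply Rmult_lt_0_compat; [pos|].
rewrite <- ln_1. apply ln_increasing; [lra|]. rewrite <- Rinv_1. apply Rinv_lt_contravar; lra.
Qed.

Lemma uu_Tend : uu Tend = 1.
Proof.
pose proof u0_bound. pose proof c_pos. unfold uu, Tend. replace (c / 2 * (2 / c * ln (/ u0))) with (ln (/ u0)) by (field; lra).
rewrite exp_ln by pos. apply Rinv_r. lra.
Qed.

Lemma uu_incr s t : s < t -> uu s < uu t.
Proof.
pose proof u0_bound. pose proof c_pos. intros Hst. apply Rmult_lt_compat_l; [lra|]. apply exp_increasing. nra.
Qed.

Lemma inT_lt_Tend t : inT T t -> t < Tend.
Proof.
intros Ht. apply Rnot_le_lt. intros [Hle|Heq].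
- apply uu_incr in Hle. rewrite uu_Tend in Hle. pose proof (uu_lt1 t Ht). lra.
- subst t. pose proof (uu_lt1 Tend Ht). rewrite uu_Tend in H. lra.
Qed.

Lemma hit_dist t : inT T t -> Cmod (cis (w t) - cis (v t))%C = 2 * sqrt (1 - uu t ^ 2).
Proof.
intros Ht. rewrite Cmod_cis_diff. fold (dd t). rewrite sin_dd by auto. rewrite Rabs_Ropp, Rabs_right; auto.
apply Rle_ge, sqrt_pos.
Qed.

(** If [T < Tend], the two points stay at positive distance, so small hitting times are infima of
    the empty set, that is [+oo], which forces [T = +oo]. On the other hand [uu < 1] on [[0, T)], so
    [Tend] cannot belong to it. *)
Lemma T_eq : T = Finite Tend.
Proof.
assert (Hb : forall e0, 0 < e0 -> (forall t, inT T t -> e0 <= Cmod (cis (w t) - cis (v t))%C) -> T = p_infty).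
{ intros e0 He0 Hl. destruct (hyp_hit _ _ _ _ _ _ _ Hyp) as [_ H2].
  assert (G : forall b, Rbar_lt T b -> False).
  { intros b Hb. specialize (H2 b Hb). destruct H2 as [d Hd].
    set (e := Rmin (d / 2) (e0 / 2)). pose proof (cond_pos d).
    assert (He : 0 < e) by pos. assert (E1 : e <= d / 2) by apply Rmin_l. assert (E2 : e <= e0 / 2) by apply Rmin_r.
    assert (B : Rbar_lt (hitting_time T w v e) b).
    { apply Hd; auto. change (Rabs (e - 0) < d). rewrite Rabs_right; lra. }
    assert (X : hitting_time T w v e = p_infty).
    { apply is_glb_Rbar_unique. split.
      - intros x [Hx1 [Hx2 Hx3]]. specialize (Hl x (conj Hx1 Hx2)). lra.
      - intros b' _. destruct b'; simpl; auto. }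
    rewrite X in B. auto. }
  destruct T as [r| |]; auto; exfalso.
  - apply (G (r + 1)). simpl. lra.
  - apply (G 0). simpl. auto. }
pose proof Tend_pos as TP.
assert (Hinf : T <> p_infty).
{ intro E. assert (Ht : inT T Tend) by (split; [lra|rewrite E; exact I]). apply inT_lt_Tend in Ht. lra. }
destruct (Rbar_lt_dec T Tend) as [Hlt|Hge].
- exfalso. apply Hinf.
  destruct (Rbar_cases T) as [[r ET]|[ET|ET]].
  + rewrite ET in Hlt. apply (Hb (2 * sqrt (1 - uu r ^ 2))).
    * assert (0 < uu r < 1). { split; [unfold uu; apply Rmult_lt_0_compat; [apply u0_bound|pos]|]. rewrite <- uu_Tend. apply uu_incr; auto. }
      apply Rmult_lt_0_compat; [lra|]. apply sqrt_lt_R0. nra.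
    * intros t Ht. rewrite hit_dist by auto. apply Rmult_le_compat_l; [lra|]. apply sqrt_le_1_alt.
      pose proof (uu_lt1 t Ht). pose proof Ht as [_ Hlt2]. rewrite ET in Hlt2.
      assert (uu t < uu r) by (apply uu_incr; auto). nra.
  + auto.
  + apply (Hb 1); [lra|]. intros t [_ Ht]. rewrite ET in Ht. contradiction.
- destruct (Rbar_cases T) as [[r ET]|[ET|ET]].
  + rewrite ET in Hge. simpl in Hge. destruct (Req_dec r Tend) as [Hr|Hn]; [rewrite ET, Hr; auto|].
    assert (Ht : inT T Tend) by (split; [lra|rewrite ET; simpl; lra]). apply inT_lt_Tend in Ht. lra.
  + contradiction.
  + exfalso. apply Hge. rewrite ET. exact I.
Qed.

Lemma inT_iff t : inT T t <-> 0 <= t < Tend.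
Proof. unfold inT. rewrite T_eq. tauto. Qed.

(** * The flow in the half-plane coordinate *)

Let eta t := sqrt (1 - uu t ^ 2) / uu t.

Lemma sq_pos t : t < Tend -> 0 < uu t < 1 /\ 0 < sqrt (1 - uu t ^ 2) /\ sqrt (1 - uu t ^ 2) ^ 2 = 1 - uu t ^ 2.
Proof.
intros Ht. assert (U : 0 < uu t < 1).
{ split; [unfold uu; apply Rmult_lt_0_compat; [apply u0_bound|pos]|]. rewrite <- uu_Tend. apply uu_incr; auto. }
assert (0 < 1 - uu t ^ 2) by nra. split; auto. split; [apply sqrt_lt_R0; auto|]. apply pow2_sqrt. lra.
Qed.

Lemma eta_pos t : t < Tend -> 0 < eta t.
Proof. intros Ht. destruct (sq_pos t Ht) as [U [S _]]. pos. Qed.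

Lemma eta_derive t : t < Tend -> is_derive eta t (- (c / 2) * (eta t ^ 2 + 1) / eta t).
Proof.
intros Ht. destruct (sq_pos t Ht) as [U [S E]].
assert (Du : is_derive uu t (c / 2 * uu t)) by (unfold uu; auto_derive; auto; ring).
assert (Dn : is_derive (fun u => sqrt (1 - u ^ 2) / u) (uu t) (- (1 / (sqrt (1 - uu t ^ 2) * uu t ^ 2)))).
{ auto_derive; [nra|]. replace (1 + - (uu t * (uu t * 1))) with (1 - uu t ^ 2) by ring.
  set (s := sqrt (1 - uu t ^ 2)) in *. apply (Rmult_eq_reg_r (s * uu t ^ 2)); [|apply Rgt_not_eq, Rmult_lt_0_compat; [auto|nra]].
  transitivity (- uu t ^ 2 - s ^ 2); [field; lra|]. rewrite E. field. lra. }
evar_last; [apply (is_derive_comp (fun u => sqrt (1 - u ^ 2) / u) uu); [exact Dn|exact Du]|].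
unfold scal; simpl; unfold mult; simpl. unfold eta. replace (uu t * (uu t * 1)) with (uu t ^ 2) by ring.
set (s := sqrt (1 - uu t ^ 2)) in *.
replace (- (c / 2) * (s / uu t * (s / uu t * 1) + 1) / (s / uu t)) with (- (c / 2) * (s ^ 2 + uu t ^ 2) / (s * uu t)) by (field; lra).
rewrite E. field. lra.
Qed.

Lemma cot_dd t : inT T t -> cot (dd t) = - (/ eta t).
Proof.
intros Ht. destruct (sq_pos t (inT_lt_Tend t Ht)) as [U [S E]]. unfold cot, eta. rewrite cos_dd, sin_dd by auto. field. lra.
Qed.

Lemma cis_dd t : inT T t -> cis (w t - v t) = ((1 - Ci * RtoC (eta t)) / (1 + Ci * RtoC (eta t)))%C.
Proof.
intros Ht. destruct (sq_pos t (inT_lt_Tend t Ht)) as [U [S E]].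
replace (w t - v t) with (dd t + dd t) by (unfold dd; field). rewrite cis_add.
assert (Ec : cis (dd t) = (RtoC (uu t) * (1 - Ci * RtoC (eta t)))%C).
{ unfold cis. rewrite cos_dd, sin_dd by auto. unfold eta. apply C_eq; simpl; field; lra. }
rewrite Ec.
assert (N : (1 + Ci * RtoC (eta t))%C <> 0) by (intro X; apply (f_equal Re) in X; simpl in X; lra).
assert (X : ((1 - Ci * RtoC (eta t)) * (1 + Ci * RtoC (eta t)) * RtoC (uu t) * RtoC (uu t) = 1)%C).
{ apply C_eq; simpl; unfold eta; [|ring].
  transitivity (sqrt (1 - uu t ^ 2) ^ 2 + uu t ^ 2); [field; lra|]. lra. }
transitivity (((1 - Ci * RtoC (eta t)) * ((1 - Ci * RtoC (eta t)) * (1 + Ci * RtoC (eta t)) * RtoC (uu t) * RtoC (uu t)) / (1 + Ci * RtoC (eta t))))%C.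
- field; auto.
- rewrite X. Cring.
Qed.

Lemma hd_eta t : inT T t -> hd Rnn (fun y => RtoC (eta (Re y))) t (RtoC (- (c / 2) * (eta t ^ 2 + 1) / eta t)).
Proof.
intros Ht. apply hd_subset with RL; [intros y Hy; apply Hy|]. apply (hd_real eta). apply eta_derive, inT_lt_Tend; auto.
Qed.

Lemma hull_mono s t z : s <= t -> hull_c gamma t z -> hull_c gamma s z.
Proof. intros Hst. apply component_mono. intros y [H1 H2]. split; auto. intros [r [Hr E]]. apply H2. exists r. split; auto. lra. Qed.

Let hh z t := (g t z * cis (- v t))%C.

(** The flow seen from the force point: the rotation by [cis (- v t)] fixes that point at [1] and
    leaves an equation whose only time-dependent coefficient is [eta]. *)
Lemma hd_hh t z : inT T t -> hull_c gamma t z ->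
  hd Rnn (fun y => hh z (Re y)) t
    (hh z t * (RtoC (eta t ^ 2 + 1) * (1 - hh z t) / (RtoC (eta t) * den (eta t) (hh z t))))%C.
Proof.
intros Ht Hz. pose proof (eta_pos t (inT_lt_Tend t Ht)) as Pe.
assert (Hg : Cmod (hh z t) < 1).
{ unfold hh. rewrite Cmod_mult, Cmod_cis, Rmult_1_r. apply (hyp_in _ _ _ _ _ _ _ Hyp); auto. }
pose proof (den_neq0 (eta t) (hh z t) Hg) as Dn.
assert (Dv : hd Rnn (fun y => cis (- v (Re y))) t (Ci * cis (- v t) * RtoC (cot (dd t)))%C).
{ apply (hd_comp Rnn RL (fun y => cis (Re y)) (fun y => RtoC (- v (Re y))) t).
  - apply hd_cis. auto.
  - eapply hd_eq; [|apply hd_ext_all with (fun y => (- RtoC (v (Re y)))%C); [intro y; rewrite RtoC_opp; auto|apply hd_opp, hd_v; auto]].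
    Cring.
  - reflexivity. }
eapply hd_eq; [|apply (hd_mult Rnn (fun y => g (Re y) z) (fun y => cis (- v (Re y)))); [apply (hyp_ode _ _ _ _ _ _ _ Hyp t z Ht); left; auto|exact Dv]].
replace (Re t) with t by auto. rewrite cot_dd by auto.
assert (Ew : cis (w t) = (cis (w t - v t) * cis (v t))%C) by (rewrite <- cis_add; f_equal; ring).
assert (Egz : g t z = (hh z t * cis (v t))%C).
{ unfold hh. rewrite <- Cmult_assoc, <- cis_add. replace (- v t + v t) with 0 by ring. rewrite cis_0. ring. }
assert (Vn : cis (v t) <> 0) by (apply Cmod_pos_neq; rewrite Cmod_cis; lra).
rewrite Ew, cis_dd by auto.
assert (Ev : cis (- v t) = (/ cis (v t))%C).
{ apply Cmult_reg_r with (cis (v t)); auto. rewrite <- cis_add, Cinv_l by auto. replace (- v t + v t) with 0 by ring. apply cis_0. }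
rewrite Egz, Ev. set (h := hh z t) in *. rewrite RtoC_opp, RtoC_inv by lra. rewrite RtoC_plus, RtoC_pow.
set (e := RtoC (eta t)) in *. assert (En : e <> 0) by (intro X; apply RtoC_inj in X; lra).
assert (Nn : (1 + Ci * e)%C <> 0) by (unfold e; intro X; apply (f_equal Re) in X; simpl in X; lra).
assert (Dd : ((1 - Ci * e) - (1 + Ci * e) * h = - Ci * den (eta t) h)%C) by Cring.
assert (In : Ci <> 0) by (intro X; apply (f_equal Im) in X; simpl in X; lra).
assert (In' : (- Ci)%C <> 0) by (intro X; apply (f_equal Im) in X; simpl in X; lra).
assert (Fr : (((1 - Ci * e) / (1 + Ci * e) * cis (v t) + h * cis (v t)) / ((1 - Ci * e) / (1 + Ci * e) * cis (v t) - h * cis (v t))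
   = ((1 - Ci * e) + (1 + Ci * e) * h) / (- Ci * den (eta t) h))%C).
{ rewrite <- Dd. field. repeat split; auto.
  - rewrite Dd. apply Cmult_neq_0; auto.
  - replace ((1 - Ci * e) * cis (v t) - h * cis (v t) * (1 + Ci * e))%C with (((1 - Ci * e) - (1 + Ci * e) * h) * cis (v t))%C by ring.
    rewrite Dd. repeat apply Cmult_neq_0; auto. }
rewrite Fr.
transitivity (h * (((1 - Ci * e) + (1 + Ci * e) * h) / (- Ci * den (eta t) h) - Ci / e))%C; [field; repeat split; auto|].
f_equal. apply Cmult_reg_r with (- Ci * e * den (eta t) h)%C.
{ repeat apply Cmult_neq_0; auto. }
transitivity (e * ((1 - Ci * e) + (1 + Ci * e) * h) + Ci * Ci * den (eta t) h)%C.
{ field. auto. }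
transitivity (- Ci * (e ^ 2 + 1) * (1 - h))%C; [|field; repeat split; auto].
Cring.
Qed.

Let Fz := Fm c v0.

Lemma eta_0 : eta 0 = tan (v0 / 2).
Proof. unfold eta, uu. rewrite Rmult_0_r, exp_0, Rmult_1_r. unfold u0, tan. f_equal.
rewrite <- (sqrt_Rsqr (sin (v0 / 2))); [|apply sin_ge_0; lra]. f_equal. rewrite sin2. unfold Rsqr. ring.
Qed.

Lemma hh_lt1 z t : inT T t -> hull_c gamma t z -> Cmod (hh z t) < 1.
Proof. unfold hh. rewrite Cmod_mult, Cmod_cis, Rmult_1_r. apply (hyp_in _ _ _ _ _ _ _ Hyp); auto. Qed.

Lemma flow_conserved t z : inT T t -> hull_c gamma t z -> FF c (eta t) (to_w (hh z t)) = Fz z.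
Proof.
intros Ht Hz. pose proof Ht as [Ht0 _]. pose proof c_pos as Pc.
assert (D : forall s, 0 <= s <= t -> hd Rnn (fun y => FF c (eta (Re y)) (to_w (hh z (Re y)))) s 0).
{ intros s Hs. assert (Hs' : inT T s) by (apply (inT_le t); auto). assert (Hz' : hull_c gamma s z) by (apply hull_mono with t; auto; lra).
  pose proof (hh_lt1 z s Hs' Hz') as Hh. pose proof (eta_pos s (inT_lt_Tend s Hs')) as Pe.
  assert (H1 : hh z s <> 1) by (intro X; rewrite X, Cmod_1 in Hh; lra).
  pose proof (den_neq0 (eta s) (hh z s) Hh) as Dn. pose proof (one_minus_neq0 _ Hh) as N1.
  eapply FF_conserved with (w := fun y => to_w (hh z (Re y))) (eta := fun y => RtoC (eta (Re y))); auto.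
  - left. apply to_w_pos. auto.
  - eauto.
  - apply (hdC_comp Rnn to_w (fun y => hh z (Re y)) s); [apply hdC_to_w; auto|apply hd_hh; auto].
  - apply hd_eta; auto.
  - replace (Re s) with s by auto. set (h := hh z s) in *.
    replace (- (c / 2) * (eta s ^ 2 + 1) / eta s) with (- (c / 2) * (eta s ^ 2 + 1) * / eta s) by lra.
    rewrite !RtoC_mult, RtoC_opp, RtoC_inv by lra. unfold Rdiv. rewrite RtoC_mult, RtoC_inv by lra. set (e := RtoC (eta s)) in *.
    (* In the half-plane coordinate [den] is the factor [eta w + i] of [FF_conserved]. *)
    assert (W1 : (e * to_w h + Ci = den (eta s) h / (1 - h))%C) by (unfold den, to_w; fold e; field; auto).
    rewrite W1. unfold to_w. field. repeat split; auto; intro X; apply (f_equal Re) in X; simpl in X; lra. }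
assert (E : FF c (eta t) (to_w (hh z t)) = FF c (eta 0) (to_w (hh z 0))).
{ apply (curve_const (fun y => FF c (eta (Re y)) (to_w (hh z (Re y)))) 0 t Ht0).
  - intros s Hs. apply ct_subset with Rnn; [apply seg_Rnn; lra|]. eapply hd_ct, D; auto.
  - intros s Hs. apply hd_subset with Rnn; [apply seg_Rnn; lra|]. apply D; lra. }
rewrite E. unfold Fz, Fm, hh. rewrite eta_0, (hyp_v0 _ _ _ _ _ _ _ Hyp), (hyp_g0 _ _ _ _ _ _ _ Hyp); auto.
apply component_sub in Hz. apply Hz.
Qed.

Let Jt t := tipJ c (/ eta t).

(** A point still in the domain has the value of [FF c (eta t)] at an interior point, hence a value
    off the part of [ell] taken by the axis at time [t]. *)
Lemma flow_avoid t z J : inT T t -> hull_c gamma t z -> J <= Jt t -> Fz z <> ell c J.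
Proof.
intros Ht Hz HJ. rewrite <- (flow_conserved t z Ht Hz). apply FF_avoid_ell; auto.
- pos.
- apply eta_pos, inT_lt_Tend; auto.
- apply to_w_pos, hh_lt1; auto.
Qed.

Lemma eta_decr s t : s < t -> t < Tend -> eta t < eta s.
Proof.
intros Hs Ht. assert (- eta s < - eta t); [|lra].
apply (incr_of_derive (fun x => - eta x) (fun x => - (- (c / 2) * (eta x ^ 2 + 1) / eta x))); [lra|..].
- intros x Hx. apply (is_derive_opp (V := R_NormedModule) eta). apply eta_derive. lra.
- intros x Hx. pose proof (eta_pos x ltac:(lra)) as Pe. pose proof c_pos.
  replace (- (- (c / 2) * (eta x ^ 2 + 1) / eta x)) with (c / 2 * (eta x ^ 2 + 1) / eta x) by lra.
  apply Rdiv_lt_0_compat; nra.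
Qed.

(* A cluster point of the trajectory is either interior, and then the two points with the same value
   of the invariant coincide, or on the boundary, where only the tip has not been excluded. *)
Lemma swallow z tau : inT T tau -> 0 < tau -> (forall s, 0 <= s < tau -> hull_c gamma s z) -> ~ hull_c gamma tau z ->
  Fz z = ell c (Jt tau).
Proof.
intros Htau Htau0 Hb Hn. apply NNPP. intro Hne. pose proof c_pos as Pc. pose proof (inT_lt_Tend tau Htau) as HT.
set (e := eta tau). assert (Pe : 0 < e) by (apply eta_pos; exact HT).
assert (Dz : disk z) by (specialize (Hb 0 ltac:(lra)); apply component_sub in Hb; apply Hb).
assert (Near : forall eps, 0 < eps -> exists d, 0 < d /\ forall s, 0 <= s -> Rabs (s - tau) < d -> Rabs (eta s - e) < eps).
{ intros eps He. destruct (hd_ct _ _ _ _ (hd_eta tau Htau) eps He) as [d [Hd H]]. exists d. split; auto. intros s Hs0 Hs.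
  specialize (H s). rewrite <- !RtoC_minus, !Cmod_R in H. apply H; auto. split; simpl; auto. }
set (sn := fun n : nat => tau - tau / (INR n + 1)).
assert (Hsn : forall n, 0 <= sn n < tau).
{ intro n. pose proof (pos_INR n). assert (0 < tau / (INR n + 1)) by pos.
  assert (tau / (INR n + 1) <= tau) by (apply Rle_div_l; [lra|nra]). unfold sn. lra. }
assert (Hlim : forall d, 0 < d -> exists N, forall n, (N <= n)%nat -> Rabs (sn n - tau) < d).
{ intros d Hd. destruct (INR_unbounded (tau / d)) as [N HN]. exists N. intros n Hle. apply le_INR in Hle. pose proof (pos_INR n).
  unfold sn. replace (tau - tau / (INR n + 1) - tau) with (- (tau / (INR n + 1))) by ring. rewrite Rabs_Ropp, Rabs_right.
  - apply Rlt_div_l; [lra|]. apply Rlt_div_l in HN; auto. nra.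
  - apply Rle_ge, Rdiv_le_0_compat; lra. }
set (wn := fun n => to_w (hh z (sn n))).
assert (Hw : forall n, 0 < Re (wn n) /\ FF c (eta (sn n)) (wn n) = Fz z).
{ intro n. assert (I : inT T (sn n)) by (apply (inT_le tau); auto; specialize (Hsn n); lra).
  split; [apply to_w_pos, hh_lt1; auto|apply flow_conserved; auto]. }
destruct (FF_inf_unif c e (Cmod (Fz z)) Pc Pe) as [M [HM HMw]].
destruct (C_BW wn M) as [w0 Hcl].
{ intro n. destruct (Hw n) as [W1 W2]. apply Rnot_lt_le. intro Hlt.
  specialize (HMw (eta (sn n)) (wn n) ltac:(left; apply eta_decr; [apply Hsn|lra]) ltac:(lra) ltac:(lra)). rewrite W2 in HMw. lra. }
assert (R0 : 0 <= Re w0).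
{ apply (Re_limit_nonneg wn); [intro n; left; apply Hw|]. intros eps He. destruct (Hcl eps O He) as [n [_ H]]. exists n. exact H. }
assert (E0 : FF c e w0 = Fz z).
{ apply C_eq_small. intros eps He. destruct (FF_joint c e w0 Pc R0 eps He) as [d [Hd H]].
  destruct (Near d Hd) as [d1 [Hd1 H1]]. destruct (Hlim d1 Hd1) as [N HN]. destruct (Hcl d N Hd) as [n [Hn1 Hn2]].
  specialize (H (eta (sn n)) (wn n) (H1 _ (proj1 (Hsn n)) (HN n Hn1)) Hn2). destruct (Hw n) as [_ W2].
  rewrite W2, Cmod_sub_sym in H. lra. }
destruct R0 as [R0|R0].
(* Surjectivity of [g tau] gives a point [z'] of the domain at time [tau] with the same value as
   [z]; injectivity of the invariant identifies it with [z], which is not in that domain. *)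
- destruct (hyp_surj _ _ _ _ _ _ _ Hyp tau (to_h w0 * cis (v tau))%C Htau) as [z' [Hz' Eg]].
  { unfold disk. rewrite Cmod_mult, Cmod_cis, Rmult_1_r. apply to_h_lt1; auto. }
  assert (Eh : hh z' tau = to_h w0).
  { unfold hh. rewrite Eg, <- Cmult_assoc, <- cis_add. replace (v tau + - v tau) with 0 by ring. rewrite cis_0. ring. }
  pose proof (flow_conserved tau z' Htau Hz') as E1. rewrite Eh, to_w_h in E1 by lra. fold e in E1. rewrite E0 in E1.
  assert (Dz' : disk z') by (apply component_sub in Hz'; apply Hz').
  apply FF_inj in E1; [|lra|apply tan_half_pos; exact Hv0|apply to_w_rot; exact Dz|apply to_w_rot; exact Dz'].
  apply (f_equal to_h) in E1. rewrite !to_h_w in E1 by (apply rot_neq1; auto).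
  apply Cmult_reg_r in E1; [|apply Cmod_pos_neq; rewrite Cmod_cis; lra]. apply Hn. rewrite E1. exact Hz'.
(* A parameter [J] strictly below the tip at time [tau] is below the tip slightly earlier, when [z]
   was still in the domain; [flow_avoid] excludes this. *)
- assert (Ew : w0 = ax (- Im w0)) by (apply C_eq; simpl; lra). rewrite Ew, FF_axis in E0 by auto. set (J := JJ c e (- Im w0)) in *.
  pose proof (JJ_le_tip c e (- Im w0) Pc Pe) as [HJ|HJ]; [|apply Hne; rewrite <- E0; unfold J; rewrite HJ; reflexivity].
  fold J in HJ. set (P := Rpower (1 + (/ e) ^ 2) (c / 2)). assert (PP : 0 < P) by apply exp_pos.
  assert (ET : tipJ c (/ e) = KK c (/ e) - e * P) by (unfold tipJ, JJ; rewrite Rinv_inv; reflexivity).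
  destruct (Near ((tipJ c (/ e) - J) / P)) as [d [Hd H]]; [pos|]. destruct (Hlim d Hd) as [N HN].
  specialize (H _ (proj1 (Hsn N)) (HN N (le_n N))). apply Rlt_div_r in H; [|exact PP]. pose proof (Rle_abs (eta (sn N) - e)).
  apply (flow_avoid (sn N) z J); [apply (inT_le tau); auto; specialize (Hsn N); lra|auto| |auto].
  pose proof (JJ_le_tip c (eta (sn N)) (/ e) Pc (eta_pos (sn N) ltac:(specialize (Hsn N); lra))) as Q. unfold JJ in Q at 1. fold P in Q.
  unfold Jt. nra.
Qed.

(** * The curve recovered from the invariant *)

Lemma gamma_cont t eps : 0 < t < Tend -> 0 < eps -> exists d, 0 < d /\ forall s, 0 < s < Tend -> Rabs (s - t) < d -> Cmod (gamma s - gamma t)%C < eps.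
Proof.
intros Ht He. destruct (hyp_cont _ _ _ _ _ _ _ Hyp t) with (eps := eps) as [d [Hd H]]; auto.
- split; [lra|]. rewrite T_eq. simpl. lra.
- exists d. split; auto. intros s Hs. apply H. split; [lra|]. rewrite T_eq. simpl. lra.
Qed.

Lemma gamma_disk t : 0 < t < Tend -> disk (gamma t).
Proof. intros Ht. apply (hyp_disk _ _ _ _ _ _ _ Hyp). split; [lra|]. rewrite T_eq. simpl. lra. Qed.

(* [gamma] starts on the circle, so [gamma ((0, t'])] is relatively closed in the disk, uniformly for [t'] near [t]. *)
Lemma trace_avoid t z : 0 <= t < Tend -> disk z -> (forall s, 0 < s <= t -> z <> gamma s) ->
  exists t' r, t < t' < Tend /\ 0 < r /\ forall y, Cmod (y - z)%C < r -> disk y /\ forall s, 0 < s <= t' -> y <> gamma s.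
Proof.
intros Ht Hz Hne. unfold disk in Hz. apply NNPP. intro Hno.
assert (X : forall n : nat, exists s, 0 < s < Tend /\ s <= t + (Tend - t) / (INR n + 2) /\ Cmod (gamma s - z) < (1 - Cmod z) / (INR n + 2)).
{ intro n. apply NNPP. intro Hn. apply Hno. pose proof (pos_INR n). exists (t + (Tend - t) / (INR n + 2)), ((1 - Cmod z) / (INR n + 2)).
  assert (0 < (Tend - t) / (INR n + 2)) by pos. assert (0 < (1 - Cmod z) / (INR n + 2)) by pos.
  assert ((Tend - t) / (INR n + 2) < Tend - t) by (apply Rlt_div_l; nra). assert ((1 - Cmod z) / (INR n + 2) < 1 - Cmod z) by (nra).
  split; [lra|]. split; [lra|]. split.
  - unfold disk. pose proof (Cmod_rev_triangle y z). lra.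
  - intros s Hs ->. apply Hn. exists s. lra. }
apply functional_choice in X. destruct X as [sn Hs].
destruct (C_BW (fun n => RtoC (sn n)) Tend) as [l Hl].
{ intro n. destruct (Hs n) as [H _]. rewrite Cmod_R, Rabs_right; lra. }
set (x := Re l).
assert (Hx : forall d eps, 0 < d -> 0 < eps -> exists s, 0 < s < Tend /\ s < t + eps /\ Rabs (s - x) < d /\ Cmod (gamma s - z) < eps).
{ intros d eps Hd He. destruct (INR_unbounded ((Tend - t + (1 - Cmod z)) / eps)) as [N HN]. destruct (Hl d N Hd) as [n [Hn1 Hn2]].
  apply le_INR in Hn1. destruct (Hs n) as [H1 [H2 H3]]. exists (sn n). apply Rlt_div_l in HN; [|lra].
  assert (Q : forall q, q <= Tend - t + (1 - Cmod z) -> q / (INR n + 2) < eps) by (intros q Hq; apply Rlt_div_l; nra).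
  pose proof (Q (Tend - t) ltac:(lra)). pose proof (Q (1 - Cmod z) ltac:(lra)).
  pose proof (re_le_Cmod (RtoC (sn n) - l)) as R. rewrite Re_sub in R. simpl (Re _) in R. repeat split; unfold x; lra. }
destruct (Rle_lt_dec x 0) as [H0|H0].
- destruct (hyp_start _ _ _ _ _ _ _ Hyp ((1 - Cmod z) / 2) ltac:(lra)) as [d [Hd H]].
  destruct (Hx d ((1 - Cmod z) / 2) Hd ltac:(lra)) as [s [S1 [_ [S2 S3]]]]. apply Rabs_lt_between in S2. specialize (H s ltac:(lra)).
  pose proof (Cmod_triangle_sub 1 (gamma s) z) as T1. rewrite (Cmod_sub_sym 1 (gamma s)) in T1. pose proof (Cmod_rev_triangle 1 z) as T2. rewrite Cmod_1 in T2. lra.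
- assert (Hxt : x <= t).
  { apply Rnot_lt_le. intro Hlt. destruct (Hx ((x - t) / 2) ((x - t) / 2) ltac:(lra) ltac:(lra)) as [s [_ [S1 [S2 _]]]]. apply Rabs_lt_between in S2. lra. }
  assert (Hp : 0 < Cmod (z - gamma x)) by (apply Cmod_pos; intro E; apply (Hne x ltac:(lra)), Csub_0, E).
  destruct (gamma_cont x (Cmod (z - gamma x) / 2) ltac:(lra) ltac:(lra)) as [d [Hd H]].
  destruct (Hx d (Cmod (z - gamma x) / 2) Hd ltac:(lra)) as [s [S1 [_ [S2 S3]]]]. specialize (H s S1 S2).
  pose proof (Cmod_triangle_sub z (gamma s) (gamma x)) as T1. rewrite (Cmod_sub_sym z (gamma s)) in T1. lra.
Qed.

Lemma gamma_neq0_compl t : 0 <= t < Tend -> forall z, hull_c gamma t z -> disk z /\ forall s, 0 < s <= t -> z <> gamma s.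
Proof.
intros Ht z Hz. apply component_sub in Hz. destruct Hz as [H1 H2]. split; auto. intros s Hs E. apply H2. exists s. auto.
Qed.

Lemma Jt_incr s t : 0 <= s < t -> t < Tend -> Jt s < Jt t.
Proof.
intros Hs Ht. apply tipJ_incr; [pos|]. pose proof (eta_pos t Ht). pose proof (eta_pos s ltac:(lra)).
split; [pos|]. apply Rinv_lt_contravar; [nra|apply eta_decr; lra].
Qed.

(** If [s < t] and [Jt s = - Jt t], then [Jt t > 0], and it is below [TT c] when [c < 1]; so
    [ell_inj] applies at [Jt t]. *)
Lemma Jt_ell_inj s t : 0 <= s <= t -> t < Tend -> ell c (Jt s) = ell c (Jt t) -> s = t.
Proof.
intros Hs Ht E. destruct (Req_dec s t) as [|Hn]; auto. pose proof c_pos as Pc.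
pose proof (Jt_incr s t ltac:(lra) Ht) as Hlt.
destruct (ell_sq c (Jt s) (Jt t) Pc E) as [X|X]; [lra|].
symmetry in E. apply ell_inj in E; auto; [lra|]. apply atan_bound_TT; auto.
intros H1. rewrite Rabs_right by lra. apply tipJ_lt_TT; [lra|]. apply Rinv_0_lt_compat, eta_pos; auto.
Qed.

Lemma hull_base t : 0 <= t < Tend -> disk 0 /\ ~ trace (fun s => 0 < s <= t) gamma 0.
Proof.
intros Ht. destruct (hyp_surj _ _ _ _ _ _ _ Hyp t 0) as [z [[A [_ [HA [A0 _]]]] _]].
- apply inT_iff; auto.
- unfold disk. rewrite Cmod_0. lra.
- auto.
Qed.

Lemma hull_0 z : disk z -> hull_c gamma 0 z.
Proof.
intros Hz. apply component_segment with (RtoC 0).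
- apply component_refl, hull_base. pose proof Tend_pos. lra.
- split; [|intros [r [Hr _]]; lra].
  unfold disk in *. replace (0 + s * (z - 0))%C with (s * z)%C by ring.
  rewrite Cmod_mult, Cmod_R, Rabs_right by lra. pose proof (Cmod_ge_0 z). nra.
Qed.

(** By [trace_avoid] the complements of [gamma ((0, t'])], for [t' > t], exhaust that of
    [gamma ((0, t])] locally uniformly; [component_exhaust] transfers this to the components of
    [0]. *)
Lemma hull_right_open t z : 0 <= t < Tend -> hull_c gamma t z -> exists t', t < t' < Tend /\ hull_c gamma t' z.
Proof.
intros Ht Hz.
apply (component_exhaust (fun z => disk z /\ ~ trace (fun s => 0 < s <= t) gamma z)
   (fun t' z => disk z /\ ~ trace (fun s => 0 < s <= t') gamma z) (fun t' => t < t' < Tend)); auto.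
- exists ((t + Tend) / 2). lra.
- intros t' Ht'. apply hull_base. lra.
- assert (M : forall t1 t2, t1 <= t2 -> forall y, disk y /\ ~ trace (fun s => 0 < s <= t2) gamma y -> disk y /\ ~ trace (fun s => 0 < s <= t1) gamma y).
  { intros t1 t2 H y [Y1 Y2]. split; auto. intros [s [Hs E]]. apply Y2. exists s. split; auto. lra. }
  intros t1 t2 _ _. destruct (Rle_lt_dec t1 t2); [right; apply M; auto|left; apply M; lra].
- intros y [Y1 Y2]. destruct (trace_avoid t y Ht Y1) as [t' [r [Ht' [Hr H]]]].
  + intros s Hs E. apply Y2. exists s. auto.
  + exists t', r. split; auto. split; auto. intros y' Hy'. destruct (H y' Hy') as [H1 H2]. split; auto.
    intros [s [Hs E]]. apply (H2 s); auto.
Qed.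

(** The supremum of the times at which [z] is in the domain is not attained, by
    [hull_right_open]. *)
Lemma swallow_time z r : disk z -> 0 <= r < Tend -> ~ hull_c gamma r z ->
  exists tau, 0 < tau <= r /\ (forall s, 0 <= s < tau -> hull_c gamma s z) /\ ~ hull_c gamma tau z.
Proof.
intros Hz Hr Hn.
destruct (completeness (fun s => 0 <= s <= r /\ hull_c gamma s z)) as [m [M1 M2]].
- exists r. intros s [Hs _]. lra.
- exists 0. split; [lra|apply hull_0; auto].
- assert (Hm : 0 <= m <= r) by (split; [apply M1; split; [lra|apply hull_0; auto]|apply M2; intros s [Hs _]; lra]).
  assert (Hm2 : ~ hull_c gamma m z).
  { intro Hmz. destruct (Req_dec m r) as [->|Hmr]; auto.
    destruct (hull_right_open m z ltac:(lra) Hmz) as [t' [Ht' Hz']].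
    assert (Rmin t' r <= m). { apply M1. split; [split; [apply Rmin_glb; lra|rmin]|]. apply hull_mono with t'; auto. rmin. }
    assert (m < Rmin t' r) by pos. lra. }
  exists m. split; [|split; auto].
  + split; [|lra]. destruct (Req_dec m 0) as [E|]; [|lra]. exfalso. apply Hm2. rewrite E. apply hull_0; auto.
  + intros s Hs. apply NNPP. intro Hns. assert (m <= s); [|lra]. apply M2. intros x [Hx1 Hx2].
    apply Rnot_lt_le. intro. apply Hns. apply hull_mono with x; auto. lra.
Qed.

Lemma swallow_value z r : disk z -> 0 <= r < Tend -> ~ hull_c gamma r z -> exists tau, 0 < tau <= r /\
  (forall s, 0 <= s < tau -> hull_c gamma s z) /\ ~ hull_c gamma tau z /\ Fz z = ell c (Jt tau).
Proof.
intros Hz Hr Hn. destruct (swallow_time z r Hz Hr Hn) as [tau [H1 [H2 H3]]]. exists tau. repeat split; try apply H1; auto.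
apply swallow; auto; [apply inT_iff|]; lra.
Qed.

Lemma swallow_exact z r : disk z -> 0 < r < Tend -> Fz z = ell c (Jt r) -> (forall s, 0 <= s < r -> hull_c gamma s z) /\ ~ hull_c gamma r z.
Proof.
intros Hz Hr E. assert (Hn : ~ hull_c gamma r z).
{ intro H. apply (flow_avoid r z (Jt r)) in E; auto; [apply inT_iff|]; lra. }
destruct (swallow_value z r Hz ltac:(lra) Hn) as [tau [H1 [H2 [H3 H4]]]].
assert (tau = r). { apply Jt_ell_inj; try lra. congruence. }
subst tau. auto.
Qed.

Lemma Fz_open z r : disk z -> 0 < r -> exists d, 0 < d /\ forall y, Cmod (y - Fz z)%C < d -> exists z', disk z' /\ Cmod (z' - z)%C < r /\ Fz z' = y.
Proof. apply Fm_open; auto. pos. Qed.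

(** If [z] were off [gamma ((0, r])], some ball around it would avoid that set and, containing a
    swallowed point, would lie entirely outside the component of [0]. All values in the ball would
    then be on [ell], against openness. *)
Lemma trace_of_value z r : disk z -> 0 < r < Tend -> Fz z = ell c (Jt r) -> z = gamma r.
Proof.
intros Hz Hr E. apply NNPP. intro Hn. destruct (swallow_exact z r Hz Hr E) as [H1 H2].
assert (Hav : forall s, 0 < s <= r -> z <> gamma s).
{ intros s Hs X. destruct (Req_dec s r) as [->|Hsr]; auto.
  destruct (gamma_neq0_compl s ltac:(lra) z (H1 s ltac:(lra))) as [_ Q]. apply (Q s); auto. lra. }
destruct (trace_avoid r z ltac:(lra) Hz Hav) as [t' [d [Ht' [Hd Hball]]]].
destruct (Fz_open z d Hz Hd) as [d2 [Hd2 Hop]].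
destruct (ell_no_interior c (Fz z) d2 c_pos Hd2) as [y [Hy1 Hy2]].
destruct (Hop y Hy1) as [z' [Z1 [Z2 Z3]]].
assert (Hn' : ~ hull_c gamma r z').
{ intro Hc. apply H2. apply component_ball with z d z'; auto.
  - intros x Hx. destruct (Hball x Hx) as [B1 B2]. split; auto. intros [s [Hs X]]. apply (B2 s); auto. lra.
  - replace (z - z)%C with (RtoC 0) by ring. rewrite Cmod_0. auto. }
destruct (swallow_value z' r Z1 ltac:(lra) Hn') as [tau [_ [_ [_ X]]]]. congruence.
Qed.

Lemma ct_Fz z : disk z -> ct all_C Fz z.
Proof. apply ct_Fm, c_pos. Qed.

Lemma Jt_near t eps : 0 <= t < Tend -> 0 < eps -> exists d, 0 < d /\ forall s, 0 <= s < Tend -> Rabs (s - t) < d -> Cmod (ell c (Jt s) - ell c (Jt t))%C < eps.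
Proof.
intros Ht He. pose proof (eta_pos t ltac:(lra)) as Pe. pose proof c_pos as Pc.
destruct (FF_joint c (eta t) (ax (/ eta t)) Pc ltac:(simpl; lra) eps He) as [d [Hd H]].
assert (Hax : ct Rnn (fun y => (- Ci / RtoC (eta (Re y)))%C) t).
{ eapply hd_ct, hd_div; [intro X; apply RtoC_inj in X; simpl in X; lra|apply hd_const|apply hd_eta; apply inT_iff; auto]. }
destruct (Hax d Hd) as [d1 [Hd1 H1]].
destruct (hd_ct _ _ _ _ (hd_eta t (proj2 (inT_iff t) Ht)) d Hd) as [d2 [Hd2 H2]].
exists (Rmin d1 d2). split; [pos|]. intros s Hs Hst.
assert (Ey : forall x, 0 <= x < Tend -> (- Ci / RtoC (eta x))%C = ax (/ eta x)).
{ intros x Hx. pose proof (eta_pos x ltac:(lra)). unfold Cdiv. rewrite <- RtoC_inv by lra. Cring. }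
assert (Cs : Cmod (s - t)%C = Rabs (s - t)) by (rewrite <- RtoC_minus; apply Cmod_R).
specialize (H1 s ltac:(split; simpl; lra)). specialize (H2 s ltac:(split; simpl; lra)). rewrite Cs in H1, H2. rewrite !Ey in H1 by auto. rewrite <- RtoC_minus, Cmod_R in H2.
specialize (H1 (Rlt_le_trans _ _ _ Hst (Rmin_l _ _))). specialize (H2 (Rlt_le_trans _ _ _ Hst (Rmin_r _ _))).
specialize (H (eta s) (ax (/ eta s)) H2 H1). rewrite !FF_tip in H; auto. apply eta_pos; lra.
Qed.

(** The good times are open and closed in [(0, Tend)]. One of them is the time [tau] at which the
    point [gamma (r / 2)] is swallowed; at this stage [tau] might still be smaller than [r / 2]. *)
Lemma Fz_gamma r : 0 < r < Tend -> Fz (gamma r) = ell c (Jt r).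
Proof.
set (P := fun r => Fz (gamma r) = ell c (Jt r)).
assert (HO : forall s, 0 < s < Tend -> P s -> exists d, 0 < d /\ forall t, 0 < t < Tend -> Rabs (t - s) < d -> P t).
{ intros s Hs Ps. destruct (Fz_open (gamma s) 1 (gamma_disk s Hs) ltac:(lra)) as [d [Hd H]].
  destruct (Jt_near s d ltac:(lra) Hd) as [d1 [Hd1 H1]]. exists d1. split; auto. intros t Ht Hts.
  specialize (H1 t ltac:(lra) Hts). rewrite <- Ps in H1. destruct (H _ H1) as [z' [Z1 [Z2 Z3]]].
  unfold P. rewrite <- (trace_of_value z' t); auto. }
assert (HC : forall s, 0 < s < Tend -> ~ P s -> exists d, 0 < d /\ forall t, 0 < t < Tend -> Rabs (t - s) < d -> ~ P t).
{ intros s Hs Ps. set (m := Cmod (Fz (gamma s) - ell c (Jt s))%C). assert (Hm : 0 < m) by (apply Cmod_pos; intro X; apply Ps, Csub_0; auto).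
  destruct (ct_Fz (gamma s) (gamma_disk s Hs) (m / 2) ltac:(lra)) as [d0 [Hd0 H0]].
  destruct (gamma_cont s d0 Hs Hd0) as [d1 [Hd1 H1]].
  destruct (Jt_near s (m / 2) ltac:(lra) ltac:(lra)) as [d2 [Hd2 H2]].
  exists (Rmin d1 d2). split; [pos|]. intros t Ht Hts Pt.
  specialize (H1 t Ht (Rlt_le_trans _ _ _ Hts (Rmin_l _ _))). specialize (H2 t ltac:(lra) (Rlt_le_trans _ _ _ Hts (Rmin_r _ _))).
  specialize (H0 _ I H1). rewrite Pt in H0.
  pose proof (Cmod_triangle_sub (Fz (gamma s)) (ell c (Jt t)) (ell c (Jt s))) as T1. fold m in T1. rewrite (Cmod_sub_sym (Fz (gamma s)) (ell c (Jt t))) in T1. lra. }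
intros Hr. destruct (swallow_value (gamma (r / 2)) (r / 2) (gamma_disk (r / 2) ltac:(lra)) ltac:(lra)) as [tau [T1 [T2 [T3 T4]]]].
{ intro Hc. destruct (gamma_neq0_compl (r / 2) ltac:(lra) _ Hc) as [_ Q]. apply (Q (r / 2)); auto. lra. }
apply (interval_clopen P tau r); [lra|unfold P; rewrite <- (trace_of_value (gamma (r / 2)) tau); auto; [apply gamma_disk; lra|lra]|..].
- intros s Hs Ps. destruct (HO s ltac:(lra) Ps) as [d [Hd H]]. exists d. split; auto. intros t Ht. apply H. lra.
- intros s Hs Ps. destruct (HC s ltac:(lra) Ps) as [d [Hd H]]. exists d. split; auto. intros t Ht. apply H. lra.
Qed.

Lemma gamma_inj s t : 0 < s < Tend -> 0 < t < Tend -> gamma s = gamma t -> s = t.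
Proof.
intros Hs Ht E. apply (f_equal Fz) in E. rewrite !Fz_gamma in E by auto.
destruct (Rle_lt_dec s t); [|symmetry in E; symmetry]; apply Jt_ell_inj; auto; lra.
Qed.

(** Explicit inverse: [/ eta = y] corresponds to [u = y / sqrt (1 + y ^ 2)]. *)
Lemma inv_eta_onto y : / eta 0 <= y -> exists t, 0 <= t < Tend /\ / eta t = y.
Proof.
intros Hy. pose proof u0_bound as U0. pose proof c_pos as Pc. pose proof Tend_pos as PT.
pose proof (eta_pos 0 PT) as P0. assert (Pi : 0 < / eta 0) by pos.
assert (S1 : 0 < 1 + y ^ 2) by nra. set (q := sqrt (1 + y ^ 2)). assert (Hq : 0 < q) by (apply sqrt_lt_R0; auto).
assert (Q2 : q ^ 2 = 1 + y ^ 2) by (apply pow2_sqrt; lra).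
set (u := y / q). assert (Yq : y < q) by nra.
assert (Hu1 : u < 1) by (apply Rlt_div_l; lra).
set (t := 2 / c * ln (u / u0)). assert (Ut : uu t = u).
{ unfold uu, t. replace (c / 2 * (2 / c * ln (u / u0))) with (ln (u / u0)) by (field; lra).
  rewrite exp_ln by pos. field. lra. }
assert (HtT : t < Tend).
{ apply Rnot_le_lt. intros [Hlt|Heq]; [apply uu_incr in Hlt; rewrite uu_Tend in Hlt; lra|]. rewrite <- Heq, uu_Tend in Ut. lra. }
assert (He : / eta t = y).
{ unfold eta. rewrite Ut. replace (1 - u ^ 2) with ((/ q) ^ 2).
  - rewrite sqrt_pow2 by (apply Rlt_le, Rinv_0_lt_compat; auto). unfold u. field. lra.
  - unfold u. apply (Rmult_eq_reg_r (q ^ 2)); [|lra]. transitivity (q ^ 2 - y ^ 2); [|field; lra]. transitivity 1; [field; lra|lra]. }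
exists t. split; auto. split; auto. apply Rnot_lt_le. intro Hneg.
pose proof (eta_decr t 0 Hneg PT) as D. assert (/ eta t < / eta 0) by (apply Rinv_lt_contravar; [nra|auto]). lra.
Qed.

Lemma Jt_onto j : Jt 0 < j -> (c < 1 -> j < TT c) -> exists t, 0 < t < Tend /\ Jt t = j.
Proof.
intros Hj HjT. pose proof c_pos as Pc. pose proof (eta_pos 0 Tend_pos) as P0. assert (Pi : 0 < / eta 0) by pos.
assert (HM : exists M, / eta 0 < M /\ j < tipJ c M).
{ destruct (Rlt_le_dec c 1) as [Hl|Hg].
  - destruct (tipJ_lim c (TT c - j) ltac:(lra) ltac:(lra)) as [M [_ HM]].
    exists (Rmax M (/ eta 0 + 1)). split; [eapply Rlt_le_trans; [|apply Rmax_r]; lra|].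
    specialize (HM _ (Rmax_l M (/ eta 0 + 1))). apply Rabs_lt_between in HM. lra.
  - destruct (tipJ_unbounded c j Hg) as [M [_ HM]]. exists (Rmax M (/ eta 0 + 1)). split; [eapply Rlt_le_trans; [|apply Rmax_r]; lra|].
    apply HM, Rmax_l. }
destruct HM as [M [HM1 HM2]].
destruct (IVT_interv (fun y => tipJ c y - j) (/ eta 0) M) as [y [Hy Ey]]; auto.
- intros x Hx. apply continuity_pt_minus; [|apply continuity_pt_const; intros ? ?; auto].
  apply derivable_continuous_pt. exists (Rpower (1 + x ^ 2) (c / 2) / x ^ 2). apply is_derive_Reals, tipJ_derive; lra.
- unfold Jt in Hj. lra.
- lra.
- destruct (inv_eta_onto y ltac:(lra)) as [t [Ht Et]]. exists t. unfold Jt. rewrite Et. split; [|lra].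
  split; [|lra]. destruct (Req_dec t 0) as [->|]; [|lra]. unfold Jt in Hj. rewrite Et in Hj. lra.
Qed.

Lemma slit_flow : Slit (- (rho + 2) / 2) v0 Tend gamma Jt.
Proof.
pose proof c_pos as Pc. constructor; auto.
- apply Tend_pos.
- unfold Jt. rewrite eta_0. auto.
- apply Jt_incr; lra.
- intros j H1 H2. apply Jt_onto; auto. unfold Jt. rewrite eta_0. auto.
- intros H t Ht. apply tipJ_lt_TT; [lra|]. apply Rinv_0_lt_compat, eta_pos; lra.
- apply gamma_disk.
- apply gamma_cont.
- apply gamma_inj.
- apply (hyp_start _ _ _ _ _ _ _ Hyp).
- apply Fz_gamma.
- apply trace_of_value.
Qed.
End TimeAnalysis.

(** * The domain left at the end *)

Lemma gau_nonneg c z : 0 < c -> 0 <= gau c z.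
Proof.
intros Hc. destruct (classic (z = 0)) as [->|Hz]; [rewrite gau_0; lra|].
rewrite gau_neq0 by auto. pose proof (Rmin_cos_bound c z Hc). apply Rmult_le_pos; [apply Rlt_le, exp_pos|apply cos_ge_0; lra].
Qed.

(** Star-shapedness of the region bounded by [ell], from homogeneity of the gauge. *)
Lemma gau_shrink c s z : 0 < c -> 0 <= s <= 1 -> gau c z < a0 c -> gau c (s * z)%C < a0 c.
Proof.
intros Hc Hs H. destruct (Req_dec s 0) as [->|Hn].
- rewrite Cmult_0_l, gau_0. apply a0_pos; auto.
- rewrite gau_scal by lra. pose proof (gau_nonneg c z Hc).
  assert (Rpower s (c / 2) <= 1).
  { rewrite <- (Rpower_O s) by lra. destruct (Req_dec s 1) as [->|]; [unfold Rpower; rewrite ln_1, !Rmult_0_r; lra|]. left. apply exp_increasing. assert (ln s < 0) by (rewrite <- ln_1; apply ln_increasing; lra). nra. }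
  nra.
Qed.

Lemma FF_cluster c eta (w : nat -> C) M L : 0 < c -> (forall n, 0 <= Re (w n) /\ Cmod (w n) <= M) ->
  (forall eps, 0 < eps -> exists N, forall n, (N <= n)%nat -> Cmod (FF c eta (w n) - L)%C < eps) ->
  exists x, 0 <= Re x /\ FF c eta x = L /\ forall eps N, 0 < eps -> exists n, (N <= n)%nat /\ Cmod (w n - x)%C < eps.
Proof.
intros Hc Hw HL. destruct (C_BW w M) as [x Hx]; [intro n; apply Hw|].
assert (Rx : 0 <= Re x).
{ apply Rnot_lt_le. intro Hneg. destruct (Hx (- Re x) O ltac:(lra)) as [n [_ Hn]]. destruct (Hw n) as [H1 _].
  pose proof (re_le_Cmod (w n - x)%C) as Q. rewrite Re_sub in Q. rewrite Rabs_right in Q; lra. }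
exists x. split; auto. split; auto. apply Cmod_sub_0, NNPP. intro Hne.
set (m := Cmod (FF c eta x - L)%C) in *.
destruct (FF_joint c eta x Hc Rx (m / 2) ltac:(lra)) as [d [Hd H]]. destruct (HL (m / 2) ltac:(lra)) as [N HN].
destruct (Hx d N Hd) as [n [Hn1 Hn2]]. specialize (HN n Hn1). specialize (H eta (w n)).
replace (eta - eta) with 0 in H by ring. rewrite Rabs_R0 in H.
pose proof (Cmod_triangle_sub (FF c eta x) (FF c eta (w n)) L) as T1. rewrite (Cmod_sub_sym (FF c eta x) (FF c eta (w n))) in T1. fold m in T1. lra.
Qed.

Lemma inv_INR_small eps : 0 < eps -> exists N, forall n, (N <= n)%nat -> / (INR n + 1) < eps.
Proof. destruct (INR_unbounded (/ eps)) as [N HN]. exists N. intros n Hn. apply le_INR in Hn.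
rewrite <- (Rinv_inv eps). apply Rinv_lt_contravar; [|lra]. assert (0 < / eps) by pos. nra.
Qed.

Definition argj (c j : R) : R := atan (j / a0 c).

Lemma Cmod_aj_opp c j : Cmod (a0 c, (- j)%R) = Cmod (a0 c, j).
Proof. unfold Cmod. simpl. f_equal. ring. Qed.

Lemma argj_TT c : 0 < c < 1 -> argj c (TT c) = PI * c / 2 /\ argj c (- TT c) = - (PI * c / 2).
Proof.
intros Hc. pose proof (a0_pos c ltac:(lra)). pose proof PI_RGT_0. unfold argj.
assert (E : atan (TT c / a0 c) = PI * c / 2).
{ unfold TT. replace (a0 c * tan (PI * c / 2) / a0 c) with (tan (PI * c / 2)) by (field; lra). apply atan_tan. nra. }
split; auto. replace (- TT c / a0 c) with (- (TT c / a0 c)) by lra. rewrite atan_opp, E. auto.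
Qed.

(** The nominal arguments are [PI] and [- PI]: the curve closes up on the negative real axis. *)
Lemma ell_TT_opp c : 0 < c < 1 -> ell c (TT c) = ell c (- TT c).
Proof.
intros Hc. destruct (argj_TT c Hc) as [E1 E2]. unfold argj in *. rewrite !ell_polar, E1, E2 by lra.
rewrite Cmod_aj_opp. replace (2 / c * (PI * c / 2)) with PI by (field; lra). replace (2 / c * - (PI * c / 2)) with (- PI) by (field; lra).
unfold cis. rewrite cos_neg, sin_neg, sin_PI. Cring.
Qed.

(** ** Straightening the curve [ell] *)

Lemma ell_neq0 c j : ell c j <> 0.
Proof. apply Cpw_neq_0. Qed.

(* The branch of [zeta ^ (c / 2)] sending [ell c j] to [a0 + i j]. *)
Definition ZZ (c j : R) (zeta : C) : C := ((a0 c, j) * Cpw (zeta / ell c j) (c / 2))%C.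

Lemma Clog_aj c j : Clog (a0 c, j) = (ln (Cmod (a0 c, j)), argj c j).
Proof. auto. Qed.

Lemma aj_exp c j : 0 < c -> (a0 c, j) = Cexp (Clog (a0 c, j)).
Proof. symmetry. apply Cexp_Clog. apply a0_pos; auto. Qed.

Lemma aj_polar c j : 0 < c -> (a0 c, j) = (RtoC (Cmod (a0 c, j)) * cis (argj c j))%C.
Proof.
intros Hc. rewrite (aj_exp c j Hc) at 1. unfold Cexp. simpl (Re _).
rewrite exp_ln by (apply Cmod_aJ_pos; auto). auto.
Qed.

Lemma ZZ_Cexp c j zeta : 0 < c -> ZZ c j zeta = Cexp (Clog (a0 c, j) + RtoC (c / 2) * Clog (zeta / ell c j))%C.
Proof. intros Hc. rewrite Cexp_add, <- aj_exp; auto. Qed.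

Lemma ZZ_near c j dl : 0 < c -> 0 < dl -> exists d, 0 < d /\ forall zeta, Cmod (zeta - ell c j)%C < d ->
  0 < Re (zeta / ell c j)%C /\ Rabs (Im (Clog (zeta / ell c j)%C)) < dl.
Proof.
intros Hc Hd. pose proof (Cmod_pos _ (ell_neq0 c j)) as P.
destruct (ct_Clog 1 ltac:(simpl; lra) dl Hd) as [d1 [Hd1 H1]].
exists (Rmin 1 d1 * Cmod (ell c j)). split; [pos|]. intros zeta Hz.
assert (Q : Cmod (zeta / ell c j - 1)%C < Rmin 1 d1).
{ replace (zeta / ell c j - 1)%C with ((zeta - ell c j) / ell c j)%C by (field; apply ell_neq0).
  rewrite Cmod_div by apply ell_neq0. apply Rlt_div_l; auto. }
split.
- apply (RHP_open 1); [simpl; lra|]. eapply Rlt_le_trans; [exact Q|apply Rmin_l].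
- specialize (H1 (zeta / ell c j)%C I (Rlt_le_trans _ _ _ Q (Rmin_r _ _))).
  rewrite Clog_R, ln_1 in H1 by lra. replace (Clog (zeta / ell c j) - 0)%C with (Clog (zeta / ell c j)) in H1 by ring.
  eapply Rle_lt_trans; [|exact H1]. apply Im_le_Cmod.
Qed.

Lemma ZZ_polar c j zeta : 0 < c -> 0 < Re (zeta / ell c j)%C ->
  let th := Im (Clog (zeta / ell c j)%C) in exists r, 0 < r /\ zeta = (r * cis (2 / c * argj c j + th))%C /\
  ZZ c j zeta = (RtoC (Rpower r (c / 2)) * cis (argj c j + c / 2 * th))%C.
Proof.
intros Hc Hq th. set (k := (RtoC (2 / c) * Clog (a0 c, j) + Clog (zeta / ell c j))%C).
assert (E : zeta = Cexp k).
{ unfold k. rewrite Cexp_add, Cexp_Clog by auto. fold (Cpw (a0 c, j) (2 / c)). fold (ell c j). field. apply ell_neq0. }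
exists (exp (Re k)). split; [pos|]. split.
- rewrite E at 1. unfold Cexp. unfold k. rewrite im_plus, im_scal_l, Clog_aj. auto.
- rewrite ZZ_Cexp by auto. unfold Cexp. f_equal; f_equal.
  + unfold Rpower. rewrite ln_exp. f_equal. unfold k. rewrite !re_plus, !re_scal_l. field. lra.
  + rewrite im_plus, im_scal_l, Clog_aj. auto.
Qed.

Lemma Cpw_ZZ c j zeta : 0 < c -> 0 < Re (zeta / ell c j)%C -> Rabs (argj c j + c / 2 * Im (Clog (zeta / ell c j)%C)) < PI / 2 ->
  Cpw (ZZ c j zeta) (2 / c) = zeta.
Proof.
intros Hc Hq Hb. apply Rabs_lt_between in Hb. rewrite ZZ_Cexp by auto. unfold Cpw. rewrite Clog_Cexp.
- replace (RtoC (2 / c) * (Clog (a0 c, j) + RtoC (c / 2) * Clog (zeta / ell c j)))%C with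
    (RtoC (2 / c) * Clog (a0 c, j) + RtoC (2 / c * (c / 2)) * Clog (zeta / ell c j))%C by Cring.
  replace (2 / c * (c / 2)) with 1 by (field; lra). rewrite Cmult_1_l, Cexp_add, Cexp_Clog by auto.
  fold (Cpw (a0 c, j) (2 / c)). fold (ell c j). field. apply ell_neq0.
- rewrite im_plus, im_scal_l, Clog_aj. auto.
Qed.

Lemma argj_bound c j : - (PI / 2) < argj c j < PI / 2.
Proof. pose proof (atan_bound (j / a0 c)). unfold argj. lra. Qed.

(** [ZZ] straightens [ell] to the line [Re = a0], but it continues the nominal argument of
    [ell c j], which may differ from the principal one; so [gau] only dominates its real part. *)
Lemma ZZ_le c j : 0 < c -> exists d, 0 < d /\ forall zeta, Cmod (zeta - ell c j)%C < d ->
  0 < Re (zeta / ell c j)%C /\ Re (ZZ c j zeta) <= gau c zeta /\ (Re (ZZ c j zeta) = a0 c -> zeta = ell c (Im (ZZ c j zeta))).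
Proof.
intros Hc. pose proof (argj_bound c j) as B.
assert (Hd : 0 < (PI / 2 - Rabs (argj c j)) / c). { apply Rdiv_lt_0_compat; auto. assert (Rabs (argj c j) < PI / 2) by (apply Rabs_lt_between; auto). lra. }
destruct (ZZ_near c j _ Hc Hd) as [d [Hd1 H1]]. exists d. split; auto. intros zeta Hz. destruct (H1 zeta Hz) as [Q1 Q2].
assert (B2 : Rabs (argj c j + c / 2 * Im (Clog (zeta / ell c j)%C)) < PI / 2).
{ eapply Rle_lt_trans; [apply Rabs_triang|]. rewrite (Rabs_mult (c / 2)), (Rabs_right (c / 2)) by lra. apply Rlt_div_r in Q2; auto.
  assert (Rabs (argj c j) < PI / 2) by (apply Rabs_lt_between; auto). nra. }
split; auto. split.
- destruct (ZZ_polar c j zeta Hc Q1) as [r [Hr [E1 E2]]]. set (th := Im (Clog (zeta / ell c j)%C)) in *.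
  rewrite E2, re_scal_l. rewrite E1 at 1. set (psi := 2 / c * argj c j + th).
  replace (argj c j + c / 2 * th) with (c * psi / 2) in * by (unfold psi; field; lra). apply gau_ge; auto.
  replace (c * Rabs psi / 2) with (Rabs (c * psi / 2)); [lra|]. unfold Rdiv. rewrite !Rabs_mult, (Rabs_right c), (Rabs_right (/ 2)) by lra. auto.
- intros E. rewrite <- (Cpw_ZZ c j zeta Hc Q1 B2) at 1. unfold ell. rewrite <- E. auto.
Qed.

(** Here the nominal argument is less than [PI] in modulus, hence principal, also at nearby
    points. *)
Lemma ZZ_eq c j : 0 < c -> Rabs (argj c j) < PI * c / 2 -> exists d, 0 < d /\ forall zeta, Cmod (zeta - ell c j)%C < d ->
  gau c zeta = Re (ZZ c j zeta).
Proof.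
intros Hc Hj. pose proof (argj_bound c j) as B. pose proof PI_RGT_0. assert (Bj : Rabs (argj c j) < PI / 2) by (apply Rabs_lt_between; auto).
assert (Hd : 0 < Rmin ((PI / 2 - Rabs (argj c j)) / c) (PI - 2 / c * Rabs (argj c j))).
{ apply Rmin_pos; [pos|]. assert (2 / c * Rabs (argj c j) < 2 / c * (PI * c / 2)) by (apply Rmult_lt_compat_l; [pos|auto]).
  replace (2 / c * (PI * c / 2)) with PI in H0 by (field; lra). lra. }
destruct (ZZ_near c j _ Hc Hd) as [d [Hd1 H1]]. exists d. split; auto. intros zeta Hz. destruct (H1 zeta Hz) as [Q1 Q2].
assert (Q3 := Rlt_le_trans _ _ _ Q2 (Rmin_l _ _)). assert (Q4 := Rlt_le_trans _ _ _ Q2 (Rmin_r _ _)).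
destruct (ZZ_polar c j zeta Hc Q1) as [r [Hr [E1 E2]]]. set (th := Im (Clog (zeta / ell c j)%C)) in *.
rewrite E2, re_scal_l. rewrite E1 at 1. set (psi := 2 / c * argj c j + th).
assert (Bp : Rabs psi <= 2 / c * Rabs (argj c j) + Rabs th).
{ eapply Rle_trans; [apply Rabs_triang|]. rewrite Rabs_mult, (Rabs_right (2 / c)); [lra|]. apply Rle_ge, Rlt_le, Rdiv_lt_0_compat; lra. }
replace (argj c j + c / 2 * th) with (c * psi / 2) in * by (unfold psi; field; lra). apply gau_eq; auto; [lra|].
apply Rlt_div_r in Q3; auto. assert (c * Rabs psi / 2 <= c * (2 / c * Rabs (argj c j) + Rabs th) / 2) by nra.
replace (c * (2 / c * Rabs (argj c j) + Rabs th) / 2) with (Rabs (argj c j) + c * Rabs th / 2) in H0 by (field; lra). nra.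
Qed.

(** At the double point each side of the negative axis is seen through its own branch. Together with
    [ZZ_le] this makes [gau] the maximum of the two real parts. *)
Lemma ZZ_TT c : 0 < c < 1 -> exists d, 0 < d /\ forall zeta, Cmod (zeta - ell c (TT c))%C < d ->
  gau c zeta = Re (ZZ c (TT c) zeta) \/ gau c zeta = Re (ZZ c (- TT c) zeta).
Proof.
intros Hc. pose proof PI_RGT_0. destruct (ZZ_near c (TT c) (Rmin PI (PI / c - PI)) ltac:(lra)) as [d [Hd1 H1]].
{ apply Rmin_pos; [lra|]. assert (PI < PI / c); [|lra]. assert (0 < PI * (1 - c)) by pos. apply (proj1 (Rlt_div_r PI PI c ltac:(lra))). lra. }
exists d. split; auto. intros zeta Hz. destruct (H1 zeta Hz) as [Q1 Q2].
assert (Q3 := Rlt_le_trans _ _ _ Q2 (Rmin_l _ _)).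
destruct (argj_TT c Hc) as [A1 A2]. destruct (ZZ_polar c (TT c) zeta ltac:(lra) Q1) as [r [Hr [E1 E2]]].
pose proof Q1 as Q1'. rewrite ell_TT_opp in Q1' by auto.
destruct (ZZ_polar c (- TT c) zeta ltac:(lra) Q1') as [r' [Hr' [E3 E4]]].
rewrite <- ell_TT_opp in E3, E4 by auto. set (th := Im (Clog (zeta / ell c (TT c))%C)) in *.
assert (Bth : c * (PI - Rabs th) / 2 <= PI / 2). { pose proof (Rabs_pos th). nra. }
destruct (Rle_lt_dec th 0) as [Hn|Hp].
- left. rewrite E2, re_scal_l. rewrite E1 at 1. rewrite A1. rewrite (Rabs_left1 th) in * by lra.
  replace (2 / c * (PI * c / 2) + th) with (PI + th) by (field; lra).
  replace (PI * c / 2 + c / 2 * th) with (c * (PI + th) / 2) by lra. apply gau_eq; auto; [lra|..]; rewrite Rabs_right by lra; [lra|]. lra.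
- right. rewrite E4, re_scal_l. rewrite E3 at 1. rewrite A2. rewrite (Rabs_right th) in * by lra.
  replace (2 / c * - (PI * c / 2) + th) with (- (PI - th)) by (field; lra).
  replace (- (PI * c / 2) + c / 2 * th) with (c * - (PI - th) / 2) by lra. apply gau_eq; auto; [lra|..]; rewrite Rabs_left1 by lra; lra.
Qed.

Lemma ZZ_ell c j j' : 0 < c -> Rabs (argj c j' - argj c j) < PI * c / 4 -> ZZ c j (ell c j') = (a0 c, j').
Proof.
intros Hc H. assert (E : (ell c j' / ell c j)%C = Cexp (RtoC (2 / c) * (Clog (a0 c, j') - Clog (a0 c, j)))%C).
{ unfold ell, Cpw, Cdiv. rewrite <- Cexp_opp, <- Cexp_add. f_equal. ring. }
apply Rabs_lt_between in H. rewrite ZZ_Cexp by auto. rewrite E, Clog_Cexp.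
- rewrite (aj_exp c j') at 2 by auto. f_equal.
  replace (RtoC (c / 2) * (RtoC (2 / c) * (Clog (a0 c, j') - Clog (a0 c, j))))%C with (RtoC (c / 2 * (2 / c)) * (Clog (a0 c, j') - Clog (a0 c, j)))%C by Cring.
  replace (c / 2 * (2 / c)) with 1 by (field; lra). ring.
- rewrite im_scal_l, Im_sub, !Clog_aj. simpl (Im (_, _)). replace (PI / 2) with (2 / c * (PI * c / 4)) by (field; lra).
  assert (0 < 2 / c) by pos. nra.
Qed.

Lemma ZZ_self c j : 0 < c -> ZZ c j (ell c j) = (a0 c, j).
Proof. intros Hc. apply ZZ_ell; auto. rewrite Rminus_diag, Rabs_R0. pose proof PI_RGT_0. nra. Qed.

Lemma hdC_ZZ c j zeta : 0 < Re (zeta / ell c j)%C -> exists l, hdC (ZZ c j) zeta l.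
Proof. eexists. apply hd_scal. apply (hd_Cpw all_C (fun z => z / ell c j)%C); auto.
apply hd_div; [apply ell_neq0|apply hd_id|apply hd_const].
Qed.

Lemma hdC_ZZ_self c j : 0 < c -> hdC (ZZ c j) (ell c j) ((a0 c, j) * RtoC (c / 2) / ell c j)%C.
Proof.
intros Hc. pose proof (ell_neq0 c j) as N. assert (E1 : (ell c j / ell c j)%C = 1) by (field; auto).
eapply hd_eq; [|unfold ZZ; apply hd_scal; apply (hd_Cpw all_C (fun z => z / ell c j)%C);
  [rewrite E1; simpl; lra|apply hd_div; [auto|apply hd_id|apply hd_const]]].
rewrite E1, Cpw_R, exp_le_id by lra. field. auto.
Qed.

Lemma ct_ell c j eps : 0 < c -> 0 < eps -> exists d, 0 < d /\ forall j', Rabs (j' - j) < d -> Cmod (ell c j' - ell c j)%C < eps.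
Proof.
intros Hc He. destruct (hd_ct _ _ _ _ (hdC_Cpw (a0 c, j) (2 / c) (a0_pos c Hc)) eps He) as [d [Hd H]].
exists d. split; auto. intros j' Hj. apply H; [exact I|].
replace ((a0 c, j') - (a0 c, j))%C with (Ci * RtoC (j' - j))%C by Cring.
rewrite Cmod_mult, Cmod_R. replace (Cmod Ci) with 1; [lra|]. unfold Cmod, Ci; simpl. replace (0 * (0 * 1) + 1 * (1 * 1)) with 1 by ring. rewrite sqrt_1; auto.
Qed.

(** A real factor times [ell / (a0 + i J)]: the second factor is, up to [c / 2], the inverse of the
    derivative of [ZZ], so the chart along the axis has a real derivative. *)
Lemma FF1_axis c eta x : 0 < c -> FF1 c eta (ax x) =
  (RtoC (- (2 * (1 - eta * x) * Rpower (1 + x ^ 2) (c / 2 - 1))) * ell c (JJ c eta x) / (a0 c, JJ c eta x))%C.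
Proof.
intros Hc. set (j := JJ c eta x). set (R0 := Rpower (1 + x ^ 2) (c / 2)). assert (PR : 0 < R0) by pos.
assert (E : (a0 c, j) = (R0 * (kap c (ax x) - Ci * eta))%C).
{ replace (R0 * (kap c (ax x) - Ci * eta))%C
   with (R0 * kap c (ax x) - Ci * RtoC (eta * R0))%C by Cring.
  unfold R0. rewrite kap_axis by auto. unfold j, JJ. Cring. }
assert (Ek : (kap c (ax x) - Ci * eta = RtoC (/ R0) * (a0 c, j))%C).
{ rewrite E, RtoC_inv by lra. field. intro X. apply RtoC_inj in X. lra. }
assert (Nj : (a0 c, j) <> RtoC 0) by (apply Cmod_pos_neq, Cmod_aJ_pos; auto).
unfold FF1. rewrite Ek, Cpw_scal; [|pos|simpl; apply a0_pos; auto].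
assert (Em : Cpw (a0 c, j) (2 / c - 1) = (ell c j / (a0 c, j))%C).
{ unfold ell. rewrite (Cpw_minus1 (a0 c, j) (2 / c)) by (simpl; apply a0_pos; auto). field. auto. }
rewrite Em. assert (Er : Rpower (/ R0) (2 / c - 1) = Rpower (1 + x ^ 2) (c / 2 - 1)).
{ unfold Rpower at 1. rewrite ln_Rinv by auto. unfold R0, Rpower. rewrite ln_exp. f_equal. field. lra. }
rewrite Er, ax_C. Cring.
Qed.

(** ** Interior angles from germs of arcs *)

Definition tends0 (k : R -> C) (p : C) : Prop :=
  forall eps, 0 < eps -> exists d, 0 < d /\ forall s, 0 < s < d -> Cmod (k s - p)%C < eps.

(** A version of [frontier_arc] on [(0, b]] whose endpoint is reached only as a limit, since the
    arcs include the end of [gamma], defined on the open interval. *)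
Definition germ (Om : C -> Prop) (p : C) (k : R -> C) (b beta : R) : Prop :=
  (forall s, 0 < s <= b -> frontier Om (k s) /\ k s <> p) /\
  (forall s eps, 0 < s <= b -> 0 < eps -> exists d, 0 < d /\ forall t, 0 < t <= b -> Rabs (t - s) < d -> Cmod (k t - k s)%C < eps) /\
  (forall s t, 0 < s <= b -> 0 < t <= b -> k s = k t -> s = t) /\
  tends0 k p /\
  tends0 (fun s => (k s - p) / RtoC (Cmod (k s - p)%C))%C (cis beta).

Lemma closure_closed (E : C -> Prop) x : (forall eps, 0 < eps -> exists y, closure E y /\ Cmod (y - x)%C < eps) -> closure E x.
Proof.
intros H eps He. destruct (H (eps / 2) ltac:(lra)) as [y [Hy1 Hy2]]. destruct (Hy1 (eps / 2) ltac:(lra)) as [z [Hz1 Hz2]].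
exists z. split; auto. pose proof (Cmod_triangle_sub z y x). lra.
Qed.

Lemma germ_arc Om p k b beta : 0 < b -> germ Om p k b beta ->
  frontier_arc Om p (fun s => if Rle_dec s 0 then p else k (b * s)) beta.
Proof.
intros Hb [G1 [G2 [G3 [G4 G5]]]].
assert (In : forall s, 0 < s <= 1 -> 0 < b * s <= b) by (intros s Hs; nra).
assert (Nz : forall s, 0 < s -> (if Rle_dec s 0 then p else k (b * s)) = k (b * s)) by (intros s Hs; destruct (Rle_dec s 0); [lra|auto]).
assert (Z : (if Rle_dec 0 0 then p else k (b * 0)) = p) by (destruct (Rle_dec 0 0); [auto|lra]).
split; [auto|]. split; [|split; [|split]].
- intros s Hs P HP. apply nbhd_C in HP. destruct HP as [eps [He HP]].
  destruct (Req_dec s 0) as [->|Hn].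
  + destruct (G4 eps He) as [d [Hd H]]. exists (mkposreal (d / b) ltac:(pos)).
    intros t Ht Dt. apply HP. rewrite Z. change (Rabs (t - 0) < d / b) in Ht.
    destruct (Req_dec t 0) as [->|Ht0]; [rewrite Z; replace (p - p)%C with (RtoC 0) by ring; rewrite Cmod_0; auto|].
    rewrite Nz by lra. apply H. rewrite Rabs_right in Ht by lra. apply Rlt_div_r in Ht; auto. nra.
  + destruct (G2 (b * s) eps (In s ltac:(lra)) He) as [d [Hd H]].
    exists (mkposreal (Rmin s (d / b)) ltac:(pos)).
    intros t Ht Dt. apply HP. change (Rabs (t - s) < Rmin s (d / b)) in Ht.
    assert (T1 := Rlt_le_trans _ _ _ Ht (Rmin_l _ _)). assert (T2 := Rlt_le_trans _ _ _ Ht (Rmin_r _ _)). apply Rabs_lt_between in T1.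
    rewrite !Nz by lra. apply H; [nra|]. replace (b * t - b * s) with (b * (t - s)) by ring.
    rewrite Rabs_mult, (Rabs_right b) by lra. apply Rlt_div_r in T2; auto. lra.
- intros s t Hs Ht E. destruct (Req_dec s 0) as [->|Hs0]; destruct (Req_dec t 0) as [->|Ht0]; auto.
  + rewrite Z, Nz in E by lra. exfalso. destruct (G1 (b * t) (In t ltac:(lra))) as [_ N]. auto.
  + rewrite Z, Nz in E by lra. exfalso. destruct (G1 (b * s) (In s ltac:(lra))) as [_ N]. auto.
  + rewrite !Nz in E by lra. apply G3 in E; try apply In; try lra. nra.
- intros s Hs. destruct (Req_dec s 0) as [->|Hs0]; [|rewrite Nz by lra; apply G1, In; lra].
  rewrite Z. split; apply closure_closed; intros eps He; destruct (G4 eps He) as [d [Hd H]];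
  (exists (k (Rmin b (d / 2))); assert (0 < Rmin b (d / 2)) by pos; pose proof (Rmin_l b (d / 2)); pose proof (Rmin_r b (d / 2));
   split; [apply G1; lra|apply H; lra]).
- intros P HP. apply nbhd_C in HP. destruct HP as [eps [He HP]]. destruct (G5 eps He) as [d [Hd H]].
  exists (mkposreal (d / b) ltac:(pos)). intros t Ht Pt. change (Rabs (t - 0) < d / b) in Ht.
  rewrite Rminus_0_r, Rabs_right in Ht by lra. apply HP. rewrite Nz by lra. apply H. apply Rlt_div_r in Ht; auto. nra.
Qed.

Lemma angle_intro (Om : C -> Prop) p alpha beta ka ba kb bb : 0 <= alpha <= 2 * PI -> 0 < ba -> 0 < bb ->
  germ Om p ka ba beta -> germ Om p kb bb (beta + alpha) ->
  (forall s t, 0 < s <= ba -> 0 < t <= bb -> ka s <> kb t) ->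
  (exists r, 0 < r /\ forall z, frontier Om z -> Cmod (z - p)%C < r ->
     z = p \/ (exists s, 0 < s <= ba /\ z = ka s) \/ (exists s, 0 < s <= bb /\ z = kb s)) ->
  (forall eps, 0 < eps -> exists r, 0 < r /\ forall s phi, 0 < s < r ->
     (beta + eps < phi < beta + alpha - eps -> Om (p + s * cis phi)%C) /\
     (beta + alpha + eps < phi < beta + 2 * PI - eps -> ~ Om (p + s * cis phi)%C)) ->
  interior_angle Om p alpha.
Proof.
intros Ha Hba Hbb Ga Gb Hdis [r [Hr Hcov]] Hsec. split; [lra|].
exists (fun s => if Rle_dec s 0 then p else ka (ba * s)), (fun s => if Rle_dec s 0 then p else kb (bb * s)), beta.
split; [apply germ_arc; auto|]. split; [apply germ_arc; auto|].
assert (Sc : forall b s, 0 < b -> 0 < s <= b -> 0 < s / b <= 1 /\ b * (s / b) = s).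
{ split; [split; [pos|apply Rle_div_l; lra]|field; lra]. }
split; [|split; [|auto]].
- intros s t Hs Ht. destruct (Rle_dec s 0); [lra|]. destruct (Rle_dec t 0); [lra|]. apply Hdis; nra.
- exists r. split; auto. intros z Hz Hzr. destruct (Hcov z Hz Hzr) as [->|[[s [Hs ->]]|[s [Hs ->]]]].
  + exists 0. split; [lra|]. left. destruct (Rle_dec 0 0); [auto|lra].
  + destruct (Sc ba s Hba Hs) as [S1 S2]. exists (s / ba). split; [lra|]. left. destruct (Rle_dec (s / ba) 0); [lra|]. rewrite S2; auto.
  + destruct (Sc bb s Hbb Hs) as [S1 S2]. exists (s / bb). split; [lra|]. right. destruct (Rle_dec (s / bb) 0); [lra|]. rewrite S2; auto.
Qed.

(** One [e] is the hypothesis itself, the other the resulting error of [r] against [|u|]. *)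
Lemma dir_bound (u : C) r beta e : u <> 0 -> 0 <= r -> Cmod (u - r * cis beta)%C <= e * Cmod u ->
  Cmod (u / RtoC (Cmod u) - cis beta)%C <= 2 * e.
Proof.
intros Hu Hr H. assert (P := Cmod_pos u Hu).
assert (N : RtoC (Cmod u) <> 0) by (intro X; apply RtoC_inj in X; lra).
replace (u / RtoC (Cmod u) - cis beta)%C with ((u - RtoC (Cmod u) * cis beta) / RtoC (Cmod u))%C by (field; auto).
rewrite Cmod_div, Cmod_R, Rabs_right by pos. apply Rle_div_l; auto.
assert (Er : Rabs (r - Cmod u) <= e * Cmod u).
{ replace r with (Cmod (r * cis beta)%C) by (rewrite Cmod_mult, Cmod_cis, Cmod_R, Rabs_right; lra).
  pose proof (Cmod_rev_triangle (r * cis beta)%C u) as T1. pose proof (Cmod_rev_triangle u (r * cis beta)%C) as T2.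
  rewrite Cmod_sub_sym in T1. apply Rabs_le_between. lra. }
replace (u - RtoC (Cmod u) * cis beta)%C with ((u - r * cis beta) + RtoC (r - Cmod u) * cis beta)%C by Cring.
eapply Rle_trans; [apply Cmod_triangle|]. rewrite Cmod_mult, Cmod_cis, Cmod_R. lra.
Qed.

Lemma Cmod_Ci : Cmod Ci = 1.
Proof. unfold Cmod, Ci; simpl. replace (0 * (0 * 1) + 1 * (1 * 1)) with 1 by ring. apply sqrt_1. Qed.

Lemma argj_near c j : 0 < c -> exists d, 0 < d /\ forall j', Rabs (j' - j) < d -> Rabs (argj c j' - argj c j) < PI * c / 4.
Proof.
intros Hc. pose proof (a0_pos c Hc) as A. pose proof PI_RGT_0.
assert (C1 : continuity_pt (fun j => atan (j / a0 c)) j).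
{ apply derivable_continuous_pt. exists (/ (1 + (j / a0 c) ^ 2) * / a0 c). apply is_derive_Reals. auto_derive; [lra|]. field. nra. }
destruct (C1 (PI * c / 4)) as [d [Hd H']]; [nra|]. exists d. split; auto. intros j' Hj.
destruct (Req_dec j' j) as [->|N]; [rewrite Rminus_diag, Rabs_R0; nra|]. apply H'. split; [split; [exact I|auto]|auto].
Qed.

Lemma sin_ge_mid e x : 0 < e <= PI / 2 -> e <= x <= PI - e -> sin e <= sin x.
Proof.
intros He Hx. destruct (Rle_lt_dec x (PI / 2)).
- apply sin_incr_1; lra.
- rewrite <- (sin_PI_x x). apply sin_incr_1; lra.
Qed.

Lemma sin_le_mid e x : 0 < e <= PI / 2 -> PI + e <= x <= 2 * PI - e -> sin x <= - sin e.
Proof.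
intros He Hx. replace x with (x - PI + PI) by ring. rewrite neg_sin. pose proof (sin_ge_mid e (x - PI) He ltac:(lra)). lra.
Qed.

(* A half-plane selects one of the two square roots. *)
Lemma dir_sqrt (u n : C) r beta e : u <> 0 -> Cmod n = 1 -> 0 <= r -> 0 <= Re (u * n)%C -> 0 < Re (cis beta * n)%C ->
  Cmod (u * u - r * cis (2 * beta))%C <= e * Cmod u ^ 2 ->
  Cmod (u / RtoC (Cmod u) - cis beta)%C <= 2 * e / Re (cis beta * n)%C.
Proof.
intros Hu Hn Hr H1 H2 H. assert (P := Cmod_pos u Hu). assert (N : RtoC (Cmod u) <> 0) by (intro X; apply RtoC_inj in X; lra).
assert (Muu : Cmod (u * u)%C = Cmod u ^ 2) by (rewrite Cmod_mult; ring). rewrite <- Muu in H.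
apply dir_bound in H; [|apply Cmult_neq_0; auto|auto]. set (q := (u / RtoC (Cmod u))%C).
assert (Eq : (u * u / RtoC (Cmod (u * u)) - cis (2 * beta) = (q - cis beta) * (q + cis beta))%C).
{ rewrite Muu, RtoC_pow. unfold q. replace (2 * beta) with (beta + beta) by ring. rewrite cis_add. field. auto. }
rewrite Eq, Cmod_mult in H. apply Rle_div_r; auto. eapply Rle_trans; [|exact H]. apply Rmult_le_compat_l; [apply Cmod_ge_0|].
pose proof (re_le_Cmod ((q + cis beta) * n)%C) as Q. rewrite Cmod_mult, Hn, Rmult_1_r in Q. eapply Rle_trans; [|exact Q].
replace ((q + cis beta) * n)%C with (q * n + cis beta * n)%C by ring. rewrite re_plus.
assert (0 <= Re (q * n)%C).
{ replace (q * n)%C with (RtoC (/ Cmod u) * (u * n))%C by (unfold q; rewrite RtoC_inv by lra; field; auto).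
  rewrite re_scal_l. apply Rmult_le_pos; [apply Rlt_le, Rinv_0_lt_compat|]; auto. }
rewrite Rabs_right; lra.
Qed.

Lemma seg_sign (f : C -> C) v w1 w2 :
  (forall s, 0 <= s <= 1 -> ct all_C f (w1 + s * (w2 - w1))%C /\ Re (f (w1 + s * (w2 - w1))%C) <> v) ->
  v < Re (f w1) -> v < Re (f w2).
Proof.
intros H H1. set (k := fun s => (w1 + s * (w2 - w1))%C).
assert (Near : forall s, 0 <= s <= 1 -> exists d, 0 < d /\ forall t, 0 <= t <= 1 -> Rabs (t - s) < d ->
  Rabs (Re (f (k t)) - Re (f (k s))) < Rabs (Re (f (k s)) - v)).
{ intros s Hs. destruct (H s Hs) as [A1 A3].
  destruct (A1 (Rabs (Re (f (k s)) - v))) as [d [Hd H2]].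
  - apply Rabs_pos_lt. unfold k. lra.
  - exists (d / (1 + Cmod (w2 - w1)%C)). pose proof (Cmod_ge_0 (w2 - w1)%C). split; [pos|]. intros t _ Ht.
    eapply Rle_lt_trans; [rewrite <- Re_sub; apply re_le_Cmod|]. apply H2; [exact I|]. unfold k.
    replace (w1 + t * (w2 - w1) - (w1 + s * (w2 - w1)))%C with (RtoC (t - s) * (w2 - w1))%C by Cring.
    rewrite Cmod_mult, Cmod_R. apply Rlt_div_r in Ht; [|lra]. nra. }
replace w2 with (k 1) by (unfold k; ring).
apply (interval_clopen (fun s => v < Re (f (k s))) 0 1); [lra| |..].
- replace (k 0) with w1 by (unfold k; ring). exact H1.
- intros s Hs Ps. destruct (Near s Hs) as [d [Hd H2]]. exists d. split; [lra|]. intros t Ht Hts. specialize (H2 t Ht Hts).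
  rewrite (Rabs_right (_ - v)) in H2 by lra. apply Rabs_lt_between in H2. lra.
- intros s Hs Ps. destruct (Near s Hs) as [d [Hd H2]]. exists d. split; [lra|]. intros t Ht Hts. specialize (H2 t Ht Hts).
  rewrite (Rabs_left1 (_ - v)) in H2 by lra. apply Rabs_lt_between in H2. lra.
Qed.

(** [tau] is measured from the counterclockwise tangent at [cis de]; for [s > 0] the point is in the
    disk exactly when [s < 2 sin tau]. *)
Lemma unit_step de s tau : Cmod (cis de + RtoC s * cis (de + PI / 2 + tau))%C ^ 2 = 1 - 2 * s * sin tau + s ^ 2.
Proof.
replace (cis de + s * cis (de + PI / 2 + tau))%C with (cis de * (1 + s * cis (PI / 2 + tau)))%C.
2:{ replace (de + PI / 2 + tau) with (de + (PI / 2 + tau)) by ring. rewrite (cis_add de). ring. }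
rewrite Cmod_mult, Cmod_cis, Rmult_1_l. unfold Cmod. rewrite pow2_sqrt by nra. simpl.
replace (cos (PI / 2 + tau)) with (- sin tau) by (rewrite (sin_cos tau); ring).
replace (sin (PI / 2 + tau)) with (cos tau) by (rewrite cos_sin; reflexivity).
pose proof (sin2_cos2 tau) as E. unfold Rsqr in E. nra.
Qed.

Opaque a0 kap PI.

(** * The component of the origin as a sublevel set of the gauge *)

Section SlitDomain.

Context (c v0 Te : R) (gamma : R -> C) (J : R -> R) (SL : Slit c v0 Te gamma J).

Let eta := tan (v0 / 2).
Let V := cis v0.
Let F := Fm c v0.
Let om (z : C) := to_w (z * cis (- v0)).
Let pt (w : C) := (to_h w * cis v0)%C.

Let Hc : 0 < c := sl_c _ _ _ _ _ SL.
Let Hv : 0 < v0 < PI := sl_v0 _ _ _ _ _ SL.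

Lemma eta_gt0 : 0 < eta.
Proof. apply tan_half_pos, Hv. Qed.

Lemma om_pt w : 0 <= Re w -> om (pt w) = w.
Proof. unfold om, pt. rewrite <- Cmult_assoc, cis_opp_r, Cmult_1_r. apply to_w_h; auto. Qed.

Lemma pt_om z : z <> V -> pt (om z) = z.
Proof.
intros Hz. unfold om, pt. rewrite to_h_w.
- rewrite <- Cmult_assoc, (Cmult_comm (cis (- v0))), cis_opp_r. ring.
- intro X. apply (f_equal (fun y => y * cis v0)%C) in X. rewrite <- Cmult_assoc, (Cmult_comm (cis (- v0))), cis_opp_r in X.
  rewrite Cmult_1_r, Cmult_1_l in X. auto.
Qed.

Lemma Cmod_V : Cmod V = 1.
Proof. apply Cmod_cis. Qed.

Lemma disk_neqV z : disk z -> z <> V.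
Proof. intros Hz ->. unfold disk in Hz. rewrite Cmod_V in Hz. lra. Qed.

Lemma om_pos z : disk z -> 0 < Re (om z).
Proof. apply to_w_rot. Qed.

Lemma pt_disk w : 0 < Re w -> disk (pt w).
Proof. unfold disk, pt. rewrite Cmod_mult, Cmod_cis, Rmult_1_r. apply to_h_lt1; auto. Qed.

Lemma F_om z : F z = FF c eta (om z).
Proof. auto. Qed.

Lemma F_pt w : 0 <= Re w -> F (pt w) = FF c eta w.
Proof. intros Hw. rewrite F_om, om_pt; auto. Qed.

Lemma F_inj z z' : disk z -> disk z' -> F z = F z' -> z = z'.
Proof.
intros Hz Hz' E. rewrite <- (pt_om z), <- (pt_om z') by (apply disk_neqV; auto). f_equal.
apply (FF_inj c eta); auto; [apply eta_gt0|apply om_pos; auto|apply om_pos; auto].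
Qed.

Lemma F_avoid_low z j : disk z -> j <= J 0 -> F z <> ell c j.
Proof.
intros Hz Hj. apply FF_avoid_ell; auto; [apply eta_gt0|apply om_pos; auto|]. rewrite (sl_J0 _ _ _ _ _ SL) in Hj. exact Hj.
Qed.

Lemma F_ell_on_trace z j : disk z -> F z = ell c j -> (c < 1 -> j < TT c) -> exists t, 0 < t < Te /\ J t = j /\ z = gamma t.
Proof.
intros Hz E Hj. destruct (Rle_lt_dec j (J 0)) as [Hl|Hg]; [exfalso; apply (F_avoid_low z j); auto|].
destruct (sl_onto _ _ _ _ _ SL j) as [t [Ht Et]]; auto.
- rewrite <- (sl_J0 _ _ _ _ _ SL). auto.
- exists t. split; auto. split; auto. apply (sl_trace _ _ _ _ _ SL); auto. rewrite Et. auto.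
Qed.

Lemma atan_bound_TT_le j : Rabs (atan (j / a0 c)) <= PI * c / 2 -> c < 1 -> - TT c <= j <= TT c.
Proof.
intros H Hc1. pose proof (a0_pos c Hc) as A. unfold TT.
assert (B : - tan (PI * c / 2) <= j / a0 c <= tan (PI * c / 2)).
{ apply Rabs_le_between in H. rewrite <- tan_neg. rewrite <- (tan_atan (j / a0 c)).
  assert (Mono : forall x y, - (PI / 2) < x -> x <= y -> y < PI / 2 -> tan x <= tan y).
  { intros x y Hx [Hxy|<-] Hy; [left; apply tan_increasing; lra|lra]. }
  split; apply Mono; nra. }
assert (E : j = a0 c * (j / a0 c)) by (field; lra). nra.
Qed.

(** A point whose value is on [ell] with parameter below [TT c] is on the curve. For [c < 1] the
    remaining parameter [TT c] has the same value as [- TT c]. *)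
Lemma gau_ne z : disk z -> (forall t, 0 < t < Te -> z <> gamma t) -> gau c (F z) <> a0 c.
Proof.
intros Hz Hn E. destruct (gau_eq_ell c (F z) Hc E) as [j [Ej Bj]].
assert (G : forall j', F z = ell c j' -> (c < 1 -> j' < TT c) -> False).
{ intros j' E' B'. destruct (F_ell_on_trace z j' Hz E' B') as [t [Ht [_ Et]]]. apply (Hn t); auto. }
destruct (Rlt_le_dec c 1) as [Hc1|Hc1]; [|apply (G j); auto; lra].
pose proof (atan_bound_TT_le j Bj Hc1) as B. destruct (Req_dec j (TT c)) as [->|Hj].
- apply (G (- TT c)); [rewrite Ej; apply ell_TT_opp; lra|]. pose proof (TT_pos c ltac:(lra)). lra.
- apply (G j); auto. lra.
Qed.

Let Om := complement0 (fun t => 0 < t < Te) gamma.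

Lemma open_gau_lt : open (fun z => disk z /\ gau c (F z) < a0 c) /\ open (fun z => disk z /\ a0 c < gau c (F z)).
Proof.
assert (G : forall z eps, disk z -> 0 < eps -> exists d, 0 < d /\ forall y, Cmod (y - z)%C < d -> disk y /\ Rabs (gau c (F y) - gau c (F z)) < eps).
{ intros z eps Hz He. destruct (ct_gau c (F z) Hc eps He) as [d1 [Hd1 H1]].
  destruct (ct_Fm c v0 z Hc Hz d1 Hd1) as [d2 [Hd2 H2]]. unfold disk in *. exists (Rmin d2 (1 - Cmod z)). split; [pos|].
  intros y Hy. assert (Y1 := Rlt_le_trans _ _ _ Hy (Rmin_l _ _)). assert (Y2 := Rlt_le_trans _ _ _ Hy (Rmin_r _ _)). split.
  - pose proof (Cmod_triangle (y - z)%C z) as T1. replace (y - z + z)%C with y in T1 by ring. lra.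
  - apply H1; [exact I|]. apply H2; auto. exact I. }
split; intros z [Hz Hg]; apply nbhd_C.
- destruct (G z (a0 c - gau c (F z)) Hz ltac:(lra)) as [d [Hd H]]. exists d. split; [lra|]. intros y Hy. destruct (H y Hy) as [H1 H2].
  split; [auto|]. apply Rabs_lt_between in H2. lra.
- destruct (G z (gau c (F z) - a0 c) Hz ltac:(lra)) as [d [Hd H]]. exists d. split; [lra|]. intros y Hy. destruct (H y Hy) as [H1 H2].
  split; [auto|]. apply Rabs_lt_between in H2. lra.
Qed.

Lemma F_0 : F 0 = 0.
Proof. rewrite F_om. unfold om. rewrite Cmult_0_l. replace (to_w 0) with (RtoC 1) by (unfold to_w; field; intro X; apply (f_equal Re) in X; simpl in X; lra). Cring. Qed.

Lemma disk_0 : disk 0.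
Proof. unfold disk. rewrite Cmod_0. lra. Qed.

(** The liftable factors form an open set because [F] is open, and a closed one because a limit on
    the axis would have [gau >= a0], whereas the shrunk value has [gau < a0]. The interval is
    parametrized by [- s] since the known lift is at [s = 1]. *)
Lemma ray_lift z s : disk z -> gau c (F z) < a0 c -> 0 <= s <= 1 -> exists y, disk y /\ F y = (s * F z)%C.
Proof.
intros Hz Hg Hs.
replace s with (- - s) by ring. apply (interval_clopen (fun x => exists y, disk y /\ F y = (RtoC (- x) * F z)%C) (- (1)) (- s)); [lra| |..].
- exists z. split; auto. Cring.
- intros x Hx [y [Hy E]]. destruct (Fm_open c v0 y 1 Hc Hv Hy ltac:(lra)) as [d [Hd H]]. pose proof (Cmod_ge_0 (F z)).
  exists (d / (1 + Cmod (F z))). split; [pos|]. intros x' _ Hx'.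
  destruct (H (RtoC (- x') * F z)%C) as [y' [Y1 [_ Y2]]]; [|exists y'; auto].
  fold F. rewrite E. replace (RtoC (- x') * F z - RtoC (- x) * F z)%C with (RtoC (- (x' - x)) * F z)%C by Cring.
  rewrite Cmod_mult, Cmod_R, Rabs_Ropp. apply Rlt_div_r in Hx'; [|lra]. nra.
- intros x Hx Hno. apply NNPP. intro Hac.
  assert (Hseq : forall n : nat, exists w, 0 < Re w /\ exists x', - (1) <= x' <= - s /\ Rabs (x' - x) < / (INR n + 1) /\ FF c eta w = (RtoC (- x') * F z)%C).
  { intro n. apply NNPP. intro Hn'. apply Hac. exists (/ (INR n + 1)). split; [apply Rinv_0_lt_compat; pose proof (pos_INR n); lra|].
    intros x' Hx' Hxx [y [Hy E]]. apply Hn'. exists (om y). split; [apply om_pos; auto|]. exists x'. auto. }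
  apply functional_choice in Hseq. destruct Hseq as [w Hw].
  destruct (FF_inf c eta (Cmod (F z)) Hc eta_gt0) as [M [HM HMw]].
  destruct (FF_cluster c eta w M (RtoC (- x) * F z)%C Hc) as [l [L1 [L2 _]]].
  + intro n. destruct (Hw n) as [W1 [x' [W2 [W3 W4]]]]. split; [lra|]. apply Rnot_lt_le. intro Hlt.
    specialize (HMw (w n) ltac:(lra) ltac:(lra)). rewrite W4, Cmod_mult, Cmod_R, Rabs_right in HMw by lra. pose proof (Cmod_ge_0 (F z)). nra.
  + intros eps He. pose proof (Cmod_ge_0 (F z)). destruct (inv_INR_small (eps / (1 + Cmod (F z)))) as [N HN]; [pos|].
    exists N. intros n Hn'. specialize (HN n Hn'). destruct (Hw n) as [W1 [x' [W2 [W3 W4]]]]. rewrite W4.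
    replace (RtoC (- x') * F z - RtoC (- x) * F z)%C with (RtoC (- (x' - x)) * F z)%C by Cring.
    rewrite Cmod_mult, Cmod_R, Rabs_Ropp. assert (Q : Rabs (x' - x) < eps / (1 + Cmod (F z))) by lra. apply Rlt_div_r in Q; [|lra]. nra.
  + destruct (Rle_lt_or_eq_dec _ _ L1) as [Hp|H0].
    * apply Hno. exists (pt l). split; [apply pt_disk; auto|]. rewrite F_pt; auto.
    * assert (El : l = ax (- Im l)) by (unfold ax; apply C_eq; simpl; unfold Re, Im in *; lra).
      rewrite El, FF_axis in L2 by auto. pose proof (gau_ell_ge c (JJ c eta (- Im l)) Hc) as G. rewrite L2 in G.
      pose proof (gau_shrink c (- x) (F z) Hc ltac:(lra) Hg). lra.
Qed.

(** From left to right, the two sides of [gau = a0] are open and [gau_ne] forbids crossing. From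
    right to left, the lifted ray joins [z] to [0] and misses the curve, on which [gau >= a0]. *)
Lemma Om_iff z : Om z <-> disk z /\ gau c (F z) < a0 c.
Proof.
split.
- intros [A [HA [AE [A0 Az]]]].
  assert (Cov : forall y, A y -> (disk y /\ gau c (F y) < a0 c) \/ (disk y /\ a0 c < gau c (F y))).
  { intros y Ay. destruct (AE y Ay) as [Y1 Y2]. destruct (Rtotal_order (gau c (F y)) (a0 c)) as [|[E|]]; auto. exfalso.
    apply (gau_ne y); auto. intros t Ht X. apply Y2. exists t. auto. }
  destruct (Cov z Az) as [|Hz]; auto.
  destruct (HA (fun z => disk z /\ gau c (F z) < a0 c) (fun z => disk z /\ a0 c < gau c (F z))) as [y [_ [[_ Y1] [_ Y2]]]]; try apply open_gau_lt; auto.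
  + exists 0. split; auto. split; [apply disk_0|]. rewrite F_0, gau_0. apply a0_pos; auto.
  + eauto.
  + lra.
- intros [Hz Hg].
  assert (Hk : forall s, exists y, 0 <= s <= 1 -> disk y /\ F y = (s * F z)%C).
  { intro s. destruct (classic (0 <= s <= 1)) as [Hs|Hs]; [destruct (ray_lift z s Hz Hg Hs) as [y Hy]; exists y; auto|exists 0; intro; contradiction]. }
  apply functional_choice in Hk. destruct Hk as [k Hk].
  exists (fun y => exists s, 0 <= s <= 1 /\ y = k s). split; [|split; [|split]].
  + apply connected_curve. intros s Hs eps He. destruct (Hk s Hs) as [K1 K2].
    destruct (Fm_open c v0 (k s) eps Hc Hv K1 He) as [d [Hd H]]. pose proof (Cmod_ge_0 (F z)).
    exists (d / (1 + Cmod (F z))). split; [pos|]. intros t Ht Hts. destruct (Hk t Ht) as [K3 K4].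
    destruct (H (F (k t))) as [y' [Y1 [Y2 Y3]]].
    * fold F. rewrite K2, K4. replace (t * F z - s * F z)%C with (RtoC (t - s) * F z)%C by Cring.
      rewrite Cmod_mult, Cmod_R. apply Rlt_div_r in Hts; [|lra]. nra.
    * apply F_inj in Y3; auto. subst y'. auto.
  + intros y [s [Hs ->]]. destruct (Hk s Hs) as [K1 K2]. split; [auto|]. intros [t [Ht X]].
    pose proof (gau_shrink c s (F z) Hc Hs Hg) as G. rewrite <- K2, X in G. unfold F in G. rewrite (sl_F _ _ _ _ _ SL t Ht) in G.
    pose proof (gau_ell_ge c (J t) Hc). lra.
  + exists 0. split; [lra|]. destruct (Hk 0 ltac:(lra)) as [K1 K2]. apply F_inj; [apply disk_0|auto|]. rewrite F_0, K2. ring.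
  + exists 1. split; [lra|]. destruct (Hk 1 ltac:(lra)) as [K1 K2]. apply F_inj; [auto|auto|]. rewrite K2. ring.
Qed.

(** ** Boundary points *)

Let jx x := JJ c eta x.
Let jd x := c * (1 - eta * x) * Rpower (1 + x ^ 2) (c / 2 - 1).

(** Along [w = - i x] the chart moves vertically with speed [jd x], so its derivative in [w] is
    real; the sign of [jd] tells on which side of the line [Re = a0] the half-plane is mapped. *)
Lemma chart_axis x : hdC (FF c eta) (ax x) (FF1 c eta (ax x)) /\ hdC (fun w => ZZ c (jx x) (FF c eta w)) (ax x) (RtoC (- jd x)).
Proof.
assert (D : hdC (FF c eta) (ax x) (FF1 c eta (ax x))) by (apply FF_hd; [lra|simpl; lra]). split; auto.
assert (N : (a0 c, jx x) <> RtoC 0) by (apply Cmod_pos_neq, Cmod_aJ_pos, Hc).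
eapply hd_eq; [|apply (hdC_comp all_C (ZZ c (jx x)) (FF c eta) (ax x)); [rewrite FF_axis by exact Hc; apply hdC_ZZ_self, Hc|exact D]].
rewrite FF1_axis by lra. set (R1 := Rpower (1 + x ^ 2) (c / 2 - 1)). pose proof (ell_neq0 c (jx x)) as Ne.
transitivity (RtoC (c / 2) * RtoC (- (2 * (1 - eta * x) * R1)))%C; [field; auto|].
rewrite <- RtoC_mult. f_equal. unfold jd, R1. field.
Qed.

Lemma ct_pt w : 0 <= Re w -> ct all_C pt w.
Proof. intros Hw. apply ct_mult; [eapply hd_ct, hdC_to_h; auto|apply ct_const]. Qed.

Lemma Re_ax_plus x t : Re (ax x + RtoC t)%C = t.
Proof. simpl. ring. Qed.

Lemma Cmod_ax_plus x t : Cmod (ax x + RtoC t - ax x)%C = Rabs t.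
Proof. replace (ax x + t - ax x)%C with (RtoC t) by ring. apply Cmod_R. Qed.

Lemma chart_inward x : jd x <> 0 -> exists d, 0 < d /\ forall t, 0 < t < d ->
  (0 < jd x -> Re (ZZ c (jx x) (FF c eta (ax x + t))) < a0 c) /\
  (jd x < 0 -> a0 c < Re (ZZ c (jx x) (FF c eta (ax x + t)))).
Proof.
intros Hn. destruct (chart_axis x) as [_ D]. assert (Hp : 0 < Rabs (jd x)) by (apply Rabs_pos_lt; auto).
destruct (D (Rabs (jd x) / 2) ltac:(lra)) as [d [Hd H]]. exists d. split; [lra|]. intros t Ht.
specialize (H (ax x + t)%C I). rewrite Cmod_ax_plus, Rabs_right in H by lra. specialize (H ltac:(lra)).
rewrite FF_axis, ZZ_self in H by lra.
replace (ax x + t - ax x)%C with (RtoC t) in H by ring. rewrite <- RtoC_mult in H.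
eapply Rle_trans in H; [|apply re_le_Cmod]. rewrite !Re_sub in H. simpl (Re (RtoC _)) in H. simpl (Re (_, _)) in H.
apply Rabs_le_between in H. split; intros Hs; [rewrite (Rabs_right (jd x)) in H by lra|rewrite (Rabs_left (jd x)) in H by lra]; nra.
Qed.

Lemma closure_bdry x : 0 < jd x -> Rabs (argj c (jx x)) < PI * c / 2 -> closure Om (pt (ax x)).
Proof.
intros Hj Ha eps He. destruct (chart_inward x ltac:(lra)) as [d1 [Hd1 H1]].
destruct (ZZ_eq c (jx x) Hc Ha) as [d2 [Hd2 H2]].
destruct (hd_ct _ _ _ _ (proj1 (chart_axis x)) d2 Hd2) as [d3 [Hd3 H3]].
destruct (ct_pt (ax x) ltac:(simpl; lra) eps He) as [d4 [Hd4 H4]].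
set (t := Rmin d1 (Rmin d3 d4) / 2). assert (Hm : 0 < Rmin d1 (Rmin d3 d4)) by pos.
assert (M1 : Rmin d1 (Rmin d3 d4) <= d1) by rmin.
assert (M3 : Rmin d1 (Rmin d3 d4) <= d3) by (eapply Rle_trans; [apply Rmin_r|rmin]).
assert (M4 : Rmin d1 (Rmin d3 d4) <= d4) by (eapply Rle_trans; [apply Rmin_r|rmin]).
assert (Ht : Cmod (ax x + t - ax x)%C = t) by (rewrite Cmod_ax_plus, Rabs_right; unfold t; lra).
exists (pt (ax x + t)%C). split.
- apply Om_iff. assert (0 < Re (ax x + t)%C) by (rewrite Re_ax_plus; unfold t; lra). split; [apply pt_disk; auto|].
  rewrite F_pt by lra. rewrite H2; [apply H1; auto; unfold t; lra|]. unfold jx. rewrite <- FF_axis by lra. apply H3; [exact I|]. rewrite Ht. unfold t; lra.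
- apply H4; [exact I|]. rewrite Ht. unfold t; lra.
Qed.

Lemma ct_ZF j w : 0 <= Re w -> 0 < Re (FF c eta w / ell c j)%C -> ct all_C (fun w => ZZ c j (FF c eta w)) w.
Proof.
intros Hw Hq. destruct (hdC_ZZ c j (FF c eta w) Hq) as [l Hl].
eapply hd_ct, (hdC_comp all_C (ZZ c j) (FF c eta)); [exact Hl|]. apply FF_hd; auto.
Qed.

Lemma J0_jx : J 0 = jx (/ eta).
Proof. rewrite (sl_J0 _ _ _ _ _ SL). unfold tipJ, jx. rewrite Rinv_inv. auto. Qed.

(** Beyond the driving point [jd < 0], so the chart starts above [a0] when entering the half-plane.
    It stays there in a whole half-neighbourhood: returning to the line would give a value [ell c j]
    with [j < J 0], excluded by [F_avoid_low]. *)
Lemma bdry_outside x : / eta < x -> exists r, 0 < r /\ forall w, 0 < Re w -> Cmod (w - ax x)%C < r -> a0 c < gau c (FF c eta w).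
Proof.
intros Hx. pose proof eta_gt0 as He. assert (Hex : 1 < eta * x). { apply (Rmult_lt_compat_l eta) in Hx; auto. rewrite Rinv_r in Hx; lra. }
assert (Hj : jd x < 0). { unfold jd. pose proof (pw_pos x (c / 2 - 1)). assert (c * (1 - eta * x) < 0) by nra. nra. }
destruct (chart_inward x ltac:(lra)) as [d1 [Hd1 H1]].
assert (Hj0 : jx x < J 0). { rewrite J0_jx. apply JJ_decr; auto. lra. }
destruct (ZZ_le c (jx x) Hc) as [d2 [Hd2 H2]].
destruct (hd_ct _ _ _ _ (proj1 (chart_axis x)) d2 Hd2) as [d3 [Hd3 H3]].
destruct (hd_ct _ _ _ _ (proj2 (chart_axis x)) (J 0 - jx x) ltac:(lra)) as [d4 [Hd4 H4]].
set (r := Rmin d1 (Rmin d3 d4)). assert (Hr : 0 < r) by pos.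
assert (M1 : r <= d1) by apply Rmin_l.
assert (M3 : r <= d3) by (eapply Rle_trans; [apply Rmin_r|rmin]).
assert (M4 : r <= d4) by (eapply Rle_trans; [apply Rmin_r|rmin]).
exists r. split; [lra|]. intros w Hw Hwr.
assert (G : forall y, 0 < Re y -> Cmod (y - ax x)%C < r -> 0 < Re (FF c eta y / ell c (jx x))%C /\ Re (ZZ c (jx x) (FF c eta y)) <= gau c (FF c eta y) /\
  Re (ZZ c (jx x) (FF c eta y)) <> a0 c).
{ intros y Hy Hyr. specialize (H3 y I ltac:(lra)). rewrite FF_axis in H3 by lra. destruct (H2 _ H3) as [B1 [B2 B3]]. split; auto. split; auto.
  intro E. specialize (H4 y I ltac:(lra)). rewrite FF_axis, ZZ_self in H4 by lra.
  apply (F_avoid_low (pt y) (Im (ZZ c (jx x) (FF c eta y)))); [apply pt_disk; auto| |rewrite F_pt by lra; auto].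
  eapply Rle_lt_trans in H4; [|apply Im_le_Cmod]. rewrite Im_sub in H4. simpl (Im (_, _)) in H4. fold (jx x) in H4. apply Rabs_lt_between in H4. lra. }
destruct (G w Hw Hwr) as [_ [B2 _]]. eapply Rlt_le_trans; [|exact B2].
set (w1 := (ax x + RtoC (r / 2))%C).
assert (W1 : Cmod (w1 - ax x)%C < r) by (unfold w1; rewrite Cmod_ax_plus, Rabs_right; lra).
apply (seg_sign (fun w => ZZ c (jx x) (FF c eta w)) (a0 c) w1 w).
- intros s Hs. assert (Hb : Cmod (w1 + s * (w - w1) - ax x)%C < r) by (apply ball_segment; auto).
  assert (Hp : 0 < Re (w1 + s * (w - w1))%C).
  { rewrite re_plus, re_scal_l, Re_sub. assert (Re w1 = r / 2) by apply Re_ax_plus. nra. }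
  destruct (G _ Hp Hb) as [C1 [C2 C3]]. split; [apply ct_ZF; [lra|lra]|lra].
- apply H1; auto. lra.
Qed.

Lemma om_ge z : Cmod z <= 1 -> z <> V -> 0 <= Re (om z).
Proof.
intros Hz Hn. unfold om. assert (N : (z * cis (- v0))%C <> 1).
{ intro X. apply (f_equal (fun y => y * cis v0)%C) in X. rewrite <- Cmult_assoc, (Cmult_comm (cis (- v0))), cis_opp_r, Cmult_1_r, Cmult_1_l in X. auto. }
rewrite to_w_Re by auto. rewrite Cmod_mult, Cmod_cis, Rmult_1_r.
apply Rdiv_le_0_compat; [pose proof (Cmod_ge_0 z); nra|]. apply pow_lt, Cmod_pos. intro X. apply N. symmetry. apply Csub_0. auto.
Qed.

Lemma om_1 : om 1 = ax (/ eta).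
Proof.
unfold om, to_w. rewrite Cmult_1_l. rewrite <- cis_0, cis_ratio. replace ((0 - - v0) / 2) with (v0 / 2) by lra. unfold eta, tan, cot. rewrite Rinv_div. Cring.
Qed.

Lemma V_neq1 : RtoC 1 <> V.
Proof. intro E. apply (f_equal Im) in E. simpl in E. pose proof (sin_gt_0 v0 (proj1 Hv) (proj2 Hv)). lra.
Qed.

Lemma hdC_om z : z <> V -> exists l, l <> RtoC 0 /\ hdC om z l /\ (RtoC 2 * V * l = (om z + 1) * (om z + 1))%C.
Proof.
intros Hz. assert (N : (z * cis (- v0))%C <> 1).
{ intro X. apply (f_equal (fun y => y * cis v0)%C) in X. rewrite <- Cmult_assoc, (Cmult_comm (cis (- v0))), cis_opp_r, Cmult_1_r, Cmult_1_l in X. auto. }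
assert (N1 : (1 - z * cis (- v0))%C <> 0) by (intro X; apply N; symmetry; apply Csub_0; auto).
assert (N2 : cis (- v0) <> 0) by (apply Cmod_pos_neq; rewrite Cmod_cis; lra).
exists (2 / ((1 - z * cis (- v0)) * (1 - z * cis (- v0))) * cis (- v0))%C. split; [|split].
- apply Cmult_neq_0; auto. intro X. apply (f_equal (fun y => y * ((1 - z * cis (- v0)) * (1 - z * cis (- v0))))%C) in X.
  rewrite Cmult_0_l in X. replace (2 / ((1 - z * cis (- v0)) * (1 - z * cis (- v0))) * ((1 - z * cis (- v0)) * (1 - z * cis (- v0))))%C with (RtoC 2) in X by (field; auto).
  apply RtoC_inj in X. lra.
- eapply hd_eq; [|apply (hdC_comp all_C to_w (fun z => (z * cis (- v0))%C)); [apply hdC_to_w; auto|apply hd_mult; [apply hd_id|apply hd_const]]].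
  Cring.
- unfold om, to_w, V. set (h := (z * cis (- v0))%C) in *. transitivity (4 * (cis v0 * cis (- v0)) / ((1 - h) * (1 - h)))%C.
  + Cring.
  + rewrite cis_opp_r. field; auto.
Qed.

(** ** The endpoint when [c < 1] *)

Lemma om_gamma t : 0 < t < Te -> 0 < Re (om (gamma t)) /\ FF c eta (om (gamma t)) = ell c (J t).
Proof.
intros Ht. split; [apply om_pos, (sl_disk _ _ _ _ _ SL); exact Ht|]. apply (sl_F _ _ _ _ _ SL). exact Ht.
Qed.

Lemma jx_left x y : x < y <= / eta -> jx x < jx y.
Proof. apply JJ_incr; [lra|exact eta_gt0]. Qed.

Lemma jx_max x : x <> / eta -> jx x < J 0.
Proof.
intros Hx. rewrite J0_jx. destruct (Rtotal_order x (/ eta)) as [H|[H|H]]; [apply jx_left; lra|lra|].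
apply JJ_decr; [lra|exact eta_gt0|lra].
Qed.

Lemma J_inj s t : 0 <= s < Te -> 0 <= t < Te -> J s = J t -> s = t.
Proof.
intros Hs Ht E. destruct (Rtotal_order s t) as [H|[H|H]]; [|lra|];
pose proof (sl_incr _ _ _ _ _ SL) as Q; [specialize (Q s t)|specialize (Q t s)]; specialize (Q ltac:(lra) ltac:(lra)); lra.
Qed.

Lemma KK_opp x : KK c (- x) = - KK c x.
Proof.
unfold KK. replace (ax (- x)) with (Cconj (ax x)) by auto.
rewrite kap_conj; [|lra|simpl; lra]. replace ((- x) ^ 2) with (x ^ 2) by ring. unfold Cconj. simpl (Im (_, _)). unfold Im. ring.
Qed.

Lemma J0_bound t : 0 < t < Te -> J 0 < J t.
Proof. intros Ht. apply (sl_incr _ _ _ _ _ SL); lra. Qed.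

Lemma Om_not_trace t : 0 < t < Te -> ~ Om (gamma t).
Proof.
intros Ht HO. apply Om_iff in HO. unfold F in HO. rewrite (sl_F _ _ _ _ _ SL t Ht) in HO.
pose proof (gau_ell_ge c (J t) Hc). lra.
Qed.

Lemma closure_self (E : C -> Prop) z : E z -> closure E z.
Proof. intros Ez eps He. exists z. split; [auto|]. replace (z - z)%C with (RtoC 0) by ring. rewrite Cmod_0. exact He. Qed.

(** The values [s * ell c (J t)], with [s] slightly below [1], have a smaller gauge and lift to
    points of [Om] near [gamma t]. *)
Lemma gamma_frontier t : 0 < t < Te -> gau c (ell c (J t)) = a0 c -> frontier Om (gamma t).
Proof.
intros Ht Hg. pose proof (sl_disk _ _ _ _ _ SL t Ht) as Dk. split; [|apply closure_self, Om_not_trace; exact Ht].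
intros eps He. destruct (Fm_open c v0 (gamma t) eps Hc Hv Dk He) as [d [Hd H]]. rewrite (sl_F _ _ _ _ _ SL t Ht) in H.
set (L := ell c (J t)) in *. pose proof (Cmod_ge_0 L) as PL. pose proof (a0_pos c Hc) as A.
set (s := 1 - Rmin (1 / 2) (d / 2 / (1 + Cmod L))).
assert (S0 : 0 < Rmin (1 / 2) (d / 2 / (1 + Cmod L))) by pos.
assert (S1 : Rmin (1 / 2) (d / 2 / (1 + Cmod L)) <= 1 / 2) by rmin.
assert (S2 : Rmin (1 / 2) (d / 2 / (1 + Cmod L)) <= d / 2 / (1 + Cmod L)) by apply Rmin_r. apply Rle_div_r in S2; [|lra].
destruct (H (s * L)%C) as [z [Z1 [Z2 Z3]]].
- replace (s * L - L)%C with (RtoC (s - 1) * L)%C by Cring.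
  rewrite Cmod_mult, Cmod_R, Rabs_left by (unfold s; lra). unfold s. nra.
- exists z. split; [|lra]. apply Om_iff. split; [auto|]. unfold F. rewrite Z3, gau_scal by (exact Hc || (unfold s; lra)).
  assert (Rpower s (c / 2) < 1); [|nra]. rewrite <- exp_0. apply exp_increasing.
  assert (ln s < 0) by (rewrite <- ln_1; apply ln_increasing; unfold s; lra). nra.
Qed.

Lemma hdC_F z : z <> V -> Cmod z <= 1 -> exists l, l <> RtoC 0 /\ (RtoC 2 * V * l = (om z + 1) * (om z + 1))%C /\ hdC om z l /\ hdC F z (FF1 c eta (om z) * l)%C.
Proof.
intros Hz H1. destruct (hdC_om z Hz) as [l [L1 [L2 L3]]]. exists l. split; [auto|]. split; [auto|]. split; [auto|].
change (hdC (fun z => FF c eta (om z)) z (FF1 c eta (om z) * l)%C).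
apply (hdC_comp all_C (FF c eta) om z); [|auto]. apply FF_hd; [lra|apply om_ge; [lra|auto]].
Qed.

Lemma frontier_value z : frontier Om z -> z <> V -> Cmod z <= 1 /\ gau c (F z) <= a0 c /\ (disk z -> gau c (F z) = a0 c).
Proof.
intros [F1 F2] Hz. assert (H1 : Cmod z <= 1).
{ apply Rnot_lt_le. intro Hlt. destruct (F1 (Cmod z - 1) ltac:(lra)) as [y [Y1 Y2]]. apply Om_iff in Y1. unfold disk in Y1.
  pose proof (Cmod_rev_triangle z y). rewrite Cmod_sub_sym in Y2. lra. }
destruct (hdC_F z Hz H1) as [l [_ [_ [_ D]]]]. pose proof (hd_ct _ _ _ _ D) as CF.
assert (G : forall eps, 0 < eps -> exists d, 0 < d /\ forall y, Cmod (y - z)%C < d -> Rabs (gau c (F y) - gau c (F z)) < eps).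
{ intros eps He. destruct (ct_gau c (F z) Hc eps He) as [d1 [Hd1 G1]]. destruct (CF d1 Hd1) as [d [Hd G2]]. exists d. split; [lra|].
  intros y Hy. apply G1; [exact I|]. apply G2; [exact I|lra]. }
split; [lra|].
assert (G1 : gau c (F z) <= a0 c).
{ apply Rnot_lt_le. intro Hlt. destruct (G (gau c (F z) - a0 c) ltac:(lra)) as [d [Hd H]]. destruct (F1 d Hd) as [y [Y1 Y2]].
  specialize (H y Y2). apply Om_iff in Y1. apply Rabs_lt_between in H. lra. }
split; [lra|]. intros Dk. unfold disk in Dk. apply Rle_antisym; [lra|]. apply Rnot_lt_le. intro Hlt.
destruct (G (a0 c - gau c (F z)) ltac:(lra)) as [d [Hd H]]. destruct (F2 (Rmin d (1 - Cmod z)) ltac:(pos)) as [y [Y1 Y2]].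
assert (Y3 := Rlt_le_trans _ _ _ Y2 (Rmin_l _ _)). assert (Y4 := Rlt_le_trans _ _ _ Y2 (Rmin_r _ _)). specialize (H y Y3). apply Rabs_lt_between in H.
apply Y1, Om_iff. split; [|lra]. unfold disk. pose proof (Cmod_triangle (y - z)%C z) as T1. replace (y - z + z)%C with y in T1 by ring. lra.
Qed.

(** [sg] is the direction of time: [1] for the arc leaving at time [s1], [-1] for the arc arriving
    at time [s1], followed backwards. *)
Lemma gamma_germ p s1 sg b beta : sg = 1 \/ sg = -1 ->
  (forall s, 0 < s <= b -> 0 < s1 + sg * s < Te /\ gamma (s1 + sg * s) <> p /\ gau c (ell c (J (s1 + sg * s))) = a0 c) ->
  tends0 (fun s => gamma (s1 + sg * s)) p ->
  tends0 (fun s => (gamma (s1 + sg * s) - p) / RtoC (Cmod (gamma (s1 + sg * s) - p)%C))%C (cis beta) ->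
  germ Om p (fun s => gamma (s1 + sg * s)) b beta.
Proof.
intros Hsg H T1 T2. split; [|split; [|split; [|auto]]].
- intros s Hs. destruct (H s Hs) as [A1 [A2 A3]]. split; [apply gamma_frontier; [lra|lra]|auto].
- intros s eps Hs He. destruct (H s Hs) as [A1 _]. destruct (sl_cont _ _ _ _ _ SL _ eps A1 He) as [d [Hd Q]]. exists d. split; [lra|].
  intros t Ht Hts. destruct (H t Ht) as [B1 _]. apply Q; [lra|]. replace (s1 + sg * t - (s1 + sg * s)) with (sg * (t - s)) by ring.
  rewrite Rabs_mult. destruct Hsg as [->| ->]; [rewrite Rabs_R1|rewrite Rabs_left by lra]; lra.
- intros s t Hs Ht E. destruct (H s Hs) as [A1 _]. destruct (H t Ht) as [B1 _]. apply (sl_inj _ _ _ _ _ SL) in E; [|lra|lra].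
  nra.
Qed.

Lemma circle_germ p X b beta :
  (forall s, 0 < s <= b -> 0 < jd (X s) /\ Rabs (argj c (jx (X s))) < PI * c / 2 /\ pt (ax (X s)) <> p) ->
  (forall s eps, 0 < s <= b -> 0 < eps -> exists d, 0 < d /\ forall t, 0 < t <= b -> Rabs (t - s) < d -> Rabs (X t - X s) < eps) ->
  (forall s t, 0 < s <= b -> 0 < t <= b -> X s = X t -> s = t) ->
  tends0 (fun s => pt (ax (X s))) p ->
  tends0 (fun s => (pt (ax (X s)) - p) / RtoC (Cmod (pt (ax (X s)) - p)%C))%C (cis beta) ->
  germ Om p (fun s => pt (ax (X s))) b beta.
Proof.
intros H HX1 HX2 T1 T2. split; [|split; [|split; [|auto]]].
- intros s Hs. destruct (H s Hs) as [A1 [A2 A3]]. split; [|auto]. split; [apply closure_bdry; [lra|lra]|].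
  apply closure_self. intro HO. apply Om_iff in HO. destruct HO as [HO _]. apply om_pos in HO. rewrite om_pt in HO by (simpl; lra). simpl in HO. lra.
- intros s eps Hs He. destruct (ct_pt (ax (X s)) ltac:(simpl; lra) eps He) as [d1 [Hd1 Q1]]. destruct (HX1 s d1 Hs Hd1) as [d [Hd Q]]. exists d. split; [lra|].
  intros t Ht Hts. apply Q1; [exact I|]. specialize (Q t Ht Hts). rewrite !ax_C. replace (- Ci * RtoC (X t) - - Ci * RtoC (X s))%C with (- Ci * RtoC (X t - X s))%C by Cring.
  rewrite Cmod_mult, Cmod_opp, Cmod_R. replace (Cmod Ci) with 1; [lra|]. unfold Cmod, Ci; simpl. replace (0 * (0 * 1) + 1 * (1 * 1)) with 1 by ring. rewrite sqrt_1; reflexivity.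
- intros s t Hs Ht E. apply HX2; [lra|lra|]. apply (f_equal om) in E. rewrite !om_pt in E by (simpl; lra). apply (f_equal Im) in E. simpl in E. lra.
Qed.

(** In the chart the arc runs along the line [Re = a0], upwards or downwards according to [sg];
    dividing by the derivative [m cis th] subtracts [th] from this direction. *)
Lemma arc_dir p jj m th sg k j b : 0 < m -> hdC (fun z => ZZ c jj (F z)) p (m * cis th)%C -> ZZ c jj (F p) = (a0 c, jj) ->
  tends0 k p -> sg = 1 \/ sg = -1 -> 0 < b -> (forall s, 0 < s < b -> k s <> p /\ F (k s) = ell c (j s) /\ 0 <= sg * (j s - jj)) ->
  (forall e, 0 < e -> exists d, 0 < d /\ forall s, 0 < s < d -> Rabs (j s - jj) < e) ->
  tends0 (fun s => (k s - p) / RtoC (Cmod (k s - p)%C))%C (cis (sg * (PI / 2) - th)).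
Proof.
intros Hm D Ep Hk Hsg Hb H Hj eps He. destruct (D (m * (eps / 4)) ltac:(nra)) as [d1 [Hd1 H1]].
destruct (Hk d1 Hd1) as [d2 [Hd2 H2]]. destruct (argj_near c jj Hc) as [d3 [Hd3 H3]]. destruct (Hj d3 Hd3) as [d4 [Hd4 H4]].
exists (Rmin b (Rmin d2 d4)). split; [pos|]. intros s Hs.
assert (S1 : s < b) by rmin.
assert (S2 : s < d2) by rmin.
assert (S4 : s < d4) by rmin.
destruct (H s ltac:(lra)) as [A1 [A2 A3]]. specialize (H1 (k s) I (H2 s ltac:(lra))).
rewrite A2, Ep, ZZ_ell in H1 by (exact Hc || apply H3, H4; lra). set (u := (k s - p)%C) in *.
assert (Hu : u <> 0) by (intro X; apply A1, Csub_0; exact X).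
set (r := sg * (j s - jj) / m).
eapply Rle_lt_trans; [apply dir_bound with (r := r) (e := eps / 4); [auto|unfold r; apply Rdiv_le_0_compat; assumption|]|lra].
assert (Ei : (sg * Ci = cis (sg * (PI / 2)))%C).
{ destruct Hsg as [->| ->]; unfold cis; [rewrite Rmult_1_l, cos_PI2, sin_PI2|replace (-1 * (PI / 2)) with (- (PI / 2)) by ring; rewrite cos_neg, sin_neg, cos_PI2, sin_PI2]; apply C_eq; simpl; ring. }
assert (Es : sg * sg = 1) by nra.
replace (u - r * cis (sg * (PI / 2) - th))%C with (- (RtoC (/ m) * cis (- th)) * ((a0 c, j s) - (a0 c, jj) - m * cis th * u))%C.
- rewrite Cmod_mult, Cmod_opp, Cmod_mult, Cmod_R, Cmod_cis, Rabs_right by (apply Rle_ge, Rlt_le, Rinv_0_lt_compat; exact Hm).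
  apply (Rmult_le_reg_l m); [lra|]. rewrite Rmult_1_r, <- Rmult_assoc, Rinv_r, Rmult_1_l by lra. lra.
- replace ((a0 c, j s) - (a0 c, jj))%C with (RtoC (j s - jj) * Ci)%C by Cring.
  replace (sg * (PI / 2) - th) with (sg * (PI / 2) + - th) by ring. rewrite cis_add, <- Ei.
  assert (Et : (cis th * cis (- th) = 1)%C) by apply cis_opp_r.
  assert (Em : (RtoC (/ m) * m = 1)%C) by (rewrite <- RtoC_mult; f_equal; field; lra).
  transitivity ((RtoC (/ m) * m) * (cis th * cis (- th)) * u - RtoC (/ m) * RtoC (j s - jj) * Ci * cis (- th))%C; [ring|]. rewrite Et, Em.
  unfold r. replace (sg * (j s - jj) / m) with (/ m * (j s - jj) * sg) by lra. rewrite !RtoC_mult.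
  transitivity (u - RtoC (/ m) * RtoC (j s - jj) * (sg * sg) * Ci * cis (- th))%C; [|ring]. rewrite <- (RtoC_mult sg sg), Es. ring.
Qed.

Section Subcritical.

Context (Hc1 : c < 1).

(** The limit of [J] follows from monotonicity together with surjectivity onto the parameters below
    [TT c]. *)
Lemma J_end e : 0 < e -> exists t1, 0 < t1 < Te /\ forall t, t1 <= t < Te -> TT c - e < J t < TT c.
Proof.
intros He. pose proof (sl_T _ _ _ _ _ SL) as PT. pose proof (sl_TT _ _ _ _ _ SL Hc1) as HT. pose proof (HT 0 ltac:(lra)) as H0.
set (j := Rmax (TT c - e / 2) ((J 0 + TT c) / 2)).
assert (J1 : TT c - e / 2 <= j) by apply Rmax_l. assert (J2 : (J 0 + TT c) / 2 <= j) by apply Rmax_r.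
assert (J3 : j < TT c) by (apply Rmax_lub_lt; lra).
destruct (sl_onto _ _ _ _ _ SL j) as [t1 [Ht1 E1]]; [rewrite <- (sl_J0 _ _ _ _ _ SL); lra|lra|].
exists t1. split; [lra|]. split; [|apply HT; lra].
destruct (Req_dec t t1) as [->|Hn]; [lra|]. pose proof (sl_incr _ _ _ _ _ SL t1 t ltac:(lra) ltac:(lra)). lra.
Qed.

Lemma argj_small j : - TT c < j < TT c -> Rabs (argj c j) < PI * c / 2.
Proof. intros Hj. apply atan_bound_TT; [lra|]. intros _. apply Rabs_lt_between. exact Hj. Qed.

Lemma gau_ell_mid j : - TT c <= j <= TT c -> gau c (ell c j) = a0 c.
Proof.
intros Hj. apply gau_ell_eq; [lra|]. fold (argj c j). destruct (argj_TT c (conj Hc Hc1)) as [A1 A2].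
destruct (Req_dec j (TT c)) as [->|N1]; [rewrite A1, Rabs_right; pose proof PI_RGT_0; nra|].
destruct (Req_dec j (- TT c)) as [->|N2]; [rewrite A2, Rabs_Ropp, Rabs_right; pose proof PI_RGT_0; nra|].
left. apply argj_small. lra.
Qed.

(** The values on the curve tend to [ell c (TT c)], which also bounds [om (gamma t)]; so every
    cluster point is a preimage of [ell c (TT c)], and the hypothesis leaves only [p]. *)
Lemma gamma_conv p :
  (forall w, 0 <= Re w -> FF c eta w = ell c (TT c) -> (forall eps, 0 < eps -> exists t, 0 < t < Te /\ Cmod (om (gamma t) - w)%C < eps) -> pt w = p) ->
  forall eps, 0 < eps -> exists t1, 0 < t1 < Te /\ forall t, t1 < t < Te -> Cmod (gamma t - p)%C < eps.
Proof.
intros Hu eps He. apply NNPP. intro Hno.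
assert (Hseq : forall n : nat, exists t, 0 < t < Te /\ eps <= Cmod (gamma t - p)%C /\ Cmod (ell c (J t) - ell c (TT c))%C < / (INR n + 1)).
{ intro n. destruct (ct_ell c (TT c) (/ (INR n + 1)) Hc) as [d [Hd H]]; [apply Rinv_0_lt_compat; pose proof (pos_INR n); lra|].
  destruct (J_end d Hd) as [t1 [Ht1 H1]]. apply NNPP. intro Hn. apply Hno. exists t1. split; [lra|]. intros t Ht.
  apply Rnot_le_lt. intro Hle. apply Hn. exists t. split; [lra|]. split; [lra|]. apply H. specialize (H1 t ltac:(lra)). apply Rabs_lt_between. lra. }
apply functional_choice in Hseq. destruct Hseq as [tn Htn].
destruct (FF_inf c eta (Cmod (ell c (TT c)) + 1) Hc eta_gt0) as [M [HM HMw]].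
destruct (FF_cluster c eta (fun n => om (gamma (tn n))) M (ell c (TT c)) Hc) as [w [W1 [W2 W3]]].
- intro n. destruct (Htn n) as [A1 [A2 A3]]. destruct (om_gamma (tn n) A1) as [B1 B2]. split; [lra|]. apply Rnot_lt_le. intro Hlt.
  specialize (HMw (om (gamma (tn n))) ltac:(lra) ltac:(lra)). rewrite B2 in HMw.
  pose proof (Cmod_rev_triangle (ell c (J (tn n))) (ell c (TT c))) as T1.
  assert (/ (INR n + 1) <= 1). { rewrite <- Rinv_1. pose proof (pos_INR n). apply Rinv_le_contravar; lra. } lra.
- intros e He'. destruct (inv_INR_small e He') as [N HN]. exists N. intros n Hn. specialize (HN n Hn). destruct (Htn n) as [A1 [A2 A3]].
  destruct (om_gamma (tn n) A1) as [_ B2]. rewrite B2. lra.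
- assert (Ep : pt w = p).
  { apply Hu; [lra|auto|]. intros e He'. destruct (W3 e O He') as [n [_ Hn]]. exists (tn n). split; [apply Htn|lra]. }
  destruct (ct_pt w W1 eps He) as [d [Hd H]]. destruct (W3 d O Hd) as [n [_ Hn]]. specialize (H _ I Hn).
  destruct (Htn n) as [A1 [A2 _]]. rewrite Ep, pt_om in H by (apply disk_neqV, (sl_disk _ _ _ _ _ SL); exact A1). lra.
Qed.

Lemma ax_of w : 0 = Re w -> w = ax (- Im w).
Proof. intros H. apply C_eq; simpl; unfold Re, Im in *; lra. Qed.

Lemma boundary_value x : FF c eta (ax x) = ell c (TT c) -> jx x = - TT c.
Proof.
intros E. rewrite FF_axis in E by lra. fold (jx x) in E. pose proof (JJ_le_tip c eta x Hc eta_gt0) as B.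
pose proof (sl_TT _ _ _ _ _ SL Hc1 0 ltac:(pose proof (sl_T _ _ _ _ _ SL); lra)) as H0. rewrite J0_jx in H0.
unfold tipJ in B. rewrite Rinv_inv in B. fold (jx x) in B. fold (jx (/ eta)) in B.
destruct (ell_sq c _ _ Hc E) as [X|X]; lra.
Qed.

Lemma find_boundary_end : - TT c < J 0 -> exists x, x < / eta /\ jx x = - TT c.
Proof.
intros H0. pose proof eta_gt0 as He. assert (Hi : 0 < / eta) by pos.
(* The tolerance is [eta] because [jx (- M) <= - KK c M - eta], which is then below [- TT c]. *)
destruct (KK_lim c eta (conj Hc Hc1) He) as [M [HM H]]. specialize (H M ltac:(lra)). apply Rabs_lt_between in H.
assert (Hlow : jx (- M) < - TT c).
{ unfold jx, JJ. rewrite KK_opp. assert (1 <= Rpower (1 + (- M) ^ 2) (c / 2)).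
  { apply Rle_trans with (Rpower (1 + (- M) ^ 2) 0); [rewrite Rpower_O; nra|apply Rle_Rpower; nra]. }
  nra. }
rewrite J0_jx in H0.
destruct (IVT_interv (fun x => jx x + TT c) (- M) (/ eta)) as [x [Hx Ex]]; try lra.
- intros a Ha. apply continuity_pt_plus; [|apply continuity_pt_const; intros ? ?; reflexivity].
  apply derivable_continuous_pt. eexists. apply is_derive_Reals. apply JJ_derive. exact Hc.
- exists x. split; [|lra]. destruct (Req_dec x (/ eta)) as [->|]; lra.
Qed.

Lemma pt_ax_inj x y : pt (ax x) = pt (ax y) -> x = y.
Proof.
intros E. apply (f_equal om) in E. rewrite !om_pt in E by (simpl; lra). apply (f_equal Im) in E. simpl in E. lra.
Qed.

Lemma pt_1 : pt (ax (/ eta)) = 1.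
Proof. rewrite <- om_1. apply pt_om, V_neq1. Qed.

Lemma pt_neqV w : 0 <= Re w -> pt w <> V.
Proof.
intros Hw E. unfold pt, V in E. apply (to_h_neq1 w Hw). apply Cmult_reg_r with (cis v0); [apply Cmod_pos_neq; rewrite Cmod_cis; lra|]. rewrite E. ring.
Qed.

(** The parameter [- TT c] gives the limiting value. Depending on its position relative to [J 0] it
    is taken by the curve itself, by the circle at some [x < / eta], or at the starting point; this
    is where the curve ends. *)
Lemma endpoint : exists p, p <> V /\ Cmod p <= 1 /\ F p = ell c (TT c) /\
  (forall eps, 0 < eps -> exists t1, 0 < t1 < Te /\ forall t, t1 < t < Te -> Cmod (gamma t - p)%C < eps) /\
  ((exists s0, 0 < s0 < Te /\ J s0 = - TT c /\ p = gamma s0) \/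
   (exists x, x < / eta /\ jx x = - TT c /\ - TT c < J 0 /\ p = pt (ax x)) \/
   (J 0 = - TT c /\ p = 1)).
Proof. pose proof (TT_pos c (conj Hc Hc1)) as PTT.
assert (Int : forall w, 0 < Re w -> FF c eta w = ell c (TT c) -> exists t, 0 < t < Te /\ J t = - TT c /\ pt w = gamma t).
{ intros w Hw E. apply F_ell_on_trace; [apply pt_disk; exact Hw| |lra]. rewrite F_pt, E by lra. apply ell_TT_opp. lra. }
assert (Bd : forall x, Cmod (pt (ax x)) <= 1).
{ intro x. unfold pt. rewrite Cmod_mult, Cmod_cis, Rmult_1_r. pose proof (to_h_sq (ax x) ltac:(simpl; lra)) as Q. simpl (Re (ax x)) in Q. nra. }
assert (Bv : forall x, jx x = - TT c -> F (pt (ax x)) = ell c (TT c)).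
{ intros x Ex. rewrite F_pt by (simpl; lra). rewrite FF_axis by lra. fold (jx x). rewrite Ex. symmetry. apply ell_TT_opp. lra. }
destruct (Rtotal_order (J 0) (- TT c)) as [Hlt|[Heq|Hgt]].
- destruct (sl_onto _ _ _ _ _ SL (- TT c)) as [s0 [Hs0 Es0]]; [rewrite <- (sl_J0 _ _ _ _ _ SL); exact Hlt|lra|].
  exists (gamma s0). pose proof (sl_disk _ _ _ _ _ SL s0 Hs0) as Dk. split; [apply disk_neqV, Dk|]. split; [unfold disk in Dk; lra|]. split.
  { unfold F. rewrite (sl_F _ _ _ _ _ SL s0 Hs0), Es0. symmetry. apply ell_TT_opp. lra. }
  split; [|left; exists s0; split; [lra|auto]].
  apply gamma_conv. intros w W1 W2 _. destruct (Rle_lt_or_eq_dec _ _ W1) as [Hp|H0].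
  + destruct (Int w Hp W2) as [t [T1 [T2 T3]]]. rewrite T3. f_equal. apply J_inj; lra.
  + rewrite (ax_of w H0) in W2. apply boundary_value in W2. destruct (Req_dec (- Im w) (/ eta)) as [E|N]; [rewrite E, <- J0_jx in W2; lra|].
    pose proof (jx_max _ N). lra.
- exists 1. rewrite <- pt_1. split; [apply pt_neqV; simpl; lra|]. split; [auto|]. split; [apply Bv; rewrite <- J0_jx; exact Heq|].
  split; [|auto].
  apply gamma_conv. intros w W1 W2 _. destruct (Rle_lt_or_eq_dec _ _ W1) as [Hp|H0].
  + destruct (Int w Hp W2) as [t [T1 [T2 T3]]]. pose proof (J0_bound t T1). lra.
  + rewrite (ax_of w H0) in *. apply boundary_value in W2. f_equal. f_equal. apply NNPP. intro N. pose proof (jx_max _ N). lra.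
- destruct (find_boundary_end Hgt) as [x [Hx Ex]].
  exists (pt (ax x)). split; [apply pt_neqV; simpl; lra|]. split; [auto|]. split; [auto|].
  split; [|right; left; exists x; split; [lra|auto]].
  apply gamma_conv. intros w W1 W2 W3. destruct (Rle_lt_or_eq_dec _ _ W1) as [Hp|H0].
  + destruct (Int w Hp W2) as [t [T1 [T2 T3]]]. pose proof (J0_bound t T1). lra.
  + rewrite (ax_of w H0) in *. set (y := - Im w) in *. apply boundary_value in W2. f_equal. f_equal. destruct (Rle_lt_dec y (/ eta)) as [Hy|Hy].
    * destruct (Rtotal_order y x) as [H|[H|H]]; [pose proof (jx_left y x ltac:(lra)); lra|lra|pose proof (jx_left x y ltac:(lra)); lra].
    (* A preimage beyond the driving point is no limit of the curve: [gau] exceeds [a0] near it and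
       equals [a0] on the curve. *)
    * destruct (bdry_outside y Hy) as [r [Hr H]]. destruct (W3 r Hr) as [t [Ht Htr]]. destruct (om_gamma t Ht) as [O1 O2].
      specialize (H _ O1 Htr). rewrite O2, gau_ell_mid in H; [lra|]. pose proof (J0_bound t Ht). pose proof (sl_TT _ _ _ _ _ SL Hc1 t ltac:(lra)). lra.
Qed.

(** * The angle at the endpoint *)

Lemma ZZ_TT_rot z : ZZ c (TT c) z = (cis (PI * c) * ZZ c (- TT c) z)%C.
Proof.
destruct (argj_TT c (conj Hc Hc1)) as [A1 A2].
(* The two branches start from conjugate points whose arguments differ by [PI c]. *)
assert (E : (a0 c, TT c) = (cis (PI * c) * (a0 c, (- TT c)%R))%C).
{ rewrite (aj_polar c (TT c) Hc), (aj_polar c (- TT c) Hc), A1, A2, Cmod_aj_opp.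
  replace (PI * c / 2) with (PI * c + - (PI * c / 2)) at 1 by lra. rewrite cis_add.
  Cring. }
unfold ZZ. rewrite ell_TT_opp, E by lra. Cring.
Qed.

Lemma ZZ_TT_at z : z = ell c (TT c) -> ZZ c (TT c) z = (a0 c, TT c) /\ ZZ c (- TT c) z = (a0 c, - TT c).
Proof.
intros ->. split; [apply ZZ_self; exact Hc|]. rewrite ell_TT_opp by lra. apply ZZ_self. exact Hc.
Qed.

Lemma conv_tends p : (forall eps, 0 < eps -> exists t1, 0 < t1 < Te /\ forall t, t1 < t < Te -> Cmod (gamma t - p)%C < eps) ->
  tends0 (fun s => gamma (Te + -1 * s)) p.
Proof.
intros H eps He. destruct (H eps He) as [t1 [Ht1 H1]]. exists (Te - t1). split; [lra|]. intros s Hs. apply H1. lra.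
Qed.

Lemma J_end_tends e : 0 < e -> exists d, 0 < d /\ forall s, 0 < s < d -> Rabs (J (Te + -1 * s) - TT c) < e.
Proof.
intros He. destruct (J_end e He) as [t1 [Ht1 H1]]. exists (Te - t1). split; [lra|]. intros s Hs. specialize (H1 (Te + -1 * s) ltac:(lra)).
apply Rabs_lt_between. lra.
Qed.

(** Near the endpoint, within the disk, [Om] is thus the intersection of the preimages of two
    half-planes under the two charts. *)
Lemma gau_local p : p <> V -> Cmod p <= 1 -> F p = ell c (TT c) -> exists d, 0 < d /\ forall z, Cmod (z - p)%C < d ->
  (Re (ZZ c (- TT c) (F z)) < a0 c -> Re (ZZ c (TT c) (F z)) < a0 c -> gau c (F z) < a0 c) /\
  (gau c (F z) < a0 c -> Re (ZZ c (- TT c) (F z)) < a0 c /\ Re (ZZ c (TT c) (F z)) < a0 c).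
Proof.
intros Hp1 Hp2 Ep. destruct (hdC_F p Hp1 Hp2) as [l [_ [_ [_ D]]]]. pose proof (hd_ct _ _ _ _ D) as CF.
destruct (ZZ_le c (TT c) Hc) as [d1 [Hd1 H1]]. destruct (ZZ_le c (- TT c) Hc) as [d2 [Hd2 H2]]. destruct (ZZ_TT c (conj Hc Hc1)) as [d3 [Hd3 H3]].
destruct (CF (Rmin d1 (Rmin d2 d3))) as [d [Hd H]]; [pos|]. exists d. split; [lra|]. intros z Hz.
specialize (H z I Hz). rewrite Ep in H.
assert (Q1 := Rlt_le_trans _ _ _ H (Rmin_l _ _)). assert (Q2 := Rlt_le_trans _ _ _ H (Rle_trans _ _ _ (Rmin_r _ _) (Rmin_l _ _))).
assert (Q3 := Rlt_le_trans _ _ _ H (Rle_trans _ _ _ (Rmin_r _ _) (Rmin_r _ _))).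
destruct (H1 _ Q1) as [_ [B1 _]]. specialize (H3 _ Q3). rewrite ell_TT_opp in Q2 by lra. destruct (H2 _ Q2) as [_ [B2 _]].
lra.
Qed.

Lemma frontier_interior z : frontier Om z -> disk z -> exists j, - TT c <= j <= TT c /\ F z = ell c j.
Proof.
intros Hz Dk. destruct (frontier_value z Hz (disk_neqV z Dk)) as [_ [_ H]]. destruct (gau_eq_ell c (F z) Hc (H Dk)) as [j [E B]].
exists j. split; [apply atan_bound_TT_le; [lra|lra]|auto].
Qed.

(** [|ell c j|] increases with [|j|], so closeness to [ell c (TT c)] forces [|j|] close to
    [TT c]. *)
Lemma ell_near_end e : 0 < e -> exists d, 0 < d /\ forall j, - TT c <= j <= TT c -> Cmod (ell c j - ell c (TT c))%C < d -> TT c - e < Rabs j.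
Proof.
intros He. pose proof (TT_pos c (conj Hc Hc1)) as PT. set (j1 := Rmax 0 (TT c - e)). assert (J1 : 0 <= j1 < TT c) by (split; [apply Rmax_l|apply Rmax_lub_lt; lra]).
assert (P2 : 0 < 2 / c) by pos.
assert (Hgap : Cmod (ell c j1) < Cmod (ell c (TT c))).
{ rewrite !Cmod_ell by lra. apply exp_increasing. apply Rmult_lt_compat_l; [lra|]. apply ln_increasing; [apply Cmod_aJ_pos; exact Hc|].
  pose proof (Cmod_aJ c j1) as E1. pose proof (Cmod_aJ c (TT c)) as E2. pose proof (Cmod_ge_0 (a0 c, TT c)). nra. }
exists (Cmod (ell c (TT c)) - Cmod (ell c j1)). split; [lra|]. intros j Hj Hd. apply Rnot_le_lt. intro Hle.
assert (Hm : Cmod (ell c j) <= Cmod (ell c j1)).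
{ rewrite !Cmod_ell by lra. apply Rle_Rpower_l; [lra|]. split; [apply Cmod_aJ_pos; exact Hc|].
  pose proof (Cmod_aJ c j) as E1. pose proof (Cmod_aJ c j1) as E2. pose proof (Cmod_ge_0 (a0 c, j1)).
  assert (Rabs j <= j1) by (apply Rle_trans with (TT c - e); [lra|apply Rmax_r]).
  assert (j ^ 2 <= j1 ^ 2). { rewrite <- (pow2_abs j). pose proof (Rabs_pos j). nra. } nra. }
pose proof (Cmod_rev_triangle (ell c (TT c)) (ell c j)) as T1. rewrite Cmod_sub_sym in Hd. lra.
Qed.

(** With [tau] measured from the direction [de + PI / 2], the real parts of the two charts change by
    about [- m s sin tau] and [- m s sin (tau + PI c)]; within one turn both are negative exactly
    for [0 < tau < PI (1 - c)]. The first side is the arc [ka] leaving from parameter [- TT c], of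
    the curve or of the circle; the second is the end of the curve. *)
Lemma angle_linear p m de ka ja ba bb : p <> V -> Cmod p <= 1 -> F p = ell c (TT c) ->
  (forall eps, 0 < eps -> exists t1, 0 < t1 < Te /\ forall t, t1 < t < Te -> Cmod (gamma t - p)%C < eps) ->
  0 < m -> hdC (fun z => ZZ c (- TT c) (F z)) p (m * cis (- de))%C ->
  0 < ba -> (forall beta, tends0 (fun s => (ka s - p) / RtoC (Cmod (ka s - p)%C))%C (cis beta) -> germ Om p ka ba beta) ->
  tends0 ka p -> (forall s, 0 < s < ba -> ka s <> p /\ F (ka s) = ell c (ja s) /\ 0 <= ja s + TT c) ->
  (forall e, 0 < e -> exists d, 0 < d /\ forall s, 0 < s < d -> Rabs (ja s + TT c) < e) ->
  0 < bb < Te -> (forall t, Te - bb <= t < Te -> gamma t <> p /\ - TT c <= J t) ->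
  (forall s t, 0 < s <= ba -> Te - bb <= t < Te -> ka s <> gamma t) ->
  (exists r, 0 < r /\ forall z, frontier Om z -> Cmod (z - p)%C < r ->
     z = p \/ (exists s, 0 < s <= ba /\ z = ka s) \/ (exists t, Te - bb <= t < Te /\ z = gamma t)) ->
  (forall eps, 0 < eps <= PI / 2 -> exists r, 0 < r /\ forall s tau, 0 < s < r -> eps <= tau <= PI - eps -> disk (p + s * cis (de + PI / 2 + tau))%C) ->
  interior_angle Om p (PI * (1 - c)).
Proof.
intros Hp1 Hp2 Ep Hconv Hm D1 Hba Ga Ka1 Ka2 Ka3 Hbb Hend Hdis [r0 [Hr0 Hcov]] Hin. pose proof PI_RGT_0 as HPI.
assert (Pc : 0 < c) by lra.
destruct (ZZ_TT_at _ Ep) as [Z1 Z2].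
assert (D2 : hdC (fun z => ZZ c (TT c) (F z)) p (m * cis (PI * c - de))%C).
{ apply hd_ext_all with (fun z => cis (PI * c) * ZZ c (- TT c) (F z))%C; [intro z; symmetry; apply ZZ_TT_rot|].
  eapply hd_eq; [|apply hd_scal; exact D1]. replace (PI * c - de) with (PI * c + - de) by ring. rewrite cis_add. ring. }
pose proof (sl_TT _ _ _ _ _ SL Hc1) as JT. pose proof (conv_tends p Hconv) as Kb.
apply (angle_intro Om p (PI * (1 - c)) (de + PI / 2) ka ba (fun s => gamma (Te + -1 * s)) bb); [nra|lra|lra|..].
- apply Ga. replace (de + PI / 2) with (1 * (PI / 2) - - de) by ring.
  apply (arc_dir p (- TT c) m (- de) 1 ka ja ba Hm D1 Z2 Ka1 (or_introl eq_refl) Hba).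
  + intros s Hs. destruct (Ka2 s Hs) as [A1 [A2 A3]]. split; [auto|]. split; [auto|lra].
  + intros e He. destruct (Ka3 e He) as [d [Hd H]]. exists d. split; [lra|]. intros s Hs. replace (ja s - - TT c) with (ja s + TT c) by ring. auto.
- apply gamma_germ; [lra| |auto|].
  + intros s Hs. destruct (Hend (Te + -1 * s) ltac:(lra)) as [E1 E2]. split; [lra|]. split; [auto|]. apply gau_ell_mid.
    split; [lra|]. left. apply JT. lra.
  + replace (cis (de + PI / 2 + PI * (1 - c))) with (cis (-1 * (PI / 2) - (PI * c - de))).
    2:{ unfold cis. replace (de + PI / 2 + PI * (1 - c)) with (-1 * (PI / 2) - (PI * c - de) + 2 * PI) by lra.
        rewrite cos_plus, sin_plus, cos_2PI, sin_2PI. Cring. }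
    apply (arc_dir p (TT c) m (PI * c - de) (-1) _ (fun s => J (Te + -1 * s)) bb Hm D2 Z1 Kb (or_intror eq_refl)); [lra| |].
    * intros s Hs. destruct (Hend (Te + -1 * s) ltac:(lra)) as [E1 _]. split; [auto|]. split; [apply (sl_F _ _ _ _ _ SL); lra|].
      specialize (JT (Te + -1 * s) ltac:(lra)). lra.
    * apply J_end_tends.
- intros s t Hs Ht. apply Hdis; [lra|lra].
- exists r0. split; [lra|]. intros z Hz Hzr. destruct (Hcov z Hz Hzr) as [E|[E|[t [Ht E]]]]; [auto|auto|].
  right. right. exists (Te - t). split; [lra|]. replace (Te + -1 * (Te - t)) with t by ring. exact E.
- intros eps He. set (e := Rmin eps (PI * (1 - c) / 2)).
  assert (He0 : 0 < e) by pos. assert (He1 : e <= eps) by apply Rmin_l. assert (He2 : e <= PI * (1 - c) / 2) by apply Rmin_r.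
  assert (He3 : e <= PI / 2) by nra. set (sg := sin e). assert (Hsg : 0 < sg) by (apply sin_gt_0; lra).
  destruct (gau_local p Hp1 Hp2 Ep) as [d0 [Hd0 H0]].
  destruct (D1 (m * sg / 2) ltac:(nra)) as [d1 [Hd1 H1]]. destruct (D2 (m * sg / 2) ltac:(nra)) as [d2 [Hd2 H2]].
  destruct (Hin e ltac:(lra)) as [d3 [Hd3 H3]].
  exists (Rmin (Rmin d0 d1) (Rmin d2 d3)). split; [pos|]. intros s phi Hs.
  assert (S0 : s < d0) by rmin.
  assert (S1 : s < d1) by rmin.
  assert (S2 : s < d2) by rmin.
  assert (S3 : s < d3) by rmin.
  set (z := (p + s * cis phi)%C).
  assert (Ez : (z - p)%C = (s * cis phi)%C) by Cring.
  assert (Mz : Cmod (z - p)%C = s) by (rewrite Ez, Cmod_mult, Cmod_R, Cmod_cis, Rabs_right; lra).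
  set (tau := phi - (de + PI / 2)).
  assert (R1 : Rabs (Re (ZZ c (- TT c) (F z)) - a0 c + m * s * sin tau) <= m * sg / 2 * s).
  { specialize (H1 z I ltac:(lra)). rewrite Mz, Z2, Ez in H1. eapply Rle_trans; [|exact H1].
    replace (Re (ZZ c (- TT c) (F z)) - a0 c + m * s * sin tau) with (Re (ZZ c (- TT c) (F z) - (a0 c, (- TT c)%R) - m * cis (- de) * (s * cis phi))%C); [apply re_le_Cmod|].
    replace (m * cis (- de) * (s * cis phi))%C with (RtoC (m * s) * cis (- de + phi))%C by (rewrite cis_add, RtoC_mult; ring).
    rewrite !Re_sub, re_scal_l. simpl (Re (cis _)). simpl (Re (_, _)). replace (- de + phi) with (PI / 2 + tau) by (unfold tau; ring).
    rewrite <- (Ropp_involutive (cos (PI / 2 + tau))), <- sin_cos. ring. }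
  assert (R2 : Rabs (Re (ZZ c (TT c) (F z)) - a0 c + m * s * sin (tau + PI * c)) <= m * sg / 2 * s).
  { specialize (H2 z I ltac:(lra)). rewrite Mz, Z1, Ez in H2. eapply Rle_trans; [|exact H2].
    replace (Re (ZZ c (TT c) (F z)) - a0 c + m * s * sin (tau + PI * c)) with (Re (ZZ c (TT c) (F z) - (a0 c, TT c) - m * cis (PI * c - de) * (s * cis phi))%C); [apply re_le_Cmod|].
    replace (m * cis (PI * c - de) * (s * cis phi))%C with (RtoC (m * s) * cis (PI * c - de + phi))%C by (rewrite cis_add, RtoC_mult; ring).
    rewrite !Re_sub, re_scal_l. simpl (Re (cis _)). simpl (Re (_, _)). replace (PI * c - de + phi) with (PI / 2 + (tau + PI * c)) by (unfold tau; ring).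
    rewrite <- (Ropp_involutive (cos (PI / 2 + (tau + PI * c)))), <- sin_cos. ring. }
  apply Rabs_le_between in R1. apply Rabs_le_between in R2. specialize (H0 z ltac:(lra)).
  assert (Pms : 0 < m * s) by pos. assert (Pmsg : 0 < m * s * sg) by pos.
  split; intros Hphi.
  + apply Om_iff. assert (T1 : e <= tau <= PI - e) by (unfold tau; nra). assert (T2 : e <= tau + PI * c <= PI - e) by (unfold tau; nra).
    split; [unfold z; replace phi with (de + PI / 2 + tau) by (unfold tau; ring); apply H3; lra|].
    pose proof (sin_ge_mid e tau ltac:(lra) T1) as Q1. pose proof (sin_ge_mid e (tau + PI * c) ltac:(lra) T2) as Q2. fold sg in Q1, Q2.
    apply H0; nra.
  + intro HO. apply Om_iff in HO.
    assert (T0 : PI * (1 - c) + e <= tau <= 2 * PI - e) by (unfold tau; lra).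
    (* One of the two sines is at most [- sin e]: the second until [tau + PI c] approaches [2 PI],
       the first afterwards. The bound [e <= PI (1 - c) / 2] makes the two ranges overlap. *)
    destruct (Rle_lt_dec (tau + PI * c) (2 * PI - e)) as [Hl|Hg].
    * pose proof (sin_le_mid e (tau + PI * c) ltac:(lra) ltac:(lra)) as Q. fold sg in Q. nra.
    * pose proof (sin_le_mid e tau ltac:(lra) ltac:(lra)) as Q. fold sg in Q. nra.
Qed.

Lemma J_right s0 e : 0 <= s0 < Te -> 0 < e -> exists d, 0 < d /\ forall s, 0 < s < d -> s0 + s < Te /\ J s0 < J (s0 + s) < J s0 + e.
Proof.
intros Hs He. pose proof (sl_TT _ _ _ _ _ SL Hc1 s0 Hs) as HT. set (j := Rmin (J s0 + e) ((J s0 + TT c) / 2)).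
assert (J1 : J s0 < j) by pos. assert (J2 : j <= J s0 + e) by apply Rmin_l. assert (J3 : j <= (J s0 + TT c) / 2) by apply Rmin_r.
assert (H0 : J 0 <= J s0). { destruct (Req_dec s0 0) as [->|]; [lra|]. left. apply (sl_incr _ _ _ _ _ SL); lra. }
destruct (sl_onto _ _ _ _ _ SL j) as [t1 [Ht1 E1]]; [rewrite <- (sl_J0 _ _ _ _ _ SL); lra|lra|].
assert (Hlt : s0 < t1). { apply Rnot_le_lt. intros [H|H]; [pose proof (sl_incr _ _ _ _ _ SL t1 s0 ltac:(lra) ltac:(lra)); lra|rewrite H in E1; lra]. }
exists (t1 - s0). split; [lra|]. split; [lra|].
pose proof (sl_incr _ _ _ _ _ SL s0 (s0 + s) ltac:(lra) ltac:(lra)). pose proof (sl_incr _ _ _ _ _ SL (s0 + s) t1 ltac:(lra) ltac:(lra)). lra.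
Qed.

(** Near [p] a frontier point has its parameter close to [TT c], at the end of the curve, or close
    to [- TT c], where the curve may pass a first time. *)
Lemma cover_interior p bb e : p <> V -> Cmod p <= 1 -> F p = ell c (TT c) -> 0 < bb < Te -> 0 < e -> exists r, 0 < r /\
  forall z, frontier Om z -> disk z -> Cmod (z - p)%C < r ->
  F z = ell c (TT c) \/ exists t, 0 < t < Te /\ z = gamma t /\ (Te - bb <= t \/ - TT c < J t < - TT c + e).
Proof.
intros Hp1 Hp2 Ep Hbb He. pose proof (sl_TT _ _ _ _ _ SL Hc1 (Te - bb) ltac:(lra)) as HT. pose proof (TT_pos c (conj Hc Hc1)) as PT.
set (e' := Rmin e (Rmin (TT c - J (Te - bb)) (TT c))).
assert (He' : 0 < e') by pos. assert (E1 : e' <= e) by apply Rmin_l.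
assert (E2 : e' <= TT c - J (Te - bb)) by (eapply Rle_trans; [apply Rmin_r|rmin]).
destruct (ell_near_end e' He') as [d [Hd H]]. destruct (hdC_F p Hp1 Hp2) as [l [_ [_ [_ D]]]].
destruct (hd_ct _ _ _ _ D d Hd) as [r [Hr H2]]. exists r. split; [lra|]. intros z Hz Dk Hzr. specialize (H2 z I Hzr). rewrite Ep in H2.
destruct (frontier_interior z Hz Dk) as [j [Hj Ej]]. rewrite Ej in H2. specialize (H j Hj H2).
destruct (Req_dec j (TT c)) as [->|N1]; [auto|]. destruct (Req_dec j (- TT c)) as [->|N2]; [left; rewrite Ej, ell_TT_opp by (lra); reflexivity|].
right. destruct (F_ell_on_trace z j Dk Ej) as [t [Ht [Jt Et]]]; [lra|]. exists t. split; [lra|]. split; [auto|].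
destruct (Rle_lt_dec j 0) as [Hn|Hp]; [rewrite Rabs_left1 in H by exact Hn; right; lra|rewrite Rabs_right in H by lra; left].
apply Rnot_lt_le. intro Hlt. pose proof (sl_incr _ _ _ _ _ SL t (Te - bb) ltac:(lra) ltac:(lra)). lra.
Qed.

Lemma gamma_tends s0 : 0 < s0 < Te -> tends0 (fun s => gamma (s0 + 1 * s)) (gamma s0).
Proof.
intros Hs eps He. destruct (sl_cont _ _ _ _ _ SL s0 eps Hs He) as [d [Hd H]]. exists (Rmin d (Te - s0)). split; [pos|].
intros s Hss. assert (s < d) by rmin. assert (s < Te - s0) by rmin.
apply H; [lra|]. rewrite Rabs_right; lra.
Qed.

Lemma chart_deriv p : p <> V -> Cmod p <= 1 -> F p = ell c (TT c) -> exists l, l <> RtoC 0 /\ (RtoC 2 * V * l = (om p + 1) * (om p + 1))%C /\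
  hdC om p l /\ hdC (fun z => ZZ c (- TT c) (F z)) p ((a0 c, (- TT c)%R) * RtoC (c / 2) / ell c (- TT c) * (FF1 c eta (om p) * l))%C.
Proof.
intros H1 H2 Ep. destruct (hdC_F p H1 H2) as [l [L1 [L2 [L3 L4]]]]. exists l. split; [auto|]. split; [auto|]. split; [auto|].
apply (hdC_comp all_C (ZZ c (- TT c)) F p); [|auto]. rewrite Ep, ell_TT_opp by lra. apply hdC_ZZ_self. exact Hc.
Qed.

(** The first side is the continuation of the curve after its passage at [s0]. The part before [s0]
    has [J < - TT c] and does not border [Om]. *)
Lemma angle_interior s0 : 0 < s0 < Te -> J s0 = - TT c -> F (gamma s0) = ell c (TT c) ->
  (forall eps, 0 < eps -> exists t1, 0 < t1 < Te /\ forall t, t1 < t < Te -> Cmod (gamma t - gamma s0)%C < eps) ->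
  interior_angle Om (gamma s0) (PI * (1 - c)).
Proof.
intros Hs0 Js0 Ep Hconv. set (p := gamma s0) in *. pose proof (sl_disk _ _ _ _ _ SL s0 Hs0) as Dk. fold p in Dk. pose proof (disk_neqV p Dk) as Hp1.
assert (Hp2 : Cmod p <= 1) by (unfold disk in Dk; lra). pose proof (sl_TT _ _ _ _ _ SL Hc1) as JT.
destruct (chart_deriv p Hp1 Hp2 Ep) as [l [L1 [_ [_ D]]]].
match type of D with hdC _ _ ?k => set (k1 := k) in * end.
assert (Nk : k1 <> 0).
{ apply Cmult_neq_0; [apply Cmult_neq_0; [apply Cmult_neq_0|]|apply Cmult_neq_0; [|auto]].
  - apply Cmod_pos_neq, Cmod_aJ_pos. exact Hc.
  - intro X. apply RtoC_inj in X. lra.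
  - intro X. pose proof (ell_neq0 c (- TT c)) as N. apply (f_equal (fun x => x * ell c (- TT c)))%C in X. rewrite Cinv_l, Cmult_0_l in X by auto. apply RtoC_inj in X. lra.
  - apply FF1_neq_0_open; [lra|left; apply eta_gt0|apply om_pos; exact Dk]. }
destruct (polar_exists k1 Nk) as [psi [_ Ek]]. rewrite Ek in D. replace (cis psi) with (cis (- - psi)) in D by (f_equal; ring).
(* A third of the remaining time keeps the arc after [s0] disjoint from the one before [Te]. *)
set (b := (Te - s0) / 3).
assert (Inj : forall t, 0 < t < Te -> t <> s0 -> gamma t <> p) by (intros t Ht N E; apply N, (sl_inj _ _ _ _ _ SL); [lra|lra|auto]).
assert (Mid : forall t, s0 < t < Te -> - TT c <= J t <= TT c).
{ intros t Ht. pose proof (sl_incr _ _ _ _ _ SL s0 t ltac:(lra) ltac:(lra)). pose proof (JT t ltac:(lra)). lra. }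
apply (angle_linear p (Cmod k1) (- psi) (fun s => gamma (s0 + 1 * s)) (fun s => J (s0 + 1 * s)) b b Hp1 Hp2 Ep Hconv (Cmod_pos _ Nk) D); [pos|..].
- intros beta Hdir. apply gamma_germ; [lra| |apply gamma_tends; exact Hs0|auto].
  intros s Hs. unfold b in Hs. split; [lra|]. split; [apply Inj; lra|]. apply gau_ell_mid, Mid. lra.
- apply gamma_tends. lra.
- intros s Hs. unfold b in Hs. split; [apply Inj; lra|]. split; [apply (sl_F _ _ _ _ _ SL); lra|]. pose proof (Mid (s0 + 1 * s) ltac:(lra)). lra.
- intros e He. destruct (J_right s0 e ltac:(lra) He) as [d [Hd H]]. exists d. split; [lra|]. intros s Hs. destruct (H s Hs) as [_ H']. rewrite Rmult_1_l. apply Rabs_lt_between. lra.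
- unfold b; lra.
- intros t Ht. unfold b in Ht. split; [apply Inj; lra|]. apply Mid. lra.
- intros s t Hs Ht E. unfold b in Hs, Ht. apply (sl_inj _ _ _ _ _ SL) in E; lra.
- pose proof (sl_incr _ _ _ _ _ SL s0 (s0 + b) ltac:(unfold b; lra) ltac:(unfold b; lra)) as Jb.
  destruct (cover_interior p b (J (s0 + b) + TT c) Hp1 Hp2 Ep ltac:(unfold b; lra) ltac:(lra)) as [r [Hr H]].
  exists (Rmin r (1 - Cmod p)). unfold disk in Dk. split; [pos|]. intros z Hz Hzr.
  assert (Z1 := Rlt_le_trans _ _ _ Hzr (Rmin_l _ _)). assert (Z2 := Rlt_le_trans _ _ _ Hzr (Rmin_r _ _)).
  assert (Dz : disk z). { unfold disk. pose proof (Cmod_triangle (z - p)%C p) as T1. replace (z - p + p)%C with z in T1 by ring. lra. }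
  destruct (H z Hz Dz Z1) as [E|[t [Ht [Et [Hend|Hj]]]]].
  + left. apply F_inj; [auto|auto|]. rewrite E, Ep. auto.
  + right. right. exists t. split; [lra|auto].
  + right. left. assert (s0 < t). { apply Rnot_le_lt. intros [Q|Q]; [pose proof (sl_incr _ _ _ _ _ SL t s0 ltac:(lra) ltac:(lra)); lra|rewrite Q in Hj; lra]. }
    assert (t < s0 + b). { apply Rnot_le_lt. intros [Q|Q]; [pose proof (sl_incr _ _ _ _ _ SL (s0 + b) t ltac:(unfold b in *; lra) ltac:(lra)); lra|rewrite Q in Hj; lra]. }
    exists (t - s0). split; [lra|]. rewrite Et. f_equal. ring.
- exists (1 - Cmod p). unfold disk in *. split; [lra|]. intros s tau Hs _.
  pose proof (Cmod_triangle p (s * cis (- psi + PI / 2 + tau))%C) as T1. rewrite Cmod_mult, Cmod_R, Cmod_cis, Rabs_right in T1 by lra. lra.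
Qed.

Lemma circle_cis p : Cmod p = 1 -> exists de, p = cis de.
Proof.
intros H. destruct (polar_exists p) as [psi [_ E]]; [apply Cmod_pos_neq; lra|]. exists psi. rewrite E, H. ring.
Qed.

Lemma pt_ax_unit x : Cmod (pt (ax x)) = 1.
Proof.
unfold pt. rewrite Cmod_mult, Cmod_cis, Rmult_1_r. pose proof (to_h_sq (ax x) ltac:(simpl; lra)) as Q. simpl (Re (ax x)) in Q.
pose proof (Cmod_ge_0 (to_h (ax x))). nra.
Qed.

(* The derivative of [om] rotates the counterclockwise tangent at [p] to [- i]. *)
Lemma om_rotation x l : (2 * V * l = (ax x + 1) * (ax x + 1))%C -> (pt (ax x) * l = RtoC (- ((1 + x ^ 2) / 2)))%C.
Proof.
intros E. pose proof (wp1_neq0 (ax x) ltac:(simpl; lra)) as N. assert (NV : V <> 0) by (apply Cmod_pos_neq; rewrite Cmod_V; lra).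
assert (El : l = ((ax x + 1) * (ax x + 1) / (2 * V))%C) by (rewrite <- E; field; exact NV).
rewrite El. unfold pt, to_h. fold V. transitivity ((ax x * ax x - 1) / 2)%C; [field; repeat split; first [exact N|exact NV]|].
replace (- ((1 + x ^ 2) / 2)) with ((- (1 + x ^ 2)) / 2) by lra. rewrite RtoC_div by lra. Cring.
Qed.

Lemma frontier_circle z : frontier Om z -> z <> V -> Cmod z = 1 -> z = pt (ax (- Im (om z))) /\ - TT c <= jx (- Im (om z)).
Proof.
intros Hz Hn H1. assert (R0 : Re (om z) = 0).
{ unfold om. rewrite to_w_Re.
  - rewrite Cmod_mult, Cmod_cis, H1. lra.
  - intro X. apply Hn. apply (f_equal (fun y => y * cis v0)%C) in X. rewrite <- Cmult_assoc, (Cmult_comm (cis (- v0))), cis_opp_r, Cmult_1_r, Cmult_1_l in X. exact X. }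
assert (Eo : om z = ax (- Im (om z))) by (apply ax_of; symmetry; exact R0). set (y := - Im (om z)) in *.
split; [rewrite <- Eo, pt_om by exact Hn; reflexivity|].
destruct (frontier_value z Hz Hn) as [_ [Hg _]]. rewrite F_om, Eo, FF_axis in Hg by lra. fold (jx y) in Hg.
pose proof (gau_ell_ge c (jx y) Hc) as Hg2. destruct (gau_eq_ell c (ell c (jx y)) Hc ltac:(lra)) as [j [Ej Bj]].
apply atan_bound_TT_le in Bj; [|lra]. destruct (ell_sq c _ _ Hc Ej); lra.
Qed.

(** The first side is now an arc of the circle. The chart sends the tangent of the circle at
    [p = cis de] to the vertical direction, so its derivative is a positive multiple of
    [cis (- de)]; [unit_step] keeps the sector inside the disk. *)
Lemma angle_boundary x : x < / eta -> jx x = - TT c -> - TT c < J 0 -> F (pt (ax x)) = ell c (TT c) ->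
  (forall eps, 0 < eps -> exists t1, 0 < t1 < Te /\ forall t, t1 < t < Te -> Cmod (gamma t - pt (ax x))%C < eps) ->
  interior_angle Om (pt (ax x)) (PI * (1 - c)).
Proof.
intros Hx Jx HJ0 Ep Hconv. set (p := pt (ax x)) in *. pose proof (pt_ax_unit x) as Hu. fold p in Hu.
assert (Hp1 : p <> V) by (apply pt_neqV; simpl; lra). assert (Hp2 : Cmod p <= 1) by lra. pose proof eta_gt0 as He.
pose proof (sl_TT _ _ _ _ _ SL Hc1) as JT. pose proof (JT 0 ltac:(pose proof (sl_T _ _ _ _ _ SL); lra)) as JT0. pose proof Hc as Pc.
destruct (circle_cis p Hu) as [de Ede].
assert (Jd : forall y, y < / eta -> 0 < jd y).
{ intros y Hy. pose proof (pw_pos y (c / 2 - 1)). apply Rmult_lt_0_compat; [pos|lra].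
  apply (Rmult_lt_compat_l eta) in Hy; [|lra]. rewrite Rinv_r in Hy by lra. lra. }
destruct (hdC_om p Hp1) as [l [_ [L2 L3]]]. assert (Eo : om p = ax x) by (apply om_pt; simpl; lra). rewrite Eo in L3.
pose proof (om_rotation x l L3) as Er. fold p in Er.
assert (D : hdC (fun z => ZZ c (- TT c) (F z)) p (RtoC (jd x * ((1 + x ^ 2) / 2)) * cis (- de))%C).
{ eapply hd_eq; [|apply (hdC_comp all_C (fun w => ZZ c (- TT c) (FF c eta w)) om p); [rewrite Eo, <- Jx; apply chart_axis|exact L2]].
  assert (El : l = (RtoC (- ((1 + x ^ 2) / 2)) * cis (- de))%C).
  { rewrite <- Er, Ede. transitivity (l * (cis de * cis (- de)))%C; [rewrite cis_opp_r; ring|ring]. }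
  rewrite El, Cmult_assoc, <- RtoC_mult. f_equal. f_equal. ring. }
set (b := (/ eta - x) / 2). set (bb := Te / 2). pose proof (sl_T _ _ _ _ _ SL) as PT.
assert (Disk1 : forall t, 0 < t < Te -> gamma t <> p) by (intros t Ht E; pose proof (sl_disk _ _ _ _ _ SL t Ht) as Dk; rewrite E in Dk; unfold disk in Dk; lra).
assert (Kt : tends0 (fun s => pt (ax (x + s))) p).
{ intros eps Heps. destruct (ct_pt (ax x) ltac:(simpl; lra) eps Heps) as [d [Hd H]]. exists d. split; [exact Hd|]. intros s Hs. apply H; [exact I|].
  rewrite !ax_C. replace (- Ci * RtoC (x + s) - - Ci * x)%C with (- Ci * s)%C by Cring.
  rewrite Cmod_mult, Cmod_opp, Cmod_R. replace (Cmod Ci) with 1; [rewrite Rabs_right; lra|]. unfold Cmod, Ci; simpl. replace (0 * (0 * 1) + 1 * (1 * 1)) with 1 by ring. rewrite sqrt_1; reflexivity. }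
assert (Jc : forall e, 0 < e -> exists d, 0 < d /\ forall s, 0 < s < d -> Rabs (jx (x + s) + TT c) < e).
{ intros e He'. destruct (real_hd_ineq (jx) x _ (JJ_derive c eta x Hc) 1 ltac:(lra)) as [d [Hd H]].
  match type of H with context [_ - ?q * _] => set (k := q) in * end.
  exists (Rmin d (e / (2 + Rabs k))). pose proof (Rabs_pos k). split; [apply Rmin_pos; [exact Hd|apply Rdiv_lt_0_compat; lra]|]. intros s Hs.
  assert (S1 : s < d) by rmin. assert (S2 : s < e / (2 + Rabs k)) by rmin.
  specialize (H (x + s)). replace (x + s - x) with s in H by ring. rewrite (Rabs_right s) in H by lra. replace (jx (x + s) + TT c) with (jx (x + s) - jx x) by lra.
  replace (jx (x + s) - jx x) with ((jx (x + s) - jx x - k * s) + k * s) by ring. eapply Rle_lt_trans; [apply Rabs_triang|].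
  rewrite (Rabs_mult k), (Rabs_right s) by lra. apply Rlt_div_r in S2; [|lra]. nra. }
apply (angle_linear p _ de (fun s => pt (ax (x + s))) (fun s => jx (x + s)) b bb Hp1 Hp2 Ep Hconv) with (2 := D); [apply Rmult_lt_0_compat; [apply Jd; exact Hx|nra]|unfold b; lra|..].
- intros beta Hdir. apply (circle_germ p (fun s => x + s)); [| | |exact Kt|exact Hdir].
  + intros s Hs. unfold b in Hs. split; [apply Jd; lra|]. split.
    * apply argj_small. pose proof (jx_left x (x + s) ltac:(lra)). pose proof (jx_max (x + s) ltac:(lra)). lra.
    * intro E. apply pt_ax_inj in E. lra.
  + intros s eps _ Heps. exists eps. split; [exact Heps|]. intros t _ Ht. replace (x + t - (x + s)) with (t - s) by ring. exact Ht.
  + intros s t _ _ E. lra.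
- auto.
- intros s Hs. unfold b in Hs. split; [intro E; apply pt_ax_inj in E; lra|]. split.
  + rewrite F_pt by (simpl; lra). apply FF_axis. exact Hc.
  + pose proof (jx_left x (x + s) ltac:(lra)). lra.
- auto.
- unfold bb. lra.
- intros t Ht. unfold bb in Ht. split; [apply Disk1; lra|]. pose proof (J0_bound t ltac:(lra)). lra.
- intros s t Hs Ht E. unfold bb in Ht. pose proof (sl_disk _ _ _ _ _ SL t ltac:(lra)) as Dk. rewrite <- E in Dk. unfold disk in Dk. rewrite pt_ax_unit in Dk. lra.
- destruct (cover_interior p bb (J 0 + TT c) Hp1 Hp2 Ep ltac:(unfold bb; lra) ltac:(lra)) as [r [Hr H]].
  destruct (hd_ct _ _ _ _ L2 b ltac:(unfold b; lra)) as [r2 [Hr2 H2]].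
  assert (PV : 0 < Cmod (V - p)%C) by (apply Cmod_pos; intro X; apply Hp1; symmetry; apply Csub_0; exact X).
  exists (Rmin r (Rmin r2 (Cmod (V - p)%C))). split; [repeat apply Rmin_pos; assumption|]. intros z Hz Hzr.
  assert (Z1 := Rlt_le_trans _ _ _ Hzr (Rmin_l _ _)). assert (Z2 := Rlt_le_trans _ _ _ Hzr (Rle_trans _ _ _ (Rmin_r _ _) (Rmin_l _ _))).
  assert (Z3 := Rlt_le_trans _ _ _ Hzr (Rle_trans _ _ _ (Rmin_r _ _) (Rmin_r _ _))).
  assert (HzV : z <> V) by (intros ->; lra). destruct (frontier_value z Hz HzV) as [H1 _].
  destruct (Rle_lt_or_eq_dec _ _ H1) as [Dz|Uz].
  + destruct (H z Hz Dz Z1) as [E|[t [Ht [Et [Hend|Hj]]]]].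
    * exfalso. apply (F_avoid_low z (- TT c) Dz); [lra|]. rewrite E. apply ell_TT_opp. split; [exact Hc|exact Hc1].
    * right. right. exists t. split; [lra|exact Et].
    * pose proof (J0_bound t Ht). lra.
  + destruct (frontier_circle z Hz HzV Uz) as [E1 E2]. specialize (H2 z I Z2). rewrite Eo in H2. set (y := - Im (om z)) in *.
    assert (Hy : Rabs (y - x) < b).
    { eapply Rle_lt_trans; [|exact H2]. replace (y - x) with (- Im (om z - ax x)%C) by (unfold y; rewrite Im_sub; simpl; ring). rewrite Rabs_Ropp. apply Im_le_Cmod. }
    apply Rabs_lt_between in Hy. assert (x <= y). { apply Rnot_lt_le. intro Hlt. pose proof (jx_left y x ltac:(lra)). lra. }
    destruct (Req_dec y x) as [E|N]; [left; rewrite E1, E; reflexivity|]. right. left. exists (y - x). split; [lra|]. rewrite E1. f_equal. f_equal. ring.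
- intros eps Heps. assert (Sp : 0 < sin eps) by (apply sin_gt_0; lra). exists (2 * sin eps). split; [lra|]. intros s tau Hs Ht.
  pose proof (unit_step de s tau) as Q. rewrite <- Ede in Q. pose proof (sin_ge_mid eps tau Heps Ht). unfold disk. nra.
Qed.

(** * The angle at the starting point *)

Lemma chart_second_order : exists k, 0 < k /\ forall e, 0 < e -> exists r, 0 < r /\ forall w, 0 <= Re w -> Cmod (w - ax (/ eta)) < r ->
  Cmod (ZZ c (J 0) (FF c eta w) - (a0 c, J 0) - Ci * RtoC k * ((w - ax (/ eta)) * (w - ax (/ eta)))) <= e * Cmod (w - ax (/ eta)) ^ 2.
Proof.
pose proof eta_gt0 as He. pose proof Hc as Pc. set (w0 := ax (/ eta)). set (X := ell c (J 0)). assert (NX : X <> 0) by apply ell_neq0.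
assert (FX : FF c eta w0 = X) by (unfold w0, X; rewrite FF_axis by exact Hc; fold (jx (/ eta)); rewrite <- J0_jx; reflexivity).
assert (Iw : (Ci * eta * w0 = 1)%C) by (unfold w0; apply C_eq; simpl; field; lra).
set (D := fun z => ((a0 c, J 0) * ((c / 2)%R * Cpw (z / X) (c / 2 - 1) * / X))%C).
assert (HD : forall z, 0 < Re (z / X)%C -> hdC (ZZ c (J 0)) z (D z)).
{ intros z Hz. apply hd_scal. apply (hd_Cpw all_C (fun z => z / X)%C); [exact Hz|].
  eapply hd_eq; [|apply hd_mult; [apply hd_id|apply hd_const]]. cbv beta; ring. }
(* The derivative of the chart is exactly [G v * (v - w0)], because [FF1] contains the factor
   [i eta v - 1]. The second-order expansion then follows from continuity of [G] and the mean value
   inequality on a segment of the half-plane. *)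
set (P := fun w => Cpw (kap c w - Ci * eta) (2 / c - 1)). set (G := fun w => (D (FF c eta w) * (2 * Ci * eta * P w))%C).
assert (Ry : 0 < Re (kap c w0 - Ci * eta)%C) by (rewrite Re_kap_eta; apply kap_Re_pos; [exact Hc|simpl; lra]).
assert (DF : hdC (FF c eta) w0 (FF1 c eta w0)) by (apply FF_hd; [exact Hc|simpl; lra]).
assert (XX : (X / X)%C = 1) by (field; exact NX).
assert (CG : ct all_C G w0).
{ apply ct_mult; [apply (ctC_comp all_C D (FF c eta)); [|eapply hd_ct, DF]|apply ct_mult; [apply ct_const|]].
  - rewrite FX. apply ct_mult; [apply ct_const|]. apply ct_mult; [apply ct_mult; [apply ct_const|]|apply ct_const].
    eapply hd_ct, (hd_Cpw all_C (fun z => z / X)%C); [rewrite XX; simpl; lra|apply hd_mult; [apply hd_id|apply hd_const]].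
  - eapply hd_ct, (hd_Cpw all_C (fun w => kap c w - Ci * eta)%C); [exact Ry|apply hd_minus; [apply hdC_kap; [exact Hc|simpl; lra]|apply hd_const]]. }
set (q := 1 + (/ eta) ^ 2). assert (Hq : 0 < q) by (unfold q; pose proof (pow2_ge_0 (/ eta)); lra).
(* Minus half the second derivative of [jx] at its maximum [/ eta]. *)
set (k := c * eta * Rpower q (c / 2 - 1) / 2).
assert (G0 : G w0 = (Ci * (2 * k)%R)%C).
{ set (y := (kap c w0 - Ci * eta)%C) in *. assert (Ny : y <> 0) by (intro Z; rewrite Z in Ry; simpl in Ry; lra).
  assert (Ea : (a0 c, J 0) = (Rpower q (c / 2) * y)%C :> C).
  { unfold y, q, w0. transitivity (Rpower (1 + (/ eta) ^ 2) (c / 2) * kap c (ax (/ eta)) - Ci * (Rpower (1 + (/ eta) ^ 2) (c / 2) * eta)%R)%C; [|rewrite RtoC_mult; ring].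
    rewrite kap_axis by exact Hc. rewrite J0_jx. unfold jx, JJ. apply C_eq; simpl; ring. }
  assert (EX : X = (q * (P w0 * y))%C).
  { rewrite <- FX. unfold FF, P. fold y. rewrite (Cpw_minus1 y (2 / c)) by exact Ry. f_equal. unfold w0, q, ax. Cring. }
  assert (Np : P w0 <> 0) by apply Cpw_neq_0.
  unfold G, D. rewrite FX, XX, Ea, EX. replace (Cpw 1 (c / 2 - 1)) with (RtoC 1) by (rewrite Cpw_R by lra; unfold Rpower; rewrite ln_1, Rmult_0_r, exp_0; reflexivity).
  assert (Er : Rpower q (c / 2) = Rpower q (c / 2 - 1) * q).
  { rewrite <- (Rpower_1 q) at 3 by exact Hq. rewrite <- Rpower_plus. f_equal. ring. }
  rewrite Er. unfold k. replace (2 * (c * eta * Rpower q (c / 2 - 1) / 2)) with (c / 2 * 2 * eta * Rpower q (c / 2 - 1)) by field. rewrite !RtoC_mult. field.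
  repeat split; auto. intro Z. apply RtoC_inj in Z. lra. }
exists k. split; [unfold k; assert (0 < Rpower q (c / 2 - 1)) by apply exp_pos; apply Rdiv_lt_0_compat; [apply Rmult_lt_0_compat; [apply Rmult_lt_0_compat|]; assumption|lra]|].
intros e Hep. destruct (CG e Hep) as [r1 [Hr1 H1]]. destruct (ZZ_near c (J 0) 1 Hc ltac:(lra)) as [d [Hd Hn]]. fold X in Hn.
destruct (hd_ct _ _ _ _ DF d Hd) as [r2 [Hr2 H2]]. rewrite FX in H2.
exists (Rmin r1 r2). split; [apply Rmin_pos; assumption|]. intros w Hw Hwr.
assert (Seg : forall s, 0 <= s <= 1 -> let v := affine w0 w (RtoC s) in 0 <= Re v /\ Cmod (v - w0) <= Cmod (w - w0)).
{ intros s Hs v. unfold v, affine. split; [rewrite re_plus, re_scal_l, Re_sub; simpl (Re w0); nra|].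
  replace (w0 + s * (w - w0) - w0)%C with (s * (w - w0))%C by ring. rewrite Cmod_mult, Cmod_R, Rabs_right by lra. pose proof (Cmod_ge_0 (w - w0)). nra. }
pose proof (convex_lip (fun v => ZZ c (J 0) (FF c eta v) - Ci * k * ((v - w0) * (v - w0)))%C (fun v => (G v - G w0) * (v - w0))%C w0 w (e * Cmod (w - w0))) as L.
cbv beta in L. rewrite FX in L. unfold X in L. rewrite (ZZ_self c (J 0)) in L by exact Hc. fold X in L.
replace (ZZ c (J 0) (FF c eta w) - (a0 c, J 0) - Ci * k * ((w - w0) * (w - w0)))%C with
  (ZZ c (J 0) (FF c eta w) - Ci * k * ((w - w0) * (w - w0)) - ((a0 c, J 0) - Ci * k * ((w0 - w0) * (w0 - w0))))%C by ring.
replace (e * Cmod (w - w0) ^ 2) with (e * Cmod (w - w0) * Cmod (w - w0)) by ring. apply L.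
- intros s Hs. destruct (Seg s Hs) as [S1 S2]. set (v := affine w0 w (RtoC s)) in *.
  assert (V2 : Cmod (v - w0) < r2) by (eapply Rle_lt_trans; [exact S2|rmin]).
  destruct (Hn _ (H2 v I V2)) as [N1 _].
  eapply hd_eq; [|apply hd_minus; [apply (hdC_comp all_C (ZZ c (J 0)) (FF c eta)); [apply HD, N1|apply FF_hd; [exact Hc|exact S1]]
    |apply hd_scal; apply hd_mult; (apply hd_minus; [apply hd_id|apply hd_const])]].
  cbv beta. rewrite G0. unfold G, FF1. fold (P v). rewrite (RtoC_mult 2 k). replace (Ci * RtoC eta * v - 1)%C with (Ci * RtoC eta * (v - w0))%C by (rewrite <- Iw; ring). ring.
- intros s Hs. destruct (Seg s Hs) as [S1 S2]. set (v := affine w0 w (RtoC s)) in *.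
  assert (V1 : Cmod (v - w0) < r1) by (eapply Rle_lt_trans; [exact S2|rmin]). specialize (H1 v I V1).
  rewrite Cmod_mult. apply Rmult_le_compat; try apply Cmod_ge_0; lra.
Qed.

(** [om] has the negative real derivative [- q] at [1], so the quadratic coefficient stays a
    positive multiple of [i]. *)
Lemma chart_at_one : J 0 = - TT c -> exists k, 0 < k /\ forall e, 0 < e -> exists r, 0 < r /\ forall z, disk z -> Cmod (z - 1)%C < r ->
  Cmod (ZZ c (- TT c) (F z) - (a0 c, (- TT c)%R) - Ci * RtoC k * ((z - 1) * (z - 1)))%C <= e * Cmod (z - 1)%C ^ 2.
Proof.
intros HJ. destruct chart_second_order as [k [Hk H]]. rewrite HJ in H. set (w0 := ax (/ eta)) in *.
destruct (hdC_om 1 V_neq1) as [l [_ [L2 L3]]]. rewrite om_1 in L3. pose proof (om_rotation (/ eta) l L3) as Er. rewrite pt_1, Cmult_1_l in Er.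
set (q := (1 + (/ eta) ^ 2) / 2) in *. assert (Hq : 0 < q) by (unfold q; pose proof (pow2_ge_0 (/ eta)); lra).
assert (Kq : 0 < k * q ^ 2) by (apply Rmult_lt_0_compat; [exact Hk|apply pow_lt; exact Hq]).
exists (k * q ^ 2). split; [exact Kq|]. intros e He.
assert (Pq : 0 < (q + 1) ^ 2) by (apply pow_lt; lra). assert (Kq2 : 0 < k * (2 * q + 1)) by (apply Rmult_lt_0_compat; lra).
destruct (H (e / 2 / (q + 1) ^ 2)) as [d [Hd H2]]; [apply Rdiv_lt_0_compat; lra|].
set (e3 := Rmin 1 (e / 2 / (k * (2 * q + 1)))). assert (E3 : 0 < e3) by (apply Rmin_pos; [lra|apply Rdiv_lt_0_compat; lra]).
destruct (L2 e3 E3) as [d3 [Hd3 H3]]. destruct (hd_ct _ _ _ _ L2 d Hd) as [d5 [Hd5 H5]].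
exists (Rmin d3 d5). split; [apply Rmin_pos; assumption|]. intros z Dk Hz.
specialize (H5 z I ltac:(rmin)). specialize (H3 z I ltac:(rmin)). rewrite om_1 in H5, H3. rewrite Er in H3. fold w0 in H5, H3.
specialize (H2 (om z) (Rlt_le _ _ (om_pos z Dk)) H5). rewrite <- F_om in H2.
set (w := (om z - w0)%C) in *. set (u := (z - 1)%C) in *. assert (e3 <= 1) by apply Rmin_l.
assert (K3 : k * ((2 * q + 1) * e3) <= e / 2). { assert (Q : e3 <= e / 2 / (k * (2 * q + 1))) by apply Rmin_r. apply Rle_div_r in Q; [|exact Kq2]. lra. }
set (B := (w - (- q)%R * u)%C) in *. pose proof (Cmod_ge_0 u) as Pu. pose proof (Cmod_ge_0 B) as PB.
assert (Mq : Cmod ((- q)%R * u) = q * Cmod u) by (rewrite Cmod_mult, Cmod_R, Rabs_Ropp, Rabs_right by lra; reflexivity).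
assert (Mw : Cmod w <= (q + 1) * Cmod u).
{ pose proof (Cmod_triangle B ((- q)%R * u)) as T1. replace (B + (- q)%R * u)%C with w in T1 by (unfold B; ring). nra. }
assert (Mw' : Cmod (w + (- q)%R * u) <= (2 * q + 1) * Cmod u) by (pose proof (Cmod_triangle w ((- q)%R * u)); lra).
replace (ZZ c (- TT c) (F z) - (a0 c, (- TT c)%R) - Ci * (k * q ^ 2)%R * (u * u))%C with
  ((ZZ c (- TT c) (F z) - (a0 c, (- TT c)%R) - Ci * k * (w * w)) + Ci * (k * (B * (w + (- q)%R * u))))%C by (unfold B; rewrite RtoC_opp, RtoC_mult, RtoC_pow; ring).
eapply Rle_trans; [apply Cmod_triangle|]. rewrite !Cmod_mult, Cmod_Ci, Cmod_R, Rabs_right by lra.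
assert (T1 : e / 2 / (q + 1) ^ 2 * Cmod w ^ 2 <= e / 2 * Cmod u ^ 2).
{ apply Rle_trans with (e / 2 / (q + 1) ^ 2 * ((q + 1) * Cmod u) ^ 2); [|right; field; lra].
  apply Rmult_le_compat_l; [apply Rlt_le, Rdiv_lt_0_compat; lra|]. apply pow_incr. split; [apply Cmod_ge_0|exact Mw]. }
assert (T2 : Cmod B * Cmod (w + (- q)%R * u) <= e3 * Cmod u * ((2 * q + 1) * Cmod u)) by (apply Rmult_le_compat; [exact PB|apply Cmod_ge_0|exact H3|exact Mw']).
apply (Rmult_le_compat_l k) in T2; [|lra]. pose proof (Rmult_le_compat_r (Cmod u ^ 2) _ _ (pow2_ge_0 _) K3). lra.
Qed.

Lemma ZZ_TT_rot_diff z : (ZZ c (TT c) z - (a0 c, TT c) = cis (PI * c) * (ZZ c (- TT c) z - (a0 c, (- TT c)%R)))%C.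
Proof.
pose proof (ZZ_TT_rot (ell c (TT c))) as E. destruct (ZZ_TT_at _ eq_refl) as [E1 E2]. rewrite E1, E2 in E.
rewrite ZZ_TT_rot, E. ring.
Qed.

(** A chart displacement along [i cis (2 th)] means that [(z - 1) ^ 2] has direction [cis (2 th)];
    as [Re (z - 1) < 0] in the disk, the root is [cis (PI + th)]. *)
Lemma arc_dir_one k th j b : 0 < cos th -> (forall s, 0 < s < b -> disk (k s)) -> 0 < b -> tends0 k 1 -> J 0 = - TT c ->
  (forall s, 0 < s < b -> exists r, 0 <= r /\ (ZZ c (- TT c) (F (k s)) - (a0 c, (- TT c)%R) = r * (Ci * cis (2 * th)))%C) ->
  j = PI + th -> tends0 (fun s => (k s - 1) / RtoC (Cmod (k s - 1)%C))%C (cis j).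
Proof.
intros Hth Hdk Hb Hk HJ Hr -> eps He. destruct (chart_at_one HJ) as [kk [Hkk Hch]].
destruct (Hch (kk * (eps * cos th / 4))) as [d [Hd H]]; [pos|].
destruct (Hk d Hd) as [d2 [Hd2 H2]]. exists (Rmin b d2). split; [pos|]. intros s Hs.
assert (S1 : s < b) by rmin. assert (S2 : s < d2) by rmin.
specialize (Hdk s ltac:(lra)). specialize (H (k s) Hdk (H2 s ltac:(lra))). destruct (Hr s ltac:(lra)) as [r [Hr0 Er]]. rewrite Er in H.
set (u := (k s - 1)%C) in *. assert (Hu : u <> 0). { intro X. apply Csub_0 in X. unfold disk in Hdk. rewrite X, Cmod_1 in Hdk. lra. }
assert (Ec : Re (cis (PI + th) * - (1))%C = cos th).
{ simpl. replace (PI + th) with (th + PI) by ring. rewrite neg_cos. ring. }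
assert (Hre : Re u < 0).
{ unfold disk in Hdk. pose proof (re_le_Cmod (k s)) as Q. apply Rabs_le_between in Q. unfold u. rewrite Re_sub. simpl. lra. }
eapply Rle_lt_trans; [apply dir_sqrt with (n := (- (1))%C) (r := r / kk) (e := eps * cos th / 4); [auto|rewrite Cmod_opp, Cmod_1; reflexivity|apply Rdiv_le_0_compat; assumption| |lra|]|].
- replace (u * - (1))%C with (- u)%C by ring. change (0 <= - Re u). lra.
- replace (2 * (PI + th)) with (2 * th + 2 * PI) by ring. replace (cis (2 * th + 2 * PI)) with (cis (2 * th)) by (rewrite cis_add; unfold cis at 3; rewrite cos_2PI, sin_2PI; apply C_eq; simpl; ring).
  replace (r * (Ci * cis (2 * th)) - Ci * kk * (u * u))%C with (- Ci * kk * (u * u - RtoC (r / kk) * cis (2 * th)))%C in H.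
  + rewrite Cmod_mult, Cmod_mult, Cmod_opp, Cmod_R, Rabs_right, Cmod_Ci, Rmult_1_l in H by lra.
    nra.
  + replace (RtoC r) with (kk * RtoC (r / kk))%C by (rewrite <- RtoC_mult; f_equal; field; lra). ring.
- apply Rlt_div_l; [lra|]. nra.
Qed.

(** Both sides belong to the curve. Its start goes up from [- TT c] in the chart, hence leaves along
    the normal [cis PI]. Its end goes down to [TT c] in the other chart, which is rotated by [PI c];
    this is the direction [i cis (2 al)] in the first one, and the square root halves the angle. *)
Lemma angle_one : J 0 = - TT c -> (forall eps, 0 < eps -> exists t1, 0 < t1 < Te /\ forall t, t1 < t < Te -> Cmod (gamma t - 1)%C < eps) ->
  interior_angle Om 1 (PI * (1 - c) / 2).
Proof.
intros HJ Hconv. pose proof PI_RGT_0 as HPI. pose proof Hc as Pc. pose proof (sl_T _ _ _ _ _ SL) as PT. pose proof (sl_TT _ _ _ _ _ SL Hc1) as JT.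
assert (Hp2 : Cmod 1 <= 1) by (rewrite Cmod_1; lra).
assert (Ep : F 1 = ell c (TT c)). { rewrite F_om, om_1, FF_axis by lra. fold (jx (/ eta)). rewrite <- J0_jx, HJ. symmetry. apply ell_TT_opp. lra. }
assert (N1 : forall t, 0 < t < Te -> gamma t <> 1). { intros t Ht E. pose proof (sl_disk _ _ _ _ _ SL t Ht) as Dk. rewrite E in Dk. unfold disk in Dk. rewrite Cmod_1 in Dk. lra. }
assert (Mid : forall t, 0 < t < Te -> - TT c <= J t <= TT c) by (intros t Ht; pose proof (J0_bound t Ht); pose proof (JT t ltac:(lra)); lra).
set (b := Te / 3). set (al := PI * (1 - c) / 2). assert (Hal : 0 < al < PI / 2) by (unfold al; nra).
assert (Kst : tends0 (fun s => gamma (0 + 1 * s)) 1).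
{ intros eps He. destruct (sl_start _ _ _ _ _ SL eps He) as [d [Hd H]]. exists d. split; [lra|]. intros s Hs. replace (0 + 1 * s) with s by ring. auto. }
pose proof (conv_tends _ Hconv) as Ken.
assert (Germ : forall s1 sg beta, sg = 1 \/ sg = -1 -> (forall s, 0 < s <= b -> 0 < s1 + sg * s < Te) -> tends0 (fun s => gamma (s1 + sg * s)) 1 ->
  tends0 (fun s => (gamma (s1 + sg * s) - 1) / RtoC (Cmod (gamma (s1 + sg * s) - 1)%C))%C (cis beta) -> germ Om 1 (fun s => gamma (s1 + sg * s)) b beta).
{ intros s1 sg beta Hsg Hr T1 T2. apply gamma_germ; [lra| |auto|auto]. intros s Hs. specialize (Hr s Hs). split; [lra|]. split; [auto|apply gau_ell_mid, Mid; exact Hr]. }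
apply (angle_intro Om 1 al PI (fun s => gamma (0 + 1 * s)) b (fun s => gamma (Te + -1 * s)) b); [lra|pos|pos|..].
- apply Germ; [lra|intros s Hs; unfold b in Hs; lra|auto|].
  destruct (argj_near c (- TT c) Hc) as [d1 [Hd1 H1]]. destruct (J_right 0 d1 ltac:(lra) Hd1) as [d2 [Hd2 H2]].
  apply (arc_dir_one _ 0 _ (Rmin b d2)); [rewrite cos_0; lra| |pos|auto|lra| |ring].
  + intros s Hs. assert (s < b) by rmin. unfold b in *. apply (sl_disk _ _ _ _ _ SL). lra.
  + intros s Hs. assert (s < d2) by rmin.
    destruct (H2 s ltac:(lra)) as [H3 H4]. replace (0 + 1 * s) with (0 + s) by ring. exists (J (0 + s) + TT c). split; [lra|].
    rewrite (sl_F _ _ _ _ _ SL) by lra. rewrite ZZ_ell; [|lra|apply H1, Rabs_lt_between; lra].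
    rewrite Rmult_0_r, cis_0. Cring.
- apply Germ; [lra|intros s Hs; unfold b in Hs; lra|auto|].
  destruct (argj_near c (TT c) Hc) as [d1 [Hd1 H1]]. destruct (J_end_tends d1 Hd1) as [d2 [Hd2 H2]].
  apply (arc_dir_one _ al _ (Rmin b d2)); [apply cos_gt_0; lra| |pos|auto|lra| |lra].
  + intros s Hs. assert (s < b) by rmin. unfold b in *. apply (sl_disk _ _ _ _ _ SL). lra.
  + intros s Hs. assert (s < b) by rmin. assert (s < d2) by rmin.
    specialize (H2 s ltac:(lra)). pose proof (JT (Te + -1 * s) ltac:(unfold b in *; lra)) as HJT. exists (TT c - J (Te + -1 * s)). split; [lra|].
    assert (Nc : cis (PI * c) <> 0) by (apply Cmod_pos_neq; rewrite Cmod_cis; lra). apply Cmult_reg_r with (cis (PI * c)); [auto|].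
    rewrite (Cmult_comm _ (cis (PI * c))), <- ZZ_TT_rot_diff. rewrite (sl_F _ _ _ _ _ SL) by (unfold b in *; lra).
    rewrite ZZ_ell; [|lra|auto].
    transitivity (RtoC (TT c - J (Te + -1 * s)) * Ci * (cis (2 * al) * cis (PI * c)))%C; [|ring]. rewrite <- cis_add. replace (2 * al + PI * c) with PI by (unfold al; field).
    unfold cis. rewrite cos_PI, sin_PI. Cring.
- intros s t Hs Ht E. unfold b in *. apply (sl_inj _ _ _ _ _ SL) in E; lra.
- pose proof (J0_bound b ltac:(unfold b; lra)) as Jb.
  destruct (cover_interior 1 b (J b + TT c) V_neq1 Hp2 Ep ltac:(unfold b; lra) ltac:(lra)) as [r [Hr H]].
  assert (PV : 0 < Cmod (V - 1)%C) by (apply Cmod_pos; intro X; apply V_neq1; symmetry; apply Csub_0; exact X).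
  exists (Rmin r (Cmod (V - 1)%C)). split; [pos|]. intros z Hz Hzr.
  assert (R1 := Rlt_le_trans _ _ _ Hzr (Rmin_l _ _)). assert (R2 := Rlt_le_trans _ _ _ Hzr (Rmin_r _ _)).
  assert (HzV : z <> V) by (intros ->; lra). destruct (frontier_value z Hz HzV) as [H1 _].
  destruct (Rle_lt_or_eq_dec _ _ H1) as [Dz|Uz].
  + destruct (H z Hz Dz R1) as [E|[t [Ht [Et [Hend|Hj]]]]].
    * exfalso. apply (F_avoid_low z (- TT c) Dz); [lra|]. rewrite E. apply ell_TT_opp. lra.
    * right. right. exists (Te - t). split; [lra|]. rewrite Et. f_equal. ring.
    * right. left. assert (t < b). { apply Rnot_le_lt. intros [Q|Q]; [pose proof (sl_incr _ _ _ _ _ SL b t ltac:(unfold b in *; lra) ltac:(lra)); lra|rewrite Q in Hj; lra]. }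
      exists t. split; [lra|]. rewrite Et. f_equal. ring.
  + left. destruct (frontier_circle z Hz HzV Uz) as [E1 E2]. rewrite E1, <- pt_1. f_equal. f_equal. apply NNPP. intro N. pose proof (jx_max _ N). lra.
- intros eps He. set (e := Rmin eps (Rmin (PI * (1 - c) / 4) (PI * c / 2))).
  assert (He0 : 0 < e) by pos. assert (He1 : e <= eps) by apply Rmin_l.
  assert (He2 : e <= PI * (1 - c) / 4) by (eapply Rle_trans; [apply Rmin_r|rmin]). assert (He3 : e <= PI * c / 2) by (eapply Rle_trans; [apply Rmin_r|rmin]).
  assert (He4 : e <= PI / 2) by nra. set (sg := sin e). assert (Hsg : 0 < sg) by (apply sin_gt_0; lra).
  destruct (gau_local 1 V_neq1 Hp2 Ep) as [d0 [Hd0 H0]].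
  destruct (chart_at_one HJ) as [k [Hk Hch]]. destruct (Hch (k * sg / 2) ltac:(nra)) as [d1 [Hd1 H1]].
  exists (Rmin (Rmin d0 d1) (2 * sg)). split; [pos|]. intros s phi Hs.
  assert (S0 : s < d0) by rmin.
  assert (S1 : s < d1) by rmin.
  assert (S2 : s < 2 * sg) by rmin.
  set (z := (1 + s * cis phi)%C). set (tau := phi - PI).
  assert (Ez : (z - 1)%C = (s * cis phi)%C) by Cring.
  assert (Mz : Cmod (z - 1)%C = s) by (rewrite Ez, Cmod_mult, Cmod_R, Cmod_cis, Rabs_right; lra).
  assert (Mz2 : Cmod z ^ 2 = 1 - 2 * s * cos tau + s ^ 2).
  { pose proof (unit_step 0 s (PI / 2 + tau)) as Q. rewrite cis_0 in Q. replace (0 + PI / 2 + (PI / 2 + tau)) with phi in Q by (unfold tau; field).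
    fold z in Q. rewrite Q. rewrite (cos_sin tau). lra. }
  assert (R12 : disk z -> Rabs (Re (ZZ c (- TT c) (F z)) - a0 c + k * s ^ 2 * sin (2 * tau)) <= k * sg / 2 * s ^ 2 /\
      Rabs (Re (ZZ c (TT c) (F z)) - a0 c + k * s ^ 2 * sin (2 * tau + PI * c)) <= k * sg / 2 * s ^ 2).
  { intros Dk. specialize (H1 z Dk ltac:(lra)). rewrite Mz, Ez in H1.
    assert (Esq : (Ci * k * (s * cis phi * (s * cis phi)) = RtoC (k * s ^ 2) * cis (PI / 2 + 2 * tau))%C).
    { replace (PI / 2 + 2 * tau) with (PI / 2 + (phi + phi) + - (2 * PI)) by (unfold tau; field). rewrite !cis_add.
      replace (cis (- (2 * PI))) with (RtoC 1) by (unfold cis; rewrite cos_neg, sin_neg, cos_2PI, sin_2PI; apply C_eq; simpl; ring).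
      replace (cis (PI / 2)) with Ci by (unfold cis; rewrite cos_PI2, sin_PI2; reflexivity). Cring. }
    rewrite Esq in H1. split.
    - eapply Rle_trans; [|exact H1]. eapply Rle_trans; [|apply re_le_Cmod]. right. f_equal. rewrite !Re_sub, re_scal_l. simpl (Re (cis _)). simpl (Re (_, _)).
      rewrite (sin_cos (2 * tau)). ring.
    - eapply Rle_trans; [|exact H1]. rewrite <- (Rmult_1_l (Cmod _)), <- (Cmod_cis (PI * c)), <- Cmod_mult. eapply Rle_trans; [|apply re_le_Cmod]. right. f_equal.
      replace (cis (PI * c) * (ZZ c (- TT c) (F z) - (a0 c, (- TT c)%R) - RtoC (k * s ^ 2) * cis (PI / 2 + 2 * tau)))%C with
        ((ZZ c (TT c) (F z) - (a0 c, TT c)) - RtoC (k * s ^ 2) * cis (PI / 2 + (2 * tau + PI * c)))%C.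
      + rewrite !Re_sub, re_scal_l. simpl (Re (cis _)). simpl (Re (_, _)). rewrite (sin_cos (2 * tau + PI * c)). ring.
      + rewrite ZZ_TT_rot_diff. replace (PI / 2 + (2 * tau + PI * c)) with (PI * c + (PI / 2 + 2 * tau)) by ring. rewrite (cis_add (PI * c)). ring. }
  specialize (H0 z ltac:(lra)). assert (Ps : 0 < s ^ 2) by nra.
  assert (Pks : 0 < k * s ^ 2) by pos. assert (Pksg : 0 < k * s ^ 2 * sg) by pos.
  split; intros Hphi.
  + assert (T0 : e <= tau <= PI / 2 - e) by (unfold tau, al in *; nra).
    assert (Dk : disk z).
    { unfold disk. pose proof (sin_ge_mid e (PI / 2 - tau) ltac:(lra) ltac:(lra)) as Q. rewrite sin_shift in Q. fold sg in Q. nra. }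
    destruct (R12 Dk) as [R1 R2]. apply Rabs_le_between in R1. apply Rabs_le_between in R2.
    apply Om_iff. split; [auto|].
    pose proof (sin_ge_mid e (2 * tau) ltac:(lra) ltac:(lra)) as Q1. pose proof (sin_ge_mid e (2 * tau + PI * c) ltac:(lra) ltac:(unfold tau, al in *; nra)) as Q2. fold sg in Q1, Q2.
    apply H0; nra.
  + intro HO. apply Om_iff in HO. destruct HO as [Dk HO].
    destruct (R12 Dk) as [R1 R2]. apply Rabs_le_between in R1. apply Rabs_le_between in R2.
    assert (T0 : al + e <= tau <= 2 * PI - e) by (unfold tau; lra).
    (* The quadratic chart takes the same values at opposite directions; membership in the disk
       selects one of the two. *)
    assert (Hcos : 0 < cos tau). { unfold disk in Dk. pose proof (Cmod_ge_0 z). apply Rnot_le_lt. intro. nra. }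
    assert (Hside : tau < PI / 2 \/ 3 * (PI / 2) < tau).
    { destruct (Rlt_le_dec tau (PI / 2)); [lra|right]. apply Rnot_le_lt. intro. pose proof (cos_le_0 tau ltac:(lra) ltac:(lra)). lra. }
    destruct Hside as [Hl|Hg].
    * pose proof (sin_le_mid e (2 * tau + PI * c) ltac:(lra) ltac:(unfold al in *; nra)) as Q. fold sg in Q. nra.
    * destruct (Rle_lt_dec (PI + e) (2 * tau - 2 * PI)) as [Hl|Hl2].
      -- pose proof (sin_le_mid e (2 * tau - 2 * PI) ltac:(lra) ltac:(lra)) as Q. fold sg in Q.
         replace (sin (2 * tau - 2 * PI)) with (sin (2 * tau)) in Q by (rewrite sin_minus, cos_2PI, sin_2PI; ring). nra.
      -- pose proof (sin_le_mid e (2 * tau - 2 * PI + PI * c) ltac:(lra) ltac:(nra)) as Q. fold sg in Q.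
         replace (2 * tau - 2 * PI + PI * c) with (2 * tau + PI * c - 2 * PI) in Q by ring.
         replace (sin (2 * tau + PI * c - 2 * PI)) with (sin (2 * tau + PI * c)) in Q by (rewrite sin_minus, cos_2PI, sin_2PI; ring). nra.
Qed.

Lemma pt_V w : 0 <= Re w -> (pt w - V)%C = (- (2 * V) / (w + 1))%C.
Proof. intros Hw. pose proof (wp1_neq0 w Hw) as N. unfold pt, to_h. fold V. field. exact N. Qed.

(** For [c < 1] the cosine in [gau] is at least [cos (c PI / 2) > 0], so [F] is bounded on [Om],
    whereas it tends to infinity at [V]. *)
Lemma Om_far_V : ~ closure Om V.
Proof.
intros HV. pose proof (a0_pos c Hc) as A. set (k := cos (c * PI / 2)). assert (Hk : 0 < k) by (apply cos_gt_0; nra).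
set (B := Rpower (a0 c / k) (2 / c)). destruct (FF_inf c eta B Hc eta_gt0) as [M [HM H]].
destruct (HV (2 / (M + 1))) as [z [Z1 Z2]]; [pos|]. apply Om_iff in Z1. destruct Z1 as [Dk Hg].
assert (HB : Cmod (F z) <= B).
{ apply Rnot_lt_le. intro Hlt. assert (PB : 0 < B) by pos.
  assert (Nz : F z <> 0) by (intro X; rewrite X, Cmod_0 in Hlt; lra).
  rewrite gau_neq0 in Hg by auto. pose proof (Th_bound (F z)) as T.
  assert (C1 : k <= cos (Rmin (c * Th (F z) / 2) (PI / 2))).
  { apply cos_decr_1; try lra; try nra. - apply Rmin_glb; nra. - rmin. - eapply Rle_trans; [apply Rmin_l|nra]. }
  assert (C2 : a0 c / k < Rpower (Cmod (F z)) (c / 2)).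
  { replace (a0 c / k) with (Rpower B (c / 2)); [apply Rlt_Rpower_l; lra|]. unfold B. rewrite Rpower_mult. replace (2 / c * (c / 2)) with 1 by (field; lra).
    apply Rpower_1, Rdiv_lt_0_compat; lra. }
  apply Rlt_div_l in C2; [|lra]. nra. }
pose proof (om_pos z Dk) as Rz. assert (Hw : Cmod (om z) < M).
{ apply Rnot_le_lt. intro Hle. specialize (H (om z) ltac:(lra) Hle). rewrite <- F_om in H. lra. }
rewrite <- (pt_om z) in Z2 by (apply disk_neqV; exact Dk). rewrite pt_V in Z2 by lra. pose proof (wp1_neq0 (om z) ltac:(lra)) as N. pose proof (Cmod_pos _ N) as PN.
rewrite Cmod_div, Cmod_opp, Cmod_mult, Cmod_R, Cmod_V, Rabs_right in Z2 by pos. pose proof (Cmod_triangle (om z) 1) as T1. rewrite Cmod_1 in T1.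
apply (proj1 (Rlt_div_l _ _ _ PN)) in Z2. assert (2 / (M + 1) * Cmod (om z + 1)%C <= 2 / (M + 1) * (M + 1)) by nra.
replace (2 / (M + 1) * (M + 1)) with 2 in H0 by (field; lra). lra.
Qed.

Lemma subcritical : exists p,
  (forall eps, 0 < eps -> exists t1, 0 < t1 < Te /\ forall t, t1 < t < Te -> Cmod (gamma t - p)%C < eps) /\
  ((exists t, 0 < t < Te /\ p = gamma t) \/ Cmod p = 1) /\ p <> V /\ ~ closure Om V /\
  (p <> 1 -> interior_angle Om p (PI * (1 - c))) /\ (p = 1 -> interior_angle Om p (PI * (1 - c) / 2)).
Proof.
destruct endpoint as [p [P1 [P2 [P3 [P4 P5]]]]]. exists p. split; [auto|].
assert (K : forall q, Cmod q = 1 -> forall t, 0 < t < Te -> gamma t <> q).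
{ intros q Hq t Ht E. pose proof (sl_disk _ _ _ _ _ SL t Ht) as Dk. rewrite E in Dk. unfold disk in Dk. lra. }
destruct P5 as [[s0 [S1 [S2 S3]]]|[[x [X1 [X2 [X3 X4]]]]|[Q1 Q2]]]; subst p.
- split; [left; exists s0; split; [lra|auto]|]. split; [auto|]. split; [exact Om_far_V|]. split; [intros _; apply angle_interior; assumption|].
  intros E. exfalso. apply (K 1 Cmod_1 s0 S1 E).
- split; [right; apply pt_ax_unit|]. split; [auto|]. split; [exact Om_far_V|]. split; [intros _; apply angle_boundary; assumption|].
  intros E. rewrite <- pt_1 in E. apply pt_ax_inj in E. lra.
- split; [right; apply Cmod_1|]. split; [auto|]. split; [exact Om_far_V|]. split; [intros E; contradiction|]. intros _. apply angle_one; assumption.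
Qed.

End Subcritical.

(** ** The endpoint when [c >= 1] *)

(* Rotated coordinate at [V]: the disk is on the side [Im y > 0], and [y > 0] is counterclockwise along the circle. *)
Let yV (z : C) : C := ((z - V) / (Ci * V))%C.

Lemma iV_neq0 : (Ci * V)%C <> 0.
Proof. apply Cmod_pos_neq. rewrite Cmod_mult, Cmod_Ci, Cmod_V. lra. Qed.

Lemma yV_spec z : (z - V = Ci * V * yV z)%C /\ Cmod (yV z) = Cmod (z - V)%C.
Proof.
pose proof iV_neq0 as N. split.
- unfold yV. field. split; [apply Cmod_pos_neq; rewrite Cmod_V; lra|apply Cmod_pos_neq; rewrite Cmod_Ci; lra].
- unfold yV. rewrite Cmod_div by auto. rewrite Cmod_mult, Cmod_Ci, Cmod_V. field.
Qed.

Lemma yV_om z : z <> V -> yV z <> 0 /\ (om z + 1 = 2 * Ci / yV z)%C.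
Proof.
intros Hz. destruct (yV_spec z) as [E1 E2]. assert (Ny : yV z <> 0).
{ intro X. rewrite X, Cmult_0_r in E1. apply Hz, Csub_0. exact E1. }
split; [auto|]. assert (Ni : (- Ci)%C <> 0) by (apply Cmod_pos_neq; rewrite Cmod_opp, Cmod_Ci; lra).
assert (Eh : (z * cis (- v0) = 1 + Ci * yV z)%C).
{ replace z with (V + (z - V))%C at 1 by ring. rewrite E1. transitivity ((cis v0 * cis (- v0)) * (1 + Ci * yV z))%C; [Cring|]. rewrite cis_opp_r. ring. }
assert (Nd : (1 - z * cis (- v0))%C <> 0) by (rewrite Eh; replace (1 - (1 + Ci * yV z))%C with (- Ci * yV z)%C by ring; apply Cmult_neq_0; assumption).
apply Cmult_reg_r with (1 - z * cis (- v0))%C; [auto|].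
transitivity 2; [unfold om, to_w; replace (RtoC 2) with (1 + 1)%C by (ring); field; exact Nd|].
rewrite Eh. transitivity (- (Ci * Ci) * 2)%C; [Cring|field; exact Ny].
Qed.

Lemma yV_disk z : disk z -> 0 < Im (yV z).
Proof.
intros Dk. destruct (yV_spec z) as [E1 _]. unfold disk in Dk. replace z with (V * (1 + Ci * yV z))%C in Dk by (transitivity (V + Ci * V * yV z)%C; [ring|rewrite <- E1; ring]).
rewrite Cmod_mult, Cmod_V, Rmult_1_l in Dk. pose proof (re_le_Cmod (1 + Ci * yV z)%C) as Q. apply Rabs_le_between in Q. simpl in *. lra.
Qed.

Lemma om_large B : exists r, 0 < r /\ forall z, z <> V -> Cmod (z - V)%C < r -> B < Cmod (om z).
Proof.
set (B1 := Rmax B 0 + 1). assert (HB1 : 0 < B1 /\ B < B1) by (unfold B1; pose proof (Rmax_l B 0); pose proof (Rmax_r B 0); lra).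
exists (2 / (B1 + 1)). split; [pos|]. intros z Hz Hr. destruct (yV_om z Hz) as [Ny E]. destruct (yV_spec z) as [_ Em].
pose proof (Cmod_pos _ Ny) as Py. apply (f_equal Cmod) in E. rewrite Cmod_div, Cmod_mult, Cmod_Ci, Cmod_R, Rabs_right in E by (pos).
pose proof (Cmod_triangle (om z) 1) as T1. rewrite Cmod_1, E in T1. rewrite Em in *.
assert (Q : Cmod (z - V)%C * (B1 + 1) < 2) by (apply Rlt_div_r in Hr; lra).
assert (B1 + 1 < 2 * 1 / Cmod (z - V)%C) by (apply (proj1 (Rlt_div_r _ _ _ Py)); lra). lra.
Qed.

(** The product [F y ^ 2] equals [4 (1 + i y) (kap - i eta) ^ (2 / c)] exactly, and [kap] tends to
    [0] at [V]. *)
Lemma V_asym e : 0 < e -> exists r, 0 < r /\ forall z, disk z -> Cmod (z - V)%C < r ->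
  Cmod (F z * (yV z * yV z) - RtoC (4 * Rpower eta (2 / c)) * cis (- (PI / c)))%C <= e.
Proof.
intros Hep. pose proof eta_gt0 as He. set (p := Rpower eta (2 / c)). assert (Pp : 0 < p) by pos.
set (e1 := Rmin 1 (e / 16)). assert (He1 : 0 < e1) by pos. assert (He2 : e1 <= e / 16) by apply Rmin_r. destruct (hd_ct _ _ _ _ (hdC_Cpw eta (2 / c) ltac:(auto)) e1 He1) as [d [Hd H]].
rewrite Cpw_R in H by lra. assert (Hde : 0 < Rmin d eta) by (pos). destruct (kap_inf c (Rmin d eta / 2) Hc ltac:(lra)) as [M [HM Hk]]. destruct (om_large M) as [r1 [Hr1 H1]].
exists (Rmin r1 (Rmin 1 (e / (8 * p)))). split; [pos|]. intros z Dk Hz.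
assert (Z1 := Rlt_le_trans _ _ _ Hz (Rmin_l _ _)). assert (Z2 := Rlt_le_trans _ _ _ Hz (Rle_trans _ _ _ (Rmin_r _ _) (Rmin_l _ _))).
assert (Z3 := Rlt_le_trans _ _ _ Hz (Rle_trans _ _ _ (Rmin_r _ _) (Rmin_r _ _))). apply Rlt_div_r in Z3; [|lra].
pose proof (disk_neqV z Dk) as HzV. specialize (H1 z HzV Z1). pose proof (om_pos z Dk) as Rw. specialize (Hk (om z) ltac:(lra) ltac:(lra)).
destruct (yV_om z HzV) as [Ny Eo]. destruct (yV_spec z) as [_ Em]. set (w := om z) in *. set (y := yV z) in *.
pose proof (Rmin_l d eta) as K1. pose proof (Rmin_r d eta) as K2.
pose proof (kap_Re_pos c w Hc ltac:(lra)) as Rk. set (ka := kap c w) in *.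
set (yk := (eta + Ci * ka)%C).
assert (Ryk : 0 < Re yk). { pose proof (Im_le_Cmod ka) as Q. apply Rabs_le_between in Q. destruct ka as [k1 k2]. simpl in *. lra. }
assert (Iyk : 0 < Im yk) by (unfold yk; destruct ka as [k1 k2]; simpl in *; lra).
assert (Hyk : Cmod (Cpw yk (2 / c) - p)%C < e1).
{ apply H; [exact I|]. replace (yk - eta)%C with (Ci * ka)%C by (Cring). rewrite Cmod_mult, Cmod_Ci. lra. }
(* rotating by [i] moves [kap - i eta] off the boundary of the half-plane *)
assert (EP : Cpw (ka - Ci * eta) (2 / c) = (Cpw yk (2 / c) * cis (- (PI / c)))%C).
{ assert (El : Clog (ka - Ci * eta)%C = (Clog yk + (0, - (PI / 2))%R)%C).
  { rewrite <- (Clog_Cexp (Clog yk + (0, (- (PI / 2))%R))%C).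
    - f_equal. rewrite Cexp_add, Cexp_Clog by lra. unfold Cexp at 1. simpl (Re (_, _)). simpl (Im (_, _)). rewrite exp_0. unfold cis. rewrite cos_neg, sin_neg, cos_PI2, sin_PI2.
      Cring.
    - assert (B : 0 < Im (Clog yk) < PI / 2).
      { split; [|apply Im_Clog]. rewrite <- atan_0. apply atan_increasing, Rdiv_lt_0_compat; assumption. }
      rewrite im_plus. simpl (Im (_, _)). lra. }
  unfold Cpw. rewrite El. replace (RtoC (2 / c) * (Clog yk + (0, (- (PI / 2))%R)))%C with (RtoC (2 / c) * Clog yk + Ci * RtoC (- (PI / c)))%C.
  - rewrite Cexp_add, Cexp_I. auto.
  - apply C_eq; simpl; field; lra. }
assert (EF : (F z * (y * y) = 4 * (1 + Ci * y) * Cpw (ka - Ci * eta) (2 / c))%C).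
{ rewrite F_om. fold w. unfold FF. fold ka. assert (Ew : w = (2 * Ci / y - 1)%C) by (rewrite <- Eo; ring).
  assert (E1 : ((1 - w * w) * (y * y) = 4 * (1 + Ci * y))%C).
  { rewrite Ew. transitivity (2 * 2 * Ci * y - 2 * 2 * (Ci * Ci) + (2 - 1 - 1) * (2 * Ci * y))%C.
    - field. exact Ny.
    - Cring. }
  rewrite <- E1. ring. }
rewrite EF, EP. set (P := Cpw yk (2 / c)) in *.
replace (4 * (1 + Ci * y) * (P * cis (- (PI / c))) - RtoC (4 * p) * cis (- (PI / c)))%C with
  ((4 * ((1 + Ci * y) * (P - p) + Ci * y * p)) * cis (- (PI / c)))%C by (Cring).
rewrite Cmod_mult, Cmod_cis, Rmult_1_r, Cmod_mult, Cmod_R, Rabs_right by lra.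
pose proof (Cmod_triangle ((1 + Ci * y) * (P - p))%C (Ci * y * p)%C) as T1. rewrite !Cmod_mult, Cmod_Ci, Cmod_R, (Rabs_right p) in T1 by lra.
pose proof (Cmod_triangle 1 (Ci * y)%C) as T2. rewrite Cmod_1, Cmod_mult, Cmod_Ci in T2. pose proof (Cmod_ge_0 (P - p)%C). nra.
Qed.

Lemma cis_lip a b : Cmod (cis a - cis b)%C <= Rabs (a - b).
Proof.
rewrite Cmod_cis_diff. assert (Q : Rabs (sin ((a - b) / 2)) <= Rabs ((a - b) / 2)).
{ assert (P : forall x, 0 <= x -> Rabs (sin x) <= x).
  { intros x Hx. destruct (Req_dec x 0) as [->|N]; [rewrite sin_0, Rabs_R0; lra|]. apply Rabs_le_between. split; [|left; apply sin_lt_x; lra].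
    destruct (Rle_lt_dec x 1) as [H1|H1]; [|pose proof (SIN_bound x); lra]. pose proof PI2_1. pose proof (sin_ge_0 x Hx ltac:(lra)). lra. }
  destruct (Rle_lt_dec 0 ((a - b) / 2)) as [H|H]; [rewrite (Rabs_right ((a - b) / 2)) by lra; apply P; exact H|].
  rewrite <- Rabs_Ropp, <- sin_neg, (Rabs_left ((a - b) / 2)) by lra. apply P. lra. }
unfold Rdiv in Q. rewrite (Rabs_mult (a - b)), (Rabs_right (/ 2)) in Q by lra. lra.
Qed.

Lemma dir_yV k tau : tends0 (fun s => yV (k s) / RtoC (Cmod (yV (k s))))%C (cis tau) ->
  tends0 (fun s => (k s - V) / RtoC (Cmod (k s - V)%C))%C (cis (v0 + PI / 2 + tau)).
Proof.
intros H eps He. destruct (H eps He) as [d [Hd H1]]. exists d. split; [lra|]. intros s Hs. specialize (H1 s Hs).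
destruct (yV_spec (k s)) as [E1 E2]. rewrite <- E2, E1.
replace (cis (v0 + PI / 2 + tau)) with (Ci * V * cis tau)%C.
- replace (Ci * V * yV (k s) / RtoC (Cmod (yV (k s))) - Ci * V * cis tau)%C with (Ci * V * (yV (k s) / RtoC (Cmod (yV (k s))) - cis tau))%C by (Cring).
  rewrite Cmod_mult, Cmod_mult, Cmod_Ci, Cmod_V. lra.
- rewrite !cis_add. unfold V. replace (cis (PI / 2)) with Ci by (unfold cis; rewrite cos_PI2, sin_PI2; reflexivity). ring.
Qed.

Lemma yV_step s tau : yV (V + RtoC s * cis (v0 + PI / 2 + tau))%C = (RtoC s * cis tau)%C.
Proof.
unfold yV. rewrite !cis_add. fold V. replace (cis (PI / 2)) with Ci by (unfold cis; rewrite cos_PI2, sin_PI2; reflexivity).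
field. split; [apply Cmod_pos_neq; rewrite Cmod_V; lra|apply Cmod_pos_neq; rewrite Cmod_Ci; lra].
Qed.

(** The conserved quantity before it is raised to [2 / c]; the equation for [kap] again eliminates
    [kap] from the derivative. *)
Lemma Zdir_hd w : 0 <= Re w -> 0 < Re (1 - w * w)%C ->
  hdC (fun w => Cpw (1 - w * w) (c / 2) * (kap c w - Ci * eta))%C w
    (c * ((Ci * eta * w - 1) * Cpw (1 - w * w) (c / 2 - 1)))%C.
Proof.
intros Hw H1. eapply hd_eq; [|apply hd_mult; [apply (hd_Cpw all_C (fun w => 1 - w * w)%C); [lra|apply hd_minus; [apply hd_const|apply hd_mult; apply hd_id]]
  |apply hd_minus; [apply hdC_kap; [lra|lra]|apply hd_const]]].
cbv beta. rewrite (Cpw_minus1 _ (c / 2) H1). pose proof (kap_ode c w Hc ltac:(lra)) as O.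
set (P := Cpw (1 - w * w) (c / 2 - 1)). set (k := kap c w) in *. rewrite RtoC_div by lra.
transitivity (P * (- c * w * (k - Ci * eta) - (w * w - 1) * kap1 c w))%C; [field; intro X; apply RtoC_inj in X; lra|].
rewrite O. ring.
Qed.

(* On the quadrant below -i/eta the real part of (1 - w^2)^(c/2) (kap - i eta) increases to the right, from the value a0 on the boundary. *)
Lemma V_clockwise : exists K M, 0 < K /\ 0 < M /\ forall w, 0 < Re w -> Im w < - K * Re w - M -> a0 c < gau c (FF c eta w).
Proof. pose proof eta_gt0 as He.
(* [tb] will bound the argument of [1 - w ^ 2]: multiplied by [|c / 2 - 1|] or by [c / 2] it stays
   below [PI / 4]. The slope [K] is what forces this argument below [tb]. *)
set (tb := PI / 4 / (c / 2 + 1)). assert (Htb : 0 < tb) by (pos).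
assert (Etb : (c / 2 + 1) * tb = PI / 4) by (unfold tb; field; lra). assert (Htb4 : tb < PI / 4) by nra.
set (q := tan tb). assert (Hq : 0 < q) by (apply tan_gt_0; lra).
set (K := 2 + 2 / q). assert (HK : 2 < K) by (unfold K; assert (0 < 2 / q) by pos; lra).
assert (Kq : 2 < q * (K - 1)) by (unfold K; replace (q * (2 + 2 / q - 1)) with (q + 2) by (field; lra); lra).
assert (IE : 0 < / eta) by pos. destruct (kap_inf c (eta / 2) Hc ltac:(lra)) as [M0 [HM0 Hk]]. exists K, (1 + / eta + M0). split; [lra|]. split; [lra|].
assert (G : forall a b, 0 <= a -> b < - K * a - (1 + / eta + M0) -> 0 < Re (1 - (a, b) * (a, b))%C /\ 0 <= Im (Clog (1 - (a, b) * (a, b))) < tb).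
{ intros a b Ha Hb. assert (E1 : Re (1 - (a, b) * (a, b))%C = 1 + b ^ 2 - a ^ 2) by (simpl; ring).
  assert (E2 : Im (1 - (a, b) * (a, b))%C = 2 * a * - b) by (simpl; ring).
  assert (Ka : 0 <= (K - 1) * a) by (nra).
  assert (R1 : 0 < 1 + b ^ 2 - a ^ 2) by nra. split; [lra|].
  change (Im (Clog (1 - (a, b) * (a, b)))) with (atan (Im (1 - (a, b) * (a, b))%C / Re (1 - (a, b) * (a, b))%C)). rewrite E1, E2. split.
  - rewrite <- atan_0. destruct (Req_dec a 0) as [->|]; [right; f_equal; field; lra|]. left. apply atan_increasing. pos.
  - rewrite <- (atan_tan tb) by lra. apply atan_increasing. fold q. apply Rlt_div_l; [lra|]. nra. }
intros w Rw Iw. destruct w as [a b]. simpl in Rw, Iw.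
set (Z := fun w => (Cpw (1 - w * w) (c / 2) * (kap c w - Ci * eta))%C).
apply Rlt_le_trans with (Re (Z (a, b))).
- assert (E0 : Re (Z (ax (- b))) = a0 c).
  { unfold Z. replace (1 - ax (- b) * ax (- b))%C with (RtoC (1 + (- b) ^ 2)) by (Cring). rewrite Cpw_R by nra.
    replace (RtoC (Rpower (1 + (- b) ^ 2) (c / 2)) * (kap c (ax (- b)) - Ci * eta))%C with (RtoC (Rpower (1 + (- b) ^ 2) (c / 2)) * kap c (ax (- b)) - Ci * RtoC (Rpower (1 + (- b) ^ 2) (c / 2) * eta))%C by (Cring).
    rewrite kap_axis by lra. simpl. ring. }
  rewrite <- E0. set (f := fun y => Z (y + b * Ci)%C).
  assert (Ef : forall u, (RtoC u + b * Ci)%C = (u, b)) by (intro u; Cring).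
  replace (ax (- b)) with (0 + b * Ci)%C by (Cring). rewrite <- (Ef a).
  apply (incr_of_derive (fun u => Re (f u)) (fun u => Re (c * ((Ci * eta * (u, b) - 1) * Cpw (1 - (u, b) * (u, b)) (c / 2 - 1)))%C)); [lra|..].
  + intros u Hu. destruct (G u b ltac:(lra) ltac:(nra)) as [G1 _]. apply (hd_Re all_C); [exists 1; split; [lra|intros; exact I]|].
    eapply hd_eq; [|apply (hdC_comp all_C Z (fun y => y + b * Ci)%C); [rewrite Ef; apply Zdir_hd; [simpl; lra|lra]|apply hd_plus; [apply hd_id|apply hd_const]]].
    ring.
  + intros u Hu. destruct (G u b ltac:(lra) ltac:(nra)) as [G1 [G2 G3]]. rewrite re_scal_l. apply Rmult_lt_0_compat; [lra|].
    unfold Cpw, Cexp. rewrite re_scal_l, im_scal_l. set (t := Im (Clog (1 - (u, b) * (u, b)))) in *. set (p := (c / 2 - 1) * t).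
    assert (Hp : - (PI / 4) < p < PI / 4) by (unfold p; split; nra).
    replace (Re _) with (exp ((c / 2 - 1) * Re (Clog (1 - (u, b) * (u, b)))) * ((- (eta * b) - 1) * cos p - eta * u * sin p)) by (simpl; unfold p, t, Re, Im, cis; simpl; ring).
    apply Rmult_lt_0_compat; [pos|].
    assert (C1 : 0 < cos p) by (apply cos_gt_0; lra).
    assert (S1 : sin p <= cos p).
    { destruct (Rle_lt_dec p 0); [|rewrite <- (sin_shift p); left; apply sin_increasing_1; lra].
      pose proof (sin_ge_0 (- p) ltac:(lra) ltac:(lra)) as Q. rewrite sin_neg in Q. lra. }
    assert (B1 : eta * u < - (eta * b) - 1).
    { assert (eta * (u + / eta) < eta * - b) by (apply Rmult_lt_compat_l; nra). rewrite Rmult_plus_distr_l, Rinv_r in H by lra. lra. }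
    assert (0 <= eta * u) by nra. nra.
(* [c / 2] times the nominal argument of [FF] is [(c / 2) th1 + th2], between [- PI / 2] and
   [PI / 4], so [gau_ge] applies to it. *)
- destruct (G a b ltac:(lra) Iw) as [G1 [G2 G3]]. set (w := (a, b) : C) in *.
  assert (Rk : 0 < Re (kap c w)) by (apply kap_Re_pos; [lra|simpl; lra]).
  set (y := (kap c w - Ci * eta)%C). assert (Ry : 0 < Re y) by (unfold y; rewrite Re_kap_eta; exact Rk).
  set (th1 := Im (Clog (1 - w * w))) in *. set (th2 := Im (Clog y)).
  set (kk := (Clog (1 - w * w) + RtoC (2 / c) * Clog y)%C).
  assert (EFF : FF c eta w = Cexp kk).
  { unfold FF, kk, Cpw. rewrite Cexp_add, Cexp_Clog by lra. auto. }
  assert (Ik : Im kk = th1 + 2 / c * th2) by (unfold kk; rewrite im_plus, im_scal_l; reflexivity).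
  assert (EZ : Z w = (RtoC (Rpower (exp (Re kk)) (c / 2)) * cis (c * Im kk / 2))%C).
  { unfold Z, Cpw. fold y. rewrite <- (Cexp_Clog y Ry) at 1. rewrite <- Cexp_add. unfold Cexp at 1. f_equal; f_equal.
    - unfold Rpower. rewrite ln_exp. f_equal. unfold kk. rewrite !re_plus, !re_scal_l. field. lra.
    - rewrite Ik, im_plus, !im_scal_l. fold th1 th2. field. lra. }
  rewrite EZ, re_scal_l, EFF. apply gau_ge; [lra|pos|].
  replace (c * Rabs (Im kk) / 2) with (Rabs (c * Im kk / 2)).
  + replace (c * Im kk / 2) with (c / 2 * th1 + th2) by (rewrite Ik; field; lra).
    apply Rabs_le_between. pose proof (Im_Clog y) as T.
    assert (T2 : th2 < 0).
    { rewrite <- atan_0. apply atan_increasing, Rlt_div_l; [lra|].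
      pose proof (Im_le_Cmod (a, b)) as Q1. simpl (Im (a, b)) in Q1. rewrite Rabs_left in Q1 by nra. assert (Q2 := Hk w ltac:(simpl; lra) ltac:(unfold w; nra)).
      pose proof (Im_le_Cmod (kap c w)) as Q3. apply Rabs_le_between in Q3. unfold y. rewrite Im_sub. replace (Im (Ci * eta)%C) with eta by (simpl; ring). lra. }
    assert (0 <= c / 2 * th1 < PI / 4) by nra. fold th2 in T. lra.
  + unfold Rdiv. rewrite !Rabs_mult, (Rabs_right c), (Rabs_right (/ 2)) by lra. lra.
Qed.

(* On the clockwise side of [V], [om z] is large of argument close to [- pi / 2]. *)
Lemma near_V_clockwise : exists sg r, 0 < sg <= 1 / 4 /\ 0 < r /\ forall z tau, disk z -> Cmod (z - V)%C < r ->
  yV z = (RtoC (Cmod (yV z)) * cis tau)%C -> PI - sg < tau < PI -> a0 c < gau c (F z).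
Proof.
destruct V_clockwise as [K [M [HK [HM H]]]]. set (sg := Rmin (1 / 4) (1 / (4 * K))).
assert (Hsg : 0 < sg) by (pos). assert (Hsg1 : sg <= 1 / 4) by apply Rmin_l.
assert (Hsg2 : sg <= 1 / (4 * K)) by apply Rmin_r. apply Rle_div_r in Hsg2; [|lra].
exists sg, (1 / M). split; [lra|]. split; [pos|]. intros z tau Dk Hz Ey Ht. pose proof (disk_neqV z Dk) as HzV.
destruct (yV_om z HzV) as [Ny Eo]. destruct (yV_spec z) as [_ Em]. set (s := Cmod (yV z)) in *. assert (Ps : 0 < s) by (apply Cmod_pos; exact Ny).
rewrite F_om. apply H; [apply om_pos; exact Dk|].
assert (Ew : om z = (RtoC (2 / s) * (Ci * cis (- tau)) - 1)%C).
{ assert (Nc : cis tau <> 0) by (apply Cmod_pos_neq; rewrite Cmod_cis; lra). assert (Ns : RtoC s <> 0) by (intro X; apply RtoC_inj in X; lra).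
  replace (om z) with (om z + 1 - 1)%C by ring. rewrite Eo, Ey. f_equal. rewrite RtoC_div by lra.
  transitivity (2 * Ci * (cis tau * cis (- tau)) / (s * cis tau))%C; [rewrite cis_opp_r; field; split; assumption|field; split; assumption]. }
assert (E1 : Re (om z) = 2 / s * sin tau - 1) by (rewrite Ew, Re_sub, re_scal_l; simpl; rewrite sin_neg; ring).
assert (E2 : Im (om z) = 2 / s * cos tau) by (rewrite Ew, Im_sub, im_scal_l; simpl; rewrite cos_neg; ring).
rewrite E1, E2. set (t' := PI - tau). assert (Es : sin tau = sin t') by (unfold t'; rewrite sin_PI_x; reflexivity).
assert (Ec : cos tau = - cos t') by (unfold t'; rewrite <- Rtrigo_facts.cos_pi_minus; f_equal; ring). rewrite Es, Ec.
assert (S1 : 0 < sin t') by (apply sin_gt_0; unfold t'; pose proof PI2_1; lra). assert (S2 : sin t' < t') by (apply sin_lt_x; unfold t'; lra).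
assert (C1 : 0 < cos t') by (apply cos_gt_0; unfold t'; pose proof PI2_1; lra). pose proof (sin2_cos2 t') as SC. unfold Rsqr in SC.
assert (C2 : 3 / 4 < cos t') by (assert (t' < 1 / 4) by (unfold t'; lra); nra).
assert (KS : K * sin t' <= 1 / 4) by (assert (t' < sg) by (unfold t'; lra); nra).
assert (MS : M * s < 1) by (rewrite <- Em in Hz; apply Rlt_div_r in Hz; lra).
apply (Rmult_lt_reg_l s); [lra|].
replace (s * (2 / s * - cos t')) with (- 2 * cos t') by (field; lra).
replace (s * (- K * (2 / s * sin t' - 1) - M)) with (- 2 * (K * sin t') + K * s - M * s) by (field; lra).
nra.
Qed.

Section Supercritical.

Context (Hc1 : 1 <= c).

Lemma J_unbounded B : exists t1, 0 < t1 < Te /\ forall t, t1 <= t < Te -> B < J t.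
Proof.
destruct (sl_onto _ _ _ _ _ SL (Rmax (B + 1) (J 0 + 1))) as [t1 [Ht1 E1]].
- rewrite <- (sl_J0 _ _ _ _ _ SL). eapply Rlt_le_trans; [|apply Rmax_r]. lra.
- lra.
- exists t1. split; [lra|]. intros t Ht. pose proof (Rmax_l (B + 1) (J 0 + 1)). destruct (Req_dec t t1) as [->|N]; [lra|].
  pose proof (sl_incr _ _ _ _ _ SL t1 t ltac:(lra) ltac:(lra)). lra.
Qed.

Lemma argj_super j : Rabs (argj c j) < PI * c / 2.
Proof. pose proof (argj_bound c j). apply Rabs_lt_between. nra. Qed.

Lemma gau_ell_super j : gau c (ell c j) = a0 c.
Proof. apply gau_ell_eq; [lra|]. left. apply argj_super. Qed.

Lemma Cmod_ell_lower B : exists j0, 0 < j0 /\ forall j, j0 <= j -> B < Cmod (ell c j).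
Proof. set (B1 := Rmax B 0 + 1). assert (HB1 : 0 < B1 /\ B < B1) by (unfold B1; pose proof (Rmax_l B 0); pose proof (Rmax_r B 0); lra).
exists (Rpower B1 (c / 2)). split; [pos|]. intros j Hj. rewrite Cmod_ell by lra. apply Rlt_le_trans with B1; [lra|].
replace B1 with (Rpower (Rpower B1 (c / 2)) (2 / c)) at 1 by (rewrite Rpower_mult; replace (c / 2 * (2 / c)) with 1 by (field; lra); apply Rpower_1; lra).
apply Rle_Rpower_l; [apply Rlt_le, Rdiv_lt_0_compat; lra|]. split; [pos|].
pose proof (Im_le_Cmod (a0 c, j)) as Q. simpl (Im (_, _)) in Q. pose proof (Rle_abs j). lra.
Qed.

Lemma Cmod_ell_upper B : 0 <= B -> exists L, forall j, Rabs j <= B -> Cmod (ell c j) <= L.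
Proof. pose proof (a0_pos c Hc) as A. exists (Rpower (a0 c + B) (2 / c)). intros j Hj. rewrite Cmod_ell by lra.
apply Rle_Rpower_l; [apply Rlt_le, Rdiv_lt_0_compat; lra|]. split; [apply Cmod_aJ_pos; exact Hc|].
pose proof (Cmod_le_ReIm (a0 c, j)) as Q. simpl (Re (_, _)) in Q. simpl (Im (_, _)) in Q. rewrite (Rabs_right (a0 c)) in Q by lra. lra.
Qed.

Lemma F_bounded M : 0 < M -> exists L, forall w, 0 <= Re w -> Cmod w <= M -> Cmod (FF c eta w) <= L.
Proof. pose proof eta_gt0 as He. exists ((1 + M * M) * Rpower (Bk c + eta) (2 / c)). intros w Hw HwM.
unfold FF. rewrite Cmod_mult. apply Rmult_le_compat; try apply Cmod_ge_0.
- pose proof (Cmod_triangle 1 (- (w * w))%C) as T1. rewrite Cmod_1, Cmod_opp, Cmod_mult in T1. pose proof (Cmod_ge_0 w). unfold Cminus. nra.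
- rewrite Cmod_Cpw. apply Rle_Rpower_l; [apply Rlt_le, Rdiv_lt_0_compat; lra|]. split.
  + apply Cmod_pos. intro X. apply (f_equal Re) in X. rewrite Re_kap_eta in X. pose proof (kap_Re_pos c w Hc Hw). simpl in X. lra.
  + pose proof (Cmod_triangle (kap c w) (- (Ci * eta))%C) as T1. rewrite Cmod_opp, Cmod_mult, Cmod_Ci, Cmod_R, Rabs_right in T1 by lra.
    pose proof (kap_bound c w Hc ltac:(lra)). unfold Cminus. lra.
Qed.

(** [|ell c (J t)|] tends to infinity, while [F] is bounded where [om] is, that is away from [V]. *)
Lemma conv_V eps : 0 < eps -> exists t1, 0 < t1 < Te /\ forall t, t1 < t < Te -> Cmod (gamma t - V)%C < eps.
Proof.
intros Hep. set (M := 2 / eps + 1). assert (HM : 0 < M) by (unfold M; assert (0 < 2 / eps) by pos; lra).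
destruct (F_bounded M HM) as [L HL]. destruct (Cmod_ell_lower L) as [j0 [_ Hj0]]. destruct (J_unbounded j0) as [t1 [Ht1 H1]].
exists t1. split; [lra|]. intros t Ht. apply Rnot_le_lt. intro Hle. destruct (om_gamma t ltac:(lra)) as [O1 O2].
specialize (H1 t ltac:(lra)). specialize (Hj0 (J t) ltac:(lra)). rewrite <- O2 in Hj0.
assert (Hw : Cmod (om (gamma t)) <= M); [|specialize (HL (om (gamma t)) ltac:(lra) Hw); lra].
destruct (yV_om (gamma t) (disk_neqV _ (sl_disk _ _ _ _ _ SL t ltac:(lra)))) as [Ny Eo]. destruct (yV_spec (gamma t)) as [_ Em].
pose proof (Cmod_triangle (om (gamma t) + 1)%C (- (1))%C) as T1. replace (om (gamma t) + 1 + - (1))%C with (om (gamma t)) in T1 by ring.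
rewrite Cmod_opp, Cmod_1, Eo, Cmod_div, Cmod_mult, Cmod_Ci, Cmod_R, Rabs_right, Em in T1 by (pos).
assert (2 * 1 / Cmod (gamma t - V)%C <= 2 / eps) by (rewrite Rmult_1_r; unfold Rdiv; apply Rmult_le_compat_l; [lra|]; apply Rinv_le_contravar; lra). unfold M. lra.
Qed.

Lemma argj_end e : 0 < e -> exists j0, forall j, j0 <= j -> PI / 2 - e < argj c j.
Proof.
intros He. pose proof (a0_pos c Hc) as A. set (e' := Rmin e (PI / 4)). assert (E1 : 0 < e') by pos. assert (E2 : e' <= e) by apply Rmin_l. assert (E3 : e' <= PI / 4) by apply Rmin_r.
exists (a0 c * (tan (PI / 2 - e') + 1)). intros j Hj. apply Rle_lt_trans with (PI / 2 - e'); [lra|].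
rewrite <- (atan_tan (PI / 2 - e')) by lra. apply atan_increasing. apply (proj1 (Rlt_div_r _ _ _ A)). lra.
Qed.

(** [q] is the quotient of [F] by its asymptotic model. It is close to [1], so its argument [th] is
    small and its modulus is at least [1/2]. *)
Lemma F_polar_V e : 0 < e -> exists r, 0 < r /\ forall z tau, disk z -> Cmod (z - V)%C < r -> yV z = (RtoC (Cmod (yV z)) * cis tau)%C ->
  exists th R, Rabs th < e /\ 2 * Rpower eta (2 / c) / Cmod (yV z) ^ 2 <= R /\ F z = (R * cis (- (PI / c) - 2 * tau + th))%C.
Proof.
intros He. set (rho0 := 4 * Rpower eta (2 / c)). assert (Prho : 0 < rho0) by (pos).
destruct (ct_Clog 1 ltac:(simpl; lra) e He) as [d [Hd H]].
destruct (V_asym (rho0 * Rmin (d / 2) (1 / 2))) as [r [Hr HV]]; [pos|].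
exists r. split; [lra|]. intros z tau Dk Hz Ey. specialize (HV z Dk Hz). fold rho0 in HV.
destruct (yV_om z (disk_neqV z Dk)) as [Ny _]. set (s := Cmod (yV z)) in *. assert (Ps : 0 < s) by (apply Cmod_pos; exact Ny).
set (q := (F z * RtoC (s ^ 2 / rho0) * cis (2 * tau + PI / c))%C).
assert (Hq : Cmod (q - 1)%C <= Rmin (d / 2) (1 / 2)).
{ apply (Rmult_le_reg_l rho0); [lra|]. eapply Rle_trans; [|exact HV]. right. rewrite Ey.
  replace (F z * (s * cis tau * (s * cis tau)) - rho0 * cis (- (PI / c)))%C with (rho0 * cis (- (PI / c)) * (q - 1))%C.
  - rewrite Cmod_mult, Cmod_mult, Cmod_R, Cmod_cis, Rabs_right by lra. ring.
  - unfold q. rewrite cis_add. replace (2 * tau) with (tau + tau) by ring. rewrite cis_add. replace (s ^ 2 / rho0) with (s * s * / rho0) by (lra). rewrite !RtoC_mult.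
    assert (E1 : (rho0 * RtoC (/ rho0) = 1)%C) by (rewrite <- RtoC_mult; f_equal; field; lra). pose proof (cis_opp_r (PI / c)) as E2.
    transitivity ((rho0 * RtoC (/ rho0)) * (cis (PI / c) * cis (- (PI / c))) * F z * (s * cis tau * (s * cis tau)) - rho0 * cis (- (PI / c)))%C; [ring|]. rewrite E1, E2. ring. }
assert (Q1 := Rle_trans _ _ _ Hq (Rmin_l _ _)). assert (Q2 := Rle_trans _ _ _ Hq (Rmin_r _ _)).
assert (Rq : 0 < Re q) by (apply (RHP_open 1); [simpl; lra|simpl (Re 1); lra]).
specialize (H q I ltac:(lra)). rewrite Clog_R, ln_1 in H by lra. replace (Clog q - 0)%C with (Clog q) in H by ring.
assert (Mq : 1 / 2 <= Cmod q). { pose proof (Cmod_rev_triangle 1 (1 - q)%C) as T1. replace (1 - (1 - q))%C with q in T1 by ring. rewrite Cmod_1, (Cmod_sub_sym 1) in T1. lra. }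
exists (Im (Clog q)), (rho0 / s ^ 2 * Cmod q). split; [eapply Rle_lt_trans; [apply Im_le_Cmod|lra]|].
assert (P2 : 0 < s ^ 2) by (nra). split.
- replace (2 * Rpower eta (2 / c) / s ^ 2) with (rho0 / s ^ 2 * (1 / 2)) by (unfold rho0; field; lra). apply Rmult_le_compat_l; [apply Rlt_le, Rdiv_lt_0_compat; lra|lra].
- assert (Eq : q = (RtoC (Cmod q) * cis (Im (Clog q)))%C).
  { rewrite <- (Cexp_Clog q Rq) at 1. unfold Cexp. f_equal. f_equal. apply exp_ln. lra. }
  rewrite cis_add, RtoC_mult. transitivity (RtoC (rho0 / s ^ 2) * cis (- (PI / c) - 2 * tau) * (RtoC (Cmod q) * cis (Im (Clog q))))%C; [|ring]. rewrite <- Eq. unfold q.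
  replace (- (PI / c) - 2 * tau) with (- (2 * tau + PI / c)) by ring. pose proof (cis_opp_r (2 * tau + PI / c)) as E2.
  assert (E1 : (RtoC (rho0 / s ^ 2) * RtoC (s ^ 2 / rho0) = 1)%C) by (rewrite <- RtoC_mult; f_equal; field; split; lra).
  transitivity ((RtoC (rho0 / s ^ 2) * RtoC (s ^ 2 / rho0)) * (cis (2 * tau + PI / c) * cis (- (2 * tau + PI / c))) * F z)%C; [rewrite E1, E2; ring|ring].
Qed.

(* The argument of [F (gamma t) = ell c (J t)] tends to [pi / c]; modulo [2 pi] this leaves a single direction. *)
Lemma gamma_dir_V : tends0 (fun s => (gamma (Te + -1 * s) - V) / RtoC (Cmod (gamma (Te + -1 * s) - V)%C))%C (cis (v0 + PI / 2 + (PI - PI / c))).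
Proof.
apply (dir_yV (fun s => gamma (Te + -1 * s))). intros eps Hep. pose proof Hc as Pc. pose proof PI_RGT_0 as HPI.
destruct near_V_clockwise as [sg [r0 [Hsg [Hr0 Hcw]]]].
assert (Pic : 0 < PI / c <= PI). { split; [apply Rdiv_lt_0_compat; lra|]. apply Rle_div_l; nra. }
(* The bounds [e <= sg] and [e <= PI / c] confine [x] to the open interval from [0] to [4 PI], where
   [cos x = 1] leaves only [2 PI]. *)
set (e := Rmin eps (Rmin sg (PI / c))). assert (He : 0 < e) by (repeat apply Rmin_pos; lra).
assert (Q : e <= eps /\ e <= sg /\ e <= PI / c) by (unfold e; repeat split; rmin). destruct Q as [E1 [E2 E3]].
destruct (F_polar_V e He) as [r1 [Hr1 HF]].
destruct (argj_end (c / 2 * e) ltac:(apply Rmult_lt_0_compat; lra)) as [j0 Hj0]. destruct (J_unbounded j0) as [t1 [Ht1 HJ]].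
destruct (conv_V (Rmin r0 r1) ltac:(apply Rmin_pos; assumption)) as [t2 [Ht2 HC]].
exists (Te - Rmax t1 t2). assert (Rmax t1 t2 < Te) by (apply Rmax_lub_lt; lra). split; [lra|]. intros s Hs. set (t := Te + -1 * s).
assert (T1 : t1 < t) by (pose proof (Rmax_l t1 t2); unfold t; lra). assert (T2 : t2 < t) by (pose proof (Rmax_r t1 t2); unfold t; lra).
assert (Ht : 0 < t < Te) by (unfold t in *; lra). set (z := gamma t). pose proof (sl_disk _ _ _ _ _ SL t Ht) as Dk. fold z in Dk.
specialize (HC t ltac:(lra)). fold z in HC. specialize (HJ t ltac:(lra)). specialize (Hj0 (J t) ltac:(lra)). pose proof (argj_bound c (J t)) as Bj.
destruct (yV_om z (disk_neqV z Dk)) as [Ny _]. pose proof (Cmod_pos _ Ny) as Py.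
destruct (polar_exists (yV z) Ny) as [tau [Htau Ey]]. pose proof (Th_bound (yV z)) as BT. pose proof (yV_disk z Dk) as Iy.
assert (Bp : - PI <= tau <= PI) by (apply Rabs_le_between; lra).
assert (Sp : 0 < sin tau). { rewrite Ey, im_scal_l in Iy. simpl in Iy. apply Rnot_le_lt. intro. nra. }
assert (P0 : 0 < tau). { apply Rnot_le_lt. intro Hle. pose proof (sin_ge_0 (- tau) ltac:(lra) ltac:(lra)) as Q. rewrite sin_neg in Q. lra. }
assert (P1 : tau <= PI - sg).
{ apply Rnot_lt_le. intro Hgt. assert (P1 : tau < PI) by (destruct (Req_dec tau PI) as [E|]; [rewrite E, sin_PI in Sp|]; lra).
  assert (Q := Hcw z tau Dk ltac:(rmin) Ey ltac:(lra)). unfold F, z in Q. rewrite (sl_F _ _ _ _ _ SL t Ht), gau_ell_super in Q. lra. }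
destruct (HF z tau Dk ltac:(rmin) Ey) as [th [R [Hth [HR EF]]]]. apply Rabs_lt_between in Hth.
assert (PR : 0 < R). { eapply Rlt_le_trans; [|exact HR]. apply Rdiv_lt_0_compat; [|apply pow_lt; exact Py]. assert (0 < Rpower eta (2 / c)) by apply exp_pos. lra. }
unfold F, z in EF. rewrite (sl_F _ _ _ _ _ SL t Ht), ell_polar in EF by exact Hc.
set (A := argj c (J t)) in *. set (R' := Rpower (Cmod (a0 c, J t)) (2 / c)) in *.
assert (PR' : 0 < R') by apply exp_pos. assert (ER : R' = R).
{ apply (f_equal Cmod) in EF. rewrite !Cmod_mult, !Cmod_cis, !Cmod_R, !Rabs_right in EF by lra. lra. }
set (x := 2 / c * A - (- (PI / c) - 2 * tau + th)).
assert (Ex : cos x = 1).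
{ rewrite ER in EF. apply (f_equal (fun y => y * (RtoC (/ R) * cis (- (- (PI / c) - 2 * tau + th))))%C) in EF.
  assert (G : forall a b, (RtoC R * cis a * (RtoC (/ R) * cis b) = cis (a + b))%C).
  { intros a0' b0'. rewrite cis_add. transitivity (RtoC (R * / R) * (cis a0' * cis b0'))%C; [rewrite RtoC_mult; ring|]. rewrite Rinv_r by lra. ring. }
  rewrite !G in EF. apply (f_equal Re) in EF. simpl in EF. rewrite Rplus_opp_r, cos_0 in EF. exact EF. }
assert (BA : PI / c - e < 2 / c * A < PI / c).
{ assert (P2c : 0 < 2 / c) by pos. replace (PI / c - e) with (2 / c * (PI / 2 - c / 2 * e)) by (field; lra). replace (PI / c) with (2 / c * (PI / 2)) by (field; lra).
  split; apply Rmult_lt_compat_l; lra. }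
assert (X2 : x = 2 * PI).
{ assert (Sx : sin (x / 2) = 0).
  { pose proof (cos_2a_sin (x / 2)) as Q. replace (2 * (x / 2)) with x in Q by field. nra. }
  destruct (sin_eq_O_2PI_0 (x / 2)) as [Q|[Q|Q]]; [unfold x; lra|unfold x; lra|exact Sx|unfold x in *; lra|lra|unfold x in *; lra]. }
replace (yV z / RtoC (Cmod (yV z)))%C with (cis tau) by (rewrite Ey at 1; field; intro X; apply RtoC_inj in X; lra).
eapply Rle_lt_trans; [apply cis_lip|]. apply Rabs_lt_between. unfold x in X2. lra.
Qed.

Lemma om_unit z : z <> V -> Cmod z = 1 -> om z = ax (- Im (om z)).
Proof.
intros Hn H1. assert (R0 : Re (om z) = 0).
{ unfold om. rewrite to_w_Re.
  - rewrite Cmod_mult, Cmod_cis, H1. lra.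
  - intro X. apply Hn. apply (f_equal (fun y => y * cis v0)%C) in X. rewrite <- Cmult_assoc, (Cmult_comm (cis (- v0))), cis_opp_r, Cmult_1_r, Cmult_1_l in X. exact X. }
revert R0. generalize (om z). intros w Hw. apply C_eq; simpl; unfold Re, Im in *; lra.
Qed.

(** The arc of the circle on the counterclockwise side of [V], reached as [s] tends to [0]. *)
Let kc s := pt (ax (- / s)).

Lemma yV_circle s : 0 < s -> yV (kc s) = (RtoC (2 * s / (s ^ 2 + 1)) * (1 + Ci * s))%C.
Proof.
intros Hs. pose proof (pt_neqV (ax (- / s)) ltac:(simpl; lra)) as N. destruct (yV_om (kc s) N) as [Ny E].
assert (Eo : om (kc s) = ax (- / s)) by (apply om_pt; simpl; lra). rewrite Eo in E.
assert (Ey : yV (kc s) = (2 * Ci / (ax (- / s) + 1))%C).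
{ rewrite E. field. repeat split; first [exact Ny|apply Cmod_pos_neq; rewrite Cmod_Ci; lra]. }
rewrite Ey. apply C_eq; simpl; field; nra.
Qed.

Lemma circle_dir_V : tends0 kc V /\ tends0 (fun s => (kc s - V) / RtoC (Cmod (kc s - V)%C))%C (cis (v0 + PI / 2)).
Proof.
assert (Main : forall s, 0 < s -> 0 < 2 * s / (s ^ 2 + 1) <= 2 * s /\ Cmod (yV (kc s) - RtoC (2 * s / (s ^ 2 + 1)) * cis 0)%C = 2 * s / (s ^ 2 + 1) * s).
{ intros s Hs. assert (P : 0 < s ^ 2 + 1) by nra. split.
  - split; [pos|]. apply Rle_div_l; [lra|]. nra.
  - rewrite yV_circle, cis_0 by lra. replace (RtoC (2 * s / (s ^ 2 + 1)) * (1 + Ci * s) - RtoC (2 * s / (s ^ 2 + 1)) * 1)%C with (RtoC (2 * s / (s ^ 2 + 1) * s) * Ci)%C by (Cring).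
    rewrite Cmod_mult, Cmod_Ci, Cmod_R, Rabs_right; [ring|]. apply Rle_ge, Rmult_le_pos; [apply Rlt_le, Rdiv_lt_0_compat; lra|lra]. }
split.
- intros eps He. exists (Rmin 1 (eps / 4)). split; [pos|]. intros s Hs.
  assert (S1 : s < 1) by (rmin). assert (S2 : s < eps / 4) by (rmin).
  destruct (Main s ltac:(lra)) as [M1 M2]. destruct (yV_spec (kc s)) as [_ Em].
  pose proof (Cmod_triangle (yV (kc s) - RtoC (2 * s / (s ^ 2 + 1)) * cis 0)%C (RtoC (2 * s / (s ^ 2 + 1)) * cis 0)%C) as T1.
  rewrite M2, Cmod_mult, Cmod_cis, Cmod_R, Rabs_right in T1 by lra.
  match type of T1 with Cmod ?X <= _ => replace X with (yV (kc s)) in T1 by ring end. nra.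
- replace (v0 + PI / 2) with (v0 + PI / 2 + 0) by ring. apply (dir_yV kc). intros eps He. exists (eps / 4). split; [lra|]. intros s Hs.
  destruct (Main s ltac:(lra)) as [M1 M2].
  assert (Ny : yV (kc s) <> 0) by (apply yV_om, pt_neqV; simpl; lra).
  eapply Rle_lt_trans; [apply dir_bound with (r := 2 * s / (s ^ 2 + 1)) (e := s); [auto|lra|]|lra].
  rewrite M2, Rmult_comm. apply Rmult_le_compat_l; [lra|]. rewrite yV_circle by lra. rewrite Cmod_mult, Cmod_R, Rabs_right by lra.
  pose proof (re_le_Cmod (1 + Ci * s)%C) as Q. simpl (Re _) in Q. replace (1 + (0 * s - 1 * 0)) with 1 in Q by ring. rewrite Rabs_R1 in Q. nra.
Qed.

Lemma cis_period x : cis (x + 2 * PI) = cis x.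
Proof. rewrite cis_add. replace (cis (2 * PI)) with (RtoC 1) by (unfold cis; rewrite cos_2PI, sin_2PI; reflexivity). ring. Qed.

(** Between the circle and the curve the argument of [F] exceeds [PI / c] in modulus, so [gau = 0].
    Past the curve it is below [PI / c - e] and [|F|] is large, so [gau > a0]. Near the clockwise
    tangent the argument approaches [- PI / c] again and the asymptotics do not decide;
    [near_V_clockwise] does. *)
Lemma angle_V : interior_angle Om V (PI - PI / c).
Proof.
pose proof PI_RGT_0 as HPI. pose proof Hc as Pc. pose proof eta_gt0 as He. pose proof (sl_T _ _ _ _ _ SL) as PT. assert (Hi : 0 < / eta) by (pos).
assert (Pic : 0 < PI / c <= PI). { split; [pos|]. apply Rle_div_l; nra. }
destruct circle_dir_V as [K1 K2].
assert (Kg : tends0 (fun s => gamma (Te + -1 * s)) V).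
{ intros eps Hep. destruct (conv_V eps Hep) as [t1 [Ht1 H1]]. exists (Te - t1). split; [lra|]. intros s Hs. apply H1. lra. }
apply (angle_intro Om V (PI - PI / c) (v0 + PI / 2) kc 1 (fun s => gamma (Te + -1 * s)) (Te / 2)); [lra|lra|lra|..].
- apply (circle_germ V (fun s => - / s)); [| | |auto|auto].
  + intros s Hs. assert (0 < / s) by pos. split; [|split; [apply argj_super|apply pt_neqV; simpl; lra]].
    unfold jd. pose proof (pw_pos (- / s) (c / 2 - 1)). apply Rmult_lt_0_compat; [apply Rmult_lt_0_compat; [lra|]; nra|lra].
  + intros s eps Hs Hep. exists (Rmin (s / 2) (eps * (s * (s / 2)))). assert (Pss : 0 < s * (s / 2)) by nra. split; [pos|]. intros t Ht Hts.
    assert (T1 := Rlt_le_trans _ _ _ Hts (Rmin_l _ _)). assert (T2 := Rlt_le_trans _ _ _ Hts (Rmin_r _ _)). apply Rabs_lt_between in T1.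
    replace (- / t - - / s) with ((t - s) / (s * t)) by (field; lra). assert (Pst : s * t > 0) by nra. unfold Rdiv. rewrite Rabs_mult, (Rabs_right (/ _)) by (apply Rle_ge, Rlt_le, Rinv_0_lt_compat; exact Pst).
    apply (proj2 (Rlt_div_l _ _ _ Pst)). eapply Rlt_le_trans; [exact T2|]. apply Rmult_le_compat_l; [lra|]. nra.
  + intros s t Hs Ht E. rewrite <- (Rinv_inv s), <- (Rinv_inv t). f_equal. lra.
- apply gamma_germ; [lra| |auto|exact gamma_dir_V].
  intros s Hs. split; [lra|]. split; [apply disk_neqV, (sl_disk _ _ _ _ _ SL); lra|apply gau_ell_super].
- intros s t Hs Ht E. pose proof (sl_disk _ _ _ _ _ SL (Te + -1 * t) ltac:(lra)) as Dk. rewrite <- E in Dk. unfold disk in Dk.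
  unfold kc, pt in Dk. rewrite Cmod_mult, Cmod_cis, Rmult_1_r in Dk. pose proof (to_h_sq (ax (- / s)) ltac:(simpl; lra)) as Q. simpl (Re (ax _)) in Q. pose proof (Cmod_ge_0 (to_h (ax (- / s)))). nra.
- set (B := Rmax (Rabs (J (Te / 2))) (Rabs (J 0))). assert (B1 : Rabs (J (Te / 2)) <= B) by apply Rmax_l. assert (B2 : Rabs (J 0) <= B) by apply Rmax_r.
  destruct (Cmod_ell_upper B) as [L HL]; [pose proof (Rabs_pos (J 0)); lra|]. destruct (FF_inf c eta L Hc He) as [M [HM HMw]].
  destruct (om_large (Rmax M (1 + / eta))) as [r [Hr H]]. exists r. split; [lra|]. intros z Hz Hzr.
  destruct (classic (z = V)) as [E|HzV]; [auto|right]. specialize (H z HzV Hzr). assert (O1 : M < Cmod (om z)) by (pose proof (Rmax_l M (1 + / eta)); lra).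
  assert (O2 : 1 + / eta < Cmod (om z)) by (pose proof (Rmax_r M (1 + / eta)); lra).
  destruct (frontier_value z Hz HzV) as [H1 [_ H3]]. destruct (Rle_lt_or_eq_dec _ _ H1) as [Dz|Uz].
  + right. destruct (gau_eq_ell c (F z) Hc (H3 Dz)) as [j [Ej _]]. pose proof (om_pos z Dz) as Rw. specialize (HMw (om z) ltac:(lra) ltac:(lra)). rewrite <- F_om, Ej in HMw.
    assert (Hj : B < Rabs j) by (apply Rnot_le_lt; intro Hle; specialize (HL j Hle); lra).
    destruct (Rle_lt_dec j (J 0)) as [Hl|Hg]; [exfalso; apply (F_avoid_low z j Dz Hl Ej)|].
    assert (Hjp : 0 < j). { apply Rnot_le_lt. intro Hn. rewrite Rabs_left1 in Hj by lra. pose proof (Rle_abs (- J 0)) as Q. rewrite Rabs_Ropp in Q. lra. }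
    rewrite Rabs_right in Hj by lra. pose proof (Rle_abs (J (Te / 2))).
    destruct (F_ell_on_trace z j Dz Ej) as [t [Ht [Jt Et]]]; [lra|]. exists (Te - t). split.
    * split; [lra|]. apply Rnot_lt_le. intro Hlt. pose proof (sl_incr _ _ _ _ _ SL t (Te / 2) ltac:(lra) ltac:(lra)). lra.
    * rewrite Et. f_equal. ring.
  + left. pose proof (om_unit z HzV Uz) as Eo. set (x := - Im (om z)) in *. assert (Mx : Cmod (om z) = Rabs x) by (rewrite Eo, ax_C, Cmod_mult, Cmod_opp, Cmod_Ci, Cmod_R; ring). rewrite Mx in O2.
    destruct (Rle_lt_dec 0 x) as [Hx|Hx].
    (* On the clockwise side [x > / eta], and there the circle does not border [Om]. *)
    * exfalso. rewrite Rabs_right in O2 by lra. destruct (bdry_outside x ltac:(lra)) as [r2 [Hr2 HB]].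
      destruct (hdC_om z HzV) as [l [_ [Dl _]]]. destruct (hd_ct _ _ _ _ Dl r2 Hr2) as [d [Hd Hcl]]. destruct Hz as [Cl _]. destruct (Cl d Hd) as [y [Y1 Y2]].
      apply Om_iff in Y1. destruct Y1 as [Dy Gy]. specialize (Hcl y I Y2). rewrite Eo in Hcl. specialize (HB (om y) (om_pos y Dy) Hcl). rewrite <- F_om in HB. lra.
    * rewrite Rabs_left in O2 by lra. exists (- / x). split.
      -- rewrite <- Rinv_opp. split; [pos|]. rewrite <- Rinv_1. apply Rinv_le_contravar; lra.
      -- unfold kc. rewrite <- (pt_om z HzV), Eo. f_equal. f_equal. rewrite <- Rinv_opp. rewrite Ropp_involutive, Rinv_inv. lra.
- intros eps Hep. destruct near_V_clockwise as [sg [r0 [Hsg [Hr0 Hcw]]]].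
  set (e := Rmin (Rmin eps sg) (Rmin (PI / c) (PI / 2))). assert (He0 : 0 < e) by (pos).
  assert (E1 : e <= eps) by (eapply Rle_trans; [apply Rmin_l|rmin]). assert (E2 : e <= sg) by (eapply Rle_trans; [apply Rmin_l|rmin]).
  assert (E3 : e <= PI / c) by (eapply Rle_trans; [apply Rmin_r|rmin]). assert (E4 : e <= PI / 2) by (eapply Rle_trans; [apply Rmin_r|rmin]).
  set (sn := sin e). assert (Hsn : 0 < sn) by (apply sin_gt_0; lra).
  assert (Ec : c * (PI / c) = PI) by (field; lra). assert (Ece : 0 < c * e <= PI) by (nra).
  set (kk := sin (c * e / 2)). assert (Hkk : 0 < kk) by (apply sin_gt_0; lra).
  set (p := Rpower eta (2 / c)). assert (Pp : 0 < p) by pos. pose proof (a0_pos c Hc) as A.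
  set (B := Rpower (a0 c / kk) (2 / c)). assert (PB : 0 < B) by pos.
  destruct (F_polar_V e He0) as [r1 [Hr1 HF]]. fold p in HF.
  exists (Rmin (Rmin r0 r1) (Rmin (2 * sn) (Rmin 1 (p / B)))). split; [pos|]. intros s phi Hs.
  assert (S0 : s < r0) by (rmin).
  assert (S1 : s < r1) by (rmin).
  assert (S2 : s < 2 * sn) by (rmin).
  assert (S3 : s < 1) by (rmin).
  assert (S4 : s < p / B) by (rmin). apply Rlt_div_r in S4; [|lra].
  set (tau := phi - (v0 + PI / 2)). replace phi with (v0 + PI / 2 + tau) by (unfold tau; ring). set (z := (V + s * cis (v0 + PI / 2 + tau))%C).
  assert (Ey : yV z = (s * cis tau)%C) by apply yV_step. assert (My : Cmod (yV z) = s) by (rewrite Ey, Cmod_mult, Cmod_cis, Cmod_R, Rabs_right; lra).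
  assert (Mz : Cmod (z - V)%C = s) by (destruct (yV_spec z) as [_ Em]; rewrite <- Em; exact My). assert (Ey' : yV z = (RtoC (Cmod (yV z)) * cis tau)%C) by (rewrite My; exact Ey).
  split; intros Hphi.
  + assert (T : eps < tau < PI - PI / c - eps) by (lra).
    assert (Dk : disk z). { pose proof (unit_step v0 s tau) as Q. fold V in Q. fold z in Q. pose proof (sin_ge_mid e tau ltac:(lra) ltac:(lra)) as Q2. fold sn in Q2. unfold disk. pose proof (Cmod_ge_0 z). nra. }
    apply Om_iff. split; [auto|]. destruct (HF z tau Dk ltac:(lra) Ey') as [th [R [Hth [HR EF]]]]. rewrite My in HR. apply Rabs_lt_between in Hth.
    assert (PR : 0 < R) by (eapply Rlt_le_trans; [|exact HR]; apply Rdiv_lt_0_compat; [lra|nra]).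
    set (psi := - (PI / c) - 2 * tau + th) in *. rewrite EF. replace (gau c (R * cis psi)%C) with 0; [lra|]. symmetry.
    destruct (Rle_lt_dec (- PI) psi) as [Hl|Hg].
    * assert (Pb : psi < - (PI / c)) by (unfold psi; lra). apply gau_zero; [lra|lra|rewrite Rabs_left1; lra|]. rewrite Rabs_left1 by lra.
      assert (c * (PI / c) <= c * - psi) by (nra). lra.
    * rewrite <- (cis_period psi). assert (PI / c < psi + 2 * PI) by (unfold psi; lra). apply gau_zero; [lra|lra|rewrite Rabs_right; lra|]. rewrite Rabs_right by lra.
      assert (c * (PI / c) <= c * (psi + 2 * PI)) by (nra). lra.
  + intro HO. apply Om_iff in HO. destruct HO as [Dk Hg].
    assert (T : PI - PI / c + eps < tau < 2 * PI - eps) by (lra).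
    pose proof (yV_disk z Dk) as Iy. rewrite Ey, im_scal_l in Iy. simpl in Iy.
    assert (T2 : tau < PI). { apply Rnot_le_lt. intro Hle. pose proof (sin_le_0 tau Hle ltac:(lra)). nra. }
    assert (T3 : tau <= PI - sg). { apply Rnot_lt_le. intro Hlt. pose proof (Hcw z tau Dk ltac:(lra) Ey' ltac:(lra)). lra. }
    destruct (HF z tau Dk ltac:(lra) Ey') as [th [R [Hth [HR EF]]]]. rewrite My in HR. apply Rabs_lt_between in Hth.
    assert (PR : B < R). { eapply Rlt_le_trans; [|exact HR]. assert (Ps : s ^ 2 > 0) by (nra). apply (proj1 (Rlt_div_r _ _ _ Ps)). nra. }
    rewrite <- cis_period in EF. set (psi := - (PI / c) - 2 * tau + th + 2 * PI) in *.
    assert (Bp : Rabs psi <= PI / c - e) by (apply Rabs_le_between; unfold psi; lra).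
    assert (Bc : c * Rabs psi / 2 <= PI / 2 - c * e / 2). { assert (c * Rabs psi <= c * (PI / c - e)) by (nra). lra. }
    pose proof (gau_ge c R psi Hc ltac:(lra) ltac:(lra)) as G. rewrite <- EF in G.
    assert (Ck : kk <= cos (c * psi / 2)).
    { replace (cos (c * psi / 2)) with (cos (c * Rabs psi / 2)).
      - unfold kk. rewrite <- cos_shift. apply cos_decr_1; try lra. pose proof (Rabs_pos psi). nra.
      - unfold Rabs. destruct (Rcase_abs psi); [|lra]. replace (c * - psi / 2) with (- (c * psi / 2)) by field. apply cos_neg. }
    assert (C2 : a0 c / kk < Rpower R (c / 2)).
    { replace (a0 c / kk) with (Rpower B (c / 2)); [apply Rlt_Rpower_l; lra|]. unfold B. rewrite Rpower_mult. replace (2 / c * (c / 2)) with 1 by (field; lra).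
      apply Rpower_1, Rdiv_lt_0_compat; lra. }
    apply (proj1 (Rlt_div_l _ _ _ Hkk)) in C2. assert (0 < Rpower R (c / 2)) by nra. nra.
Qed.

End Supercritical.
End SlitDomain.

(** * Reflection of interior angles, and the conclusion *)

Section ConjAngle.

Context (Om Om' : C -> Prop) (HOm : forall z, Om' z <-> Om (Cconj z)).

Lemma closure_conj (E E' : C -> Prop) x : (forall z, E z -> E' (Cconj z)) -> closure E x -> closure E' (Cconj x).
Proof.
intros HE H eps He. destruct (H eps He) as [y [Ey Hy]]. exists (Cconj y). split; [auto|].
rewrite <- Cconj_sub, Cmod_conj. exact Hy.
Qed.

Lemma frontier_conj z : frontier Om z -> frontier Om' (Cconj z).
Proof.
intros [H1 H2]. split.
- eapply closure_conj; [|exact H1]. intros y Hy. apply HOm. rewrite Cconj_conj. auto.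
- eapply closure_conj; [|exact H2]. intros y Hy Hn. apply HOm in Hn. rewrite Cconj_conj in Hn. auto.
Qed.

Lemma frontier_conj' z : frontier Om' z -> frontier Om (Cconj z).
Proof.
intros [H1 H2]. split.
- eapply closure_conj; [|exact H1]. apply HOm.
- eapply closure_conj; [|exact H2]. intros y Hy Hn. apply Hy. apply HOm. auto.
Qed.

Lemma Cconj_inj (x y : C) : Cconj x = Cconj y -> x = y.
Proof. intro E. rewrite <- (Cconj_conj x), E, Cconj_conj. auto. Qed.

Lemma continuous_on_conj (D : R -> Prop) (f : R -> C) : continuous_on D f -> continuous_on D (fun t => Cconj (f t)).
Proof.
intros H t Dt P HP. apply nbhd_C in HP. destruct HP as [e [He HP]].
destruct (continuous_on_C D f H t Dt e He) as [d [Hd H']]. exists (mkposreal d Hd). intros s Hs Ds.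
apply HP. rewrite <- Cconj_sub, Cmod_conj. auto.
Qed.

Lemma filterlim_conj {F : (R -> Prop) -> Prop} {FF : Filter F} (f : R -> C) l :
  filterlim f F (locally l) -> filterlim (fun t => Cconj (f t)) F (locally (Cconj l)).
Proof.
intros H P HP. apply nbhd_C in HP. destruct HP as [e [He HP]].
apply (H (fun y => P (Cconj y))). apply nbhd_C. exists e. split; auto. intros y Hy. apply HP.
rewrite <- Cconj_sub, Cmod_conj. auto.
Qed.

Lemma frontier_arc_conj p a beta : frontier_arc Om p a beta ->
  frontier_arc Om' (Cconj p) (fun s => Cconj (a s)) (- beta).
Proof.
intros [H0 [Hc [Hi [Hf Hl]]]]. split; [rewrite H0; auto|]. split; [apply continuous_on_conj; auto|].
split; [intros s t Hs Ht E; apply Hi; auto; apply Cconj_inj; auto|].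
split; [intros s Hs; apply frontier_conj; auto|].
rewrite <- Cconj_cis. apply filterlim_conj in Hl. eapply filterlim_ext; [|exact Hl].
intro s. cbv beta. rewrite Cconj_div, !Cconj_sub.
rewrite <- (Cmod_conj (a s - p)%C), Cconj_sub. f_equal. Cring.
Qed.

(** Conjugation reverses orientation, so the two arcs exchange roles and the initial direction
    becomes [- (beta + alpha)]. *)
Lemma interior_angle_conj p alpha : interior_angle Om p alpha -> interior_angle Om' (Cconj p) alpha.
Proof.
intros [Ha [a [b [beta [A [B [D [[r [Hr N]] S]]]]]]]]. split; auto.
exists (fun s => Cconj (b s)), (fun s => Cconj (a s)), (- (beta + alpha)).
split; [apply frontier_arc_conj; auto|].
split; [replace (- (beta + alpha) + alpha) with (- beta) by ring; apply frontier_arc_conj; auto|].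
split; [intros s t Hs Ht E; apply (D t s Ht Hs); apply Cconj_inj; auto|].
split.
- exists r. split; auto. intros z Hz Hzp. destruct (N (Cconj z)) as [s [Hs E]].
  + apply frontier_conj'; auto.
  + rewrite <- (Cconj_conj p), <- Cconj_sub, Cmod_conj. auto.
  + exists s. split; auto. rewrite <- (Cconj_conj z). destruct E as [E|E]; rewrite E; auto.
- intros eps He. destruct (S eps He) as [r' [Hr' H]]. exists r'. split; auto. intros s phi Hs. split.
  + intro Hphi. apply HOm. rewrite Cconj_add, Cconj_conj, Cconj_mul, Cconj_cis.
    replace (Cconj s) with (RtoC s) by Cring. apply (H s (- phi) Hs). lra.
  + intros Hphi Hn. apply HOm in Hn. rewrite Cconj_add, Cconj_conj, Cconj_mul, <- cis_2PI_minus in Hn.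
    replace (Cconj s) with (RtoC s) in Hn by Cring.
    apply (proj2 (H s (2 * PI - phi) Hs)) in Hn; [auto|lra].
Qed.

End ConjAngle.

Definition corollary3_conclusion (rho v0 : R) (T : Rbar) (gamma : R -> C) : Prop :=
  simple_curve T gamma /\
  exists p : C,
    left_limit T gamma p /\
    (-4 < rho ->
       (trace (before T) gamma p \/ Cmod p = 1) /\
       p <> cis v0 /\
       ~ closure (complement0 (before T) gamma) (cis v0) /\
       (p <> RtoC 1 -> interior_angle (complement0 (before T) gamma) p (PI * ((4 + rho) / 2))) /\
       (p = RtoC 1 -> interior_angle (complement0 (before T) gamma) p (PI * ((4 + rho) / 4)))) /\
    (rho <= -4 ->
       p = cis v0 /\
       interior_angle (complement0 (before T) gamma) p (PI * ((rho + 4) / (rho + 2)))).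

Lemma corollary3_conclusion_conj rho v0 T gamma : corollary3_conclusion rho v0 T gamma ->
  corollary3_conclusion rho (2 * PI - v0) T (fun t => Cconj (gamma t)).
Proof.
intros [[Hc Hi] [p [Hl [H1 H2]]]].
assert (HOm : forall z, complement0 (before T) (fun t => Cconj (gamma t)) z <-> complement0 (before T) gamma (Cconj z)).
{ split; [apply complement0_conj'|]. intro H. apply complement0_conj in H. rewrite Cconj_conj in H. auto. }
assert (E1 : Cconj 1 = 1) by Cring.
split.
- split; [apply continuous_on_conj; auto|]. intros s t Hs Ht E. apply Hi; auto. apply Cconj_inj; auto.
- exists (Cconj p). split; [apply filterlim_conj; auto; typeclasses eauto|]. rewrite cis_2PI_minus. split.
  + intro Hr. destruct (H1 Hr) as [A [B [D [F G]]]]. split; [|split; [|split; [|split]]].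
    * rewrite Cmod_conj. destruct A as [[t [Ht E]]|A]; [left|lra]. exists t. split; auto. rewrite E. auto.
    * intro E. apply B, Cconj_inj; auto.
    * intro H. apply D. rewrite <- (Cconj_conj (cis v0)). eapply closure_conj; [|exact H]. apply HOm.
    * intro E. eapply interior_angle_conj; [auto|]. apply F. intro X. apply E. rewrite X. auto.
    * intro E. eapply interior_angle_conj; [auto|]. apply G. apply Cconj_inj. rewrite E, E1. auto.
  + intro Hr. destruct (H2 Hr) as [A B]. split; [rewrite A; auto|]. eapply interior_angle_conj; [auto|]. auto.
Qed.

Lemma corollary3_upper rho v0 T gamma w v g : rho < -2 -> 0 < v0 < PI -> SLEhyp rho v0 T gamma w v g ->
  corollary3_conclusion rho v0 T gamma.
Proof.
intros Hrho Hv0 Hyp. pose proof (T_eq _ _ _ _ _ _ _ Hyp Hrho Hv0) as ET. pose proof (slit_flow _ _ _ _ _ _ _ Hyp Hrho Hv0) as SL.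
revert SL. generalize (Tend rho v0) ET. clear ET Hyp. intros Te ET. subst T.
assert (LL : forall p, (forall eps, 0 < eps -> exists t1, 0 < t1 < Te /\ forall t, t1 < t < Te -> Cmod (gamma t - p)%C < eps) ->
  left_limit (Finite Te) gamma p).
{ intros p Hp P HP. apply nbhd_C in HP. destruct HP as [e [He HP]]. destruct (Hp e He) as [t1 [Ht1 H]].
  assert (Hd : 0 < Te - t1) by lra. exists (mkposreal _ Hd).
  enough (forall t : R, Rabs (t - Te) < Te - t1 -> t < Te -> P (gamma t)) by auto.
  intros t Ht HtT. apply Rabs_lt_between in Ht. apply HP, H. lra. }
split.
- split.
  + intros t Ht P HP. apply nbhd_C in HP. destruct HP as [e [He HP]].
    destruct (sl_cont _ _ _ _ _ SL t e Ht He) as [d [Hd H]]. exists (mkposreal d Hd). auto.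
  + apply (sl_inj _ _ _ _ _ SL); auto.
- destruct (Rlt_le_dec (-4) rho) as [Hr|Hr].
  + destruct (subcritical _ _ _ _ _ SL) as [p [Hp [A [B [D [F G]]]]]]; [lra|].
    exists p. split; [auto|]. split; [intros _|lra].
    split; [auto|]. split; [auto|]. split; [auto|]. split; intro E.
    * replace (PI * ((4 + rho) / 2)) with (PI * (1 - - (rho + 2) / 2)) by lra. auto.
    * replace (PI * ((4 + rho) / 4)) with (PI * (1 - - (rho + 2) / 2) / 2) by lra. auto.
  + assert (Hc : 1 <= - (rho + 2) / 2) by lra.
    exists (cis v0). split; [apply LL; intros eps He; apply (conv_V _ _ _ _ _ SL Hc eps He)|].
    split; [lra|intros _]. split; [auto|].
    replace (PI * ((rho + 4) / (rho + 2))) with (PI - PI / (- (rho + 2) / 2)) by (field; lra).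
    apply (angle_V _ _ _ _ _ SL Hc).
Qed.

Theorem corollary3 :
  forall (rho v0 : R) (T : Rbar) (gamma : R -> C),
    rho < -2 ->
    0 < v0 < PI \/ PI < v0 < 2 * PI ->
    radial_SLE0 rho v0 T gamma ->
    let Om := complement0 (before T) gamma in
    simple_curve T gamma /\
    exists p : C,
      left_limit T gamma p /\
      (-4 < rho ->
         (trace (before T) gamma p \/ Cmod p = 1) /\
         p <> cis v0 /\
         ~ closure Om (cis v0) /\
         (p <> RtoC 1 -> interior_angle Om p (PI * ((4 + rho) / 2))) /\
         (p = RtoC 1 -> interior_angle Om p (PI * ((4 + rho) / 4)))) /\
      (rho <= -4 ->
         p = cis v0 /\
         interior_angle Om p (PI * ((rho + 4) / (rho + 2)))).
Proof.
intros rho v0 T gamma Hrho Hv0 H Om. change (corollary3_conclusion rho v0 T gamma).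
destruct (radial_SLE0_hyp _ _ _ _ H) as [w [v [g Hyp]]]. destruct Hv0 as [Hv0|Hv0].
- eapply corollary3_upper; eauto.
(* The given data are the reflection of their own reflection, whose force point is on the upper
   half-circle. *)
- replace v0 with (2 * PI - (2 * PI - v0)) by ring.
  replace gamma with (fun t => Cconj (Cconj (gamma t))) by (apply functional_extensionality; intro; apply Cconj_conj).
  apply (corollary3_conclusion_conj rho (2 * PI - v0) T (fun t => Cconj (gamma t))).
  eapply corollary3_upper; [auto|lra|apply SLEhyp_conj; exact Hyp].
Qed.
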